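(* Let $A,S$ be non-negative random variables with $\mathbb{E}[A]=\mathbb{E}[S]=1$ and let $\alpha\in(1,2)$. Suppose that there exists $C_A\in(0,\infty)$ with $\lim_{x\to\infty}x^{\alpha}\mathbb{P}(A>x)=C_A$; that there exists $\epsilon\in(0,1]$ with $\mathbb{E}[S^{1+\epsilon}]<\infty$; and that for each fixed $B>0$, $Q^n_{A,S,B,\alpha}(\infty)$ and $W^n_{A,S,B,\alpha}(\infty)$ exist for all sufficiently large $n$. Then for every $B>0$ and all $x>0$, $$\limsup_{n\to\infty}\mathbb{P}\Big(n^{-\frac1\alpha}L^n_{A,S,B,\alpha}(\infty)>x\Big)\le\exp\Big(-\Big(\frac{B}{C_A\,\alpha\,\Gamma(-\alpha)}\Big)^{\frac1{\alpha-1}}x\Big),$$ and moreover $$\mathbb{P}\Big(\sup_{t\ge0}\Big(-\big(\tfrac{C_A}{C_\alpha}\big)^{\frac1\alpha}\hat S_{\alpha,1}(t)-Bt\Big)>x\Big)=\exp\Big(-\Big(\frac{B}{C_A\,\alpha\,\Gamma(-\alpha)}\Big)^{\frac1{\alpha-1}}x\Big).$$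
   Context: For $B>0$, $\alpha>1$ and an integer $n>B^{\frac{\alpha}{\alpha-1}}$, let $\lambda_{n,B,\alpha}=n-Bn^{1/\alpha}$, and let $\mathcal{Q}^n_{A,S,B,\alpha}$ be the first-come-first-served (FCFS) $GI/GI/n$ queue ($n$ identical parallel servers, infinite waiting room) with i.i.d. inter-arrival times distributed as $A/\lambda_{n,B,\alpha}$ and i.i.d. processing times distributed as $S$, independent of the arrivals. If, for any given initial condition, the total number of jobs in the system (in service plus waiting) converges in distribution as time goes to infinity to a (finite) random variable $Q^n_{A,S,B,\alpha}(\infty)$ whose law does not depend on the initial condition, we say that $Q^n_{A,S,B,\alpha}(\infty)$ exists; then $L^n_{A,S,B,\alpha}(\infty)=\big(Q^n_{A,S,B,\alpha}(\infty)-n\big)^+$ is the steady-state number of jobs waiting in queue. Similarly, if for any initial condition the waiting time (time between arrival and start of processing) of the $j$th arriving job converges in distribution as $j\to\infty$ to a random variable $W^n_{A,S,B,\alpha}(\infty)$ whose law does not depend on the initial condition, we say that $W^n_{A,S,B,\alpha}(\infty)$ exists. $\Gamma$ is the Gamma function, extended to negative non-integers by $\Gamma(-t)=\pi\big(-t\,\Gamma(t)\sin(\pi t)\big)^{-1}$ for non-integer $t>0$. For $\alpha\in(1,2)$, $C_\alpha=(1-\alpha)\big(\Gamma(2-\alpha)\cos(\frac{\pi}{2}\alpha)\big)^{-1}\in(0,\infty)$. For $\sigma>0$, $\beta\in[-1,1]$, $\mu\in\mathbb{R}$, the $\alpha$-stable random variable $S_\alpha(\sigma,\beta,\mu)$ has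 characteristic function $\mathbb{E}[e^{i\theta S_\alpha(\sigma,\beta,\mu)}]=\exp\big(-(\sigma|\theta|)^\alpha(1-i\beta\,\mathrm{sign}(\theta)\tan(\frac\pi2\alpha))+i\mu\theta\big)$, $\theta\in\mathbb{R}$. The standardized $(\alpha,\beta)$-stable Lévy motion $\hat S_{\alpha,\beta}(t)_{t\ge0}$ is the Lévy process (stationary independent increments, right-continuous paths with left limits) with $\hat S_{\alpha,\beta}(0)=0$ and $\hat S_{\alpha,\beta}(s+t)-\hat S_{\alpha,\beta}(s)$ distributed as $t^{1/\alpha}S_\alpha(1,\beta,0)$ for all $s,t\ge0$. *)

(* Defs.v *)
From HB Require Import structures.
From mathcomp Require Import all_boot all_order all_algebra.
From mathcomp Require Import finmap.
From mathcomp Require Import all_classical all_reals all_analysis.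
From mathcomp Require Import complex.
Set Implicit Arguments.
Unset Strict Implicit.
Unset Printing Implicit Defensive.
Import Order.TTheory GRing.Theory Num.Theory.
Import numFieldNormedType.Exports.
Local Open Scope classical_set_scope.
Local Open Scope ring_scope.

Section special_functions.
Context {R : realType}.

(* For u < 0 not an integer this is the extension
   Gamma(-t) = pi / (- t * Gamma(t) * sin (pi * t)) with t = - u; the values
   at 0, -1, -2, ... are meaningless. *)
Definition Gamma (u : R) : R :=
  let Gamma_pos (t : R) :=
    Rintegral (@lebesgue_measure R) `]0, +oo[
      (fun x : R => x `^ (t - 1) * expR (- x)) in
  if 0 < u then Gamma_pos u
  else pi / (u * Gamma_pos (- u) * sin (pi * - u)).

Definition stable_const (alpha : R) : R :=
  (1 - alpha) / (Gamma (2 - alpha) * cos (pi / 2 * alpha)).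

Definition cexp (z : R[i]) : R[i] :=
  let: Complex a b := z in Complex (expR a * cos b) (expR a * sin b).

(* Characteristic function of S_alpha(sigma, beta, mu). *)
Definition stable_cf (alpha sigma beta mu theta : R) : R[i] :=
  let i : R[i] := Complex 0 1 in
  (cexp (- ((sigma * `|theta|) `^ alpha)%:C
           * (1 - i * (beta * Num.sg theta * tan (pi / 2 * alpha))%:C)
         + i * (mu * theta)%:C))%C.

End special_functions.

Section laws.
Context {R : realType}.

Definition charfun d (T : measurableType d) (P : probability T R)
    (X : T -> R) (theta : R) : R[i] :=
  Complex (fine 'E_P[fun w => cos (theta * X w)])
          (fine 'E_P[fun w => sin (theta * X w)]).

Definition same_law d (T : measurableType d) (P : probability T R)
    d' (T' : measurableType d') (P' : probability T' R)
    (X : T -> R) (Y : T' -> R) : Prop :=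
  forall E : set R, measurable E -> P (X @^-1` E) = P' (Y @^-1` E).

Definition mutually_independent d (T : measurableType d) (P : probability T R)
    (I : choiceType) (X : I -> T -> R) : Prop :=
  forall (J : {fset I}) (E : I -> set R), (forall i, measurable (E i)) ->
    P (\bigcap_(i in [set` J]) (X i @^-1` E i)) =
    (\prod_(i <- J) P (X i @^-1` E i))%E.

(* Convergence in distribution, along the filter F, of the variables X i to a
   real random variable with law nu: the distribution functions converge at
   every continuity point of the limit. *)
Definition cvg_in_law d (T : measurableType d) (P : probability T R) (I : Type)
    (X : I -> T -> R) (F : set_system I)
    (nu : probability R R) : Prop :=
  forall x : R, {for x, continuous (fun y : R => nu [set z : R | z <= y])} ->
    P [set w | X i w <= x] @[i --> F] --> nu [set z : R | z <= x].

End laws.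

(* Sample paths of the FCFS n-server queue. *)
Section fcfs_queue.
Context {R : realType}.

(* State of the system at time 0: remaining processing times of the jobs in
   service, number of jobs waiting in the queue, and remaining time until the
   first arrival. *)
Record initial_condition := InitialCondition {
  in_service : seq R ;
  in_queue : nat ;
  first_arrival : R }.

(* Jobs wait only if all n servers are busy. *)
Definition valid_initial (n : nat) (ic : initial_condition) : Prop :=
  [/\ (size (in_service ic) <= n)%N,
      all (fun r => 0 < r) (in_service ic),
      ((0 < in_queue ic)%N -> size (in_service ic) = n) &
      0 <= first_arrival ic].

Variables (n : nat) (ic : initial_condition).
(* Inter-arrival times after the first arrival, and processing times. *)
Variables u v : nat -> R.

Definition arrival (j : nat) : R := first_arrival ic + \sum_(k < j) u k.

(* The jobs not in service at time 0 are numbered in order of arrival: first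
   those waiting at time 0, then the arrivals of the open arrival stream.
   [job_arrival i] is 0 for the former. *)
Definition job_arrival (i : nat) : R :=
  if (i < in_queue ic)%N then 0 else arrival (i - in_queue ic).

(* [server_free i] is the sorted list of the times at which each of the n
   servers becomes free if only the jobs numbered below i are to be served
   (0 for a server which is idle at time 0).  Under FCFS, job i goes to the
   server that becomes free first, and starts at that time or at its arrival,
   whichever is later. *)
Fixpoint server_free (i : nat) : seq R :=
  if i is i'.+1 then
    let f := server_free i' in
    sort <=%R ((Num.max (job_arrival i') (head 0 f) + v i') :: behead f)
  else sort <=%R (in_service ic ++ nseq (n - size (in_service ic)) 0).

Definition job_start (i : nat) : R :=
  Num.max (job_arrival i) (head 0 (server_free i)).

Definition job_departure (i : nat) : R := job_start i + v i.

(* Jobs in service or waiting at time t >= 0.  [fset_set] of an infinite set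
   is empty; infinitely many arrivals before a finite time only occur on a null
   event in the i.i.d. setting. *)
Definition number_in_system (t : R) : nat :=
  (count (fun r => (t < r)%R) (in_service ic) +
   #|` fset_set [set i | (job_arrival i <= t < job_departure i)%R]|)%N.

(* Time between arrival and start of processing of the j-th job to arrive
   after time 0, j = 0, 1, ... *)
Definition waiting_time (j : nat) : R :=
  job_start (in_queue ic + j) - arrival j.

End fcfs_queue.

Section steady_state.
Context {R : realType} d (T : measurableType d) (P : probability T R).
Variables (A S : nat -> {RV P >-> R}).

(* The sequences A and S are i.i.d. copies of A0 and S0, independent of each
   other. *)
Definition queue_primitives d0 (T0 : measurableType d0)
    (P0 : probability T0 R) (A0 S0 : {RV P0 >-> R}) : Prop :=
  [/\ forall k, same_law P P0 (A k) A0,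
      forall k, same_law P P0 (S k) S0 &
      mutually_independent P
        (fun i : nat + nat => match i with
                              | inl k => A k : T -> R
                              | inr k => S k : T -> R
                              end)].

Definition arrival_rate (n : nat) (B alpha : R) : R :=
  n%:R - B * n%:R `^ alpha^-1.

(* [nu] is the law of Q^n(oo); meaningful when the arrival rate is positive,
   i.e. n > B^(alpha / (alpha - 1)). *)
Definition steady_state_number (n : nat) (B alpha : R)
    (nu : probability R R) : Prop :=
  forall ic, valid_initial n ic ->
    cvg_in_law P
      (fun t w => (number_in_system n ic
                     (fun k => A k w / arrival_rate n B alpha)
                     (fun k => S k w) t)%:R)
      +oo nu.

Definition steady_state_wait (n : nat) (B alpha : R)
    (nu : probability R R) : Prop :=
  forall ic, valid_initial n ic ->
    cvg_in_law P
      (fun j w => waiting_time n ic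
                    (fun k => A k w / arrival_rate n B alpha)
                    (fun k => S k w) j)
      \oo nu.

End steady_state.

Section levy.
Context {R : realType} d (T : measurableType d) (P : probability T R).

(* Only the times t >= 0 matter. *)
Definition levy_process (X : R -> {RV P >-> R}) : Prop :=
  [/\ forall w, X 0 w = 0,
      (forall s t, 0 <= s -> 0 <= t ->
         same_law P P (fun w => X (s + t) w - X s w) (X t)),
      (forall t : nat -> R, 0 <= t 0%N -> nondecreasing_seq t ->
         mutually_independent P (fun k w => X (t k.+1) w - X (t k) w)),
      (forall w t, 0 <= t -> X s w @[s --> t^'+] --> X t w) &
      (forall w t, 0 < t -> cvg (X s w @[s --> t^'-]))].

(* The characteristic function of c * Y is theta |-> charfun Y (c * theta). *)
Definition stable_levy_motion (alpha beta : R) (X : R -> {RV P >-> R}) : Prop :=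
  levy_process X /\
  forall s t, 0 <= s -> 0 <= t -> forall theta,
    charfun P (fun w => X (s + t) w - X s w) theta =
    stable_cf alpha 1 beta 0 (t `^ alpha^-1 * theta).

End levy.

(* Main.v *)
(* Start the queue with [n] busy servers whose residual processing times have the
   equilibrium law.  If a server never idled, its completions would then form a
   stationary renewal process of rate 1, and a pathwise comparison shows that the
   number of waiting jobs at time [t] is at most one plus the maximum, over the
   arrival times [s] before [t], of the number of arrivals in [s, t] minus the
   number of completions of the never idling servers in [s, t).

   The completions are at least [n (t - s) - d n^(1/alpha) (1 + t - s)] for all
   [s] at once, up to a small probability uniform in [t]: the moment of order
   [1 + eps] gives [Var N[s, t) <= C (l + l^p)] with [p < 2] for one server and
   [l = t - s], and the Rademacher-Menshov inequality on a mesh of step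
   [n^(1/alpha - 1)] makes the bound uniform in [s].  Reversing the order of the
   arrivals, the maximum becomes that of a random walk with steps [1 - b A],
   where [b] is slightly larger than 1, and Lundberg's inequality applies because
   [E exp (- eta A) = 1 - eta + C_A alpha Gamma(- alpha) eta^alpha + o(eta^alpha)].
   The limit law does not depend on the initial condition, so the bound, which is
   uniform in [t], passes to the limit.

   The process [- c S(t)] has no positive jumps; its Laplace transform follows
   from its characteristic function by a contour shift after Gaussian smoothing.
   On the skeletons of step [h], the exponential martingale gives the upper bound
   for the supremum, and also the lower one, because the overshoot of the level
   vanishes as [h] tends to 0. *)
Require Import Defs.
From HB Require Import structures.
From mathcomp Require Import all_boot all_order all_algebra.
From mathcomp Require Import finmap.
From mathcomp Require Import all_classical all_reals all_analysis.
From mathcomp Require Import measurable_realfun lebesgue_integral_under.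
From mathcomp Require Import complex.
From mathcomp Require Import ring lra zify.
Set Implicit Arguments.
Unset Strict Implicit.
Unset Printing Implicit Defensive.
Import Order.TTheory GRing.Theory Num.Theory.
Import numFieldNormedType.Exports.
Local Open Scope classical_set_scope.
Local Open Scope ring_scope.

(** Arrivals fluctuate at scale n^(1/alpha) with alpha < 2, whereas over a fixed window n
    independent servers fluctuate at scale sqrt n. So a lower bound on the completions with an error
    of order de n^(1/alpha), de arbitrarily small, is enough, and the services enter the limit only
    through their mean.

    Three obstacles shape the proof. The queue lists processing times by job, the renewal processes
    list them by server: one space carries the server lists, the job list is read off from them, and
    it is again i.i.d. because the choice of a server never depends on the time about to be
    revealed. The steady-state hypothesis concerns deterministic initial conditions and the given
    sequences, while the comparison starts from random residual times on another space: equality of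
    laws, Fubini and dominated convergence over the residual times carry the limit across. Finally S
    may have infinite variance, so the second moment of a renewal count comes from Wald's identity
    with times truncated at a level that grows with the window. *)

Section derivation_rules.
Context {R : realType}.
Implicit Types (f g : R -> R) (x a b : R).

Lemma deriveW f x a b : is_derive x 1 f a -> a = b -> is_derive x 1 f b.
Proof. by move=> ? <-. Qed.

Lemma dD f g x a b : is_derive x 1 f a -> is_derive x 1 g b ->
  is_derive x 1 (fun y => f y + g y) (a + b).
Proof. by move=> df dg; exact: is_deriveD. Qed.

Lemma dB f g x a b : is_derive x 1 f a -> is_derive x 1 g b ->
  is_derive x 1 (fun y => f y - g y) (a - b).
Proof. by move=> df dg; exact: is_deriveB. Qed.

Lemma dN f x a : is_derive x 1 f a -> is_derive x 1 (fun y => - f y) (- a).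
Proof. by move=> df; exact: is_deriveN. Qed.

Lemma dM f g x a b : is_derive x 1 f a -> is_derive x 1 g b ->
  is_derive x 1 (fun y => f y * g y) (a * g x + f x * b).
Proof.
move=> df dg; have h := is_deriveM df dg; apply: (deriveW h).
by rewrite /GRing.scale /=; ring.
Qed.

Lemma dC c x : is_derive x 1 (fun _ : R => c) (0 : R).
Proof. first [exact: (@is_derive_cst R R R c x 1) | exact: (@is_derive_cst R R^o R^o c x 1)]. Qed.

Lemma dZ c f x a : is_derive x 1 f a -> is_derive x 1 (fun y => c * f y) (c * a).
Proof. by move=> df; apply: (deriveW (dM (dC c x) df)); rewrite mul0r add0r. Qed.

Lemma dI x : is_derive x 1 (fun y : R => y) (1 : R).
Proof. first [exact: (@is_derive_id R R x 1) | exact: (@is_derive_id R R^o x 1)]. Qed.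

Lemma dcomp f g x a b : is_derive (g x) 1 f a -> is_derive x 1 g b ->
  is_derive x 1 (fun y => f (g y)) (a * b).
Proof. by move=> df dg; exact: is_derive1_comp. Qed.

Lemma dX f x a n : is_derive x 1 f a ->
  is_derive x 1 (fun y => f y ^+ n.+1) (n.+1%:R * f x ^+ n * a).
Proof.
move=> df; elim: n => [|n IH]; first by apply: (deriveW df); rewrite expr0 !mul1r.
have h := dM df IH.
apply: (deriveW h); by rewrite exprS -[in RHS]natr1; ring.
Qed.

Lemma dsin f x a : is_derive x 1 f a ->
  is_derive x 1 (fun y => sin (f y)) (cos (f x) * a).
Proof. by apply: dcomp; exact: is_derive_sin. Qed.

Lemma dcos f x a : is_derive x 1 f a ->
  is_derive x 1 (fun y => cos (f y)) (- sin (f x) * a).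
Proof. by apply: dcomp; exact: is_derive_cos. Qed.

Lemma dexp f x a : is_derive x 1 f a ->
  is_derive x 1 (fun y => expR (f y)) (expR (f x) * a).
Proof. by apply: dcomp; exact: is_derive_expR. Qed.

Lemma datan f x a : is_derive x 1 f a ->
  is_derive x 1 (fun y => atan (f y)) ((1 + f x ^+ 2)^-1 * a).
Proof. by apply: dcomp; exact: is_derive1_atan. Qed.

Lemma dpowR f x a s : 0 < f x -> is_derive x 1 f a ->
  is_derive x 1 (fun y => f y `^ s) (s * f x `^ (s - 1) * a).
Proof.
move=> fx; apply: (@dcomp (fun z => z `^ s)).
exact: is_derive1_powR.
Qed.

Lemma is_derive_derivable f x a : is_derive x 1 f a -> derivable f x 1.
Proof. by case. Qed.

Lemma is_derive_val f x a : is_derive x 1 f a -> f^`()%classic x = a.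
Proof. by move=> df; rewrite derive1E; exact: derive_val. Qed.

Lemma is_derive_continuous f x a : is_derive x 1 f a -> {for x, continuous f}.
Proof. by case=> df _; exact/differentiable_continuous/derivable1_diffP. Qed.

Lemma FTC f F a b : a < b -> (forall x, a <= x <= b -> {for x, continuous f}) ->
  (forall x, a <= x <= b -> is_derive x 1 F (f x)) ->
  (\int[lebesgue_measure]_(x in `[a, b]) (f x)%:E)%E = (F b - F a)%:E.
Proof.
move=> ab cf dF.
have la : a <= a <= b by rewrite lexx (ltW ab).
have lb : a <= b <= b by rewrite lexx (ltW ab).
rewrite (@continuous_FTC2 _ f F a b) ?EFinB//.
- apply: continuous_in_subspaceT => x; rewrite inE /= in_itv /=; exact: cf.
- split.
  + move=> x; rewrite in_itv /= => /andP[ax xb].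
    by apply: (is_derive_derivable (dF x _)); rewrite (ltW ax) (ltW xb).
  + exact: cvg_at_right_filter (is_derive_continuous (dF a la)).
  + exact: cvg_at_left_filter (is_derive_continuous (dF b lb)).
- move=> x; rewrite in_itv /= => /andP[ax xb]; apply: is_derive_val.
  by apply: dF; rewrite (ltW ax) (ltW xb).
Qed.

End derivation_rules.

(** * Independent families and their laws *)

Section product_probability.
Context {R : realType} d1 d2 (T1 : measurableType d1) (T2 : measurableType d2).
Variables (P : probability T1 R) (Q : probability T2 R).

Definition prod_prob : set (T1 * T2) -> \bar R := (P \x Q)%E.

HB.instance Definition _ := Measure.on prod_prob.

Let prod_prob_setT : prod_prob setT = 1%E.
Proof.
transitivity (P setT * Q setT)%E; last by rewrite !probability_setT mule1.
by rewrite /prod_prob -setXTT; exact: product_measure1E.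
Qed.

HB.instance Definition _ :=
  Measure_isProbability.Build _ _ _ prod_prob prod_prob_setT.

Lemma prod_probE (A : set T1) (B : set T2) : measurable A -> measurable B ->
  (prod_prob : probability _ R) (A `*` B) = (P A * Q B)%E.
Proof. exact: product_measure1E. Qed.

Lemma prod_prob_integral1 (f : T1 * T2 -> \bar R) : measurable_fun setT f ->
  (forall x, 0 <= f x)%E ->
  (\int[(prod_prob : probability _ R)]_z f z = \int[P]_x \int[Q]_y f (x, y))%E.
Proof. exact: fubini_tonelli1. Qed.

End product_probability.

Section path_space.
Context {R : realType} {I : choiceType}.

Definition cylinder (J : {fset I}) (E : I -> set R) : set (I -> R) :=
  [set x | forall i, i \in J -> E i (x i)].

Definition cylinders : set (set (I -> R)) :=
  [set B | exists J E, (forall i, measurable (E i)) /\ B = cylinder J E].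

(** The product sigma-algebra on families of reals. Cylinders form a pi-system, so
    finite-dimensional probabilities determine a law on it. *)
Definition path := g_sigma_algebraType cylinders.

Lemma cylinder_bigcap T (X : I -> T -> R) J E :
  \bigcap_(i in [set` J]) (X i @^-1` E i) = (fun w => X^~ w) @^-1` cylinder J E.
Proof. by apply/seteqP; split. Qed.

Lemma cylindersI : setI_closed cylinders.
Proof.
move=> _ _ [J [E [mE ->]]] [K [F [mF ->]]].
exists (J `|` K)%fset.
exists (fun i => (if i \in J then E i else setT) `&`
                 (if i \in K then F i else setT)); split.
  by move=> i; apply: measurableI; case: ifP.
apply/seteqP; split => x.
  by move=> [HJ HK] i iJK; split; case: ifPn => // h; [exact: HJ|exact: HK].
move=> H; split=> i h; have := H i; rewrite inE h ?orbT => /(_ isT) []; rewrite /=.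
  by [].
by [].
Qed.

Lemma measurable_coord i : measurable_fun setT (fun x : path => x i).
Proof.
move=> _ B mB; rewrite setTI; apply: sub_sigma_algebra.
exists [fset i]%fset, (fun=> B); split => //.
by apply/seteqP; split => x /= => [Bx j|]; [rewrite inE => /eqP ->|apply; rewrite inE].
Qed.

Lemma measurable_path d (T : measurableType d) (X : I -> T -> R) :
  (forall i, measurable_fun setT (X i)) ->
  measurable_fun setT (fun w => (X^~ w) : path).
Proof.
move=> mX; apply: (@measurability _ _ T path _ _ cylinders).
  by [].
move=> _ [_ [J [E [mE ->]]] <-]; rewrite setTI -cylinder_bigcap.
apply: fin_bigcap_measurable => // i _.
by rewrite -[X in measurable X]setTI; exact: mX.
Qed.

End path_space.
Arguments path : clear implicits.
Arguments cylinders : clear implicits.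

Section independent_families.
Context {R : realType} {I : choiceType}.

Section law_unique.
Context d (T : measurableType d) (P : probability T R).
Context d' (T' : measurableType d') (Q : probability T' R).
Variables (X : I -> T -> R) (Y : I -> T' -> R).
Hypotheses (mX : forall i, measurable_fun setT (X i))
  (mY : forall i, measurable_fun setT (Y i)).
Hypotheses (XY : forall (J : {fset I}) E, (forall i, measurable (E i)) ->
  P (\bigcap_(i in [set` J]) (X i @^-1` E i)) =
  Q (\bigcap_(i in [set` J]) (Y i @^-1` E i))).

Lemma law_unique (B : set (path R I)) : measurable B ->
  P ((fun w => X^~ w) @^-1` B) = Q ((fun w => Y^~ w) @^-1` B).
Proof.
move=> mB.
pose mfX := isMeasurableFun.Build _ _ _ _ _ (measurable_path mX).
pose fX : {mfun T >-> path R I} := HB.pack (fun w => (X^~ w) : path R I) mfX.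
pose mfY := isMeasurableFun.Build _ _ _ _ _ (measurable_path mY).
pose fY : {mfun T' >-> path R I} := HB.pack (fun w => (Y^~ w) : path R I) mfY.
have := @measure_unique _ R (path R I) (cylinders R I) (fun=> setT) erefl
   cylindersI _ _ (pushforward P fX) (pushforward Q fY) _ _ B mB.
apply.
- move=> _; exists fset0, (fun=> setT); split => //.
  by apply/seteqP; split.
- by apply/seteqP; split => // x _; exists 0%N.
- move=> _ [J [E [mE ->]]].
  by have := XY J mE; rewrite (cylinder_bigcap X J E) (cylinder_bigcap Y J E).
- by move=> _; change (P setT < +oo)%E; rewrite probability_setT ltry.
Qed.

Lemma law_unique_integral (f : path R I -> \bar R) : measurable_fun setT f ->
  (forall x, 0 <= f x)%E ->
  (\int[P]_w f (X^~ w) = \int[Q]_w f (Y^~ w))%E.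
Proof.
move=> mf f0.
pose mfX := isMeasurableFun.Build _ _ _ _ _ (measurable_path mX).
pose fX : {mfun T >-> path R I} := HB.pack (fun w => (X^~ w) : path R I) mfX.
pose mfY := isMeasurableFun.Build _ _ _ _ _ (measurable_path mY).
pose fY : {mfun T' >-> path R I} := HB.pack (fun w => (Y^~ w) : path R I) mfY.
transitivity (\int[pushforward P fX]_x f x)%E.
  by rewrite ge0_integral_pushforward// preimage_setT.
rewrite (eq_measure_integral (pushforward Q fY)).
  by rewrite ge0_integral_pushforward// preimage_setT.
by move=> A mA _; exact: law_unique.
Qed.

End law_unique.

Section same_independent.
Context d (T : measurableType d) (P : probability T R).
Context d' (T' : measurableType d') (Q : probability T' R).
Variables (X : I -> T -> R) (Y : I -> T' -> R).
Hypotheses (iX : mutually_independent P X) (iY : mutually_independent Q Y)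
  (XY : forall i, same_law P Q (X i) (Y i)).

Lemma independent_same_law (J : {fset I}) E : (forall i, measurable (E i)) ->
  P (\bigcap_(i in [set` J]) (X i @^-1` E i)) =
  Q (\bigcap_(i in [set` J]) (Y i @^-1` E i)).
Proof.
by move=> mE; rewrite iX// iY//; apply: eq_bigr => i _; exact: XY.
Qed.

End same_independent.

Section splice.
Context d (T : measurableType d) (P : probability T R).
Context d' (T' : measurableType d') (Q : probability T' R).
Variables (X : I -> T -> R) (Y : I -> T' -> R) (K : pred I).
Hypotheses (mX : forall i, measurable_fun setT (X i))
  (mY : forall i, measurable_fun setT (Y i)).
Hypothesis iX : mutually_independent P X.
Hypothesis iY : forall (J : {fset I}) (E : I -> set R), {in J, forall i, K i} ->
  (forall i, measurable (E i)) ->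
    Q (\bigcap_(i in [set` J]) (Y i @^-1` E i)) =
    (\prod_(i <- J) Q (Y i @^-1` E i))%E.

(** Glues two families on the product space. Independence of [Y] is assumed for indices in [K] only,
    because in the applications the other coordinates of [Y] are placeholders. *)
Definition splice i (w : T * T') := if K i then Y i w.2 else X i w.1.

Lemma measurable_splice i : measurable_fun setT (splice i).
Proof.
rewrite /splice; case: (K i).
  exact: measurableT_comp (mY i) measurable_snd.
exact: measurableT_comp (mX i) measurable_fst.
Qed.

Lemma splice_same_lawl i : ~~ K i -> same_law (prod_prob P Q) P (splice i) (X i).
Proof.
move=> /negbTE Ki E mE; rewrite /splice Ki.
rewrite (_ : _ @^-1` _ = (X i @^-1` E) `*` setT); last first.
  by apply/seteqP; split => // -[a b] //= [].
rewrite prod_probE// ?probability_setT ?mule1//.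
by rewrite -[X in measurable X]setTI; exact: mX.
Qed.

Lemma splice_same_lawr i : K i -> same_law (prod_prob P Q) Q (splice i) (Y i).
Proof.
move=> Ki E mE; rewrite /splice Ki.
rewrite (_ : _ @^-1` _ = setT `*` (Y i @^-1` E)); last first.
  by apply/seteqP; split => // -[a b] //= [].
rewrite prod_probE// ?probability_setT ?mul1e//.
by rewrite -[X in measurable X]setTI; exact: mY.
Qed.

Lemma splice_independent : mutually_independent (prod_prob P Q) splice.
Proof.
move=> J E mE.
have mXE i : measurable (X i @^-1` E i).
  by rewrite -[X in measurable X]setTI; exact: mX.
have mYE i : measurable (Y i @^-1` E i).
  by rewrite -[X in measurable X]setTI; exact: mY.
rewrite (_ : \bigcap_(i in _) _ =
   (\bigcap_(i in [set` [fset j in J | ~~ K j]%fset]) (X i @^-1` E i)) `*`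
   (\bigcap_(i in [set` [fset j in J | K j]%fset]) (Y i @^-1` E i))); last first.
  apply/seteqP; split => [[a b] /= H|[a b] /= [H1 H2] i iJ].
    split=> i /=; rewrite !inE => /andP[iJ Ki]; have := H i iJ; rewrite /splice.
      by rewrite (negbTE Ki).
    by rewrite Ki.
  rewrite /preimage /splice /=; have [Ki|Ki] := boolP (K i).
    by apply: H2; rewrite /= !inE Ki andbT.
  by apply: H1; rewrite /= !inE Ki andbT.
rewrite prod_probE; last 2 first.
  by apply: fin_bigcap_measurable.
  by apply: fin_bigcap_measurable.
rewrite iX// iY//; last by move=> i; rewrite !inE => /andP[].
have prodE (L : pred I) (F : I -> \bar R) : (\prod_(i <- J | L i) F i =
    \prod_(i <- [fset j in J | L j]%fset) F i)%E.
  rewrite -(big_filter _ L); apply: perm_big.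
  apply: uniq_perm; rewrite ?filter_uniq ?fset_uniq// => i.
  by rewrite mem_filter !inE /= andbC.
rewrite [RHS](bigID K) /= [RHS]muleC !prodE; congr (_ * _)%E.
  apply: eq_big_seq => i; rewrite !inE => /andP[_ Ki].
  by rewrite splice_same_lawl.
apply: eq_big_seq => i; rewrite !inE => /andP[_ Ki].
by rewrite splice_same_lawr.
Qed.

End splice.

Section resample.
Context d (T : measurableType d) (P : probability T R).
Variables (X : I -> T -> R) (K : pred I).
Hypotheses (mX : forall i, measurable_fun setT (X i)).
Hypothesis iX : mutually_independent P X.

(** Replacing the coordinates in [K] by an independent copy preserves the joint law. The inner
    integral plays the part of the conditional expectation given the coordinates outside [K]; every
    conditioning argument below has this form. *)
Lemma resample_integral (f : path R I -> \bar R) : measurable_fun setT f ->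
  (forall x, 0 <= f x)%E ->
  (\int[P]_w f (X^~ w) =
   \int[P]_w \int[P]_w' f (fun i => if K i then X i w' else X i w))%E.
Proof.
move=> mf f0.
have iXK (J : {fset I}) (E : I -> set R) : {in J, forall i, K i} ->
  (forall i, measurable (E i)) ->
    P (\bigcap_(i in [set` J]) (X i @^-1` E i)) =
    (\prod_(i <- J) P (X i @^-1` E i))%E by move=> _; exact: iX.
have ms := measurable_splice K mX mX.
rewrite (@law_unique_integral _ _ P _ _ (prod_prob P P) X (splice X X K) mX ms)//.
  rewrite prod_prob_integral1//.
  exact: measurableT_comp mf (measurable_path ms).
apply: independent_same_law => //; first exact: splice_independent.
move=> i; have [Ki|Ki] := boolP (K i).
  by move=> E mE; rewrite splice_same_lawr.
by move=> E mE; rewrite splice_same_lawl.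
Qed.

End resample.

Lemma same_law_integral d (T : measurableType d) (P : probability T R)
    d' (T' : measurableType d') (Q : probability T' R)
    (X : T -> R) (Y : T' -> R) (f : R -> \bar R) :
  measurable_fun setT X -> measurable_fun setT Y -> same_law P Q X Y ->
  measurable_fun setT f -> (forall x, 0 <= f x)%E ->
  (\int[P]_w f (X w) = \int[Q]_w f (Y w))%E.
Proof.
move=> mX mY XY mf f0.
pose mfX := isMeasurableFun.Build _ _ _ _ _ mX.
pose fX : {mfun T >-> R} := HB.pack X mfX.
pose mfY := isMeasurableFun.Build _ _ _ _ _ mY.
pose fY : {mfun T' >-> R} := HB.pack Y mfY.
transitivity (\int[pushforward P fX]_x f x)%E.
  by rewrite ge0_integral_pushforward// preimage_setT.
rewrite (eq_measure_integral (pushforward Q fY)).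
  by rewrite ge0_integral_pushforward// preimage_setT.
by move=> A mA _; exact: XY.
Qed.

End independent_families.

Lemma reindex_independent {R : realType} {I J : choiceType} (h : J -> I)
    d (T : measurableType d) (P : probability T R) (X : I -> T -> R) :
  injective h -> mutually_independent P X ->
  mutually_independent P (fun j => X (h j)).
Proof.
move=> hI iX K E mE.
have [g hK] : exists g : I -> option J, pcancel h g.
  exists (fun i => if pselect (exists j, h j = i) is left e then Some (projT1 (cid e)) else None).
  move=> j; case: pselect => [e|[]]; last by exists j.
  by congr Some; apply: hI; case: cid => ? /=.
pose F i := if g i is Some j then E j else setT.
have := iX (h @` K)%fset F; rewrite (_ : \bigcap_(i in _) _ =
  \bigcap_(i in [set` K]) (X (h i) @^-1` E i)); last first.
  apply/seteqP; split => w /= H i.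
    move=> iK; have := H (h i); rewrite /F hK; apply; exact: in_imfset.
  by move=> /= /imfsetP[j /= jK ->]; rewrite /F hK; exact: H.
move=> ->; last by move=> i; rewrite /F; case: (g i).
rewrite big_imfset /=; last by move=> ? ? _ _ /hI.
by apply: eq_bigr => i _; rewrite /F hK.
Qed.

(** * The Gamma function *)

Section measure_helpers.
Context d (T : measurableType d) {R : realType} (mu : {measure set T -> \bar R}).

Lemma integral_set_if (b : T -> bool) (f : T -> \bar R) :
  (\int[mu]_(x in [set x | b x]) f x = \int[mu]_x (if b x then f x else 0))%E.
Proof.
rewrite integral_mkcond; apply: eq_integral => x _; rewrite patchE.
by case: ifPn => [|/negP]; rewrite inE /= => H; [rewrite H|case: ifP].
Qed.

End measure_helpers.

Section half_line_FTC.
Context {R : realType}.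
Notation mu := (@lebesgue_measure R).

(** The integrand may blow up at 0, as y^(s-1) does for s < 1: the interval is exhausted by the
    segments [b/(k+2), b] and only the limit of the primitive at 0 is used. *)
Lemma ge0_FTC_right (f F : R -> R) (b m : R) : 0 < b ->
  (forall x : R, 0 < x -> {for x, continuous f}) ->
  (forall x : R, 0 < x -> is_derive x 1 F (f x)) ->
  (forall x : R, 0 < x -> 0 <= f x) -> F x @[x --> (0:R)^'+] --> m ->
  (\int[mu]_(x in `]0%R, b]) (f x)%:E = (F b - m)%:E)%E.
Proof.
move=> b0 cf dF f0 Fm.
pose A (k : nat) : set R := `[b / k.+2%:R, b]%classic.
have Apos k x : A k x -> 0 < x.
  by rewrite /A /= in_itv /= => /andP[+ _]; apply: lt_le_trans; rewrite divr_gt0.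
have bigA : \bigcup_k A k = `]0, b]%classic.
  apply/seteqP; split => x.
    by move=> [k _ Ax]; rewrite /= in_itv /= (Apos k)//; move: Ax; rewrite /A /= in_itv => /andP[].
  rewrite /= in_itv /= => /andP[x0 xb].
  exists (Num.bound (b / x)) => //; rewrite /A /= in_itv /= xb andbT.
  rewrite ler_pdivrMr// mulrC -ler_pdivrMr//.
  have := archi_boundP (ltW (divr_gt0 b0 x0)); move=> /ltW/le_trans; apply.
  by rewrite ler_nat -addn2 leq_addr.
have H : (\int[mu]_(x in A k) (f x)%:E)%E @[k --> \oo] -->
    (\int[mu]_(x in `]0%R, b]) (f x)%:E)%E.
  rewrite -bigA; apply: ge0_nondecreasing_set_cvg_integral.
  - move=> n k nk; apply/subsetPset => x; rewrite /A /= !in_itv /= => /andP[bx ->].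
    rewrite andbT (le_trans _ bx)// ler_pM2l// lef_pV2 ?posrE//.
    by rewrite ler_nat.
  - by move=> k; exact: measurable_itv.
  - move=> k; apply/measurable_EFinP.
    have cA : {within A k, continuous f}.
      by apply: continuous_in_subspaceT => x; rewrite inE => /Apos; exact: cf.
    by apply: subspace_continuous_measurable_fun => //; exact: measurable_itv.
  - by move=> k x /Apos x0; rewrite lee_fin f0.
apply: (cvg_unique _ H) => //.
rewrite (_ : (fun k => _) = fun k => (F b - F (b / k.+2%:R))%:E); last first.
  apply/funext => k; apply: (@FTC _ f F).
  - rewrite ltr_pdivrMr// -[ltLHS]mulr1 ltr_pM2l//.
    by rewrite ltr1n.
  - by move=> x xk; apply: cf; apply: (Apos k); rewrite /A /= in_itv.
  - by move=> x xk; apply: dF; apply: (Apos k); rewrite /A /= in_itv.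
apply: cvg_EFin; first by near=> k.
apply: cvgB; first exact: cvg_cst.
move/cvg_at_rightP : Fm; apply; split => [k|]; first by rewrite divr_gt0.
rewrite -(mulr0 b); apply: cvgM; first exact: cvg_cst.
have := @cvg_harmonic R; rewrite -(cvg_shiftn 1).
by apply: cvg_trans; apply: near_eq_cvg; near=> k; rewrite /harmonic /= addn1.
Unshelve. all: by end_near. Qed.

End half_line_FTC.

Section gamma.
Context {R : realType}.
Notation mu := (@lebesgue_measure R).
Implicit Types s t x : R.

Definition gamma_fun s x : R := x `^ (s - 1) * expR (- x).
(** Extended-real valued, so that the functional equation is available before finiteness and serves
    to prove it. *)
Definition egamma s : \bar R := (\int[mu]_(x in `]0%R, +oo[) (gamma_fun s x)%:E)%E.

Lemma gamma_fun_ge0 s x : 0 <= gamma_fun s x.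
Proof. by rewrite mulr_ge0 ?powR_ge0 ?expR_ge0. Qed.

Lemma measurable_expRN : measurable_fun setT (fun x : R => expR (- x)).
Proof. exact: measurableT_comp. Qed.

Lemma measurable_gamma_fun s : measurable_fun setT (gamma_fun s).
Proof.
apply: measurable_funM; last exact: measurable_expRN.
exact: measurable_powR.
Qed.

Lemma egamma_ge0 s : (0 <= egamma s)%E.
Proof. by apply: integral_ge0 => x _; rewrite lee_fin gamma_fun_ge0. Qed.

Lemma integral_expRN x :
  (\int[mu]_(y in `[x, +oo[) (expR (- y))%:E = (expR (- x))%:E)%E.
Proof.
have d (y : R) : is_derive y 1 (fun z => - expR (- z)) (expR (- y)).
  by apply: (deriveW (dN (dexp (dN (dI y))))); ring.
rewrite (@ge0_continuous_FTC2y _ _ (fun z => - expR (- z)) _ 0).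
- by rewrite sub0e -EFinN opprK.
- by move=> y _; exact: expR_ge0.
- have c : continuous (fun y : R => expR (- y)).
    by move=> y; exact: (is_derive_continuous (dexp (dN (dI y)))).
  exact: continuous_subspaceT c.
- by rewrite -oppr0; apply: cvgN; exact: cvgr_expR.
- by move=> y _; exact: is_derive_derivable (d y).
- exact: cvg_at_right_filter (is_derive_continuous (d x)).
- by move=> y _; exact: is_derive_val (d y).
Qed.

Lemma egamma1 : egamma 1 = 1%E.
Proof.
rewrite /egamma integral_itv_obnd_cbnd; last first.
  by apply: measurable_funTS; apply/measurable_EFinP; exact: measurable_gamma_fun.
transitivity (\int[mu]_(y in `[0%R, +oo[) (expR (- y))%:E)%E.
  by apply: eq_integral => x _; rewrite /gamma_fun subrr powRr0 mul1r.
by rewrite integral_expRN oppr0 expR0.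
Qed.

Lemma integral_powR s x : 0 < s -> 0 < x ->
  (\int[mu]_(y in `]0%R, x]) (s * y `^ (s - 1))%:E = (x `^ s)%:E)%E.
Proof.
move=> s0 x0; rewrite (@ge0_FTC_right _ _ (fun y => y `^ s) x 0) ?subr0//.
- move=> y y0; exact: (is_derive_continuous (dZ _ (dpowR _ y0 (dI y)))).
- by move=> y _; rewrite mulr_ge0 ?powR_ge0 ?ltW.
- exact: powR_cvg0.
Qed.

Lemma egammaS s : 0 < s -> egamma (s + 1) = (s%:E * egamma s)%E.
Proof.
move=> s0.
pose h (z : R * R) : \bar R := (if (0 < z.1) && (z.1 <= z.2)
  then s * z.1 `^ (s - 1) * expR (- z.2) else 0)%:E.
have mh : measurable_fun setT h.
  apply/measurable_EFinP/measurable_fun_ifT.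
  - apply: measurable_and; first exact: measurable_fun_ltr.
    exact: measurable_fun_ler.
  - apply: measurable_funM; first apply: measurable_funM => //.
      by apply: measurableT_comp (measurable_powR _) _.
    by apply: measurableT_comp measurable_expRN _.
  - exact: measurable_cst.
have h0 z : (0 <= h z)%E.
  rewrite /h lee_fin; case: ifP => // _.
  by rewrite !mulr_ge0 ?powR_ge0 ?expR_ge0 ?ltW.
transitivity (\int[mu]_y \int[mu]_x h (x, y))%E.
  rewrite /egamma -[X in (\int[_]_(_ in X) _)%E]/[set x | x \in `]0, +oo[].
  rewrite integral_set_if; apply: eq_integral => y _.
  rewrite in_itv /= andbT; case: ifPn => y0; last first.
    rewrite (eq_integral (cst 0%E)) ?integral0// => x _; rewrite /h /=.
    case: ifP => // /andP[x0 xy]; move: y0; by rewrite (lt_le_trans x0 xy).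
  transitivity (\int[mu]_(x in `]0%R, y]) ((expR (- y))%:E * (s * x `^ (s - 1))%:E))%E.
    rewrite ge0_integralZl_EFin ?expR_ge0//.
    - by rewrite integral_powR// /gamma_fun addrK -EFinM mulrC.
    - by move=> x _; rewrite lee_fin mulr_ge0 ?powR_ge0 ?ltW.
    - apply: (measurable_funTS _); apply/measurable_EFinP; apply: measurable_funM => //. 
  rewrite -[X in (\int[_]_(_ in X) _)%E]/[set x | x \in `]0, y]].
  rewrite integral_set_if; apply: eq_integral => x _.
  by rewrite in_itv /= /h /=; case: ifP => // _; rewrite -EFinM mulrC.
transitivity (\int[mu]_x \int[mu]_y h (x, y))%E.
  exact/esym/fubini_tonelli.
rewrite /egamma.
rewrite -ge0_integralZl_EFin ?ltW//; last 2 first.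
  - by move=> x _; rewrite lee_fin gamma_fun_ge0.
  - apply: measurable_funTS; apply/measurable_EFinP; exact: measurable_gamma_fun.
rewrite -[X in (_ = \int[_]_(_ in X) _)%E]/[set x | x \in `]0, +oo[].
rewrite integral_set_if; apply: eq_integral => x _.
rewrite in_itv /= andbT; case: ifPn => x0; last first.
  by rewrite (eq_integral (cst 0%E)) ?integral0// => y _; rewrite /h /= (negbTE x0).
transitivity (\int[mu]_(y in `[x, +oo[) ((s * x `^ (s - 1))%:E * (expR (- y))%:E))%E.
  rewrite -[X in (_ = \int[_]_(_ in X) _)%E]/[set y | y \in `[x, +oo[].
  rewrite integral_set_if; apply: eq_integral => y _.
  by rewrite in_itv /= /h /= x0 /= andbT; case: ifP => // _; rewrite -EFinM.
rewrite ge0_integralZl_EFin ?mulr_ge0 ?powR_ge0 ?(ltW s0)//.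
- by rewrite integral_expRN -!EFinM /gamma_fun mulrA.
- apply: measurable_funTS; apply/measurable_EFinP; exact: measurable_expRN.
Qed.

(** Concavity of y^t. With l = ln y and after division by y^t, this is the tangent bound exp u >= 1
    + u at u = -t l and u = (1-t) l, averaged with weights 1-t and t so that the linear terms
    cancel. *)
Lemma powR_le_affine t y : 0 <= t <= 1 -> 0 < y -> y `^ t <= 1 - t + t * y.
Proof.
move=> /andP[t0 t1] y0; rewrite /powR gt_eqF//.
have [l ->] : exists l, y = expR l by exists (ln y); rewrite lnK.
rewrite expRK; have e0 : 0 < expR (t * l) by exact: expR_gt0.
have yE : expR l = expR (t * l) * expR ((1 - t) * l).
  by rewrite -expRD; congr expR; ring.
have oneE : 1 = expR (t * l) * expR (- (t * l)) by rewrite -expRD subrr expR0.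
have h1 := expR_ge1Dx ((1 - t) * l).
have h2 := expR_ge1Dx (- (t * l)).
have : expR (t * l) * ((1 - t) * (1 + - (t * l)) + t * (1 + (1 - t) * l)) <=
       expR (t * l) * ((1 - t) * expR (- (t * l)) + t * expR ((1 - t) * l)).
  by rewrite ler_pM2l// lerD// ler_wpM2l// subr_ge0.
rewrite [leRHS]mulrDr (mulrCA _ (1 - t)) (mulrCA _ t) -oneE -yE mulr1.
by apply: le_trans; rewrite le_eqVlt; apply/orP; left; apply/eqP; ring.
Qed.

Lemma egammaZ c s : 0 <= c ->
  (c%:E * egamma s = \int[mu]_(x in `]0%R, +oo[) (c * gamma_fun s x)%:E)%E.
Proof.
move=> c0; transitivity (\int[mu]_(x in `]0%R, +oo[) (c%:E * (gamma_fun s x)%:E))%E.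
  apply/esym/ge0_integralZl_EFin => //.
  - by move=> x _; rewrite lee_fin gamma_fun_ge0.
  - by apply: measurable_funTS; apply/measurable_EFinP; exact: measurable_gamma_fun.
by apply: eq_integral => x _; rewrite EFinM.
Qed.

(** One half of Wendel's inequality: the tangent of x^t at x = s, integrated against the Gamma
    density. It yields both the finiteness of Gamma and its asymptotics. *)
Lemma egammaD_le s t : 0 < s -> 0 <= t <= 1 ->
  (egamma (s + t) <= (s `^ t)%:E * egamma s)%E.
Proof.
move=> s0 t01; have /andP[t0 t1] := t01.
have mg r c : measurable_fun (`]0%R, +oo[ : set R) (fun x => (c * gamma_fun r x)%:E).
  apply: measurable_funTS; apply/measurable_EFinP; apply: measurable_funM => //.
  exact: measurable_gamma_fun.
have E : ((s `^ t)%:E * egamma s = (s `^ t * (1 - t))%:E * egamma s +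
    (s `^ t * t / s)%:E * egamma (s + 1))%E.
  rewrite egammaS// muleA -EFinM divfK ?gt_eqF//.
  rewrite -ge0_muleDl ?lee_fin ?mulr_ge0 ?powR_ge0 ?subr_ge0//.
  by rewrite -EFinD -mulrDr subrK mulr1.
have c1 : 0 <= s `^ t * (1 - t) by rewrite mulr_ge0 ?powR_ge0 ?subr_ge0.
have c2 : 0 <= s `^ t * t / s by rewrite !mulr_ge0 ?powR_ge0 ?invr_ge0// ltW.
have p r c (x : R) : 0 <= c -> (0 <= (c * gamma_fun r x)%:E)%E.
  by move=> c0; rewrite lee_fin mulr_ge0// gamma_fun_ge0.
rewrite E (egammaZ _ c1) (egammaZ _ c2).
rewrite -ge0_integralD; [|exact: measurable_itv|by move=> x _; exact: p|exact: mg|by move=> x _; exact: p|exact: mg].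
apply: ge0_le_integral => //.
- by move=> x _; rewrite lee_fin gamma_fun_ge0.
- by apply: measurable_funTS; apply/measurable_EFinP; exact: measurable_gamma_fun.
- by apply: emeasurable_funD; exact: mg.
move=> x; rewrite /= in_itv /= andbT => x0.
rewrite -EFinD lee_fin /gamma_fun.
have xs : 0 < x / s by rewrite divr_gt0.
have H : x `^ t <= s `^ t * (1 - t + t * (x / s)).
  have xE : x = s * (x / s) by rewrite mulrC divfK ?gt_eqF.
  rewrite {1}xE powRM ?(ltW s0) ?(ltW xs)//.
  by rewrite ler_pM2l ?powR_gt0// powR_le_affine.
have -> : s + t - 1 = (s - 1) + t by ring.
rewrite powRD; last by rewrite (gt_eqF x0) implybT.
have -> : x `^ (s + 1 - 1) = x `^ (s - 1) * x.
  by rewrite addrK mulrC mulr_powRB1// ltW.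
have e0 : 0 <= x `^ (s - 1) * expR (- x) by rewrite mulr_ge0 ?powR_ge0 ?expR_ge0.
have := ler_wpM2l e0 H; congr (_ <= _); ring.
Qed.

(** Comparison with [egamma 1] gives finiteness on [1, 2]; the functional equation carries it down
    to (0, 1], where [egammaD_le] forbids the value 0, and then up to all s. *)
Lemma egamma_fin_num s : 0 < s -> (egamma s \is a fin_num) && (0 < egamma s)%E.
Proof.
have pos n : (egamma n.+1%:R \is a fin_num) && (0 < egamma n.+1%:R)%E.
  elim: n => [|n /andP[fn pn]]; first by rewrite egamma1 lte01.
  by rewrite -natr1 egammaS// fin_numM//= mule_gt0.
have fin12 t : 0 <= t <= 1 -> egamma (1 + t) \is a fin_num.
  move=> t01; rewrite ge0_fin_numE ?egamma_ge0//.
  by rewrite (le_lt_trans (egammaD_le _ t01))// egamma1 mule1 ltry.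
move=> s0.
have fin01 t : 0 < t <= 1 -> egamma t \is a fin_num.
  move=> /andP[t0 t1]; have := fin12 t; rewrite (ltW t0) t1 addrC => /(_ isT).
  rewrite egammaS// !ge0_fin_numE ?mule_ge0 ?egamma_ge0 ?lee_fin ?(ltW t0)//.
  by case: (egamma t) => // [r|]; rewrite ?ltry// gt0_muley ?lte_fin.
have posx t : 0 < t <= 1 -> (0 < egamma t)%E.
  move=> /andP[t0 t1]; rewrite lt0e egamma_ge0 andbT; apply/eqP => g0.
  have := @egammaD_le t (1 - t) t0.
  rewrite (_ : t + (1 - t) = 1); last by ring.
  rewrite g0 mule0 egamma1.
  rewrite subr_ge0 t1 lerBlDr lerDl (ltW t0) => /(_ isT).
  by rewrite leNgt lte01.
have H n : forall s, n%:R < s <= n.+1%:R -> (egamma s \is a fin_num) && (0 < egamma s)%E.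
  elim: n => [|n IH] {s0}s ns; first by rewrite fin01//= posx.
  have s1 : n%:R < s - 1 <= n.+1%:R.
    by rewrite ltrBrDr lerBlDr !natr1.
  have s10 : 0 < s - 1 by move/andP: s1 => [+ _]; apply: le_lt_trans.
  rewrite -(subrK 1 s) egammaS//; have /andP[f p] := IH _ s1.
  by rewrite fin_numM//= mule_gt0.
have K n : s <= n.+1%:R -> (egamma s \is a fin_num) && (0 < egamma s)%E.
  elim: n => [s1|n IH sn]; first by rewrite (H 0%N)// s0.
  have [/IH//|ns] := leP s n.+1%:R.
  by rewrite (H n.+1)// ns.
apply: (K (Num.bound s)); apply/ltW/(lt_le_trans (archi_boundP (ltW s0))).
by rewrite ler_nat.
Qed.

End gamma.

(** * Wallis-type integrals of cos (2tx) cos^(2m) x *)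

Section wallis.
Context {R : realType}.
Notation mu := (@lebesgue_measure R).
Implicit Types t x : R.

Notation I f := (\int[mu]_(x in `[0%R, pi / 2]) f x).

Lemma pihalf_gt0 : 0 < pi / 2 :> R.
Proof. by rewrite divr_gt0 ?pi_gt0. Qed.

Lemma I_integrable (f : R -> R) : continuous f ->
  mu.-integrable `[0, pi / 2] (EFin \o f).
Proof.
move=> cf; apply: continuous_compact_integrable; first exact: segment_compact.
exact: continuous_subspaceT.
Qed.

Lemma I_FTC (f F : R -> R) : continuous f -> (forall x, is_derive x 1 F (f x)) ->
  I f = F (pi / 2) - F 0.
Proof.
move=> cf dF.
have := @FTC _ f F 0 (pi / 2) pihalf_gt0 (fun x _ => cf x) (fun x _ => dF x).
by rewrite /Rintegral => ->.
Qed.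

Lemma continuousZ (c : R) (f : R -> R) : continuous f -> continuous (fun x => c * f x).
Proof. by move=> cf x; apply: (@continuousM R R); [exact: cst_continuous|exact: cf]. Qed.

Lemma continuous_add (f g : R -> R) : continuous f -> continuous g ->
  continuous (fun x => f x + g x).
Proof. by move=> cf cg x; apply: cvgD; [exact: cf|exact: cg]. Qed.

(** The integral over [0, pi/2] contains sin (pi t) for m = 0, has a recursion in m matching that of
    Gamma (m+1+t) Gamma (m+1-t), and forgets t as m grows. This is what gives the reflection
    formula. *)
Definition wallis_fun t m x := cos (2 * t * x) * cos x ^+ (2 * m).
Definition wallis t m := I (wallis_fun t m).

Lemma derive_cosX n x : is_derive x 1 (fun y => cos y ^+ n) (- (n%:R * cos x ^+ n.-1 * sin x)).
Proof.
case: n => [|n]; first by apply: (deriveW (dC _ _)); rewrite !mul0r oppr0.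
by apply: (deriveW (dX _ (dcos (dI x)))); rewrite /=; ring.
Qed.

Lemma derive_cosZ t x : is_derive x 1 (fun y => cos (t * y)) (- (t * sin (t * x))).
Proof. by apply: (deriveW (dcos (dZ t (dI x)))); ring. Qed.

Lemma derive_sinZ t x : is_derive x 1 (fun y => sin (t * y)) (t * cos (t * x)).
Proof. by apply: (deriveW (dsin (dZ t (dI x)))); ring. Qed.

Lemma continuous_wallis_fun t m : continuous (wallis_fun t m).
Proof.
move=> x; exact: (is_derive_continuous (dM (derive_cosZ (2 * t) x) (derive_cosX (2 * m) x))).
Qed.

Lemma wallisS t m : ((2 * m + 2)%:R ^+ 2 - 4 * t ^+ 2) * wallis t m.+1 =
  (2 * m + 2)%:R * (2 * m + 1)%:R * wallis t m.
Proof.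
pose n := (2 * m + 2)%N.
pose f x := (4 * t ^+ 2 - n%:R ^+ 2) * wallis_fun t m.+1 x +
  n%:R * (2 * m + 1)%:R * wallis_fun t m x.
(* The boundary terms of two integrations by parts; they vanish at 0 and at pi/2, so the integral of
   [f] is 0, which is the recursion. *)
pose F x := 2 * t * (sin (2 * t * x) * cos x ^+ n) -
  n%:R * (cos (2 * t * x) * (cos x ^+ (2 * m + 1) * sin x)).
have cw s k := @continuous_wallis_fun s k.
have iw s k := I_integrable (cw s k).
have If : I f = (4 * t ^+ 2 - n%:R ^+ 2) * wallis t m.+1 +
    n%:R * (2 * m + 1)%:R * wallis t m.
  rewrite /f RintegralD//.
  - by rewrite !RintegralZl.
  - exact/I_integrable/continuousZ.
  - exact/I_integrable/continuousZ.
have cf : continuous f.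
  by apply: continuous_add; exact: continuousZ.
have dF x : is_derive x 1 F (f x).
  apply: (deriveW (dB (dZ _ (dM (derive_sinZ (2 * t) x) (derive_cosX n x)))
    (dZ _ (dM (derive_cosZ (2 * t) x) (dM (derive_cosX (2 * m + 1) x) (dsin (dI x))))))).
  rewrite /f /wallis_fun /n mulnS [(2 + 2 * m)%N]addnC.
  rewrite addn1 addn2 /= !exprS.
  have s2 : sin x ^+ 2 = 1 - cos x ^+ 2 := sin2cos2 x.
  set S := sin (2 * t * x); set C := cos (2 * t * x).
  set cm := cos x ^+ (2 * m).
  move: s2; set s := sin x; set c := cos x => s2.
  have -> : (2 * m).+2%:R = (2 * m).+1%:R + 1 :> R by rewrite -natr1.
  set k : R := (2 * m).+1%:R.
  apply/eqP; rewrite -subr_eq0; apply/eqP.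
  transitivity ((k + 1) * k * C * cm * (s ^+ 2 - (1 - c ^+ 2))); last first.
    by rewrite s2 subrr mulr0.
  ring.
have F0 : F 0 = 0 by rewrite /F !mulr0 sin0 mul0r !mulr0 subrr.
have Fp : F (pi / 2) = 0.
  by rewrite /F cos_pihalf /n addn2 addn1 !exprS !mul0r !mulr0 subrr.
move: If; rewrite (I_FTC cf dF) F0 Fp subrr => E.
have -> : (2 * m + 2)%:R = n%:R by [].
lra.
Qed.

Lemma wallis0 t : t != 0 -> wallis t 0 = sin (pi * t) / (2 * t).
Proof.
move=> t0; rewrite /wallis.
have dF x : is_derive x 1 (fun x => sin (2 * t * x) / (2 * t)) (wallis_fun t 0 x).
  have h := dM (derive_sinZ (2 * t) x) (dC (2 * t)^-1 x).
  apply: (deriveW h); rewrite /wallis_fun muln0 expr0 mulr1 mulr0 addr0.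
  by field.
rewrite (I_FTC (@continuous_wallis_fun _ _) dF) mulr0 sin0 mul0r subr0.
by congr (sin _ / _); field.
Qed.

Lemma wallis00 : wallis 0 0 = pi / 2.
Proof.
have dF x : is_derive x 1 (fun x => x) (wallis_fun 0 0 x).
  apply: (deriveW (dI x)).
  by rewrite /wallis_fun mulr0 mul0r cos0 muln0 expr0 mulr1.
by rewrite /wallis (I_FTC (@continuous_wallis_fun _ _) dF) subr0.
Qed.

Lemma wallis0S m : wallis 0 m.+1 = (2 * m + 1)%:R / (2 * m + 2)%:R * wallis 0 m.
Proof.
have := wallisS 0 m; rewrite expr0n mulr0 subr0.
have n0 : (2 * m + 2)%:R != 0 :> R by rewrite pnatr_eq0 addn2.
move=> H; apply: (mulfI (mulf_neq0 n0 n0)); rewrite -expr2 H; field.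
by rewrite -natrM -natrD pnatr_eq0 addn2.
Qed.

Lemma wallis0_gt0 m : 0 < wallis 0 m.
Proof.
elim: m => [|m IH]; first by rewrite wallis00 pihalf_gt0.
by rewrite wallis0S mulr_gt0// divr_gt0// ltr0n ?addn1 ?addn2.
Qed.

(** On [0, pi/2], sin (tx) <= sin x gives cos (2tx) >= 1 - 2 sin^2 x. The integral of sin^2 x
    cos^(2m) x is [wallis 0 m - wallis 0 m.+1], that is [wallis 0 m] divided by 2(m+1). *)
Lemma wallis_bounds t m : 0 <= t <= 1 ->
  (1 - m.+1%:R^-1) * wallis 0 m <= wallis t m <= wallis 0 m.
Proof.
move=> /andP[t0 t1].
have cw s k := @continuous_wallis_fun s k.
have iw s k := I_integrable (cw s k).
have cos_ge0 x : x \in `[0, pi / 2] -> 0 <= cos x.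
  rewrite in_itv /= => /andP[x0 xp]; apply: cos_ge0_pihalf; rewrite xp andbT.
  by apply: le_trans x0; rewrite oppr_le0 ltW// pihalf_gt0.
have key x : x \in `[0, pi / 2] -> 1 - 2 * (1 - cos x ^+ 2) <= cos (2 * t * x).
  move=> xI; have := xI; rewrite in_itv /= => /andP[x0 xp].
  have -> : 2 * t * x = (t * x) *+ 2 by ring.
  rewrite cos_mulr2n (cos2sin2 (t * x)) (cos2sin2 x).
  have tx0 : 0 <= t * x by rewrite mulr_ge0.
  have txx : t * x <= x by rewrite ler_piMl.
  have s0 : 0 <= sin (t * x).
    apply: sin_ge0_pi; rewrite tx0 (le_trans txx)// (le_trans xp)//.
    by rewrite ler_pdivrMr// ler_peMr ?pi_ge0// ler1n.
  have ss : sin (t * x) <= sin x.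
    have b (y : R) : 0 <= y -> y <= pi / 2 -> y \in `[- (pi / 2), pi / 2].
      move=> y0 yp; rewrite in_itv /= yp andbT (le_trans _ y0)//.
      by rewrite oppr_le0 ltW// pihalf_gt0.
    have := txx; rewrite le_eqVlt => /predU1P[->//|lt].
    by apply/ltW; rewrite ltr_sin ?b// (le_trans txx).
  have : sin (t * x) ^+ 2 <= sin x ^+ 2 by rewrite lerXn2r// nnegrE (le_trans s0).
  lra.
have mI : measurable (`[0%R, pi / 2]%classic : set R) by exact: measurable_itv.
apply/andP; split; last first.
  apply: le_Rintegral => // x xI.
  rewrite /wallis_fun mulr0 mul0r cos0 ler_wpM2r// ?exprn_ge0 ?cos_ge0// cos_le1.
have -> : (1 - m.+1%:R^-1) * wallis 0 m = wallis 0 m - 2 * (wallis 0 m - wallis 0 m.+1).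
  have m0 : m.+1%:R != 0 :> R by rewrite pnatr_eq0.
  rewrite wallis0S (_ : (2 * m + 2)%:R = 2 * m.+1%:R :> R); last first.
    by rewrite -natrM mulnS addnC.
  rewrite (_ : (2 * m + 1)%:R = 2 * m.+1%:R - 1 :> R); last first.
    by rewrite -natr1 natrD natrM; ring.
  by field.
pose g x := wallis_fun 0 m x - wallis_fun 0 m.+1 x.
have cg : continuous g.
  by move=> x; apply: cvgB; exact: cw.
have c2g : continuous (fun x => 2 * g x) by exact: continuousZ.
have ch : continuous (fun x => wallis_fun 0 m x - 2 * g x).
  by move=> x; apply: cvgB; [exact: cw|exact: c2g].
have iD := I_integrable cg; have iD2 := I_integrable c2g.
have iD3 := I_integrable ch.
rewrite /wallis -RintegralB// -RintegralZl// -RintegralB//.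
apply: le_Rintegral => //.
move=> x xI; rewrite /g /wallis_fun mulr0 mul0r cos0 !mul1r mulnS exprD.
have := key x xI; have := exprn_ge0 (2 * m) (cos_ge0 x xI).
set p := cos x ^+ (2 * m) => p0 K; have := ler_wpM2r p0 K.
by apply: le_trans; rewrite le_eqVlt; apply/orP; left; apply/eqP; ring.
Qed.

End wallis.

(** * Reflection formula for the Gamma function *)

Section reflection.
Context {R : realType}.
Implicit Types s t : R.

Definition rgamma s : R := fine (egamma s).

Lemma rgamma_gt0 s : 0 < s -> 0 < rgamma s.
Proof.
by move=> /egamma_fin_num/andP[f p]; rewrite fine_gt0// p ltey_eq f.
Qed.

Lemma rgamma1 : rgamma 1 = 1.
Proof. by rewrite /rgamma egamma1. Qed.

Lemma rgammaS s : 0 < s -> rgamma (s + 1) = s * rgamma s.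
Proof.
move=> s0; have /andP[f _] := egamma_fin_num s0.
by rewrite /rgamma egammaS// fineM.
Qed.

Lemma rgammaD_le s t : 0 < s -> 0 <= t <= 1 -> rgamma (s + t) <= s `^ t * rgamma s.
Proof.
move=> s0 t01; have /andP[f _] := egamma_fin_num s0.
have st0 : 0 < s + t by rewrite ltr_wpDr//; case/andP: t01.
have /andP[f' _] := egamma_fin_num st0.
by rewrite -lee_fin EFinM /rgamma !fineK// egammaD_le.
Qed.

Lemma rgamma_nat m : rgamma m.+1%:R = m`!%:R.
Proof.
elim: m => [|m IH]; first by rewrite rgamma1.
by rewrite -natr1 rgammaS// IH factS natrM.
Qed.

(** [rgammaD_le] is used with both increments t and 1-t, to reach an integer from m+2+t and m+2-t,
    or to reach these from an integer; the powers combine to exponent t + (1-t) = 1. *)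
Lemma rgamma_prod_bounds t m : 0 < t < 1 ->
  m.+2%:R / m.+3%:R * (m.+1`!%:R ^+ 2) <= rgamma (m.+2%:R + t) * rgamma (m.+2%:R - t)
  <= m.+2%:R / m.+1%:R * (m.+1`!%:R ^+ 2).
Proof.
move=> /andP[t0 t1].
have t01 : 0 <= t <= 1 by rewrite (ltW t0) ltW.
have t'01 : 0 <= 1 - t <= 1 by rewrite subr_ge0 lerBlDr lerDl (ltW t0) ltW.
have f0 : 0 < m.+1`!%:R :> R by rewrite ltr0n fact_gt0.
have mt : 0 < m.+2%:R - t.
  by rewrite subr_gt0 (lt_trans t1)// ltr1n.
have gA : 0 < rgamma (m.+2%:R + t) by rewrite rgamma_gt0// addr_gt0.
have gB : 0 < rgamma (m.+2%:R - t) by rewrite rgamma_gt0.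
apply/andP; split.
  have h1 := @rgammaD_le (m.+2%:R + t) (1 - t) (addr_gt0 (ltr0Sn _ _) t0) t'01.
  have h2 := @rgammaD_le (m.+2%:R - t) t mt t01.
  rewrite subrK rgamma_nat in h2.
  rewrite (_ : _ + t + _ = m.+3%:R) in h1; last by rewrite -[in RHS]natr1; ring.
  rewrite rgamma_nat in h1.
  have c1 : (m.+2%:R + t) `^ (1 - t) <= m.+3%:R `^ (1 - t).
    apply: ge0_ler_powR; rewrite ?nnegrE ?ler0n//; first by case/andP: t'01.
      by rewrite addr_ge0// ltW.
    by rewrite -[leRHS]natr1 lerD2l ltW.
  have c2 : (m.+2%:R - t) `^ t <= m.+3%:R `^ t.
    apply: ge0_ler_powR; rewrite ?nnegrE ?ler0n ?(ltW mt) ?(ltW t0)//.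
    by rewrite -[leRHS]natr1; lra.
  have h1' : m.+2`!%:R <= m.+3%:R `^ (1 - t) * rgamma (m.+2%:R + t).
    by apply: le_trans h1 _; rewrite ler_pM2r.
  have h2' : m.+1`!%:R <= m.+3%:R `^ t * rgamma (m.+2%:R - t).
    by apply: le_trans h2 _; rewrite ler_pM2r.
  have := ler_pM (ler0n _ _) (ler0n _ _) h1' h2'.
  rewrite mulrACA -powRD; last by rewrite pnatr_eq0 implybT.
  rewrite subrK powRr1 ?ler0n// factS natrM => H.
  rewrite mulrAC ler_pdivrMr// mulrC [leRHS]mulrC.
  by apply: le_trans H; rewrite le_eqVlt; apply/orP; left; apply/eqP; ring.
have h1 := @rgammaD_le m.+2%:R t (ltr0Sn _ _) t01.
have h2 := @rgammaD_le m.+1%:R (1 - t) (ltr0Sn _ _) t'01.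
rewrite rgamma_nat in h1; rewrite rgamma_nat in h2.
rewrite (_ : _ + (1 - t) = m.+2%:R - t) in h2; last by rewrite -[in RHS]natr1; ring.
apply: le_trans (ler_pM (ltW gA) (ltW gB) h1 h2) _.
have -> : m.+1`!%:R = m.+1%:R * m`!%:R :> R by rewrite factS natrM.
have -> : m.+1%:R `^ (1 - t) = m.+1%:R / m.+1%:R `^ t :> R.
  by rewrite powRB ?powRr1 ?pnatr_eq0 ?implybT// ler0n.
have p0 : 0 < m.+1%:R `^ t :> R by rewrite powR_gt0.
have H : m.+2%:R `^ t <= m.+2%:R / m.+1%:R * m.+1%:R `^ t :> R.
  have -> : m.+2%:R = (m.+2%:R / m.+1%:R) * m.+1%:R :> R by rewrite divfK ?pnatr_eq0.
  rewrite powRM ?divr_ge0 ?ler0n// mulfK ?pnatr_eq0// ler_pM2r//.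
  rewrite -[leRHS]powRr1 ?divr_ge0 ?ler0n//.
  rewrite ler_powR// ?(ltW t1)//.
  by rewrite ler_pdivlMr// mul1r ler_nat.
have m0 : 0 < m`!%:R :> R by rewrite ltr0n fact_gt0.
have k0 : 0 < m.+1%:R :> R by [].
have -> : m.+2%:R `^ t * (m.+1%:R * m`!%:R) * (m.+1%:R / m.+1%:R `^ t * m`!%:R) =
  (m.+2%:R `^ t / m.+1%:R `^ t) * (m.+1%:R * m`!%:R) ^+ 2 :> R.
  by field; rewrite gt_eqF.
rewrite ler_pM2r ?exprn_gt0 ?mulr_gt0//.
by rewrite ler_pdivrMr.
Qed.

Lemma rgamma_reflection t : 0 < t < 1 ->
  rgamma (1 + t) * rgamma (1 - t) * sin (pi * t) = pi * t.
Proof.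
move=> t01; have /andP[t0 t1] := t01.
have pi0 := pi_gt0 R.
(* By the recursions for Gamma and [wallis], the expression in [KE] does not depend on m; its value
   at m = 0 is [K], and its two factors are squeezed to 1 for large m. *)
pose K := rgamma (1 + t) * rgamma (1 - t) * (sin (pi * t) / (pi * t)).
suff : K = 1.
  move=> K1; have <- : K * (pi * t) = rgamma (1 + t) * rgamma (1 - t) * sin (pi * t).
    by rewrite /K -mulrA divfK// mulf_neq0 ?(gt_eqF pi0) ?(gt_eqF t0).
  by rewrite K1 mul1r.
have KE m : K = rgamma (m.+1%:R + t) * rgamma (m.+1%:R - t) / (m`!%:R ^+ 2) *
    (wallis t m / wallis 0 m).
  elim: m => [|m IH].
    rewrite /K wallis0 ?gt_eqF// wallis00 expr1n divr1; congr (_ * _).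
    by rewrite -mulrA -invfM; congr (_ * _^-1); field.
  rewrite IH; have mt : 0 < m.+1%:R - t.
    by rewrite subr_gt0 (lt_le_trans t1)// ler1n.
  have w0 := wallis0_gt0 m (R := R).
  rewrite (_ : m.+2%:R + t = m.+1%:R + t + 1); last by rewrite -[in LHS]natr1; ring.
  rewrite (_ : m.+2%:R - t = m.+1%:R - t + 1); last by rewrite -[in LHS]natr1; ring.
  rewrite !rgammaS// ?addr_gt0// wallis0S factS natrM.
  have := wallisS t m; rewrite (_ : (2 * m + 2)%:R = 2 * m.+1%:R :> R); last first.
    by rewrite -natrM mulnS addnC.
  have f0 : 0 < m`!%:R :> R by rewrite ltr0n fact_gt0.
  have k0 : 0 < m.+1%:R :> R by [].
  have l0 : 0 < (2 * m + 1)%:R :> R by rewrite ltr0n addn1.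
  set f := m`!%:R; set k : R := m.+1%:R; set l := (2 * m + 1)%:R.
  move=> H.
  have H' : wallis t m = ((2 * k) ^+ 2 - 4 * t ^+ 2) * wallis t m.+1 / (2 * k * l).
    by rewrite H mulrAC divff ?mul1r// !mulf_neq0 ?gt_eqF.
  rewrite H'; field.
  by rewrite !gt_eqF.
have lo m : m.+1%:R / m.+3%:R <= K.
  have /andP[g1 g2] := rgamma_prod_bounds m t01.
  have t01' : 0 <= t <= 1 by rewrite (ltW t0) (ltW t1).
  have /andP[w1 w2] := wallis_bounds m.+1 t01'.
  have w0 := wallis0_gt0 m.+1 (R := R).
  have f0 : 0 < m.+1`!%:R ^+ 2 :> R by rewrite exprn_gt0// ltr0n fact_gt0.
  rewrite (KE m.+1).
  have a1 : m.+2%:R / m.+3%:R <= rgamma (m.+2%:R + t) * rgamma (m.+2%:R - t) / (m.+1`!%:R ^+ 2).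
    by rewrite ler_pdivlMr.
  have a2 : m.+1%:R / m.+2%:R <= wallis t m.+1 / wallis 0 m.+1.
    rewrite ler_pdivlMr//; apply: le_trans w1; rewrite ler_pM2r//.
    rewrite le_eqVlt; apply/orP; left; apply/eqP.
    have k0 : m.+2%:R != 0 :> R by rewrite pnatr_eq0.
    apply: (mulIf k0); rewrite divfK// mulrBl mulVf// mul1r.
    by rewrite -[m.+2%:R]natr1 addrK.
  apply: le_trans (ler_pM _ _ a1 a2); rewrite ?divr_ge0 ?ler0n//.
  by rewrite [leRHS]mulrC mulrA divfK// pnatr_eq0.
have hi m : K <= m.+2%:R / m.+1%:R.
  have /andP[g1 g2] := rgamma_prod_bounds m t01.
  have t01' : 0 <= t <= 1 by rewrite (ltW t0) (ltW t1).
  have /andP[w1 w2] := wallis_bounds m.+1 t01'.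
  have w0 := wallis0_gt0 m.+1 (R := R).
  have f0 : 0 < m.+1`!%:R ^+ 2 :> R by rewrite exprn_gt0// ltr0n fact_gt0.
  rewrite (KE m.+1).
  rewrite -[leRHS]mulr1; apply: ler_pM.
  - have mt : 0 < m.+2%:R - t by rewrite subr_gt0 (lt_trans t1)// ltr1n.
    rewrite divr_ge0 ?(ltW f0)// ltW// mulr_gt0// rgamma_gt0//.
    by rewrite addr_gt0.
  - rewrite divr_ge0 ?(ltW w0)//; apply: le_trans w1.
    by rewrite mulr_ge0 ?(ltW w0)// subr_ge0 invf_le1// ler1n.
  - by rewrite ler_pdivrMr.
  - by rewrite ler_pdivrMr// mul1r.
apply/eqP; rewrite eq_le; apply/andP; split.
  apply/ler_addgt0Pr => e e0; apply: le_trans (hi (Num.bound e^-1)) _.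
  rewrite ler_pdivrMr// mulrDl mul1r -natr1 lerD2l.
  rewrite -ler_pdivrMl// mulr1 (le_trans (ltW (archi_boundP _)))//.
    by rewrite invr_ge0 ltW.
  by rewrite ler_nat.
apply/ler_addgt0Pr => e e0.
have := lo (Num.bound (2 / e)); set m := Num.bound _ => H.
have : 1 - e <= m.+1%:R / m.+3%:R.
  rewrite ler_pdivlMr// mulrBl mul1r.
  have -> : m.+3%:R = m.+1%:R + 2 :> R by rewrite -natrD addn2.
  rewrite lerBlDr lerD2l -ler_pdivrMl// mulrC.
  rewrite (le_trans (ltW (archi_boundP _)))//; first by rewrite divr_ge0 ?ltW.
  by rewrite -/m -natrD ler_nat; lia.
by move=> H1; rewrite -lerBlDr; exact: le_trans H.
Qed.

Lemma GammaE u : 0 < u -> Gamma u = rgamma u.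
Proof. by rewrite /Gamma => ->. Qed.

(** [Gamma (- alpha)] is defined through reflection, so this is Euler's formula at alpha - 1. It
    converts the constant of the statement into the one that both the stable exponent and the
    expansion for A produce. *)
Lemma Gamma_reflection (alpha : R) : 1 < alpha < 2 ->
  alpha * Gamma (- alpha) = Gamma (2 - alpha) / (alpha - 1).
Proof.
move=> /andP[a1 a2].
have -> : Gamma (2 - alpha) = rgamma (2 - alpha) by apply: GammaE; rewrite subr_gt0.
have a0 : 0 < alpha by rewrite (lt_trans _ a1).
have -> : Gamma (- alpha) = pi / (- alpha * rgamma alpha * sin (pi * alpha)).
  by rewrite /Gamma oppr_gt0 ltNge (ltW a0) /= opprK.
have t01 : 0 < alpha - 1 < 1 by rewrite subr_gt0 a1 ltrBlDr.
have := rgamma_reflection t01.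
rewrite (_ : 1 + (alpha - 1) = alpha); last by ring.
rewrite (_ : 1 - (alpha - 1) = 2 - alpha); last by ring.
rewrite (_ : pi * (alpha - 1) = pi * alpha - pi); last by ring.
have -> : sin (pi * alpha - pi) = - sin (pi * alpha).
  by rewrite sinB sinpi cospi; ring.
have pi0 := pi_gt0 R.
have g0 := rgamma_gt0 a0.
set g := rgamma alpha => H.
have b0 : alpha - 1 != 0 by rewrite subr_eq0 gt_eqF.
have s0 : sin (pi * alpha) != 0.
  apply/eqP => s0; move: H; rewrite s0 oppr0 mulr0 => /esym/eqP.
  by rewrite -[X in _ - X]mulr1 -mulrBr mulf_eq0 (negbTE b0) gt_eqF.
have -> : rgamma (2 - alpha) = - (pi * (alpha - 1)) / (g * sin (pi * alpha)).
  apply: (mulfI (mulf_neq0 (lt0r_neq0 g0) s0)).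
  rewrite [RHS]mulrC divfK ?(mulf_neq0 (lt0r_neq0 g0) s0)//.
  by rewrite mulrBr mulr1 -H /g; ring.
by field; rewrite b0 s0 !gt_eqF.
Qed.

End reflection.

(** * Laplace transform of a totally skewed stable law *)

Section half_line.
Context {R : realType}.
Notation mu := (@lebesgue_measure R).
Notation D := (`]0%R, +oo[%classic : set R).

Lemma half_lineP (x : R) : D x <-> 0 < x.
Proof. by rewrite /= in_itv /= andbT. Qed.

Lemma expRN_integrable : mu.-integrable D (EFin \o (fun x => expR (- x))).
Proof.
apply/integrableP; split.
  by apply: measurable_funTS; apply/measurable_EFinP; exact: measurable_expRN.
rewrite integral_itv_obnd_cbnd; last first.
  apply: measurable_funTS; apply: measurableT_comp => //.
  by apply/measurable_EFinP; exact: measurable_expRN.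
rewrite [ltLHS](_ : _ = (\int[mu]_(y in `[0%R, +oo[) (expR (- y))%:E)%E).
  by rewrite integral_expRN ltry.
by apply: eq_integral => x _; rewrite /= ger0_norm ?expR_ge0.
Qed.

Lemma half_line_integrable (f : R -> R) (C : R) : measurable_fun D f ->
  (forall x, 0 < x -> `|f x| <= C * expR (- x)) ->
  mu.-integrable D (EFin \o f).
Proof.
move=> mf fC.
have iC : mu.-integrable D (fun x : R => (C%:E * (EFin \o (fun x => expR (- x))) x)%E).
  by apply: integrableZl => //; exact: expRN_integrable.
apply: le_integrable iC => //; first exact/measurable_EFinP.
by move=> x /half_lineP x0; rewrite /= lee_fin (le_trans (fC x x0))// ler_norm.
Qed.

Lemma half_line_dct (f_ : nat -> R -> R) (f : R -> R) (C : R) :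
  (forall n, measurable_fun D (f_ n)) ->
  (forall x, 0 < x -> f_ n x @[n --> \oo] --> f x) ->
  (forall n x, 0 < x -> `|f_ n x| <= C * expR (- x)) ->
  (\int[mu]_(x in D) f_ n x) @[n --> \oo] --> \int[mu]_(x in D) f x.
Proof.
move=> mf ff fC.
have mlim : measurable_fun D f.
  apply: (measurable_fun_cvg mf) => x /half_lineP; exact: ff.
have flim x : 0 < x -> `|f x| <= C * expR (- x).
  move=> x0; have /cvg_norm h := ff x x0.
  apply: (ler_cvg_to h (cvg_cst _)).
  by near=> n; exact: fC.
have fi := half_line_integrable mlim flim.
apply/fine_cvg; rewrite fineK; last exact: integrable_fin_num.
pose g : measurableTypeR R -> \bar R := fun x => (C * expR (- x))%:E.
apply: (@dominated_cvg _ (measurableTypeR R) R mu D _ (fun n => EFin \o f_ n)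
  (EFin \o f) g) => //.
- by move=> n; apply/measurable_EFinP; exact: (mf n).
- move=> x /half_lineP x0; apply: cvg_EFin; first by near=> n.
  exact: ff.
- apply: (@half_line_integrable (fun x => C * expR (- x)) `|C|).
    by apply: measurable_funTS; apply: measurable_funM => //; exact: measurable_expRN.
  by move=> x _; rewrite normrM (ger0_norm (expR_ge0 _)).
- by move=> n x /half_lineP x0; rewrite /= lee_fin fC.
Unshelve. all: by end_near. Qed.

Lemma half_line_FTC0 (f F : R -> R) (C : R) : continuous f ->
  (forall x : R, is_derive x 1 F (f x)) -> F 0 = 0 ->
  (forall x, 0 < x -> `|f x| <= C * expR (- x)) ->
  (forall x, 0 < x -> `|F x| <= C * expR (- x)) ->
  \int[mu]_(x in D) f x = 0.
Proof.
move=> cf dF F0 fC FC.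
have mf := continuous_measurable_fun cf.
pose g (n : nat) x := if x <= n.+1%:R then f x else 0.
have gf : (\int[mu]_(x in D) g n x) @[n --> \oo] --> \int[mu]_(x in D) f x.
  apply: (@half_line_dct _ _ C).
  - move=> n; apply: measurable_funTS; apply: measurable_fun_ifT => //.
    by apply: measurable_fun_ler.
  - move=> x x0; apply: cvg_near_cst; near=> n; rewrite /g.
    case: ifPn => //; rewrite -ltNge => /ltW; rewrite leNgt => /negP; case.
    apply: (@lt_trans _ _ n%:R); last by rewrite ltr_nat.
    by near: n; exact: nbhs_infty_gtr.
  - move=> n x x0; rewrite /g; case: ifP => _; first exact: fC.
    rewrite normr0; exact: le_trans (normr_ge0 _) (fC x x0).
have gE n : \int[mu]_(x in D) g n x = F n.+1%:R.
  have n0 : 0 < n.+1%:R :> R by [].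
  have := @FTC _ f F 0 n.+1%:R n0 (fun x _ => cf x) (fun x _ => dF x).
  rewrite F0 subr0 => H; rewrite /Rintegral -[RHS]/(fine (F n.+1%:R)%:E) -H.
  congr fine; rewrite -integral_itv_obnd_cbnd; last first.
    by apply: measurable_funTS; apply/measurable_EFinP.
  rewrite [LHS]integral_mkcond [RHS]integral_mkcond; apply: eq_integral => x _.
  rewrite !patchE /g !mem_setE !in_itv /= andbT.
  by case: (0 < x); case: (x <= _).
apply/esym/(cvg_unique _ _ gf) => //; rewrite (funext gE).
apply/cvgr0Pnorm_le => e e0; near=> n.
apply: le_trans (FC _ _) _ => //.
apply: (@le_trans _ _ (`|C| / n.+1%:R)).
  apply: (@le_trans _ _ (`|C| * expR (- n.+1%:R))).
    by rewrite ler_wpM2r ?expR_ge0 ?ler_norm.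
  rewrite ler_wpM2l// expRN lef_pV2 ?posrE ?expR_gt0//.
  by apply: le_trans (expR_ge1Dx _); rewrite lerDr.
rewrite ler_pdivrMr// -ler_pdivrMl// (@le_trans _ _ n%:R)//; last by rewrite ler_nat.
by near: n; exact: nbhs_infty_ger.
Unshelve. all: by end_near. Qed.

End half_line.

(** * Contour shift for a Gaussian-smoothed stable exponent *)

Section contour.
Context {R : realType}.
Notation mu := (@lebesgue_measure R).
Variables (al ka h q : R).
Hypotheses (al1 : 1 < al) (al2 : al < 2) (ka0 : 0 <= ka) (h0 : 0 < h) (h1 : h <= 1)
  (q0 : 0 < q).
Implicit Types y f : R.

(* Writing [z = y - i h f], these are the modulus squared and minus the argument
   of [z], then [z ^ al = P - i Q], [al * z ^ (al - 1) = al (P1 - i Q1)], and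
   [E - i J] is the holomorphic exponent [ka z ^ al + ((z - q) / h) ^ 2 / 2]. *)
Definition rho2 y f := y ^+ 2 + (h * f) ^+ 2.
Definition arg y f := atan (h * f / y).
Definition powP y f := rho2 y f `^ (al / 2) * cos (al * arg y f).
Definition powQ y f := rho2 y f `^ (al / 2) * sin (al * arg y f).
Definition powP1 y f := rho2 y f `^ (al / 2 - 1) *
  (y * cos (al * arg y f) + h * f * sin (al * arg y f)).
Definition powQ1 y f := rho2 y f `^ (al / 2 - 1) *
  (y * sin (al * arg y f) - h * f * cos (al * arg y f)).
Definition expoE y f := ka * powP y f + 2^-1 * ((h^-1 * (y - q)) ^+ 2 - f ^+ 2).
Definition expoJ y f := ka * powQ y f + h^-1 * ((y - q) * f).
Definition cgauss y f := expR (expoE y f) * cos (expoJ y f).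
Definition sgauss y f := expR (expoE y f) * sin (expoJ y f).
Definition dE y f := ka * (al * powP1 y f) + h^-1 ^+ 2 * (y - q).
Definition dJ y f := ka * (al * powQ1 y f) + h^-1 * f.
Definition dcgauss y f :=
  expR (expoE y f) * (dE y f * cos (expoJ y f) - dJ y f * sin (expoJ y f)).

Lemma rho2_gt0 y f : 0 < y -> 0 < rho2 y f.
Proof. by move=> y0; rewrite ltr_wpDr ?sqr_ge0// exprn_gt0. Qed.

Lemma arg_rho2 y f : y != 0 -> 1 + (h * f / y) ^+ 2 = rho2 y f / y ^+ 2.
Proof. by move=> y0; rewrite /rho2; field. Qed.

Lemma darg_y y f : 0 < y -> is_derive y 1 (arg ^~ f) (- (h * f) / rho2 y f).
Proof.
move=> y0; have yn0 : y != 0 by rewrite gt_eqF.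
have rn0 : rho2 y f != 0 by rewrite gt_eqF ?rho2_gt0.
have dV : is_derive y 1 (fun t : R => h * f / t) (- (h * f) / y ^+ 2).
  have h2 : is_derive y 1 (fun t : R => t^-1) (- y ^- 2).
    apply: (deriveW (is_deriveV yn0 (dI y))).
    by rewrite /GRing.scale /= mulr1.
  by apply: (deriveW (dZ (h * f) h2)); rewrite mulrN mulNr.
apply: (deriveW (datan dV)); rewrite arg_rho2//.
by rewrite invf_div; field; rewrite yn0 rn0.
Qed.

Lemma darg_f y f : 0 < y -> is_derive f 1 (arg y) (h * y / rho2 y f).
Proof.
move=> y0; have yn0 : y != 0 by rewrite gt_eqF.
have rn0 : rho2 y f != 0 by rewrite gt_eqF ?rho2_gt0.
have d1 : is_derive f 1 (fun t : R => h * t / y) (h / y).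
  by apply: (deriveW (dM (dZ h (dI f)) (dC y^-1 f))); rewrite mulr0 addr0 mulr1.
apply: (deriveW (datan d1)); rewrite arg_rho2//.
by rewrite invf_div; field; rewrite yn0 rn0.
Qed.

Lemma drho2_y y f : is_derive y 1 (rho2 ^~ f) (2 * y).
Proof.
by apply: (deriveW (dD (dX 1 (dI y)) (dC ((h * f) ^+ 2) y))); rewrite expr1; ring.
Qed.

Lemma drho2_f y f : is_derive f 1 (rho2 y) (2 * h ^+ 2 * f).
Proof.
by apply: (deriveW (dD (dC (y ^+ 2) f) (dX 1 (dZ h (dI f))))); rewrite expr1; ring.
Qed.

Lemma rho2_powB1 y f : 0 < y ->
  rho2 y f `^ (al / 2) = rho2 y f `^ (al / 2 - 1) * rho2 y f.
Proof.
move=> y0; rewrite [RHS]mulrC mulr_powRB1//; first by rewrite ltW ?rho2_gt0.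
by rewrite divr_gt0// (lt_trans ltr01).
Qed.

Lemma dpowP_y y f : 0 < y -> is_derive y 1 (powP ^~ f) (al * powP1 y f).
Proof.
move=> y0; have r0 := rho2_gt0 f y0.
apply: (deriveW (dM (@dpowR R (rho2 ^~ f) y (2 * y) (al / 2) r0 (drho2_y y f)) (dcos (dZ al (darg_y f y0))))).
rewrite rho2_powB1// /powP1.
by field; rewrite gt_eqF.
Qed.

Lemma dpowQ_y y f : 0 < y -> is_derive y 1 (powQ ^~ f) (al * powQ1 y f).
Proof.
move=> y0; have r0 := rho2_gt0 f y0.
apply: (deriveW (dM (@dpowR R (rho2 ^~ f) y (2 * y) (al / 2) r0 (drho2_y y f)) (dsin (dZ al (darg_y f y0))))).
rewrite rho2_powB1// /powQ1.
by field; rewrite gt_eqF.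
Qed.

Lemma dpowP_f y f : 0 < y -> is_derive f 1 (powP y) (- (h * (al * powQ1 y f))).
Proof.
move=> y0; have r0 := rho2_gt0 f y0.
apply: (deriveW (dM (dpowR (al / 2) r0 (drho2_f y f)) (dcos (dZ al (darg_f f y0))))).
rewrite rho2_powB1// /powQ1.
by field; rewrite gt_eqF.
Qed.

Lemma dpowQ_f y f : 0 < y -> is_derive f 1 (powQ y) (h * (al * powP1 y f)).
Proof.
move=> y0; have r0 := rho2_gt0 f y0.
apply: (deriveW (dM (dpowR (al / 2) r0 (drho2_f y f)) (dsin (dZ al (darg_f f y0))))).
rewrite rho2_powB1// /powP1.
by field; rewrite gt_eqF.
Qed.

Lemma dexpoE_y y f : 0 < y -> is_derive y 1 (expoE ^~ f) (dE y f).
Proof.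
move=> y0; apply: (deriveW (dD (dZ ka (dpowP_y f y0)) (dZ 2^-1
  (dB (dX 1 (dZ h^-1 (dB (dI y) (dC q y)))) (dC (f ^+ 2) y))))).
by rewrite /dE expr1; field; rewrite gt_eqF.
Qed.

Lemma dexpoJ_y y f : 0 < y -> is_derive y 1 (expoJ ^~ f) (dJ y f).
Proof.
move=> y0; apply: (deriveW (dD (dZ ka (dpowQ_y f y0)) (dZ h^-1
  (dM (dB (dI y) (dC q y)) (dC f y))))).
by rewrite /dJ mulr0 addr0 subr0 mul1r.
Qed.

Lemma dexpoE_f y f : 0 < y -> is_derive f 1 (expoE y) (- (h * dJ y f)).
Proof.
move=> y0; apply: (deriveW (dD (dZ ka (dpowP_f f y0)) (dZ 2^-1
  (dB (dC ((h^-1 * (y - q)) ^+ 2) f) (dX 1 (dI f)))))).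
by rewrite /dJ expr1; field; rewrite gt_eqF.
Qed.

Lemma dexpoJ_f y f : 0 < y -> is_derive f 1 (expoJ y) (h * dE y f).
Proof.
move=> y0; apply: (deriveW (dD (dZ ka (dpowQ_f f y0)) (dZ h^-1
  (dZ (y - q) (dI f))))).
by rewrite /dE; field; rewrite gt_eqF.
Qed.

Lemma dcgauss_y y f : 0 < y -> is_derive y 1 (cgauss ^~ f) (dcgauss y f).
Proof.
move=> y0.
apply: (deriveW (dM (dexp (dexpoE_y f y0)) (dcos (dexpoJ_y f y0)))).
by rewrite /dcgauss; ring.
Qed.

(* The Cauchy-Riemann equations. *)
Lemma dsgauss_f y f : 0 < y -> is_derive f 1 (sgauss y) (h * dcgauss y f).
Proof.
move=> y0.
apply: (deriveW (dM (dexp (dexpoE_f f y0)) (dsin (dexpoJ_f f y0)))).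
by rewrite /dcgauss; ring.
Qed.

Lemma continuous_cgauss y : 0 < y -> continuous (cgauss y).
Proof.
move=> y0 f; exact: (is_derive_continuous
  (dM (dexp (dexpoE_f f y0)) (dcos (dexpoJ_f f y0)))).
Qed.

Lemma continuous_dcgauss y : 0 < y -> continuous (dcgauss y).
Proof.
move=> y0 f; have r0 := rho2_gt0 f y0.
have da := dZ al (darg_f f y0).
have dp := dpowR (al / 2 - 1) r0 (drho2_f y f).
have dhf := dZ h (dI f).
have dP1 := dM dp (dD (dZ y (dcos da)) (dM dhf (dsin da))).
have dQ1 := dM dp (dB (dZ y (dsin da)) (dM dhf (dcos da))).
have dEf := dD (dZ ka (dZ al dP1)) (dC (h^-1 ^+ 2 * (y - q)) f).
have dJf := dD (dZ ka (dZ al dQ1)) (dZ h^-1 (dI f)).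
have dj := dexpoJ_f f y0.
exact: (is_derive_continuous (dM (dexp (dexpoE_f f y0))
  (dB (dM dEf (dcos dj)) (dM dJf (dsin dj))))).
Qed.

Lemma abs_cos_le1 (x : R) : `|cos x| <= 1.
Proof. by rewrite ler_norml cos_geN1 cos_le1. Qed.

Lemma abs_sin_le1 (x : R) : `|sin x| <= 1.
Proof. by rewrite ler_norml sin_geN1 sin_le1. Qed.

(** As al/2 < 1 the power is sublinear in r: at the scale [s] where its slope is small enough, it
    lies below a constant plus r/4. The Gaussian term - f^2/2 of the exponent therefore wins. *)
Lemma powP_bound (v : R) : exists A : R, forall r f, 0 <= r <= v ^+ 2 + f ^+ 2 ->
  ka * r `^ (al / 2) <= A + f ^+ 2 / 4.
Proof using al1 al2 ka0.
have a1 := al1; have a2 := al2; have k0 := ka0.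
have [s s0 Hs] : exists2 s : R, 0 < s & ka * s `^ (al / 2 - 1) <= 4^-1.
  have d0 : 0 < 1 - al / 2 by lra.
  exists ((4 * ka + 1) `^ (1 - al / 2)^-1); first by rewrite powR_gt0; lra.
  have k1 : 0 < 4 * ka + 1 by lra.
  rewrite -powRrM (_ : _^-1 * _ = -1); last by field; lra.
  rewrite powR_inv1; last by lra.
  by rewrite ler_pdivrMr//; lra.
exists (ka * s `^ (al / 2) + v ^+ 2 / 4) => r f /andP[r0 rv].
have t01 : 0 <= al / 2 <= 1 by apply/andP; split; lra.
have main : r `^ (al / 2) <= s `^ (al / 2) + s `^ (al / 2 - 1) * r.
  have [r1|] := eqVneq r 0.
    rewrite r1 mulr0 addr0 powR0; first by rewrite powR_ge0.
    by rewrite gt_eqF//; lra.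
  move=> rn; have rp : 0 < r / s by rewrite divr_gt0// lt_neqAle eq_sym rn.
  have E : r = s * (r / s) by rewrite mulrC divfK ?gt_eqF.
  rewrite {1}E powRM ?(ltW s0) ?(ltW rp)//.
  apply: le_trans (_ : s `^ (al / 2) * (1 + r / s) <= _).
    rewrite ler_pM2l ?powR_gt0//; apply: le_trans (powR_le_affine t01 rp) _.
    rewrite lerD//; first by lra.
    by rewrite ler_piMl ?(ltW rp)//; lra.
  rewrite mulrDr mulr1 lerD2l.
  have -> : s `^ (al / 2) = s * s `^ (al / 2 - 1).
    by rewrite mulr_powRB1 ?(ltW s0)//; lra.
  by rewrite mulrC -mulrA [X in X <= _](_ : _ = s `^ (al / 2 - 1) * r)//;
    field; rewrite gt_eqF.
apply: le_trans (ler_wpM2l ka0 main) _; rewrite mulrDr -addrA lerD2l mulrA.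
apply: le_trans (ler_wpM2r r0 Hs) _; lra.
Qed.

Lemma rho2_le (v : R) y f : 0 <= y <= v -> 0 <= rho2 y f <= v ^+ 2 + f ^+ 2.
Proof.
move=> /andP[y0 yv]; rewrite addr_ge0 ?sqr_ge0//= lerD//.
  by rewrite lerXn2r ?nnegrE// (le_trans y0).
by rewrite exprMn ler_piMl ?sqr_ge0// expr_le1 ?(ltW h0).
Qed.

Lemma powP_le y f : `|powP y f| <= rho2 y f `^ (al / 2).
Proof.
rewrite normrM (ger0_norm (powR_ge0 _ _)) ler_piMr ?powR_ge0//.
exact: abs_cos_le1.
Qed.

Lemma expoE_bound (v : R) : exists A : R, forall y f, 0 <= y <= v ->
  expoE y f <= A + (h^-1 * (y - q)) ^+ 2 - 2 * f.
Proof.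
have [A HA] := powP_bound v; exists (A + 4) => y f yv.
have H1 := HA _ f (rho2_le f yv); have H2 := ler_wpM2l ka0 (powP_le y f).
have H3 : ka * powP y f <= ka * `|powP y f| by rewrite ler_wpM2l// ler_norm.
have := sqr_ge0 (f / 2 - 2); have := sqr_ge0 (h^-1 * (y - q)).
rewrite /expoE; set b := (h^-1 * _) ^+ 2.
have -> : (f / 2 - 2) ^+ 2 = f ^+ 2 / 4 - 2 * f + 4 by field.
lra.
Qed.

Definition contour y := \int[mu]_(f in `]0%R, +oo[%classic) cgauss y f.

(** Two factors exp (-f) are kept: one will absorb the factor 1 + f coming from the derivative, the
    other remains as the integrable dominating function. *)
Lemma expR_expoE_bound (v : R) : exists2 C : R, 0 <= C & forall y f,
  0 <= y <= v -> 0 <= f -> expR (expoE y f) <= C * expR (- f) * expR (- f).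
Proof.
have [A HA] := expoE_bound v.
exists (expR (A + (h^-1 * (v + q)) ^+ 2)); first exact: expR_ge0.
move=> y f yv f0; rewrite -!expRD ler_expR; apply: le_trans (HA y f yv) _.
have /andP[y0 yv'] := yv.
have : (h^-1 * (y - q)) ^+ 2 <= (h^-1 * (v + q)) ^+ 2.
  rewrite !exprMn ler_wpM2l ?sqr_ge0// -subr_ge0 subr_sqr mulr_ge0//.
    by have := q0; lra.
  by have := q0; lra.
lra.
Qed.

Lemma cgauss_bound (v : R) : exists2 C : R, 0 <= C & forall y f,
  0 <= y <= v -> 0 <= f -> `|cgauss y f| <= C * expR (- f) /\
                           `|sgauss y f| <= C * expR (- f).
Proof.
have [C C0 HC] := expR_expoE_bound v; exists C => // y f yv f0.
have E : expR (expoE y f) <= C * expR (- f).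
  apply: le_trans (HC y f yv f0) _.
  rewrite ler_piMr ?mulr_ge0 ?expR_ge0//.
  by rewrite -expR0 ler_expR oppr_le0.
rewrite !normrM (ger0_norm (expR_ge0 _)).
split; apply: le_trans E; rewrite ler_piMr ?expR_ge0 ?abs_cos_le1//.
exact: abs_sin_le1.
Qed.

Lemma dcgauss_bound (u v : R) : 0 < u -> exists2 C : R, 0 <= C & forall y f,
  u <= y <= v -> 0 <= f -> `|dcgauss y f| <= C * expR (- f).
Proof.
move=> u0; have [C C0 HC] := expR_expoE_bound v.
pose B := (u ^+ 2) `^ (al / 2 - 1).
have B0 : 0 <= B by exact: powR_ge0.
have al0 : 0 < al := lt_trans ltr01 al1.
pose M := ka * (al * (B * (`|v| + 1))) + h^-1 ^+ 2 * (`|v| + q) +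
          (ka * (al * (B * (`|v| + 1))) + h^-1).
have hi0 : 0 <= h^-1 by rewrite invr_ge0 ltW.
have M0 : 0 <= M.
  by rewrite !addr_ge0 ?mulr_ge0 ?addr_ge0 ?exprn_ge0 ?(ltW q0)// ltW.
exists (C * M); first by rewrite mulr_ge0.
move=> y f /andP[uy yv] f0.
have y0 : 0 < y := lt_le_trans u0 uy.
have yv0 : 0 <= y <= v by rewrite (ltW y0).
have vE : `|v| = v by rewrite ger0_norm// (le_trans (ltW y0)).
have rB : rho2 y f `^ (al / 2 - 1) <= B.
  have -> : B = ((u ^+ 2) `^ (1 - al / 2))^-1.
    by rewrite -powRN; congr (_ `^ _); ring.
  rewrite (_ : al / 2 - 1 = - (1 - al / 2)); last by ring.
  rewrite powRN lef_pV2 ?posrE ?powR_gt0 ?exprn_gt0 ?rho2_gt0//.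
  apply: ge0_ler_powR; rewrite ?nnegrE ?sqr_ge0 ?(ltW (rho2_gt0 _ _))//.
    by have := al2; lra.
  rewrite /rho2 (le_trans (_ : _ <= y ^+ 2)) ?lerDl ?sqr_ge0//.
  by rewrite lerXn2r ?nnegrE ?(ltW u0) ?(ltW y0).
have hf : 0 <= h * f <= f by rewrite mulr_ge0 ?(ltW h0)//= ler_piMl.
have tri (a b : R) (s t : R) : `|s| <= 1 -> `|t| <= 1 -> 0 <= a -> 0 <= b ->
    `|a * s + b * t| <= a + b.
  move=> s1 t1 a0 b0; apply: le_trans (ler_normD _ _) _.
  by rewrite !normrM (ger0_norm a0) (ger0_norm b0) lerD// ler_piMr.
have P1b : `|powP1 y f| <= B * ((`|v| + 1) * (1 + f)).
  rewrite normrM (ger0_norm (powR_ge0 _ _)) ler_pM ?powR_ge0//.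
  apply: le_trans (tri _ _ _ _ (abs_cos_le1 _) (abs_sin_le1 _) (ltW y0) _) _.
    by case/andP: hf.
  rewrite vE; have /andP[_ ] := hf; have := ltW y0.
  have : 0 <= v * f by rewrite mulr_ge0// (le_trans (ltW y0)).
  lra.
have Q1b : `|powQ1 y f| <= B * ((`|v| + 1) * (1 + f)).
  rewrite normrM (ger0_norm (powR_ge0 _ _)) ler_pM ?powR_ge0//.
  rewrite -mulrN; apply: le_trans (tri _ _ _ _ (abs_sin_le1 _) _ (ltW y0) _) _.
  - by rewrite normrN abs_cos_le1.
  - by case/andP: hf.
  rewrite vE; have /andP[_ ] := hf; have := ltW y0.
  have : 0 <= v * f by rewrite mulr_ge0// (le_trans (ltW y0)).
  lra.
have f1 : 1 <= 1 + f by rewrite lerDl.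
have dEb : `|dE y f| <= (ka * (al * (B * (`|v| + 1))) + h^-1 ^+ 2 * (`|v| + q)) * (1 + f).
  apply: le_trans (ler_normD _ _) _; rewrite mulrDl; apply: lerD.
    rewrite normrM (ger0_norm ka0) -mulrA ler_wpM2l// normrM (gtr0_norm al0).
    by rewrite -mulrA ler_wpM2l ?(ltW al0)// -mulrA.
  rewrite normrM (ger0_norm (exprn_ge0 _ hi0)) -[leRHS]mulrA ler_wpM2l ?exprn_ge0//.
  apply: le_trans (_ : `|v| + q <= _); last first.
    by rewrite ler_peMr// addr_ge0 ?(ltW q0).
  by rewrite vE ler_norml; have := ltW q0; have := ltW y0; lra.
have dJb : `|dJ y f| <= (ka * (al * (B * (`|v| + 1))) + h^-1) * (1 + f).
  apply: le_trans (ler_normD _ _) _; rewrite mulrDl; apply: lerD.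
    rewrite normrM (ger0_norm ka0) -mulrA ler_wpM2l// normrM (gtr0_norm al0).
    by rewrite -mulrA ler_wpM2l ?(ltW al0)// -mulrA.
  by rewrite normrM (ger0_norm hi0) (ger0_norm f0) ler_wpM2l// lerDr.
have main : `|dE y f * cos (expoJ y f) - dJ y f * sin (expoJ y f)| <= M * (1 + f).
  apply: le_trans (ler_normB _ _) _; rewrite !normrM /M [leRHS]mulrDl.
  apply: lerD.
    by apply: le_trans dEb; rewrite ler_piMr// abs_cos_le1.
  by apply: le_trans dJb; rewrite ler_piMr// abs_sin_le1.
rewrite normrM (ger0_norm (expR_ge0 _)).
apply: le_trans (ler_pM (expR_ge0 _) (normr_ge0 _) (HC y f yv0 f0) main) _.
have fe : (1 + f) * expR (- f) <= 1.
  have /(ler_wpM2r (expR_ge0 (- f))) := expR_ge1Dx f.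
  by rewrite -expRD subrr expR0.
have CM : 0 <= C * expR (- f) * M by rewrite !mulr_ge0 ?expR_ge0.
have := ler_wpM2l CM fe; rewrite mulr1.
set e := expR _ => H; rewrite (_ : C * M * e = C * e * M); last by ring.
by apply: le_trans H; rewrite le_eqVlt; apply/orP; left; apply/eqP; ring.
Qed.

Lemma measurable_cgauss y : 0 < y -> measurable_fun (`]0%R, +oo[%classic : set R) (cgauss y).
Proof.
move=> y0; apply: measurable_funTS; apply: continuous_measurable_fun.
exact: continuous_cgauss.
Qed.

(** By the Cauchy-Riemann equations the y-derivative of [cgauss] is h^-1 times the f-derivative of
    [sgauss], and [sgauss] vanishes at f = 0, where z is real, and at infinity. Only the real part
    is integrated, which is why half a contour suffices. *)
Lemma contour_derive0 y : 0 < y -> is_derive y 1 contour 0.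
Proof.
move=> y0; pose u := y / 2; pose v := y + 1.
have u0 : 0 < u by rewrite divr_gt0.
have Iy : `]u, v[%classic y by rewrite /= in_itv /= /u /v; lra.
have Ipos z : `]u, v[%classic z -> 0 < z.
  by rewrite /= in_itv /= => /andP[uz _]; exact: lt_trans uz.
have [C C0 HC] := cgauss_bound v; have [C' C'0 HC'] := @dcgauss_bound u v u0.
have partialE z f : 0 < z -> partial1of2 cgauss z f = dcgauss z f.
  by move=> z0; rewrite /partial1of2; exact: is_derive_val (dcgauss_y f z0).
have intc z : `]u, v[%classic z ->
    mu.-integrable (`]0%R, +oo[%classic : set R) (EFin \o cgauss z).
  move=> Iz; have z0 := Ipos z Iz.
  apply: (@half_line_integrable _ _ C); first exact: measurable_cgauss.
  move=> x x0; apply: (HC z x _ (ltW x0)).1; rewrite (ltW z0) ltW//.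
  by move: Iz; rewrite /= in_itv => /andP[].
have derc z f : `]u, v[%classic z -> (`]0%R, +oo[%classic : set R) f ->
    derivable (cgauss ^~ f) z 1.
  by move=> /Ipos z0 _; exact: is_derive_derivable (dcgauss_y f z0).
pose G f := C' * expR (- f).
have G0 f : 0 <= G f by rewrite mulr_ge0 ?expR_ge0.
have intG : mu.-integrable (`]0%R, +oo[%classic : set R) (EFin \o G).
  apply: (@half_line_integrable _ _ C').
    by apply: measurable_funTS; apply: measurable_funM => //; exact: measurable_expRN.
  by move=> x _; rewrite ger0_norm.
have Gub z f : `]u, v[%classic z -> (`]0%R, +oo[%classic : set R) f ->
    `|partial1of2 cgauss z f| <= G f.
  move=> Iz /half_lineP f0; have z0 := Ipos z Iz; rewrite partialE//.
  apply: HC'; last exact: ltW.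
  by move: Iz; rewrite /= in_itv /= => /andP[/ltW -> /ltW ->].
have mD : measurable (`]0%R, +oo[%classic : set R) by exact: measurable_itv.
have H1 := @derivable_under_integral _ _ _ mu cgauss _ mD y u v Iy intc derc G G0 intG Gub.
have H2 := @differentiation_under_integral _ _ _ mu cgauss _ mD y u v Iy intc derc G G0 intG Gub.
apply: DeriveDef => //; rewrite -derive1E H2.
transitivity (\int[mu]_(f in `]0%R, +oo[) (h^-1 * (h * dcgauss y f))).
  by apply: eq_Rintegral => f _; rewrite partialE// mulrA mulVf ?mul1r// gt_eqF.
have chd : continuous (fun f => h * dcgauss y f).
  by apply: continuousZ; exact: continuous_dcgauss.
have hdb f : 0 < f -> `|h * dcgauss y f| <= (h * C' + C) * expR (- f).
  move=> f0; rewrite normrM (gtr0_norm h0) mulrDl -mulrA.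
  apply: ler_wpDr; first by rewrite mulr_ge0 ?expR_ge0.
  rewrite ler_wpM2l ?(ltW h0)//; apply: HC'; last exact: ltW.
  by move: Iy; rewrite /= in_itv /= => /andP[/ltW -> /ltW ->].
rewrite RintegralZl//; last first.
  apply: half_line_integrable hdb.
  by apply: measurable_funTS; exact: continuous_measurable_fun.
suff -> : \int[mu]_(f in `]0%R, +oo[) (h * dcgauss y f) = 0 by rewrite mulr0.
apply: (@half_line_FTC0 _ _ (sgauss y) (h * C' + C)) => //.
- by move=> x; exact: dsgauss_f.
- rewrite /sgauss /expoJ /powQ /arg !mulr0 mul0r atan0 !mulr0 sin0 !mulr0.
  by rewrite addr0 sin0 mulr0.
- move=> x x0; have [] // := HC y x _ (ltW x0).
    by rewrite (ltW y0) /v lerDl ler01.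
  move=> _ H; apply: le_trans H _; rewrite mulrDl lerDr.
  by rewrite !mulr_ge0 ?expR_ge0 ?(ltW h0).
Qed.

Lemma contour_cst y : 0 < y -> y <= q -> contour y = contour q.
Proof.
move=> y0; rewrite le_eqVlt => /predU1P[->//|yq].
have [|z|c _] := @MVT R contour (fun _ => 0) y q yq.
- by move=> x; rewrite in_itv /= => /andP[yx _]; apply: contour_derive0; exact: lt_trans yx.
- apply: continuous_in_subspaceT => x; rewrite inE /= in_itv /= => /andP[yx _].
  exact: (is_derive_continuous (contour_derive0 (lt_le_trans y0 yx))).
- by rewrite mul0r => /eqP; rewrite subr_eq0 => /eqP.
Qed.

(* The limit of [cgauss y f] as [y] tends to 0. *)
Definition cgauss0 f := expR (ka * ((h * f) `^ al * cos (al * (pi / 2))) +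
    2^-1 * ((h^-1 * q) ^+ 2 - f ^+ 2)) *
  cos (ka * ((h * f) `^ al * sin (al * (pi / 2))) - h^-1 * (q * f)).

(** At y = 0 the contour is the imaginary half-axis, where z^al produces the characteristic function
    of the stable law; at y = q the Gaussian is centred, and as h tends to 0 it isolates the value
    of exp (ka z^al) at q. *)
Lemma contour0 : \int[mu]_(f in `]0%R, +oo[%classic) cgauss0 f = contour q.
Proof.
pose y_ (n : nat) := q / n.+1%:R.
have y_gt0 n : 0 < y_ n by rewrite divr_gt0.
have y_le n : y_ n <= q by rewrite ler_pdivrMr// ler_peMr ?(ltW q0)// ler1n.
have y_cvg : y_ n @[n --> \oo] --> (0 : R).
  rewrite -(mulr0 q); apply: cvgM; first exact: cvg_cst.
  exact: cvg_harmonic.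
have [C C0 HC] := cgauss_bound q.
have H : (\int[mu]_(f in `]0%R, +oo[%classic) cgauss (y_ n) f) @[n --> \oo] -->
    \int[mu]_(f in `]0%R, +oo[%classic) cgauss0 f.
  apply: (@half_line_dct _ _ _ C).
  - by move=> n; exact: measurable_cgauss.
  - move=> f f0.
    have hf0 : 0 < h * f by rewrite mulr_gt0.
    have argc : al * arg (y_ n) f @[n --> \oo] --> al * (pi / 2).
      apply: cvgM; first exact: cvg_cst.
      apply: (cvg_comp (fun n => h * f / y_ n) atan _ (@cvgy_atan R)).
      apply/cvgryPge => M; near=> n.
      rewrite /y_ invf_div mulrA ler_pdivlMr// -ler_pdivrMl//.
      apply: (@le_trans _ _ n%:R); last by rewrite ler_nat.
      by near: n; exact: nbhs_infty_ger.
    have rhoc : rho2 (y_ n) f `^ (al / 2) @[n --> \oo] --> (h * f) `^ al.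
      have -> : (h * f) `^ al = rho2 0 f `^ (al / 2).
        rewrite /rho2 expr0n add0r -powR_mulrn ?(ltW hf0)// -powRrM.
        by congr (_ `^ _); field.
      have r0 : 0 < rho2 0 f by rewrite /rho2 expr0n add0r exprn_gt0.
      apply: (@cvg_comp _ _ _ (fun n => rho2 (y_ n) f) (fun z => z `^ (al / 2)) _
        (nbhs (rho2 0 f))).
        rewrite /rho2; apply: cvgD; last exact: cvg_cst.
        by rewrite expr2; under eq_fun do rewrite expr2; exact: cvgM.
      exact: (is_derive_continuous (@is_derive1_powR R (al / 2) (rho2 0 f) r0)).
    have ccos : cos (al * arg (y_ n) f) @[n --> \oo] --> cos (al * (pi / 2)).
      exact: (cvg_comp _ _ argc (@continuous_cos R _)).
    have csin : sin (al * arg (y_ n) f) @[n --> \oo] --> sin (al * (pi / 2)).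
      exact: (cvg_comp _ _ argc (@continuous_sin R _)).
    have cyq : y_ n - q @[n --> \oo] --> - q.
      by rewrite -[X in _ --> X]add0r; apply: cvgB => //; exact: cvg_cst.
    have cE : expoE (y_ n) f @[n --> \oo] --> ka * ((h * f) `^ al * cos (al * (pi / 2))) +
        2^-1 * ((h^-1 * q) ^+ 2 - f ^+ 2).
      apply: cvgD; first by apply: cvgM; [exact: cvg_cst|exact: cvgM].
      apply: cvgM; first exact: cvg_cst.
      apply: cvgB; last exact: cvg_cst.
      rewrite -sqrrN -mulrN expr2; under eq_fun do rewrite expr2.
      by apply: cvgM; apply: cvgM => //; exact: cvg_cst.
    have cJ : expoJ (y_ n) f @[n --> \oo] --> ka * ((h * f) `^ al * sin (al * (pi / 2)))
        - h^-1 * (q * f).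
      rewrite -mulrN -mulNr.
      apply: cvgD; first by apply: cvgM; [exact: cvg_cst|exact: cvgM].
      apply: cvgM; first exact: cvg_cst.
      by apply: cvgM => //; exact: cvg_cst.
    apply: cvgM; first exact: (cvg_comp _ _ cE (@continuous_expR R _)).
    exact: (cvg_comp _ _ cJ (@continuous_cos R _)).
  - move=> n x x0; apply: (HC _ _ _ (ltW x0)).1.
    by rewrite (ltW (y_gt0 n)) y_le.
apply: (cvg_unique _ H) => //.
rewrite (_ : (fun n => _) = fun _ => contour q); first exact: cvg_cst.
by apply/funext => n; rewrite -(contour_cst (y_gt0 n) (y_le n)).
Unshelve. all: by end_near. Qed.

End contour.

(** * From the characteristic function to the Laplace transform *)

Section laplace.
Context {R : realType}.
Notation mu := (@lebesgue_measure R).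
Notation D := (`]0%R, +oo[%classic : set R).

Definition gauss0 : R := \int[mu]_(f in D) expR (- (f ^+ 2 / 2)).

Lemma gauss_le (f : R) : expR (- (f ^+ 2 / 2)) <= expR 1 * expR (- f).
Proof.
rewrite -expRD ler_expR; have := sqr_ge0 (f - 1); rewrite sqrrB1; lra.
Qed.

Lemma measurable_gauss : measurable_fun setT (fun f : R => expR (- (f ^+ 2 / 2))).
Proof.
apply: measurableT_comp => //; apply: measurableT_comp => //.
by apply: measurable_funM => //; exact: exprn_measurable.
Qed.

(** With [ka = 0] and [h = 1] the contour shift is that of the Gaussian itself; 3/2 is just some
    exponent in (1, 2). The constant [gauss0] cancels later and is never computed. *)
Lemma gauss_cos (p : R) :
  \int[mu]_(f in D) (expR (- (f ^+ 2 / 2)) * cos (f * p)) =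
  gauss0 * expR (- (p ^+ 2 / 2)).
Proof.
have pos (q : R) : 0 < q -> \int[mu]_(f in D) (expR (- (f ^+ 2 / 2)) * cos (f * q)) =
    gauss0 * expR (- (q ^+ 2 / 2)).
  move=> q0.
  have a1 : 1 < 3 / 2 :> R by lra.
  have a2 : 3 / 2 < 2 :> R by lra.
  have h1 : 1 <= 1 :> R by [].
  have H := contour0 a1 a2 (lexx 0) ltr01 h1 q0.
  have E : contour (3 / 2) 0 1 q q = gauss0.
    apply: eq_Rintegral => f _; rewrite /cgauss /expoE /expoJ !mul0r subrr.
    rewrite !mul0r !mulr0 !add0r cos0 mulr1 expr0n sub0r mulrN.
    by rewrite [2^-1 * _]mulrC.
  have E2 : \int[mu]_(f in D) cgauss0 (3 / 2) 0 1 q f =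
      \int[mu]_(f in D) (expR (q ^+ 2 / 2) * (expR (- (f ^+ 2 / 2)) * cos (f * q))).
    apply: eq_Rintegral => f _; rewrite /cgauss0 !mul0r !add0r invr1 !mul1r.
    by rewrite cosN mulrBr expRD mulrA [q * f]mulrC ![2^-1 * _]mulrC.
  have mg : measurable_fun D (fun f : R => expR (- (f ^+ 2 / 2)) * cos (f * q)).
    apply: measurable_funTS; apply: measurable_funM; first exact: measurable_gauss.
    apply: continuous_measurable_fun => x.
    exact: (is_derive_continuous (dcos (dM (dI x) (dC q x)))).
  rewrite -E -H E2 RintegralZl//.
    by rewrite mulrAC -expRD subrr expR0 mul1r.
  apply: (half_line_integrable mg) => x x0; rewrite normrM (ger0_norm (expR_ge0 _)).
  apply: le_trans (gauss_le x); rewrite ler_piMr ?expR_ge0 ?abs_cos_le1//.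
have [p0|p0|->] := ltgtP p 0.
- rewrite -sqrrN -pos ?oppr_gt0//; apply: eq_Rintegral => f _.
  by rewrite mulrN cosN.
- exact: pos.
- rewrite expr0n mul0r oppr0 expR0 mulr1; apply: eq_Rintegral => f _.
  by rewrite mulr0 cos0 mulr1.
Qed.

Lemma gauss_integrable : mu.-integrable D (EFin \o (fun f => expR (- (f ^+ 2 / 2)))).
Proof.
apply: (@half_line_integrable _ _ (expR 1)).
  by apply: measurable_funTS; exact: measurable_gauss.
by move=> x _; rewrite ger0_norm ?expR_ge0// gauss_le.
Qed.

Lemma gauss0_gt0 : 0 < gauss0.
Proof.
have := gauss_cos 1.
rewrite lt_neqAle; move=> _; apply/andP; split; last first.
  by apply: Rintegral_ge0 => x _; exact: expR_ge0.
apply/eqP => E.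
exfalso; have i01 : (\int[mu]_(x in `[0%R, 1%R]) (expR (- 1))%:E = (expR (-1))%:E)%E.
  by rewrite integral_cst//= lebesgue_measure_itv/= lte_fin ltr01 oppr0 adde0 mule1.
suff : ((expR (- 1))%:E <= gauss0%:E)%E.
  by rewrite -E lee_fin leNgt expR_gt0.
rewrite -i01 /gauss0 /Rintegral fineK; last first.
  by apply: integrable_fin_num => //; exact: gauss_integrable.
apply: (@le_trans _ _ (\int[mu]_(x in `]0%R, 1%R]) (expR (- 1))%:E)%E).
  by rewrite integral_itv_obnd_cbnd//; exact: measurable_cst.
apply: (@le_trans _ _ (\int[mu]_(x in (`]0%R, 1%R]%classic : set R)) (expR (- (x ^+ 2 / 2)))%:E)%E).
  apply: ge0_le_integral => //.
  - by apply: measurable_funTS; apply/measurable_EFinP; exact: measurable_gauss.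
  - move=> x; rewrite /= in_itv /= => /andP[x0 x1]; rewrite lee_fin ler_expR lerN2.
    have : x ^+ 2 <= 1 by rewrite expr_le1// ltW.
    lra.
apply: ge0_subset_integral => //.
- by apply: measurable_funTS; apply/measurable_EFinP; exact: measurable_gauss.
- by move=> x; rewrite /= !in_itv /= => /andP[-> _].
Qed.


Lemma bounded_integrable d (T : measurableType d) (P : probability T R) (f : T -> R) (C : R) :
  measurable_fun setT f -> (forall w, `|f w| <= C) -> P.-integrable setT (EFin \o f).
Proof.
move=> mf fC; apply: (@le_integrable _ _ _ P setT measurableT _ (EFin \o cst C)) => //.
- exact/measurable_EFinP.
- by move=> w _; rewrite /= lee_fin (le_trans (fC w))// ler_norm.
- exact: finite_measure_integrable_cst.
Qed.

Section smoothing.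
Variables (d : measure_display) (T : measurableType d) (P : probability T R).

(** A Gaussian function of [Y] is a mixture of the functions cos (f Y), so by Fubini its mean only
    involves the characteristic function. *)
Lemma gauss_char (Y : T -> R) : measurable_fun setT Y ->
  gauss0 * \int[P]_w expR (- (Y w ^+ 2 / 2)) =
  \int[mu]_(f in D) (expR (- (f ^+ 2 / 2)) * \int[P]_w cos (f * Y w)).
Proof.
move=> mY.
have mG : measurable_fun setT (fun w => expR (- (Y w ^+ 2 / 2))).
  by apply: (measurableT_comp measurable_gauss).
have mcos : measurable_fun setT (fun z : T * measurableTypeR R => cos (z.2 * Y z.1)).
  apply: (measurableT_comp (continuous_measurable_fun (@continuous_cos R))).
  by apply: measurable_funM => //; apply: measurableT_comp.
pose g (z : T * measurableTypeR R) : R :=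
  (0 < (z.2 : R))%R%:R * expR (- (z.2 ^+ 2 / 2)) * cos (z.2 * Y z.1).
have mpos : measurable_fun setT (fun x : measurableTypeR R => (0 < (x : R))%R%:R : R).
  rewrite (_ : (fun _ => _) = fun x : measurableTypeR R => if 0 < (x : R) then 1 else 0); last first.
    by apply/funext => x; case: (0 < (x : R)).
  by apply: measurable_fun_ifT => //; exact: measurable_fun_ltr.
have mg : measurable_fun setT g.
  apply: measurable_funM => //; apply: measurable_funM.
    exact: (measurableT_comp mpos measurable_snd).
  exact: (measurableT_comp measurable_gauss measurable_snd).
have gE w : (\int[mu]_f (g (w, f))%:E = \int[mu]_(f in D) (expR (- (f ^+ 2 / 2)) * cos (f * Y w))%:E)%E.
  rewrite [RHS]integral_mkcond; apply: eq_integral => f _.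
  by rewrite patchE /g /= mem_setE in_itv /= andbT; case: (0 < f); rewrite ?mul1r ?mul0r.
have ig : (P \x (mu : measure (measurableTypeR R) R))%E.-integrable setT (EFin \o g).
  apply/integrable12ltyP; first exact/measurable_EFinP.
  apply: (@le_lt_trans _ _ (\int[P]_w gauss0%:E)%E); last first.
    by rewrite integral_cst//= probability_setT mule1 ltry.
  apply: ge0_le_integral => //.
  - by move=> w _; exact: integral_ge0.
  - apply: (@measurable_fun_fubini_tonelli_F _ _ _ _ _ mu (fun z => `|(g z)%:E|)%E) => //.
    by apply: measurableT_comp => //; exact/measurable_EFinP.
  - move=> w _; rewrite /gauss0 /Rintegral fineK; last first.
      by apply: integrable_fin_num => //; exact: gauss_integrable.
    rewrite [leRHS]integral_mkcond; apply: ge0_le_integral => //.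
    - apply: measurableT_comp => //; apply/measurable_EFinP.
      by apply: (measurableT_comp mg).
    - apply/(measurable_restrictT _ _).1 => //.
      by apply: measurable_funTS; apply/measurable_EFinP; exact: measurable_gauss.
    - move=> f _; rewrite /= patchE /g /= mem_setE in_itv /= andbT.
      case: (0 < f); last by rewrite !mul0r normr0.
      rewrite lee_fin mul1r normrM (ger0_norm (expR_ge0 _)) ler_piMr ?expR_ge0//.
      exact: abs_cos_le1.
have F := Fubini ig.
transitivity (fine (\int[P]_w \int[mu]_f (g (w, f))%:E)%E).
  rewrite -RintegralZl//; last first.
    apply: (@bounded_integrable _ _ _ _ 1) => // w.
    by rewrite ger0_norm ?expR_ge0// -expR0 ler_expR oppr_le0 divr_ge0// sqr_ge0.
  congr fine; apply: eq_integral => w _; rewrite gE -gauss_cos fineK//.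
  apply: integrable_fin_num => //.
  apply: (@half_line_integrable _ _ (expR 1)).
    apply: measurable_funTS; apply: measurable_funM; first exact: measurable_gauss.
    apply: (measurableT_comp (continuous_measurable_fun (@continuous_cos R))).
    exact: measurable_funM.
  move=> x _; rewrite normrM (ger0_norm (expR_ge0 _)).
  by apply: le_trans (gauss_le x); rewrite ler_piMr ?expR_ge0 ?abs_cos_le1.
rewrite F; rewrite /Rintegral [in RHS]integral_mkcond; congr fine; apply: eq_integral => f _.
have mcf : measurable_fun setT (fun w => cos (f * Y w)).
  apply: (measurableT_comp (continuous_measurable_fun (@continuous_cos R))).
  exact: measurable_funM.
have icf : P.-integrable setT (EFin \o (fun w => cos (f * Y w))).
  by apply: (@bounded_integrable _ _ _ _ 1) => // w; exact: abs_cos_le1.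
rewrite patchE mem_setE in_itv /= andbT /g /=; case: (0 < f); last first.
  by under eq_integral do rewrite !mul0r; rewrite integral0.
under eq_integral do rewrite mul1r EFinM.
by rewrite integralZl//= EFinM fineK// integrable_fin_num.
Qed.

Variables (X : T -> R) (al b : R).
Hypotheses (mX : measurable_fun setT X) (al1 : 1 < al) (al2 : al < 2) (b0 : 0 <= b).
Let tau := tan (pi / 2 * al).
Hypothesis Xcos : forall th : R, 0 < th ->
  \int[P]_w cos (th * X w) = expR (- (b * th `^ al)) * cos (b * th `^ al * tau).
Hypothesis Xsin : forall th : R, 0 < th ->
  \int[P]_w sin (th * X w) = expR (- (b * th `^ al)) * sin (b * th `^ al * tau).
Let ka := - (b / cos (pi / 2 * al)).

Lemma cos_lt0 : cos (pi / 2 * al) < 0.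
Proof.
have p0 := pi_gt0 R.
have -> : pi / 2 * al = pi + - (pi - pi / 2 * al) by ring.
rewrite cosD cospi sinpi mul0r subr0 mulN1r oppr_lt0 cosN cos_gt0_pihalf//.
have := al1; have := al2.
set p := pi in p0 *; nra.
Qed.

Lemma ka_ge0 : 0 <= ka.
Proof.
by rewrite /ka -mulrN -invrN divr_ge0// oppr_ge0 ltW// cos_lt0.
Qed.

Lemma cos_affine (h c f : R) : 0 < h -> 0 < f ->
  \int[P]_w cos (f * (h * X w + c)) =
  expR (- (b * (f * h) `^ al)) * cos (b * (f * h) `^ al * tau + f * c).
Proof.
move=> h0 f0; have fh : 0 < f * h by rewrite mulr_gt0.
have mfX : measurable_fun setT (fun w => f * h * X w) by exact: measurable_funM.
have mc : measurable_fun setT (fun w => cos (f * h * X w)).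
  exact: (measurableT_comp (continuous_measurable_fun (@continuous_cos R))).
have ms : measurable_fun setT (fun w => sin (f * h * X w)).
  exact: (measurableT_comp (continuous_measurable_fun (@continuous_sin R))).
have ic : P.-integrable setT (EFin \o (fun w => cos (f * h * X w))).
  by apply: (@bounded_integrable _ _ _ _ 1) => // w; exact: abs_cos_le1.
have is_ : P.-integrable setT (EFin \o (fun w => sin (f * h * X w))).
  by apply: (@bounded_integrable _ _ _ _ 1) => // w; exact: abs_sin_le1.
transitivity (\int[P]_w (cos (f * c) * cos (f * h * X w) - sin (f * c) * sin (f * h * X w))).
  apply: eq_Rintegral => w _; rewrite mulrDr mulrA cosD; ring.
rewrite RintegralB//=; last 2 first.
- by have := integrableZl measurableT (cos (f * c)) ic.
- by have := integrableZl measurableT (sin (f * c)) is_.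
rewrite !RintegralZl//= Xcos// Xsin// cosD; ring.
Qed.

(** Completing the square, - qX - (hX)^2/2 = (q/h)^2/2 - (hX + q/h)^2/2. The Gaussian factor makes
    the integrand bounded while the finiteness of E exp (-qX) is still unknown. *)
Lemma smoothed_laplace (q h : R) : 0 < q -> 0 < h -> h <= 1 ->
  gauss0 * \int[P]_w expR (- (q * X w) - (h * X w) ^+ 2 / 2) = contour al ka h q q.
Proof.
move=> q0 h0 h1; rewrite -(contour0 al1 al2 ka_ge0 h0 h1 q0).
pose c := q / h; have hn : h != 0 by rewrite gt_eqF.
have mY : measurable_fun setT (fun w => h * X w + c).
  by apply: measurable_funD => //; exact: measurable_funM.
have := gauss_char mY => G.
have mE : measurable_fun setT (fun w => expR (- ((h * X w + c) ^+ 2 / 2))).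
  by apply: (measurableT_comp measurable_gauss).
transitivity (expR (c ^+ 2 / 2) * (gauss0 * \int[P]_w expR (- ((h * X w + c) ^+ 2 / 2)))).
  rewrite mulrCA; congr (_ * _); rewrite -RintegralZl//; last first.
    apply: (@bounded_integrable _ _ _ _ 1) => // w.
    by rewrite ger0_norm ?expR_ge0// -expR0 ler_expR oppr_le0 divr_ge0// sqr_ge0.
  apply: eq_Rintegral => w _; rewrite -expRD; congr expR; rewrite /c; field.
  done.
have cn0 : cos (pi / 2 * al) != 0 by rewrite lt_eqF// cos_lt0.
rewrite G (_ : \int[mu]_(f in D) _ = \int[mu]_(f in D) (expR (- (f ^+ 2 / 2)) *
    (expR (- (b * (f * h) `^ al)) * cos (b * (f * h) `^ al * tau + f * c)))); last first.
  by apply: eq_Rintegral => f /set_mem /half_lineP f0; rewrite cos_affine.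
have mp : measurable_fun setT (fun f : R => b * (f * h) `^ al).
  apply: measurable_funM => //.
  have mfh : measurable_fun setT (fun f : R => f * h) by exact: measurable_funM.
  exact: (measurableT_comp (measurable_powR al) mfh).
rewrite -RintegralZl//; last first.
  apply: (@half_line_integrable _ _ (expR 1)).
    apply: measurable_funTS; apply: measurable_funM; first exact: measurable_gauss.
    apply: measurable_funM.
      by apply: measurableT_comp => //; exact: measurableT_comp.
    apply: (measurableT_comp (continuous_measurable_fun (@continuous_cos R))).
    by apply: measurable_funD; exact: measurable_funM.
  move=> f f0; rewrite normrM (ger0_norm (expR_ge0 _)).
  apply: le_trans (gauss_le f); rewrite ler_piMr ?expR_ge0//.
  rewrite normrM (ger0_norm (expR_ge0 _)) mulr_ile1 ?expR_ge0 ?abs_cos_le1//.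
  by rewrite -expR0 ler_expR oppr_le0 mulr_ge0 ?powR_ge0.
apply: eq_Rintegral => f /set_mem /half_lineP f0.
rewrite /cgauss0 mulrA mulrA -!expRD.
have E1 : ka * ((h * f) `^ al * cos (al * (pi / 2))) = - (b * (f * h) `^ al).
  by rewrite [h * f]mulrC [al * _]mulrC /ka; field.
have E2 : ka * ((h * f) `^ al * sin (al * (pi / 2))) = - (b * (f * h) `^ al * tau).
  by rewrite [h * f]mulrC [al * _]mulrC /ka /tau /tan; field.
rewrite E1 E2 -opprD cosN; congr (expR _ * cos _); rewrite /c; field => //.
Qed.

Lemma contour_cvg (q : R) : 0 < q ->
  contour al ka n.+1%:R^-1 q q @[n --> \oo] --> gauss0 * expR (ka * q `^ al).
Proof.
move=> q0.
have h0 n : 0 < n.+1%:R^-1 :> R by rewrite invr_gt0.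
have h1 n : n.+1%:R^-1 <= 1 :> R by rewrite invf_le1// ler1n.
have hc : n.+1%:R^-1 @[n --> \oo] --> (0 : R) by exact: cvg_harmonic.
rewrite mulrC -RintegralZl//; last exact: gauss_integrable.
have [A HA] := powP_bound al1 al2 ka_ge0 q.
apply: (@half_line_dct _ _ _ (expR (A + 1))).
- by move=> n; exact: measurable_cgauss.
- move=> f f0; rewrite -expRD.
  have hf : n.+1%:R^-1 * f @[n --> \oo] --> (0 : R).
    by rewrite -(mul0r f); apply: cvgM => //; exact: cvg_cst.
  have hf2 : (n.+1%:R^-1 * f) ^+ 2 @[n --> \oo] --> (0 : R).
    by under eq_fun do rewrite expr2; rewrite -(mul0r 0); exact: cvgM.
  have argc : al * arg n.+1%:R^-1 q f @[n --> \oo] --> (0 : R).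
    rewrite -(mulr0 al); apply: cvgM; first exact: cvg_cst.
    have h3 : n.+1%:R^-1 * f / q @[n --> \oo] --> (0 : R).
      by rewrite -(mul0r q^-1); apply: cvgM => //; exact: cvg_cst.
    by rewrite -(@atan0 R); exact: (cvg_comp _ _ h3 (@continuous_atan R 0)).
  have rhoc : rho2 n.+1%:R^-1 q f `^ (al / 2) @[n --> \oo] --> q `^ al.
    have -> : q `^ al = (q ^+ 2) `^ (al / 2).
      rewrite -powR_mulrn ?(ltW q0)// -powRrM.
      by congr (_ `^ _); field.
    have h3 : rho2 n.+1%:R^-1 q f @[n --> \oo] --> q ^+ 2.
      by rewrite /rho2 -[X in _ --> X]addr0; apply: cvgD => //; exact: cvg_cst.
    have q2 : 0 < q ^+ 2 by exact: exprn_gt0.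
    exact: (cvg_comp _ _ h3 (is_derive_continuous (@is_derive1_powR R (al / 2) (q ^+ 2) q2))).
  have ccos : cos (al * arg n.+1%:R^-1 q f) @[n --> \oo] --> (1 : R).
    by rewrite -[X in _ --> X](@cos0 R); exact: (cvg_comp _ _ argc (@continuous_cos R _)).
  have csin : sin (al * arg n.+1%:R^-1 q f) @[n --> \oo] --> (0 : R).
    by rewrite -[X in _ --> X](@sin0 R); exact: (cvg_comp _ _ argc (@continuous_sin R _)).
  rewrite -[X in _ --> X]mulr1; apply: cvgM.
    have h3 : expoE al ka n.+1%:R^-1 q q f @[n --> \oo] --> ka * q `^ al - f ^+ 2 / 2; last first.
      exact: (cvg_comp _ _ h3 (@continuous_expR R _)).
    rewrite /expoE; under eq_fun do rewrite subrr mulr0 expr0n sub0r mulrN [2^-1 * _]mulrC.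
    apply: cvgD; last exact: cvg_cst.
    apply: cvgM; first exact: cvg_cst.
    by rewrite -[X in _ --> X]mulr1; exact: cvgM.
  have h3 : expoJ al ka n.+1%:R^-1 q q f @[n --> \oo] --> (0 : R); last first.
    by rewrite -[X in _ --> X](@cos0 R); exact: (cvg_comp _ _ h3 (@continuous_cos R _)).
  rewrite /expoJ; under eq_fun do rewrite subrr mul0r mulr0 addr0.
  rewrite -(mulr0 ka); apply: cvgM; first exact: cvg_cst.
  by rewrite -(mulr0 (q `^ al)); exact: cvgM.
- move=> n f f0; rewrite /cgauss normrM (ger0_norm (expR_ge0 _)).
  apply: (@le_trans _ _ (expR (expoE al ka n.+1%:R^-1 q q f))).
    by rewrite ler_piMr ?expR_ge0 ?abs_cos_le1.
  rewrite -expRD ler_expR /expoE subrr mulr0 expr0n sub0r mulrN.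
  have qq : 0 <= q <= q by rewrite lexx ltW.
  have H1 := HA _ f (rho2_le (h0 n) (h1 n) f qq).
  have H2 := ler_wpM2l ka_ge0 (powP_le al n.+1%:R^-1 q f).
  have H3 : ka * powP al n.+1%:R^-1 q f <= ka * `|powP al n.+1%:R^-1 q f|.
    by rewrite ler_wpM2l ?ka_ge0// ler_norm.
  have := sqr_ge0 (f / 2 - 1).
  have -> : (f / 2 - 1) ^+ 2 = f ^+ 2 / 4 - f + 1 by field.
  lra.
Qed.

(** Removing the smoothing: the integrands increase as h decreases to 0, so monotone convergence
    gives finiteness and value at once. *)
Lemma laplace_transform (q : R) : 0 <= q ->
  (\int[P]_w (expR (- (q * X w)))%:E = (expR (ka * q `^ al))%:E)%E.
Proof.
rewrite le_eqVlt => /predU1P[<-|q0].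
  rewrite powR0; last by rewrite gt_eqF// (lt_trans ltr01).
  rewrite mulr0 expR0; under eq_integral do rewrite mul0r oppr0 expR0.
  by rewrite integral_cst//= probability_setT mule1.
pose h (n : nat) : R := n.+1%:R^-1.
have h0 n : 0 < h n by rewrite invr_gt0.
have h1 n : h n <= 1 by rewrite invf_le1// ler1n.
have hc : h n @[n --> \oo] --> (0 : R) by exact: cvg_harmonic.
pose f n w := expR (- (q * X w) - (h n * X w) ^+ 2 / 2).
have mf n : measurable_fun setT (f n).
  apply: measurableT_comp => //; apply: measurable_funB.
    by apply: measurableT_comp => //; exact: measurable_funM.
  apply: measurable_funM => //.
  apply: (measurableT_comp (@exprn_measurable R setT 2)).
  exact: measurable_funM.
have fi n : P.-integrable setT (EFin \o f n).
  apply: (@bounded_integrable _ _ _ _ (expR ((q / h n) ^+ 2 / 2))) => // w.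
  rewrite ger0_norm ?expR_ge0// ler_expR.
  have := sqr_ge0 (h n * X w + q / h n).
  have -> : (h n * X w + q / h n) ^+ 2 = (h n * X w) ^+ 2 + 2 * (q * X w) + (q / h n) ^+ 2.
    by field; rewrite gt_eqF.
  lra.
have flim w : (EFin \o f ^~ w) n @[n --> \oo] --> (expR (- (q * X w)))%:E.
  apply: cvg_EFin; first by near=> n.
  have h3 : - (q * X w) - (h n * X w) ^+ 2 / 2 @[n --> \oo] --> - (q * X w); last first.
    exact: (cvg_comp _ _ h3 (@continuous_expR R _)).
  rewrite -[X in _ --> X]subr0; apply: cvgB; first exact: cvg_cst.
  rewrite -(mul0r 2^-1); apply: cvgM; last exact: cvg_cst.
  under eq_fun do rewrite expr2; rewrite -(mul0r 0).
  by apply: cvgM; rewrite -[X in _ --> X](mul0r (X w)); apply: cvgM => //; exact: cvg_cst.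
have := @cvg_monotone_convergence _ _ _ P setT measurableT (fun n => EFin \o f n).
have -> : (\int[P]_w limn ((fun n => EFin \o f n) ^~ w) = \int[P]_w (expR (- (q * X w)))%:E)%E.
  by apply: eq_integral => w _; apply: cvg_lim => //; exact: flim.
move=> /(_ _ _ _)/wrap[] => [n|n w _|w _ m n mn|H].
- exact/measurable_EFinP.
- by rewrite /= lee_fin expR_ge0.
- rewrite /= lee_fin ler_expR lerB// ler_pM2r// !exprMn ler_wpM2r ?sqr_ge0//.
  by rewrite lerXn2r ?nnegrE ?(ltW (h0 _))// lef_pV2 ?posrE// ler_nat.
apply: (cvg_unique _ H) => //.
have fE n : (\int[P]_w (EFin \o f n) w = (gauss0^-1 * contour al ka (h n) q q)%:E)%E.
  rewrite -[LHS]fineK; last exact: integrable_fin_num.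
  have := smoothed_laplace q0 (h0 n) (h1 n); rewrite /Rintegral => <-.
  by rewrite mulrA mulVf ?mul1r// gt_eqF// gauss0_gt0.
rewrite /= (funext fE).
apply: cvg_EFin; first by near=> n.
have -> : expR (ka * q `^ al) = gauss0^-1 * (gauss0 * expR (ka * q `^ al)).
  by rewrite mulrA mulVf ?mul1r// gt_eqF// gauss0_gt0.
apply: cvgM; first exact: cvg_cst.
exact: contour_cvg.
Unshelve. all: by end_near. Qed.

End smoothing.
End laplace.

(** * Comparison with a system whose servers never idle *)

Section busy_system.
Context {R : realType} (n : nat).
Variables (r : nat -> R) (X : nat -> nat -> R) (a : nat -> R).

Definition slot (k m : nat) : R := r k + \sum_(l < m) X k l.

Implicit Types (c : {ffun 'I_n.+1 -> nat}).

Definition next_slot c (k : 'I_n.+1) : R := slot k (c k).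

(* Ties are broken in favour of the smallest index, so that each value of
   [first_server] is a Boolean combination of comparisons. *)
Definition is_first c (k : 'I_n.+1) : bool :=
  [forall j, next_slot c k <= next_slot c j] &&
  [forall j : 'I_n.+1, (j < k)%N ==> (next_slot c k < next_slot c j)].

Definition first_server c : 'I_n.+1 := odflt ord0 [pick k | is_first c k].

Lemma first_serverP c : is_first c (first_server c).
Proof.
rewrite /first_server; case: pickP => [//|H]; exfalso.
pose k0 := [arg min_(k < ord0) next_slot c k]%O.
have k0P : [forall j, next_slot c k0 <= next_slot c j].
  apply/forallP => j; rewrite /k0; case: arg_minP => // i _; exact.
pose k1 := [arg min_(k < k0 | [forall j, next_slot c k <= next_slot c j]) (k : nat)].
have : is_first c k1; last by rewrite H.
rewrite /k1; case: arg_minnP => // k kmin Hk.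
rewrite /is_first kmin /=; apply/forallP => j; apply/implyP => jk.
rewrite ltNge; apply/negP => jmin.
have /Hk : [forall j0, next_slot c j <= next_slot c j0].
  apply/forallP => i; apply: le_trans jmin _; exact/(forallP kmin).
by rewrite leqNgt jk.
Qed.

Lemma is_first_inj c k k' : is_first c k -> is_first c k' -> k = k'.
Proof.
move=> /andP[/forallP H1 /forallP H2] /andP[/forallP H1' /forallP H2'].
apply/val_inj; case: (ltngtP k k') => // kk'.
- by have := H2' k; rewrite kk' /= ltNge H1.
- by have := H2 k'; rewrite kk' /= ltNge H1'.
Qed.

Lemma first_serverE c k : (first_server c == k) = is_first c k.
Proof.
apply/eqP/idP => [<-|]; first exact: first_serverP.
exact: is_first_inj (first_serverP c).
Qed.

Lemma first_server_le c k : next_slot c (first_server c) <= next_slot c k.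
Proof. by have /andP[/forallP ->] := first_serverP c. Qed.

(* The queue of the system in which a server never idles: the next slot goes to
   the first job not yet served if that job has arrived, and is wasted
   otherwise. The state records the number of slots used at each server and the
   number of jobs served. *)
Definition step (s : {ffun 'I_n.+1 -> nat} * nat) :=
  ([ffun j => s.1 j + (j == first_server s.1)]%N,
   (s.2 + (a s.2 <= next_slot s.1 (first_server s.1))%R)%N).

Definition state (p : nat) := iter p step ([ffun=> 0%N], 0%N).

Notation used p := (state p).1.
Notation served p := (state p).2.
Definition server p := first_server (used p).
Definition slot_time p := next_slot (used p) (server p).
Definition serves p i : bool := (served p == i) && (a i <= slot_time p).

Lemma usedS p j : used p.+1 j = (used p j + (j == server p))%N.
Proof. by rewrite /= ffunE. Qed.

Lemma servedS p : served p.+1 = (served p + (a (served p) <= slot_time p)%R)%N.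
Proof. by []. Qed.

Lemma served_nd p p' : (p <= p')%N -> (served p <= served p')%N.
Proof.
move=> /subnKC <-; elim: (p' - p)%N => [|k IH]; first by rewrite addn0.
by rewrite addnS (leq_trans IH)// servedS leq_addr.
Qed.

Lemma serves_inj p p' i : serves p i -> serves p' i -> p = p'.
Proof.
wlog pp' : p p' / (p <= p')%N.
  by move=> H; case/orP: (leq_total p p') => /H h ? ?; [|symmetry]; exact: h.
move=> /andP[/eqP sp ap] /andP[/eqP sp' _].
move: pp'; rewrite leq_eqVlt => /orP[/eqP//|/served_nd].
by rewrite servedS sp sp' ap addn1 ltnn.
Qed.

(** The coupling: job i receives the processing time that belongs to the server and slot serving it
    in the busy system. The default 0 is for a job that is never served, a case excluded by
    [all_served]. *)
Definition service (i : nat) : R :=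
  if pselect (exists p, serves p i) is left e then
    X (server (projT1 (cid e))) (used (projT1 (cid e)) (server (projT1 (cid e))))
  else 0.

Lemma serviceE p i : serves p i -> service i = X (server p) (used p (server p)).
Proof.
move=> pi; rewrite /service; case: pselect => [e|[]]; last by exists p.
by case: cid => p' /= /(serves_inj pi) <-.
Qed.

Hypothesis X_ge0 : forall k m, 0 <= X k m.
Hypothesis r_ge0 : forall k, 0 <= r k.

Lemma slot_nd k m m' : (m <= m')%N -> slot k m <= slot k m'.
Proof.
move=> /subnKC <-; elim: (m' - m)%N => [|l IH]; first by rewrite addn0.
by rewrite addnS (le_trans IH)// /slot big_ord_recr /= addrA lerDl.
Qed.

Lemma slotS k m : slot k m.+1 = slot k m + X k m.
Proof. by rewrite /slot big_ord_recr /= addrA. Qed.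

Lemma next_slotS p k :
  next_slot (used p.+1) k = next_slot (used p) k + X k (used p k) *+ (k == server p).
Proof.
rewrite /next_slot usedS; case: eqP => _; last by rewrite addn0 addr0.
by rewrite addn1 slotS.
Qed.

Lemma count_next_slotS (D : pred R) p :
  (\sum_k D (next_slot (used p.+1) k) + D (slot_time p) =
   \sum_k D (next_slot (used p) k) +
     D (slot_time p + X (server p) (used p (server p)))%R)%N.
Proof.
rewrite (bigD1 (server p))//= [in RHS](bigD1 (server p))//= next_slotS eqxx.
rewrite -/(slot_time p) mulr1n.
under eq_bigr => k /negbTE kp do rewrite next_slotS kp mulr0n addr0.
by lia.
Qed.

Lemma slot_timeS p : slot_time p <= slot_time p.+1.
Proof.
rewrite /slot_time; set k := server p.+1.
apply: le_trans (first_server_le _ k) _.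
by rewrite next_slotS lerDl; case: eqP => // _; exact: X_ge0.
Qed.

Lemma slot_time_nd p p' : (p <= p')%N -> slot_time p <= slot_time p'.
Proof.
move=> /subnKC <-; elim: (p' - p)%N => [|l IH]; first by rewrite addn0.
by rewrite addnS (le_trans IH)// slot_timeS.
Qed.

Hypothesis slot_unbounded : forall t (k : 'I_n.+1), exists m, t < slot k m.

(** Pigeonhole: if all slot times stayed below t, server k would use at most [M k] slots, but p
    steps use p slots in total. *)
Lemma slot_time_unbounded t : exists p, t < slot_time p.
Proof.
apply: contrapT => /forallNP H.
have {}H p : slot_time p <= t by rewrite leNgt; apply/negP/H.
have /choice [M HM] := slot_unbounded t.
have used_le p k : (used p k <= M k)%N.
  elim: p => [|p IH]; first by rewrite ffunE.
  rewrite usedS; case: eqP => [kp|_]; last by rewrite addn0.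
  rewrite addn1 ltn_neqAle IH andbT; apply/eqP => E.
  have := H p; rewrite leNgt => /negP; apply.
  by rewrite /slot_time /next_slot -kp E.
have sum_used p : (\sum_k used p k = p)%N.
  elim: p => [|p IH]; first by rewrite big1// => k _; rewrite ffunE.
  under eq_bigr do rewrite usedS.
  rewrite big_split /= IH (bigD1 (server p))//= eqxx big1 ?addn0 ?addn1// => k.
  by move=> /negbTE ->.
have : (\sum_k used (\sum_k M k).+1 k <= \sum_k M k)%N by exact: leq_sum.
by rewrite sum_used ltnn.
Qed.

Lemma served_serves p i : served p = i -> exists q, serves q i.
Proof.
move=> pi; have [p1 hp1] := slot_time_unbounded (a i).
have ex : exists q, (p <= q)%N && (a i <= slot_time q).
  exists (maxn p p1); rewrite leq_maxl /= (le_trans (ltW hp1))//.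
  by rewrite slot_time_nd// leq_maxr.
exists (ex_minn ex); rewrite /serves.
case: ex_minnP => m /andP[pm am] mmin; rewrite am andbT.
suff : forall k, (p + k <= m)%N -> served (p + k) = i.
  by move=> /(_ (m - p)%N); rewrite subnKC// leqnn => ->.
elim=> [|k IH]; first by rewrite addn0.
rewrite addnS => km; rewrite servedS IH ?(ltnW km)//.
rewrite (_ : (a i <= _)%R = false) ?addn0//.
apply/negP => ak; have := mmin (p + k)%N; rewrite leq_addr ak => /(_ isT).
by rewrite leqNgt km.
Qed.

Lemma all_served i : exists p, serves p i.
Proof.
suff [p /served_serves] : exists p, served p = i by [].
elim: i => [|i [p /served_serves[q /andP[/eqP qi ai]]]]; first by exists 0%N.
by exists q.+1; rewrite servedS qi ai addn1.
Qed.

Hypothesis a_nd : forall i j, (i <= j)%N -> a i <= a j.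

Definition slots_from (p i : nat) : nat :=
  (\sum_(k < n.+1) \sum_(m < used p k) (a i <= slot k m)%R)%N.

Lemma slots_fromS p i :
  slots_from p.+1 i = (slots_from p i + (a i <= slot_time p)%R)%N.
Proof.
rewrite /slots_from (bigD1 (server p))//= [in RHS](bigD1 (server p))//=.
rewrite usedS eqxx addn1 big_ord_recr /= -/(slot_time p) -!addnA; congr (_ + _)%N.
rewrite [RHS]addnC; congr (_ + _)%N.
by apply: eq_bigr => k /negbTE kp; rewrite usedS kp addn0.
Qed.

(* The job [i] is the last one that found an idle server. *)
Lemma busy_period p : exists2 i, (i <= served p)%N &
  (served p = i + slots_from p i)%N.
Proof.
elim: p => [|p [i ip IH]].
  exists 0%N => //; rewrite /slots_from big1// => k _.
  by rewrite ffunE big_ord0.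
have [ap|ap] := boolP (a (served p) <= slot_time p).
  exists i; first by rewrite servedS (leq_trans ip)// leq_addr.
  rewrite servedS ap slots_fromS (le_trans _ ap) ?a_nd// addnA.
  by rewrite -IH.
exists (served p); first by rewrite servedS leq_addr.
rewrite servedS (negbTE ap) addn0 slots_fromS (negbTE ap) addn0.
rewrite /slots_from big1 ?addn0// => k _; rewrite big1// => m _.
rewrite (_ : (a _ <= _)%R = false)//; apply/negP => H; move/negP: ap; apply.
apply: le_trans H _; elim: p k m {IH ip} => [k|p IH k]; first by rewrite ffunE => -[].
rewrite usedS; case: (eqVneq k (server p)) => [->|_] m.
  apply: (@le_trans _ _ (slot_time p)); last exact: slot_timeS.
  by apply: slot_nd; case: m => m /=; rewrite addn1 ltnS.
have mk : (m < used p k)%N by case: m => m /=; rewrite addn0.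
exact: le_trans (IH k (Ordinal mk)) (slot_timeS p).
Qed.

(** Slots are used in the order of their times, so every slot before t has been used by step p. [M]
    makes the count of the slots of a server a finite sum. *)
Lemma slots_before t p M i : t < slot_time p ->
  (\sum_(k < n.+1) \sum_(m < M) ((a i <= slot k m) && (slot k m < t))%R <=
   slots_from p i)%N.
Proof.
move=> tp; apply: leq_sum => k _.
rewrite -(big_mkord xpredT (fun m => nat_of_bool ((a i <= slot k m) && (slot k m < t))%R)).
rewrite -(big_mkord xpredT (fun m => nat_of_bool (a i <= slot k m)%R)).
have tk m : (used p k <= m)%N -> (slot k m < t) = false.
  move=> um; apply/negbTE; rewrite -leNgt; apply/ltW/(lt_le_trans tp).
  apply: le_trans (first_server_le _ k) _; exact: slot_nd.
have [Mu|uM] := leqP M (used p k).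
  rewrite (big_cat_nat (n := M) (p := used p k))//= (leq_trans _ (leq_addr _ _))//.
  by apply: leq_sum => m _; case: (a i <= _); case: (_ < t).
rewrite (big_cat_nat (n := used p k) (p := M))//=; last exact: ltnW.
rewrite [X in (_ + X)%N](_ : _ = 0%N); last first.
  by rewrite big_nat_cond big1// => m /andP[/andP[/tk -> _] _]; rewrite andbF.
by rewrite addn0; apply: leq_sum => m _; case: (a i <= _); case: (_ < t).
Qed.

End busy_system.

(** * Pathwise domination of the FCFS queue by the busy system *)

Section fcfs_comparison.
Context {R : realType} (n : nat).
Variables (r : nat -> R) (X : nat -> nat -> R) (u : nat -> R).
Hypotheses (X_ge0 : forall k m, 0 <= X k m) (r_ge0 : forall k, 0 <= r k).
Hypothesis u_ge0 : forall k, 0 <= u k.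
Hypothesis slot_unbounded : forall t (k : 'I_n.+1), exists m, t < slot r X k m.

Let ic := InitialCondition (mkseq r n.+1) 0 (0 : R).
Let a (i : nat) : R := \sum_(k < i) u k.
Let v := service n r X a.

Let Used p := (state n r X a p).1.
Let Served p := (state n r X a p).2.

Let f i := server_free n.+1 ic u v i.

Lemma arrivalE i : job_arrival ic u i = a i.
Proof. by rewrite /job_arrival ltn0 subn0 /arrival /= add0r. Qed.

Lemma partial_sum_nd i j : (i <= j)%N -> a i <= a j.
Proof.
move=> /subnKC <-; elim: (j - i)%N => [|l IH]; first by rewrite addn0.
by rewrite addnS (le_trans IH)// /a big_ord_recr /= lerDl.
Qed.

Lemma service_ge0 i : 0 <= v i.
Proof. by rewrite /v /service; case: pselect => // e; exact: X_ge0. Qed.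

Lemma server_free0 : f 0 = sort <=%R (mkseq r n.+1).
Proof.
rewrite -[LHS]/(sort <=%R (mkseq r n.+1 ++ nseq (n.+1 - size (mkseq r n.+1)) 0)).
by rewrite size_mkseq subnn cats0.
Qed.

Lemma size_server_free i : size (f i) = n.+1.
Proof.
elim: i => [|i IH]; first by rewrite server_free0 size_sort size_mkseq.
by rewrite /f /= size_sort /= size_behead IH.
Qed.

Lemma sorted_server_free i : sorted <=%R (f i).
Proof. by case: i => [|i]; apply: sort_sorted; exact: le_total. Qed.

Lemma head_server_free i x : x \in f i -> head 0 (f i) <= x.
Proof.
have := sorted_server_free i; case: (f i) => //= y s.
rewrite path_sortedE; last exact: le_trans.
by move=> /andP[/allP ys _]; rewrite inE => /predU1P[->//|/ys].
Qed.

Lemma count_server_free (P : pred R) i :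
  (count P (f i.+1) + P (head 0%R (f i)) =
   count P (f i) + P (Num.max (a i) (head 0%R (f i)) + v i)%R)%N.
Proof.
rewrite /f /= count_sort /= arrivalE -/(f i).
by case: (f i) (size_server_free i) => //= y s _; lia.
Qed.

(** A wasted slot delays the busy system only. A used slot adds the same processing time on both
    sides, started no later under FCFS. Counting the servers free by time x compares the two
    multisets without matching servers. *)
Lemma free_dominated p x :
  (\sum_(k < n.+1) (next_slot r X (Used p) k <= x)%R <=
   count (fun y => (y <= x)%R) (f (Served p)))%N.
Proof.
elim: p x => [|p IH] x.
  rewrite (_ : f (Served 0) = f 0)// server_free0 count_sort /mkseq count_map.
  rewrite -sum1_count (_ : iota 0 n.+1 = index_iota 0 n.+1); last first.
    by rewrite /index_iota subn0.
  rewrite [leqRHS]big_mkcond big_mkord.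
  apply: leq_sum => k _; rewrite /next_slot /slot /Used /= ffunE big_ord0 addr0.
  by case: ifP.
set t := slot_time n r X a p.
have head_t : head 0 (f (Served p)) <= t.
  have : (0 < \sum_(k < n.+1) (next_slot r X (Used p) k <= t)%R)%N.
    by rewrite (bigD1 (server n r X a p))//= /t /slot_time lexx.
  move=> /leq_trans/(_ (IH t)); rewrite -has_count => /hasP[y yf yt].
  exact: le_trans (head_server_free yf) yt.
have := count_next_slotS n r X a (fun y => y <= x) p.
rewrite -/t -/(Used p) -/(Used p.+1); set y := t + _.
have ty : t <= y by rewrite lerDl.
have t0 : x < t -> (\sum_(k < n.+1) (next_slot r X (Used p) k <= x)%R = 0)%N.
  move=> xt; rewrite big1// => k _.
  by rewrite leNgt (lt_le_trans xt)//; exact: first_server_le.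
have {IH} := IH x; move: t0; rewrite /Served servedS -/(Served p) -/t.
have [at_|at_] := boolP (a (Served p) <= t); last first.
  rewrite addn0; set A := (\sum_(k < _) _)%N; set B := (\sum_(k < _) _)%N.
  case: (leP t x) => tx; case: (leP y x) => yx /=; try lia.
  by have := le_trans ty yx; rewrite leNgt tx.
have vE : v (Served p) = X (server n r X a p) (Used p (server n r X a p)).
  by apply: serviceE; rewrite /serves eqxx.
have sy : Num.max (a (Served p)) (head 0 (f (Served p))) + v (Served p) <= y.
  by rewrite vE lerD2r ge_max at_ head_t.
rewrite addn1; have := count_server_free (fun y => (y <= x)%R) (Served p).
move: sy head_t; set b := Num.max _ _ + _; set h := head _ _.
set A := (\sum_(k < _) _)%N; set B := (\sum_(k < _) _)%N.
set C := count _ _; set D := count _ _ => sy ht.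
case: (leP t x) => tx; case: (leP y x) => yx /=.
- by rewrite (le_trans ht tx) (le_trans sy yx); lia.
- by rewrite (le_trans ht tx); case: (b <= x); lia.
- by have := le_trans ty yx; rewrite leNgt tx.
- by move=> _ /(_ isT) ->; case: (h <= x); case: (b <= x); lia.
Qed.

Lemma head_free_le p : head 0 (f (Served p)) <= slot_time n r X a p.
Proof.
set t := slot_time n r X a p.
have : (0 < \sum_(k < n.+1) (next_slot r X (Used p) k <= t)%R)%N.
  by rewrite (bigD1 (server n r X a p))//= /t /slot_time lexx.
move=> /leq_trans/(_ (free_dominated p t)); rewrite -has_count => /hasP[y yf yt].
exact: le_trans (head_server_free yf) yt.
Qed.

Lemma job_start_le p i : serves n r X a p i ->
  job_start n.+1 ic u v i <= slot_time n r X a p.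
Proof.
move=> /andP[/eqP pi ap]; rewrite /job_start arrivalE ge_max ap /=.
by rewrite -pi; exact: head_free_le.
Qed.

(** The jobs being processed at time t correspond to distinct entries of [server_free] larger than
    t, and there are n+1 entries. *)
Lemma in_service_le t i :
  (count (fun y => (t < y)%R) (mkseq r n.+1) +
   \sum_(j < i) ((job_start n.+1 ic u v j <= t) &&
                 (t < job_departure n.+1 ic u v j))%R <= n.+1)%N.
Proof.
apply: (@leq_trans (count (fun y => (t < y)%R) (f i))); last first.
  by rewrite -(size_server_free i) count_size.
elim: i => [|i IH].
  by rewrite big_ord0 addn0 server_free0 count_sort.
have := count_server_free (fun y => (t < y)%R) i.
move: IH; rewrite big_ord_recr.
set N := (\sum_(j < i) _)%N; set c1 := count _ (f i.+1); set c0 := count _ (f i).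
set c := count _ (mkseq _ _) => IH /=.
rewrite /job_departure /job_start -/(f i) arrivalE.
set s := Num.max _ _; set h := head _ _ => E.
have hs : h <= s by rewrite le_max lexx orbT.
have sv : s <= s + v i by rewrite lerDl service_ge0.
move: E; case: (leP s t) => st /=; last first.
  by rewrite (lt_le_trans st sv); case: (t < h) => /=; lia.
have -> : (t < h) = false by apply/negbTE; rewrite -leNgt (le_trans hs st).
by case: (t < _) => /=; lia.
Qed.

Lemma number_in_system_le t j M : 0 <= t -> a j <= t -> t < a j.+1 ->
  exists2 i, (i <= j)%N & (number_in_system n.+1 ic u v t <=
    n.+1 + (j.+1 - i -
      \sum_(k < n.+1) \sum_(m < M) ((a i <= slot r X k m) &&
         (slot r X k m < t))%R))%N.
Proof.
move=> t0 ajt tj.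
have exq : exists q, t < slot_time n r X a q by exact: slot_time_unbounded.
(* The first step whose slot lies after t. A job starting after t under FCFS is served at step q or
   later in the busy system, hence its number is at least [Served q]. *)
have [q tq qmin] := ex_minnP exq.
have late i : t < job_start n.+1 ic u v i -> (Served q <= i)%N.
  move=> ti; have [p pi] : exists p, serves n r X a p i by exact: all_served.
  have tp := lt_le_trans ti (job_start_le pi).
  move/andP: pi => [/eqP <- _].
  exact/served_nd/qmin.
have H : (number_in_system n.+1 ic u v t <= n.+1 + (j.+1 - Served q))%N.
  rewrite /number_in_system.
  set A := [set i | _].
  have [s sE] : exists s, s = index_iota 0 j.+1 by exists (index_iota 0 j.+1).
  have AE : A = [set` [fset i in s |
     (job_arrival ic u i <= t < job_departure n.+1 ic u v i)%R]%fset].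
    apply/seteqP; split => i; rewrite /A /= !inE /=; last by move=> /andP[].
    move=> H; rewrite H andbT sE; change (i \in index_iota 0 j.+1); rewrite mem_index_iota /= ltnNge; apply/negP => ji.
    move/andP: H => [ai _]; move: tj; rewrite ltNge => /negP; apply.
    by apply: le_trans (partial_sum_nd ji) _; rewrite -arrivalE.
  have cA : #|` fset_set A| = (\sum_(i < j.+1)
      (job_arrival ic u i <= t < job_departure n.+1 ic u v i)%R)%N.
    rewrite AE set_fsetK -sum1_size.
    rewrite (perm_big [seq i <- s | (job_arrival ic u i <= t <
       job_departure n.+1 ic u v i)%R]) /=; last first.
      apply: uniq_perm; rewrite ?filter_uniq ?fset_uniq ?sE ?iota_uniq// => i.
      by rewrite mem_filter !inE /= andbC.
    by rewrite big_filter sE big_mkcond big_mkord.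
  rewrite cA; apply: (@leq_trans (count (fun y => (t < y)%R) (mkseq r n.+1) +
    (\sum_(i < j.+1) ((job_start n.+1 ic u v i <= t) &&
      (t < job_departure n.+1 ic u v i))%R +
     \sum_(i < j.+1) (t < job_start n.+1 ic u v i)%R))).
    rewrite leq_add2l -big_split /=; apply: leq_sum => i _.
    case: (leP (job_start n.+1 ic u v i) t) => _ /=.
      by case: (job_arrival _ _ _ <= t); case: (t < _).
    by rewrite addn1; case: (_ && _).
  rewrite addnA leq_add ?in_service_le//.
  apply: (@leq_trans (\sum_(i < j.+1) (Served q <= i))).
    apply: leq_sum => i _.
    by case: (boolP (t < job_start n.+1 ic u v i)%R) => [/late ->|].
  rewrite -(big_mkord xpredT (fun i => nat_of_bool (Served q <= i)%N)).
  have [sj|js] := leqP (Served q) j.+1.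
    rewrite (big_cat_nat (n := Served q))//=.
    rewrite [X in (X + _)%N](_ : _ = 0%N); last first.
      by rewrite big_nat_cond big1// => i /andP[/andP[_ iq] _]; rewrite leqNgt iq.
    rewrite add0n (@leq_trans (\sum_(Served q <= i < j.+1) 1))//.
      by apply: leq_sum => i _; exact: leq_b1.
    by rewrite sum_nat_const_nat muln1.
  rewrite big_nat_cond big1// => i /andP[/andP[_ ij] _].
  by rewrite leqNgt (ltn_trans ij js).
have [i iq qE] := busy_period n r X_ge0 partial_sum_nd q.
(* Otherwise every job that has arrived is already served, nobody waits, and any index i will do. *)
have [qj|jq] := leqP (Served q) j.
  exists i; first exact: leq_trans iq qj.
  apply: leq_trans H _; rewrite leq_add2l /Served qE subnDA leq_sub2l//.
  exact: slots_before.
exists j => //; apply: leq_trans H _; rewrite leq_add2l.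
by have -> : (j.+1 - Served q = 0)%N by apply/eqP; rewrite subn_eq0.
Qed.

End fcfs_comparison.

(** * Exponential bounds for random walks *)

Section random_walk.
Context {R : realType} d (T : measurableType d) (P : probability T R).
Implicit Types x : path R nat.

Definition rsum (x : nat -> R) k := \sum_(i < k) x i.

Lemma rsumS (x : nat -> R) k : rsum x k.+1 = rsum x k + x k.
Proof. by rewrite /rsum big_ord_recr. Qed.

Lemma eq_rsum (x y : nat -> R) k : (forall i, (i < k)%N -> x i = y i) -> rsum x k = rsum y k.
Proof. by move=> xy; apply: eq_bigr => i _; exact: xy. Qed.

Lemma measurable_rsum k : measurable_fun setT (fun x : path R nat => rsum x k).
Proof. by apply: measurable_sum => i; exact: measurable_coord. Qed.

(* The partial sums up to the [k]-th do not exceed [b]; the [0]-th one is not tested. *)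
Fixpoint below (b : R) (x : nat -> R) k : bool :=
  if k is k'.+1 then below b x k' && (rsum x k <= b) else true.

Definition first_exceeds b (x : nat -> R) k := below b x k && (b < rsum x k.+1).

Lemma eq_below b (x y : nat -> R) k : (forall i, (i < k)%N -> x i = y i) ->
  below b x k = below b y k.
Proof.
elim: k => //= k IH xy; rewrite IH; last by move=> i ik; apply: xy; exact: ltnW.
by rewrite (eq_rsum xy).
Qed.

Lemma measurable_below b k : measurable_fun setT (fun x : path R nat => below b x k).
Proof.
elim: k => [|k IH] /=; first exact: measurable_cst.
apply: measurable_and => //.
by apply: measurable_fun_ler; [exact: measurable_rsum|exact: measurable_cst].
Qed.

Lemma measurable_first_exceeds b k :
  measurable_fun setT (fun x : path R nat => first_exceeds b x k).
Proof.
apply: measurable_and; first exact: measurable_below.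
by apply: measurable_fun_ltr; [exact: measurable_cst|exact: measurable_rsum].
Qed.

Lemma exceeds_first b (x : nat -> R) k : 0 <= b -> b < rsum x k ->
  exists2 j, (j < k)%N & first_exceeds b x j.
Proof.
move=> b0 bk.
have H j : ~~ below b x j -> exists2 i, (i < j)%N & first_exceeds b x i.
  elim: j => //= j IH; rewrite negb_and => /orP[/IH[i ij Hi]|Hj].
    by exists i => //; exact: ltnW.
  have [bj|/IH[i ij Hi]] := boolP (below b x j).
    by exists j => //; rewrite /first_exceeds bj ltNge.
  by exists i => //; exact: ltnW.
apply: H; case: k bk => [|k]; first by rewrite /rsum big_ord0 ltNge b0.
by move=> bk /=; rewrite negb_and -ltNge bk orbT.
Qed.

Variables (xi : nat -> T -> R) (theta b : R).
Hypotheses (mxi : forall i, measurable_fun setT (xi i)).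
Hypothesis ixi : mutually_independent P xi.
Hypotheses (theta0 : 0 <= theta) (b0 : 0 <= b).

Let mpath : measurable_fun setT (fun w => (xi^~ w) : path R nat) := measurable_path mxi.

(** The exponential supermartingale stopped at the first passage above b is split into the part
    still below the level and the contributions of the passage times. *)
Definition alive_mgf k :=
  (\int[P]_w ((below b (xi^~ w) k)%:R * expR (theta * rsum (xi^~ w) k))%:E)%E.
Definition exit_mgf k :=
  (\int[P]_w ((first_exceeds b (xi^~ w) k)%:R * expR (theta * rsum (xi^~ w) k.+1))%:E)%E.

Lemma measurable_bool_expR (B : path R nat -> bool) k : measurable_fun setT B ->
  measurable_fun setT (fun x => ((B x)%:R * expR (theta * rsum x k))%:E).
Proof.
move=> mB; apply/measurable_EFinP; apply: measurable_funM.
  rewrite (_ : (fun _ => _) = fun x => if B x then 1 else 0); last first.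
    by apply/funext => x; case: (B x).
  exact: measurable_fun_ifT.
apply: measurableT_comp => //; apply: measurable_funM => //.
exact: measurable_rsum.
Qed.

Lemma alive_mgf0 : alive_mgf 0 = 1%E.
Proof.
rewrite /alive_mgf (eq_integral (fun=> 1%E)).
  by rewrite integral_cst//= probability_setT mule1.
by move=> w _; rewrite /= /rsum big_ord0 mulr0 expR0 mul1r.
Qed.

(** Survival up to k depends on the first k steps only, so step k may be resampled independently. *)
Lemma alive_mgfS k : (alive_mgf k.+1 + exit_mgf k =
  alive_mgf k * \int[P]_w (expR (theta * xi k w))%:E)%E.
Proof.
have mb := measurable_bool_expR.
rewrite /alive_mgf /exit_mgf -ge0_integralD//; last 2 first.
- apply: (measurableT_comp (mb (fun x => below b x k.+1) k.+1 _) mpath).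
  exact: measurable_below.
- apply: (measurableT_comp (mb (fun x => first_exceeds b x k) k.+1 _) mpath).
  exact: measurable_first_exceeds.
pose f x := ((below b x k)%:R * expR (theta * rsum x k.+1))%:E.
have mf : measurable_fun setT (f : path R nat -> \bar R) by apply: mb; exact: measurable_below.
have f0 x : (0 <= f x)%E by rewrite lee_fin mulr_ge0 ?expR_ge0.
transitivity (\int[P]_w f (xi^~ w))%E.
  apply: eq_integral => w _; rewrite -EFinD /f -mulrDl /first_exceeds /=.
  congr (_ * _)%:E; rewrite ltNge; case: (below _ _ _); case: (_ <= b);
    by rewrite ?addr0 ?add0r.
rewrite (resample_integral (pred1 k) mxi ixi mf f0).
rewrite muleC -ge0_integralZl//; last 2 first.
- apply: (measurableT_comp (mb (fun x => below b x k) k _) mpath).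
  exact: measurable_below.
- by apply: integral_ge0 => w _; rewrite lee_fin expR_ge0.
apply: eq_integral => w _; rewrite muleC -ge0_integralZl//; last first.
  by apply/measurable_EFinP; apply: measurableT_comp => //; exact: measurable_funM.
apply: eq_integral => w' _; rewrite /f -EFinM; congr EFin.
rewrite (@eq_below _ _ (xi^~ w)); last by move=> i ik; rewrite /= ltn_eqF.
rewrite rsumS (@eq_rsum _ (xi^~ w)); last by move=> i ik; rewrite /= ltn_eqF.
by rewrite /= eqxx mulrDr expRD mulrA.
Qed.

Lemma alive_mgf_ge0 k : (0 <= alive_mgf k)%E.
Proof. by apply: integral_ge0 => w _; rewrite lee_fin mulr_ge0 ?expR_ge0. Qed.

Lemma exit_mgf_le1 : (forall k, \int[P]_w (expR (theta * xi k w))%:E <= 1)%E ->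
  forall k, (alive_mgf k + \sum_(j < k) exit_mgf j <= 1)%E.
Proof.
move=> le1; elim=> [|k IH]; first by rewrite big_ord0 adde0 alive_mgf0.
apply: le_trans IH; rewrite big_ord_recr /= addeA [X in (X + _)%E]addeC -addeA [leLHS]addeC.
rewrite alive_mgfS leeD2r//.
by rewrite -[leRHS]mule1 lee_wpmul2l// alive_mgf_ge0.
Qed.

Lemma exit_mgf_eq1 : (forall k, \int[P]_w (expR (theta * xi k w))%:E = 1)%E ->
  forall k, (alive_mgf k + \sum_(j < k) exit_mgf j = 1)%E.
Proof.
move=> eq1; elim=> [|k IH]; first by rewrite big_ord0 adde0 alive_mgf0.
rewrite -IH big_ord_recr /= addeA [X in (X + _)%E]addeC -addeA addeC.
by rewrite alive_mgfS eq1 mule1.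
Qed.

Lemma measurable_exit k : measurable [set w | first_exceeds b (xi^~ w) k].
Proof.
rewrite -[X in measurable X]setTI.
exact: (measurableT_comp (measurable_first_exceeds b k) mpath).
Qed.

Lemma exit_mgf_ge k :
  ((expR (theta * b))%:E * P [set w | first_exceeds b (xi^~ w) k] <= exit_mgf k)%E.
Proof.
have mE := measurable_exit k.
rewrite -[X in P X]setIT -integral_indic// -ge0_integralZl//; last first.
  by apply/measurable_EFinP; exact: measurable_indic.
apply: ge0_le_integral => //.
- by apply: measurable_funeM; apply/measurable_EFinP; exact: measurable_indic.
- exact: (measurableT_comp (measurable_bool_expR k.+1 (measurable_first_exceeds b k)) mpath).
- move=> w _; rewrite -EFinM lee_fin indicE mulrC.
  case: (boolP (first_exceeds b (xi^~ w) k)) => h; last first.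
    by rewrite memNset ?mul0r//; apply/negP.
  rewrite mem_set// !mul1r ler_expR ler_wpM2l//.
  by case/andP: h => _ /ltW.
Qed.

Lemma first_exceeds_sum_le :
  (forall k, \int[P]_w (expR (theta * xi k w))%:E <= 1)%E ->
  forall k, (\sum_(j < k) P [set w | first_exceeds b (xi^~ w) j] <= (expR (- (theta * b)))%:E)%E.
Proof.
move=> le1 k.
rewrite -[leRHS]mule1 expRN lee_pdivlMl ?expR_gt0// ge0_sume_distrr//.
apply: le_trans (exit_mgf_le1 le1 k); rewrite -[leLHS]add0e leeD ?alive_mgf_ge0//.
by apply: lee_sum => j _; exact: exit_mgf_ge.
Qed.

Lemma lundberg : (forall k, \int[P]_w (expR (theta * xi k w))%:E <= 1)%E ->
  (P [set w | exists k, (b < rsum (xi^~ w) k)%R] <= (expR (- (theta * b)))%:E)%E.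
Proof.
move=> le1.
have E : [set w | exists k, b < rsum (xi^~ w) k] =
    \bigcup_k [set w | first_exceeds b (xi^~ w) k].
  apply/seteqP; split => w /=.
    by move=> [k /(exceeds_first b0)[j _ Hj]]; exists j.
  by move=> [k _ /= /andP[_ H]]; exists k.+1.
have mF := measurable_exit.
apply: (@le_trans _ _ (\big[+%E/0%R]_(0 <= n <oo) P [set w | first_exceeds b (xi^~ w) n])%E).
  apply: measure_sigma_subadditive_tail => //.
    by rewrite E; exact: bigcupT_measurable.
  by rewrite E => w [n _ H]; exists n.
apply: lime_le; first by apply: is_cvg_nneseries => n _ _.
by near=> n; rewrite big_mkord first_exceeds_sum_le.
Unshelve. all: by end_near. Qed.

Lemma below_rsum (x : nat -> R) k : below b x k -> rsum x k <= b.
Proof. by case: k => [|k] /=; [rewrite /rsum big_ord0|case/andP]. Qed.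

(* Overshooting the level by more than [eta] requires a jump larger than [eta]. *)
Lemma exit_mgf_overshoot (eta : R) k :
  (exit_mgf k <= (expR (theta * (b + eta)))%:E * P [set w | first_exceeds b (xi^~ w) k] +
   (expR (theta * b))%:E * \int[P]_w ((eta < xi k w)%R%:R * expR (theta * xi k w))%:E)%E.
Proof.
have mE := measurable_exit k.
have mi : measurable_fun setT (fun w => (\1_[set w | first_exceeds b (xi^~ w) k] w)%:E : \bar R).
  by apply/measurable_EFinP; exact: measurable_indic.
have mj : measurable_fun setT (fun w => ((eta < xi k w)%R%:R * expR (theta * xi k w))%:E).
  apply/measurable_EFinP; apply: measurable_funM; last first.
    by apply: measurableT_comp => //; exact: measurable_funM.
  rewrite (_ : (fun _ => _) = fun w => if eta < xi k w then 1 else 0); last first.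
    by apply/funext => w; case: (_ < _).
  by apply: measurable_fun_ifT => //; exact: measurable_fun_ltr.
rewrite -[X in P X]setIT -integral_indic// -!ge0_integralZl//.
rewrite -ge0_integralD//; last 2 first.
- exact: measurable_funeM.
- exact: measurable_funeM.
apply: ge0_le_integral => //.
- exact: (measurableT_comp (measurable_bool_expR k.+1 (measurable_first_exceeds b k)) mpath).
- by apply: emeasurable_funD; exact: measurable_funeM.
- move=> w _; rewrite -!EFinM -EFinD lee_fin indicE.
  case: (boolP (first_exceeds b (xi^~ w) k)) => h; last first.
    by rewrite mul0r addr_ge0 ?mulr_ge0 ?expR_ge0.
  rewrite mem_set// mul1r mulr1; have Sk := below_rsum (andP h).1.
  have S1 : rsum (xi^~ w) k.+1 <= b + xi k w by rewrite rsumS lerD2r.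
  case: ltP => he.
    rewrite mul1r -expRD -mulrDr; apply: ler_wpDl; first exact: expR_ge0.
    by rewrite ler_expR ler_wpM2l.
  rewrite mul0r mulr0 addr0 ler_expR ler_wpM2l// (le_trans S1)// lerD2l.
  exact: he.
Qed.

End random_walk.

(** * Supremum of a stable motion with drift *)

Lemma independent_comp {R : realType} {I : choiceType} d (T : measurableType d)
    (P : probability T R) (X : I -> T -> R) (f : I -> R -> R) :
  (forall i, measurable_fun setT (f i)) -> mutually_independent P X ->
  mutually_independent P (fun i w => f i (X i w)).
Proof.
move=> mf iX J E mE.
rewrite [RHS](_ : _ = \prod_(i <- J) P (X i @^-1` (f i @^-1` E i)))%E//.
rewrite -(iX J (fun i => f i @^-1` E i))// => i.
by rewrite -[X in measurable X]setTI; exact: mf.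
Qed.

Section stable_levy.
Context {R : realType} (al B C_A : R).
Hypotheses (al1 : 1 < al) (al2 : al < 2) (B0 : 0 < B) (C_A0 : 0 < C_A).
Context d (T : measurableType d) (P : probability T R) (X : R -> {RV P >-> R}).
Hypothesis SX : stable_levy_motion al 1 X.

Let tau := tan (pi / 2 * al).
Let kappa := (C_A / stable_const al) `^ al^-1.
(** By [Gamma_reflection] this is C_A al Gamma (- al). Below, [psi] is the Laplace exponent of the
    process [Z] and [theta] its positive zero, the decay rate of the supremum. *)
Let c := C_A * Gamma (2 - al) / (al - 1).
Let theta := (B / c) `^ (al - 1)^-1.
Let psi q := c * q `^ al - B * q.

Lemma stable_cfE (t : R) : 0 <= t ->
  stable_cf al 1 1 0 t = Complex (expR (- t `^ al) * cos (t `^ al * tau))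
                                (expR (- t `^ al) * sin (t `^ al * tau)).
Proof.
move=> t0; rewrite /stable_cf mul1r mul0r (ger0_norm t0) /cexp /= mul1r -/tau.
have E : t `^ al * (Num.sg t * tau) = t `^ al * tau.
  move: t0; rewrite le_eqVlt => /predU1P[<-|t0]; last by rewrite gtr0_sg// mul1r.
  by rewrite powR0 ?mul0r// gt_eqF// (lt_trans ltr01).
rewrite -E; move: (Num.sg t * tau) (t `^ al) => {E} u v.
by congr (Complex (expR _ * cos _) (expR _ * sin _)); ring.
Qed.

Let Z t w := - (kappa * X t w) - B * t.

Lemma stable_const_gt0 : 0 < C_A / stable_const al.
Proof.
have G0 : 0 < Gamma (2 - al) by rewrite GammaE ?rgamma_gt0// subr_gt0.
have a1 := al1; have cn := cos_lt0 al1 al2.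
apply: divr_gt0 => //; rewrite /stable_const -(opprB al 1) mulNr -mulrN -invrN.
by rewrite divr_gt0 ?subr_gt0// -mulrN mulr_gt0// oppr_gt0.
Qed.

Lemma c_gt0 : 0 < c.
Proof.
have G0 : 0 < Gamma (2 - al) by rewrite GammaE ?rgamma_gt0// subr_gt0.
by rewrite /c divr_gt0 ?mulr_gt0// subr_gt0.
Qed.

Lemma kappa_pow : kappa `^ al = C_A / stable_const al.
Proof.
rewrite -powRrM mulVf ?powRr1 ?(ltW stable_const_gt0)// gt_eqF//.
exact: lt_trans al1.
Qed.

Lemma levy_mgf s t q : 0 <= s -> 0 <= t -> 0 <= q ->
  (\int[P]_w (expR (q * (Z (s + t) w - Z s w)))%:E = (expR (t * psi q))%:E)%E.
Proof.
move=> s0 t0 q0; pose Y w := X (s + t) w - X s w.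
have mY : measurable_fun setT Y by exact: measurable_funB.
have al0 : 0 < al := lt_trans ltr01 al1.
have cf th : 0 < th -> charfun P Y th =
    Complex (expR (- (t * th `^ al)) * cos (t * th `^ al * tau))
            (expR (- (t * th `^ al)) * sin (t * th `^ al * tau)).
  move=> th0; have [_ /(_ s t s0 t0 th) ->] := SX.
  rewrite stable_cfE; last by rewrite mulr_ge0 ?powR_ge0// ltW.
  by rewrite powRM ?powR_ge0 ?(ltW th0)// -powRrM mulVf ?powRr1// gt_eqF.
have Xcos th : 0 < th -> \int[P]_w cos (th * Y w) =
    expR (- (t * th `^ al)) * cos (t * th `^ al * tau).
  by move=> /cf [+ _]; rewrite unlock.
have Xsin th : 0 < th -> \int[P]_w sin (th * Y w) =
    expR (- (t * th `^ al)) * sin (t * th `^ al * tau).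
  by move=> /cf [_]; rewrite unlock.
have k0 : 0 <= kappa * q by rewrite mulr_ge0 ?powR_ge0.
have H := laplace_transform mY al1 al2 t0 Xcos Xsin k0.
transitivity (\int[P]_w ((expR (- (q * (B * t))))%:E * (expR (- (kappa * q * Y w)))%:E))%E.
  apply: eq_integral => w _; rewrite -EFinM -expRD; congr (expR _)%:E.
  by rewrite /Z /Y; ring.
rewrite ge0_integralZl//; last first.
  by apply/measurable_EFinP; apply: measurableT_comp => //; apply: measurableT_comp => //; exact: measurable_funM.
rewrite H -EFinM -expRD; congr (expR _)%:E.
(* The factor cos (pi al / 2) in [stable_const] cancels the one in the Laplace exponent, and 1 - al
   combines with the sign. *)
rewrite powRM ?powR_ge0// kappa_pow /psi /c /stable_const.
have G0 : 0 < Gamma (2 - al) by rewrite GammaE ?rgamma_gt0// subr_gt0.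
have cn := cos_lt0 al1 al2.
have a1 : al - 1 != 0 by rewrite gt_eqF// subr_gt0.
have a1' : 1 - al != 0 by rewrite lt_eqF// subr_lt0.
by field; rewrite a1 a1' (gt_eqF G0) (lt_eqF cn).
Qed.

Section skeleton.
Variables (h : R).
Hypothesis (h0 : 0 <= h).
Definition skel k w := Z (h * k.+1%:R) w - Z (h * k%:R) w.

Lemma measurable_Z t : measurable_fun setT (Z t).
Proof. by apply: measurable_funB => //; apply: measurableT_comp => //; exact: measurable_funM. Qed.

Lemma measurable_skel k : measurable_fun setT (skel k).
Proof. by apply: measurable_funB; exact: measurable_Z. Qed.

Lemma skel_independent : mutually_independent P skel.
Proof.
have [[_ _ /(_ (fun k => h * k%:R)) H _ _] _] := SX.
have t00 : 0 <= h * 0%:R by rewrite mulr0.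
have tnd : nondecreasing_seq (fun k : nat => h * k%:R).
  by move=> m n mn; rewrite ler_wpM2l// ler_nat.
have mf (i : nat) : measurable_fun setT (fun z : R => - (kappa * z) - B * h).
  by apply: measurable_funB => //; apply: measurableT_comp => //; exact: measurable_funM.
have := independent_comp mf (H t00 tnd).
rewrite (_ : skel = fun k w => - (kappa * (X (h * k.+1%:R) w - X (h * k%:R) w)) - B * h)//.
 apply/funext => k; apply/funext => w; rewrite /skel /Z -natr1; ring.
Qed.

Lemma rsum_skel k w : rsum (skel^~ w) k = Z (h * k%:R) w.
Proof.
elim: k => [|k IH]; last by rewrite rsumS IH /skel addrC subrK.
have [[X0 _ _ _ _] _] := SX.
by rewrite /rsum big_ord0 /Z mulr0 X0 !mulr0 subr0 oppr0.
Qed.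

Lemma skel_mgf k q : 0 <= q ->
  (\int[P]_w (expR (q * skel k w))%:E = (expR (h * psi q))%:E)%E.
Proof.
move=> q0; rewrite -(@levy_mgf (h * k%:R) h q)//; last by rewrite mulr_ge0.
have E : h * k.+1%:R = h * k%:R + h by rewrite -natr1 mulrDr mulr1.
by apply: eq_integral => w _; rewrite /skel E.
Qed.

End skeleton.

Lemma theta_gt0 : 0 < theta.
Proof. by rewrite powR_gt0// divr_gt0// c_gt0. Qed.

Lemma psiE q : 0 < q -> psi q = q * (c * q `^ (al - 1) - B).
Proof.
move=> q0; rewrite /psi mulrBr; congr (_ - _); last by rewrite mulrC.
by rewrite mulrCA mulr_powRB1 ?(ltW q0)// (lt_trans ltr01).
Qed.

Lemma theta_pow : c * theta `^ (al - 1) = B.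
Proof.
have := c_gt0 => c0.
rewrite -powRrM mulVf; last by rewrite gt_eqF// subr_gt0.
by rewrite powRr1; [rewrite mulrCA mulfV ?mulr1// gt_eqF|rewrite ltW// divr_gt0].
Qed.

Lemma psi_theta : psi theta = 0.
Proof. by rewrite psiE ?theta_gt0// theta_pow subrr mulr0. Qed.

Lemma psi_lt0 q : 0 < q -> q < theta -> psi q < 0.
Proof.
move=> q0 qt; rewrite psiE// pmulr_rlt0// subr_lt0 -theta_pow ltr_pM2l ?c_gt0//.
by apply: gt0_ltr_powR; rewrite ?nnegrE ?subr_gt0 ?(ltW q0) ?(ltW theta_gt0).
Qed.

Variable x : R.
Hypothesis x0 : 0 < x.

Definition exceeds := [set w | exists2 t, 0 <= t & x < Z t w].

Lemma skel_sup_le h : 0 <= h ->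
  (P [set w | exists k, (x < Z (h * k%:R) w)%R] <= (expR (- (theta * x)))%:E)%E.
Proof.
move=> h0.
rewrite (_ : [set w | _] = [set w | exists k, x < rsum ((skel h)^~ w) k]).
  apply: lundberg; rewrite ?(ltW theta_gt0) ?(ltW x0)//.
  - exact: measurable_skel.
  - exact: skel_independent.
  - by move=> k; rewrite skel_mgf ?(ltW theta_gt0)// psi_theta mulr0 expR0.
by apply/seteqP; split => w [k]; rewrite /= ?rsum_skel => H; exists k; rewrite ?rsum_skel.
Qed.

Let dyadic_exceeds m := [set w | exists k, (x < Z ((2 ^+ m)^-1 * k%:R) w)%R].

(** By right continuity an exceedance persists on a right neighbourhood, which contains a dyadic
    time. This also makes the supremum event measurable. *)
Lemma exceedsE : exceeds = \bigcup_m dyadic_exceeds m.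
Proof.
apply/seteqP; split => w /=; last first.
  by move=> [m _ [k Hk]]; exists ((2 ^+ m)^-1 * k%:R) => //; rewrite mulr_ge0 ?invr_ge0 ?exprn_ge0.
move=> [t t0 xt].
have [[_ _ _ rc _] _] := SX.
have cZ : Z s w @[s --> t^'+] --> Z t w.
  apply: cvgB; last by apply: cvgM; [exact: cvg_cst|exact: cvg_at_right_filter].
  by apply: cvgN; apply: cvgM; [exact: cvg_cst|exact: rc].
have : \forall s \near t^'+, x < Z s w.
  by apply: (cvgr_gt _ cZ).
move=> [e /= e0 He].
pose m := (Num.truncn e^-1).+1; have p0 : 0 < 2 ^+ m :> R by rewrite exprn_gt0.
have me : (2 ^+ m)^-1 < e.
  rewrite invf_plt ?posrE//.
  have /andP[_ h1] := truncn_itv (ltW (etrans (invr_gt0 e) e0)).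
  apply: lt_le_trans h1 _; rewrite -natrX ler_nat.
  by apply: (@leq_trans m); [|exact/ltnW/ltn_expl].
have /andP[h1 h2] := truncn_itv (mulr_ge0 t0 (ltW p0)).
set k := Num.truncn _ in h1 h2.
have ts : t < (2 ^+ m)^-1 * k.+1%:R by rewrite ltr_pdivlMl// mulrC.
exists m => //; exists k.+1; apply: He => //=.
rewrite ltr0_norm ?subr_lt0// opprB ltrBlDl.
apply: le_lt_trans (_ : t + (2 ^+ m)^-1 < _); last by rewrite ltrD2l.
rewrite -(natr1 k) mulrDr mulr1 lerD2r ler_pdivrMl// mulrC; exact: h1.
Qed.

Lemma measurable_dyadic m : measurable (dyadic_exceeds m).
Proof.
rewrite (_ : dyadic_exceeds m = \bigcup_k [set w | x < Z ((2 ^+ m)^-1 * k%:R) w]); last first.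
  by apply/seteqP; split => w /= [k]; [move=> H; exists k|move=> _ H; exists k].
apply: bigcupT_measurable => k; rewrite -[X in measurable X]setTI.
by apply: measurable_fun_ltr => //; exact: measurable_Z.
Qed.

Lemma measurable_exceeds : measurable exceeds.
Proof. by rewrite exceedsE; apply: bigcupT_measurable; exact: measurable_dyadic. Qed.

Lemma exceeds_le : (P exceeds <= (expR (- (theta * x)))%:E)%E.
Proof.
have nd : nondecreasing_seq dyadic_exceeds.
  apply/nondecreasing_seqP => m; apply/subsetPset => w /= [k Hk]; exists (2 * k)%N.
  rewrite natrM mulrA (_ : _ * 2 = (2 ^+ m)^-1)//.
  by rewrite exprS; field.
have := @nondecreasing_cvg_mu _ _ _ P _ measurable_dyadic _ nd.
rewrite -exceedsE => /(_ measurable_exceeds) H.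
apply: (closed_cvg (fun y => (y <= (expR (- (theta * x)))%:E)%E)) H.
  exact: closed_ereal_ge_ereal.
near=> m; apply: skel_sup_le.
by rewrite invr_ge0 exprn_ge0.
Unshelve. all: by end_near. Qed.


(** All positive exponential moments are finite, as there are no positive jumps; an extra exponent m
    makes a large increment over a short step very costly. *)
Lemma skel_jump h (eta : R) (m k : nat) : 0 <= h ->
  (\int[P]_w ((eta < skel h k w)%R%:R * expR (theta * skel h k w))%:E <=
   (expR (- (m%:R * eta)) * expR (h * psi (theta + m%:R)))%:E)%E.
Proof.
move=> h0; have t0 := ltW theta_gt0; have ms := measurable_skel h k.
have tm : 0 <= theta + m%:R by rewrite addr_ge0.
rewrite EFinM -(skel_mgf h0 k tm) -ge0_integralZl//; last first.
  by apply/measurable_EFinP; apply: measurableT_comp => //; exact: measurable_funM.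
apply: ge0_le_integral => //.
- apply/measurable_EFinP; apply: measurable_funM; last first.
    by apply: measurableT_comp => //; exact: measurable_funM.
  rewrite (_ : (fun _ => _) = fun w => if eta < skel h k w then 1 else 0); last first.
    by apply/funext => w; case: (_ < _).
  by apply: measurable_fun_ifT => //; exact: measurable_fun_ltr.
- apply: measurable_funeM.
  by apply/measurable_EFinP; apply: measurableT_comp => //; exact: measurable_funM.
- move=> w _; rewrite -EFinM lee_fin -expRD; case: ltP => he; last by rewrite mul0r expR_ge0.
  rewrite mul1r ler_expR mulrDl addrCA lerDl -mulrN addrC -mulrDr mulr_ge0// subr_ge0 ltW//.
Qed.

(** On paths still below x, exp (theta Z) <= exp ((theta - q) x) exp (q Z), and the mean of exp (q
    Z) decays in time because [psi q] is negative between 0 and theta. *)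
Lemma skel_alive h q k : 0 <= h -> 0 <= q -> q <= theta ->
  (alive_mgf P (skel h) theta x k.+1 <=
   (expR ((theta - q) * x) * expR (h * k.+1%:R * psi q))%:E)%E.
Proof.
move=> h0 q0 qt; have mZ := measurable_Z (h * k.+1%:R).
have [[X0 _ _ _ _] _] := SX.
have Z0 w : Z 0 w = 0 by rewrite /Z X0 !mulr0 subr0 oppr0.
have hk : 0 <= h * k.+1%:R by rewrite mulr_ge0.
have := levy_mgf (lexx 0) hk q0; under eq_integral do rewrite add0r Z0 subr0.
rewrite EFinM => <-; rewrite -ge0_integralZl//; last first.
  by apply/measurable_EFinP; apply: measurableT_comp => //; exact: measurable_funM.
apply: ge0_le_integral => //.
- exact: (measurableT_comp (measurable_bool_expR theta k.+1 (measurable_below x k.+1)) (measurable_path (measurable_skel h))).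
- apply: measurable_funeM.
  by apply/measurable_EFinP; apply: measurableT_comp => //; exact: measurable_funM.
- move=> w _; rewrite -EFinM lee_fin -expRD rsum_skel /= rsum_skel.
  case: (below _ _ _); rewrite ?mul0r ?expR_ge0//=.
  case: (boolP (Z (h * k.+1%:R) w <= x)) => hx; rewrite ?mul0r ?expR_ge0// mul1r ler_expR.
  by rewrite -[X in X * Z _ _](subrK q theta) mulrDl lerD2r ler_wpM2l// subr_ge0.
Qed.

Lemma trivIset_first_exceeds (xi : nat -> T -> R) (b : R) :
  trivIset setT (fun k => [set w | first_exceeds b (xi^~ w) k]).
Proof.
have below_le (y : nat -> R) i j : (i <= j)%N -> below b y j -> below b y i.
  elim: j => [|j IH]; first by rewrite leqn0 => /eqP ->.
  rewrite leq_eqVlt => /predU1P[-> //|]; rewrite ltnS => ij /= /andP[/(IH ij)//].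
have H (i j : nat) w : (i < j)%N -> first_exceeds b (xi^~ w) i ->
    first_exceeds b (xi^~ w) j -> False.
  move=> ij /andP[_ h1] /andP[h2 _]; have /= /andP[_] := below_le _ _ _ ij h2.
  by rewrite leNgt h1.
move=> i j _ _ [w [/= hi hj]].
by have [ij|ji|//] := ltngtP i j; [case: (H _ _ _ ij hi hj)|case: (H _ _ _ ji hj hi)].
Qed.

(** The unit mass of the exponential martingale is shared among surviving paths, crossings with
    overshoot at most eta, and crossings by an increment larger than eta. *)
Lemma skel_optional_stopping h q (eta : R) (m k : nat) : 0 <= h -> 0 <= q -> q <= theta ->
  (1 <= (expR ((theta - q) * x) * expR (h * k.+1%:R * psi q))%:E +
    ((expR (theta * (x + eta)))%:E * P exceeds +
    (k.+1%:R * (expR (theta * x) * (expR (- (m%:R * eta)) * expR (h * psi (theta + m%:R)))))%:E))%E.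
Proof.
move=> h0 q0 qt; have t0 := ltW theta_gt0.
have m1 j : (\int[P]_w (expR (theta * skel h j w))%:E = 1)%E.
  by rewrite skel_mgf// psi_theta mulr0 expR0.
rewrite -(exit_mgf_eq1 x (measurable_skel h) (skel_independent h0) m1 k.+1).
apply: leeD; first exact: skel_alive.
pose J := (expR (theta * x) * (expR (- (m%:R * eta)) * expR (h * psi (theta + m%:R))))%:E.
pose E j := [set w | first_exceeds x ((skel h)^~ w) j].
have mE j : measurable (E j).
  exact: (measurable_exit x (measurable_skel h)).
apply: (@le_trans _ _ (\sum_(j < k.+1) ((expR (theta * (x + eta)))%:E * P (E j) + J))%E).
  apply: lee_sum => j _.
  apply: le_trans (exit_mgf_overshoot P (measurable_skel h) t0 (ltW x0) eta j) _.
  rewrite leeD2l// /J [leRHS]EFinM lee_wpmul2l ?lee_fin ?expR_ge0//.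
  exact: skel_jump.
rewrite big_split /=; apply: leeD; last first.
  by rewrite sumEFin sumr_const card_ord lee_fin [leRHS]mulr_natl.
rewrite -ge0_sume_distrr// lee_wpmul2l ?lee_fin ?expR_ge0//.
rewrite -(measure_bigsetU P mE); last exact: trivIset_first_exceeds.
apply: le_measure; rewrite ?inE//.
- exact: bigsetU_measurable.
- exact: measurable_exceeds.
- move=> w; rewrite -bigcup_mkord => -[j _ /= /andP[_]]; rewrite rsum_skel => hx.
  by exists (h * j.+1%:R) => //; rewrite mulr_ge0.
Qed.

Lemma exceeds_eq : P exceeds = (expR (- (theta * x)))%:E.
Proof.
apply/eqP; rewrite eq_le exceeds_le /=.
have t0 := theta_gt0.
have fP : P exceeds \is a fin_num by exact: fin_num_measure measurable_exceeds.
rewrite -(fineK fP) lee_fin; set F := fine _.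
have F0 : 0 <= F by exact: fine_ge0.
pose q := theta / 2.
have q0 : 0 < q by rewrite divr_gt0.
have qt : q < theta by rewrite /q; lra.
pose dl := - psi q; have dl0 : 0 < dl by rewrite oppr_gt0 psi_lt0.
have c0 := c_gt0.
pose A := expR ((theta - q) * x); have A0 : 0 < A by exact: expR_gt0.
pose C := expR (theta * x) * expR (c * (theta + 1) ^+ 2).
have C0 : 0 < C by rewrite mulr_gt0 ?expR_gt0.
have expRN_le (y : R) : 0 < y -> expR (- y) <= y^-1.
  move=> y0; rewrite expRN lef_pV2 ?posrE ?expR_gt0//.
  by apply: le_trans (expR_ge1Dx y); rewrite lerDr.
have main eta e : 0 < eta -> 0 < e -> 1 <= e + (expR (theta * (x + eta)) * F + e).
  move=> eta0 e0.
  pose n := (Num.truncn (A / (dl * e))).+1.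
  have n0 : 0 < n%:R :> R by rewrite ltr0n.
  have nA : A * expR (- (n%:R * dl)) <= e.
    apply: le_trans (ler_wpM2l (ltW A0) (expRN_le _ (mulr_gt0 n0 dl0))) _.
    have /andP[_ h2] := truncn_itv (ltW (divr_gt0 A0 (mulr_gt0 dl0 e0))).
    rewrite ler_pdivrMr ?mulr_gt0//; have := ltW h2.
    by rewrite ler_pdivrMr ?mulr_gt0// -/n; congr (_ <= _); ring.
  pose D := n%:R * C * 27 / (eta ^+ 3 * e).
  have D0 : 0 < D.
    apply: divr_gt0; first by apply: mulr_gt0 => //; exact: mulr_gt0.
    by apply: mulr_gt0 => //; exact: exprn_gt0.
  pose m := (Num.truncn D).+1.
  have m0 : 0 < m%:R :> R by rewrite ltr0n.
  have m1 : 1 <= m%:R :> R by rewrite ler1n.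
  have mD : D <= m%:R by have /andP[_ /ltW] := truncn_itv (ltW D0).
  (* With step 1/m^2 and extra exponent m, h psi (theta + m) stays bounded since al < 2; the n m^2
     steps up to time n contribute at most a constant times n m^2 exp (- m eta), which is O(n/m). *)
  pose h : R := (m%:R ^+ 2)^-1.
  have h0 : 0 <= h by rewrite invr_ge0 exprn_ge0.
  pose k := (n * m ^ 2).-1.
  have kE : k.+1%:R = n%:R * m%:R ^+ 2 :> R.
    by rewrite prednK ?muln_gt0// ?expn_gt0// natrM natrX.
  have hk : h * k.+1%:R = n%:R by rewrite kE /h; field; rewrite gt_eqF.
  have jump : h * psi (theta + m%:R) <= c * (theta + 1) ^+ 2.
    have tm0 : 0 < theta + m%:R by rewrite addr_gt0.
    apply: (@le_trans _ _ (h * (c * (theta + m%:R) ^+ 2))).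
      rewrite ler_wpM2l// /psi lerBlDr; apply: ler_wpDr.
        by rewrite mulr_ge0 ?ltW.
      rewrite ler_pM2l// -powR_mulrn ?(ltW tm0)//; apply: ler_powR; last exact: ltW.
      by apply: ler_wpDl => //; exact: ltW.
    rewrite mulrCA ler_pM2l// /h ler_pdivrMl ?exprn_gt0// -exprMn lerXn2r ?nnegrE//.
    - exact: ltW.
    - by rewrite mulr_ge0 ?addr_ge0// ltW.
    - by rewrite mulrDr mulr1 lerD2r ler_peMl// ltW.
  have third : k.+1%:R * (expR (theta * x) * (expR (- (m%:R * eta)) *
      expR (h * psi (theta + m%:R)))) <= e.
    apply: (@le_trans _ _ (n%:R * m%:R ^+ 2 * (C * (3 / (m%:R * eta)) ^+ 3))).
      rewrite kE ler_pM2l ?mulr_gt0 ?exprn_gt0//.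
      rewrite [X in expR _ * X]mulrC mulrA ler_pM ?mulr_ge0 ?expR_ge0//.
        by rewrite ler_pM2l ?expR_gt0// ler_expR.
      have me0 : 0 < m%:R * eta by rewrite mulr_gt0.
      have -> : - (m%:R * eta) = 3%:R * (- (m%:R * eta / 3)) by field.
      rewrite expRM_natl lerXn2r ?nnegrE ?expR_ge0//; first by rewrite divr_ge0// ltW.
      by apply: le_trans (expRN_le _ (divr_gt0 me0 _)) _ => //; rewrite invf_div.
    rewrite [leLHS](_ : _ = D * e / m%:R); last first.
      by rewrite /D; field; rewrite !gt_eqF.
    by rewrite ler_pdivrMr// mulrC ler_pM2l.
  have := skel_optional_stopping eta m k h0 (ltW q0) (ltW qt).
  rewrite hk -(fineK fP) -/F -!EFinM -!EFinD lee_fin => H; apply: le_trans H _.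
  apply: lerD; last by rewrite lerD2l.
  by apply: le_trans nA; rewrite /A /dl mulrN opprK.
rewrite leNgt; apply/negP => FL.
have gen eta : 0 < eta -> 1 <= expR (theta * (x + eta)) * F.
  move=> eta0; apply/ler_addgt0Pr => e e0.
  have := main eta (e / 2) eta0; rewrite divr_gt0// => /(_ isT).
  lra.
have F1 : 0 < F.
  rewrite lt_neqAle F0 andbT; apply/eqP => F00.
  by have := gen 1 ltr01; rewrite -F00 mulr0 ler10.
have lnF : theta * x < - ln F.
  by rewrite ltrNr -ltr_expR lnK ?posrE.
(* Puts theta (x + eta) halfway between theta x and - ln F, which contradicts [gen]. *)
pose eta := (- ln F - theta * x) / (2 * theta).
have eta0 : 0 < eta by rewrite divr_gt0 ?mulr_gt0// subr_gt0.
have := gen eta eta0; rewrite leNgt => /negP; apply.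
rewrite -ltr_pdivlMr// mul1r -[F]lnK ?posrE// -expRN ltr_expR mulrDr.
rewrite (_ : theta * eta = (- ln F - theta * x) / 2); first by lra.
by rewrite /eta; field; rewrite gt_eqF.
Qed.

Lemma levy_sup : P [set w | (x%:E < ereal_sup
      [set (- ((C_A / stable_const al) `^ al^-1 * X t w) - B * t)%:E | t in `[0%R, +oo[])%E] =
  (expR (- ((B / (C_A * al * Gamma (- al))) `^ (al - 1)^-1 * x)))%:E.
Proof.
rewrite (_ : C_A * al * Gamma (- al) = c); last first.
  by rewrite -mulrA Gamma_reflection ?al1// mulrA.
rewrite -exceeds_eq; congr (P _); apply/seteqP; split => w /=.
  move=> /ereal_sup_gt[_ [t /= t0 <-]]; rewrite lte_fin => xt; exists t => //.
  by move: t0; rewrite in_itv /= andbT.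
move=> [t t0 xt]; apply: (@lt_le_trans _ _ (Z t w)%:E); first by rewrite lte_fin.
by apply: ereal_sup_ubound; exists t => //=; rewrite in_itv /= andbT.
Qed.

End stable_levy.

(** * Law of the services received by the successive jobs *)

Section state_local.
Context {R : realType} (n : nat) (r a : nat -> R).

Lemma used_nd X p p' k : (p <= p')%N ->
  ((state n r X a p).1 k <= (state n r X a p').1 k)%N.
Proof.
move=> /subnKC <-; elim: (p' - p)%N => [|l IH]; first by rewrite addn0.
by rewrite addnS (leq_trans IH)// usedS leq_addr.
Qed.

Lemma serves_before X p i : (i < (state n r X a p).2)%N ->
  exists2 q, (q < p)%N & serves n r X a q i.
Proof.
elim: p => [//|p IH]; rewrite servedS => ip.
have [/IH[q qp qi]|pi] := ltnP i (state n r X a p).2.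
  by exists q => //; exact: ltnW.
exists p => //; move: ip; rewrite /serves.
have [ai|ai] := boolP (a (state n r X a p).2 <= slot_time n r X a p); last first.
  by rewrite addn0 ltnNge pi.
rewrite addn1 ltnS => ip; have E : (state n r X a p).2 = i by apply/eqP; rewrite eqn_leq ip pi.
by rewrite -E eqxx ai.
Qed.

Variables (X X' : nat -> nat -> R) (k0 : 'I_n.+1) (c0 : nat).
Hypothesis XX' : forall k m, (k, m) != (k0 : nat, c0) -> X k m = X' k m.

Lemma next_slot_local (c : {ffun 'I_n.+1 -> nat}) : (c k0 <= c0)%N ->
  next_slot r X c = next_slot r X' c.
Proof.
move=> ck; apply/funext => k; rewrite /next_slot /slot; congr (_ + _).
apply: eq_bigr => l _; apply: XX'; apply/eqP => -[kk lc].
have E : k = k0 by apply/val_inj.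
by move: l lc; rewrite E => l lc; have := ltn_ord l; rewrite ltnNge lc ck.
Qed.

Variable p : nat.
Hypothesis pc : ((state n r X a p).1 k0 <= c0)%N.

(** The selection is non-anticipating: the entry (k0, c0) first matters when server k0 has used more
    than c0 slots, so changing it cannot affect the steps up to p. *)
Lemma state_local q : (q <= p)%N -> state n r X' a q = state n r X a q.
Proof.
elim: q => [//|q IH] qp; rewrite /= IH 1?ltnW// /step /first_server /is_first.
by rewrite next_slot_local// (leq_trans _ pc)// used_nd// ltnW.
Qed.

Lemma server_local q : (q <= p)%N -> server n r X' a q = server n r X a q.
Proof.
move=> qp; rewrite /server /first_server /is_first state_local//.
by rewrite next_slot_local// (leq_trans _ pc)// used_nd.
Qed.

Lemma slot_time_local q : (q <= p)%N -> slot_time n r X' a q = slot_time n r X a q.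
Proof.
move=> qp; rewrite /slot_time server_local// state_local// next_slot_local//.
by rewrite (leq_trans _ pc)// used_nd.
Qed.

Lemma service_local i : (i < (state n r X a p).2)%N ->
  service n r X' a i = service n r X a i.
Proof.
move=> /serves_before[q qp qi].
have qi' : serves n r X' a q i.
  by rewrite /serves slot_time_local ?(ltnW qp)// state_local ?(ltnW qp).
rewrite (serviceE qi) (serviceE qi') server_local ?(ltnW qp)// state_local ?(ltnW qp)//.
rewrite XX'//; apply/eqP => -[kk cc].
have E : server n r X a q = k0 by exact/val_inj.
have : (c0 < (state n r X a p).1 k0)%N.
  apply: leq_trans (used_nd X k0 qp).
  by rewrite usedS -cc E eqxx addn1.
by rewrite ltnNge pc.
Qed.

End state_local.

Section measurable_bool.
Context d (T : measurableType d).

Lemma measurable_boolP (b : T -> bool) :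
  measurable [set w | b w] <-> measurable_fun setT b.
Proof.
split => [mb|mb].
  apply: (@measurable_fun_bool _ _ _ _ true); rewrite setTI.
  by rewrite (_ : _ @^-1` _ = [set w | b w])//; apply/seteqP; split => w /=.
have := mb measurableT [set true]; rewrite setTI => /(_ (I : measurable ([set true] : set bool))).
by rewrite (_ : _ @^-1` _ = [set w | b w])//; apply/seteqP; split => w /=.
Qed.

Lemma measurable_all_fin (I : finType) (b : I -> T -> bool) :
  (forall i, measurable [set w | b i w]) -> measurable [set w | [forall i, b i w]].
Proof.
move=> mb; rewrite (_ : [set w | _] = \bigcap_(i in [set: I]) [set w | b i w]).
  apply: fin_bigcap_measurable => // ; exact: finite_finset.
apply/seteqP; split => w /=; first by move=> /forallP H i _; exact: H.
by move=> H; apply/forallP => i; exact: H.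
Qed.

Lemma measurable_ex_count (I : countType) (B : I -> set T) :
  (forall i, measurable (B i)) -> measurable [set w | exists i, B i w].
Proof.
move=> mB; rewrite (_ : [set w | _] =
    \bigcup_m (if (choice.unpickle m : option I) is Some i then B i else classical_sets.set0)).
  by apply: bigcupT_measurable => m; case: choice.unpickle.
apply/seteqP; split => w /=; first by move=> [i Bi]; exists (choice.pickle i) => //; rewrite choice.pickleK.
by move=> [m _]; case: choice.unpickle => // i Bi; exists i.
Qed.

Lemma measurable_fun_cover (I : countType) d' (T' : measurableType d') (B : I -> set T) (f : T -> T') :
  (forall i, measurable (B i)) -> (forall i, measurable_fun (B i) f) ->
  (forall w, exists i, B i w) -> measurable_fun setT f.
Proof.
move=> mB mf cov; pose C m := if (choice.unpickle m : option I) is Some i then B i else classical_sets.set0.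
rewrite (_ : setT = \bigcup_m C m).
  apply/measurable_fun_bigcup => m; rewrite /C; case: choice.unpickle => //.
  exact: measurable_fun_set0.
apply/seteqP; split => // w _; have [i Bi] := cov w.
by exists (choice.pickle i) => //; rewrite /C choice.pickleK.
Qed.

End measurable_bool.

(** * Measurability of the assignment of jobs to servers *)

Section selection.
Context {R : realType} (n : nat).
(* [inl i] is the [i]-th inter-arrival time, [inr (inl (k, m))] the [m]-th
   processing time at server [k], and [inr (inr k)] the residual time of the job
   that server [k] is processing at time 0. *)
Definition prim := (nat + (nat * nat + nat))%type.
Variable lam : R.

Definition wu (z : prim -> R) i := z (inl i) / lam.
Definition wX (z : prim -> R) k m := z (inr (inl (k, m))).
Definition wr (z : prim -> R) k := z (inr (inr k)).
Definition wa z (i : nat) : R := \sum_(k < i) wu z k.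
Definition wstate z p := state n (wr z) (wX z) (wa z) p.
Definition wserver z p := server n (wr z) (wX z) (wa z) p.
Definition wslot_time z p := slot_time n (wr z) (wX z) (wa z) p.
Definition wservice z i := service n (wr z) (wX z) (wa z) i.

Lemma measurable_wa i : measurable_fun setT (fun z : path R prim => wa z i).
Proof.
by apply: measurable_sum => k; apply: measurable_funM => //; exact: measurable_coord.
Qed.

Lemma measurable_slot k m : measurable_fun setT (fun z : path R prim => slot (wr z) (wX z) k m).
Proof.
apply: measurable_funD; first exact: measurable_coord.
by apply: measurable_sum => l; exact: measurable_coord.
Qed.

Lemma measurable_is_first c k :
  measurable [set z : path R prim | @is_first R n (wr z) (wX z) c k].
Proof.
apply/measurable_boolP; apply: measurable_and.
  apply/measurable_boolP; apply: measurable_all_fin => j.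
  by apply/measurable_boolP; apply: measurable_fun_ler; exact: measurable_slot.
apply/measurable_boolP; apply: measurable_all_fin => j.
apply/measurable_boolP; case: (j < k)%N => /=; last exact: measurable_cst.
by apply: measurable_fun_ltr; exact: measurable_slot.
Qed.

Lemma measurable_first_server c k :
  measurable [set z : path R prim | @first_server R n (wr z) (wX z) c = k].
Proof.
rewrite (_ : [set z | _] = [set z : path R prim | @is_first R n (wr z) (wX z) c k]).
  exact: measurable_is_first.
by apply/seteqP; split => z /= => [/eqP|H]; [|apply/eqP]; rewrite first_serverE.
Qed.

(** The state takes countably many values, so each fibre is a countable union over the previous
    state, the server chosen and the outcome of the arrival test. *)
Lemma measurable_state p s : measurable [set z : path R prim | wstate z p = s].
Proof.
elim: p s => [|p IH] s'.
  rewrite /wstate /=; have [E|E] := pselect (([ffun=> 0%N], 0%N) = s' :> {ffun 'I_n.+1 -> nat} * nat).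
    by rewrite (_ : [set z | _] = setT)//; apply/seteqP; split.
  by rewrite (_ : [set z | _] = set0)//; apply/seteqP; split.
pose G (s : {ffun 'I_n.+1 -> nat} * nat) (k : 'I_n.+1) (b : bool) :=
  ([ffun j => s.1 j + (j == k)]%N, (s.2 + b)%N).
rewrite (_ : [set z | _] = [set z | exists e : ({ffun 'I_n.+1 -> nat} * nat) * ('I_n.+1 * bool),
    ([set z : path R prim | wstate z p = e.1] `&`
     [set z | @first_server R n (wr z) (wX z) e.1.1 = e.2.1] `&`
     [set z | (wa z e.1.2 <= slot (wr z) (wX z) e.2.1 (e.1.1 e.2.1)) = e.2.2] `&`
     [set z | G e.1 e.2.1 e.2.2 = s']) z]).
  apply: measurable_ex_count => -[s [k b]]; apply: measurableI; last first.
    have [E|E] := pselect (G s k b = s').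
      by rewrite (_ : [set z | _] = setT)//; apply/seteqP; split.
    by rewrite (_ : [set z | _] = set0)//; apply/seteqP; split.
  apply: measurableI; first by apply: measurableI; [exact: IH|exact: measurable_first_server].
  have mb : measurable_fun setT (fun z : path R prim => wa z s.2 <= slot (wr z) (wX z) k (s.1 k)).
    by apply: measurable_fun_ler; [exact: measurable_wa|exact: measurable_slot].
  by rewrite -[X in measurable X]setTI; exact: (mb measurableT [set b]).
apply/seteqP; split => z /=.
  move=> E; exists (wstate z p, (wserver z p, wa z (wstate z p).2 <= wslot_time z p)).
  by split => //; rewrite -E.
by move=> [[s [k b]] /= [[[<- <-] <-] <-]].
Qed.

Lemma measurable_server p s k :
  measurable [set z : path R prim | wstate z p = s /\ wserver z p = k].
Proof.
rewrite (_ : [set z | _] = [set z : path R prim | wstate z p = s] `&`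
  [set z : path R prim | @first_server R n (wr z) (wX z) s.1 = k]).
  by apply: measurableI; [exact: measurable_state|exact: measurable_first_server].
by apply/seteqP; split => z /= -[<-]; rewrite /wserver /server /wstate.
Qed.

Lemma measurable_service i : measurable_fun setT (fun z : path R prim => wservice z i).
Proof.
pose S p s k := [set z : path R prim | wstate z p = s /\ wserver z p = k] `&`
   [set z : path R prim | (s.2 == i) && (wa z i <= slot (wr z) (wX z) k (s.1 k))].
have mS p s k : measurable (S p s k).
  apply: measurableI; first exact: measurable_server.
  apply/measurable_boolP; apply: measurable_and; first exact: measurable_cst.
  by apply: measurable_fun_ler; [exact: measurable_wa|exact: measurable_slot].
have SE p z : serves n (wr z) (wX z) (wa z) p i -> S p (wstate z p) (wserver z p) z.
  by move=> pi; split.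
have SE' p s k z : S p s k z -> serves n (wr z) (wX z) (wa z) p i.
  by move=> [[<- <-] H].
pose B (e : option (nat * (({ffun 'I_n.+1 -> nat} * nat) * 'I_n.+1))) :=
  if e is Some (p, (s, k)) then S p s k
  else ~` [set z | exists e : nat * (({ffun 'I_n.+1 -> nat} * nat) * 'I_n.+1),
    S e.1 e.2.1 e.2.2 z].
apply: (@measurable_fun_cover _ _ _ _ _ B).
- move=> [[p [s k]]|]; first exact: mS.
  apply: measurableC; apply: measurable_ex_count => e; exact: mS.
- move=> [[p [s k]]|].
    apply: (eq_measurable_fun (fun z : path R prim => wX z k (s.1 k))).
      move=> z /set_mem zS; rewrite /wservice (serviceE (SE' _ _ _ _ zS)).
      by case: zS => -[<- <-].
    by apply: measurable_funTS; exact: measurable_coord.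
  apply: (eq_measurable_fun (fun z : path R prim => 0 : R)); last exact: measurable_cst.
  move=> z /set_mem zS; rewrite /wservice /service; case: pselect => [[p pi]|//].
  have pS := SE _ _ pi.
  by case: zS; exists (p, (wstate z p, wserver z p)).
- move=> z; have [[e He]|H] := pselect (exists e : nat * (({ffun 'I_n.+1 -> nat} * nat) * 'I_n.+1),
    S e.1 e.2.1 e.2.2 z).
    by exists (Some e); case: e He => p [s k].
  by exists None.
Qed.

End selection.

Section selection_law.
Context {R : realType} (n : nat) (lam : R).
Context d (T : measurableType d) (P : probability T R) (W : prim -> T -> R).
Hypotheses (mW : forall i, measurable_fun setT (W i)) (iW : mutually_independent P W).
Hypothesis W0 : forall i w, 0 <= W i w.
Hypothesis lam0 : 0 < lam.
Hypothesis unboundedX : forall w t (k : 'I_n.+1), exists m,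
  t < slot (wr (W^~ w)) (wX (W^~ w)) k m.
Hypothesis same_X : forall k m, same_law P P (W (inr (inl (k, m)))) (W (inr (inl (0, 0)%N))).

(* The same data with the processing times listed by job instead of by server. *)
Definition queue_index := (nat + (nat + nat))%type.

Definition queue_data (z : prim -> R) (j : queue_index) : R :=
  match j with
  | inl i => z (inl i)
  | inr (inl i) => wservice n lam z i
  | inr (inr k) => z (inr (inr k))
  end.

(** An injective choice of coordinates whose joint law will turn out to be that of [queue_data]: job
    i is matched with the i-th processing time of server 0. *)
Definition fresh (j : queue_index) : prim :=
  match j with
  | inl i => inl i
  | inr (inl i) => inr (inl (0%N, i))
  | inr (inr k) => inr (inr k)
  end.

Lemma fresh_inj : injective fresh.
Proof. by case=> [i|[i|i]] [j|[j|j]] //= [->]. Qed.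

Lemma measurable_queue_data j :
  measurable_fun setT (fun z : path R prim => queue_data z j).
Proof.
by case: j => [i|[i|k]] /=; [exact: measurable_coord|exact: measurable_service|exact: measurable_coord].
Qed.

Variables (J : {fset queue_index}) (E : queue_index -> set R).
Hypothesis mE : forall j, measurable (E j).
Let c j : R := fine (P (W (inr (inl (0, 0)%N)) @^-1` E j)).

(* The indicators of the services of the jobs served during the first [p] steps,
   and the probabilities for the other ones. *)
Definition sel_factor p (j : queue_index) (z : prim -> R) : R :=
  match j with
  | inr (inl i) => if (i < (wstate n lam z p).2)%N then \1_(E j) (wservice n lam z i) else c j
  | _ => \1_(E j) (queue_data z j)
  end.
Definition sel_prod p z : R := \prod_(j <- J) sel_factor p j z.

Lemma c_ge0 j : 0 <= c j.
Proof. exact: fine_ge0. Qed.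

Lemma c_le1 j : c j <= 1.
Proof.
rewrite -lee_fin fineK ?probability_le1 ?fin_num_measure// -[X in measurable X]setTI; exact: mW.
Qed.

Lemma indic01 (A : set R) (x : R) : 0 <= (\1_A x : R) <= 1.
Proof. by rewrite indicE; case: (x \in A); rewrite ?ler01 ?lexx. Qed.

Lemma sel_factor01 p j z : 0 <= sel_factor p j z <= 1.
Proof.
case: j => [i|[i|k]] /=; [exact: indic01| |exact: indic01].
by case: ifP => _; [exact: indic01|rewrite c_ge0 c_le1].
Qed.

Lemma sel_prod_ge0 p z : 0 <= sel_prod p z.
Proof. by apply: prodr_ge0 => j _; have /andP[] := sel_factor01 p j z. Qed.

Lemma sel_prod_le1 p z : sel_prod p z <= 1.
Proof.
by apply: prodr_ile1 => j _; exact: sel_factor01.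
Qed.

Lemma measurable_sel_factor p j : measurable_fun setT (fun z : path R prim => sel_factor p j z).
Proof.
have mi k : measurable_fun setT (fun z : path R prim => \1_(E k) (queue_data z k) : R).
  have mi : measurable_fun setT (\1_(E k) : R -> R) by exact: measurable_indic.
  exact: (measurableT_comp mi (measurable_queue_data k)).
case: j => [i|[i|k]]; rewrite /sel_factor; [exact: mi| |exact: mi].
apply: measurable_fun_ifT; [|exact: (mi (inr (inl i)))|exact: measurable_cst].
apply/measurable_boolP.
rewrite (_ : [set w | _] = [set z : path R prim | exists s : {ffun 'I_n.+1 -> nat} * nat,
   ([set z | wstate n lam z p = s] `&` [set z | (i < s.2)%N]) z]).
  apply: measurable_ex_count => s; apply: measurableI; first exact: measurable_state.
  have [si|si] := boolP (i < s.2)%N.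
    by rewrite (_ : [set z | _] = setT)//; apply/seteqP; split.
  by rewrite (_ : [set z | _] = set0)//; apply/seteqP; split.
apply/seteqP; split => z /=; first by move=> H; exists (wstate n lam z p).
by move=> [s [->]].
Qed.

Lemma measurable_sel_prod p : measurable_fun setT (fun z : path R prim => sel_prod p z).
Proof.
by apply: measurable_prod => j _; exact: measurable_sel_factor.
Qed.

Section one_step.
Variables (p : nat) (s : {ffun 'I_n.+1 -> nat} * nat) (k : 'I_n.+1).
Let De := [set z : path R prim | wstate n lam z p = s /\ wserver n lam z p = k].
Let ki : prim := inr (inl (k : nat, s.1 k)).

(** The event [De] fixes the state and the server at step p; the coordinate [ki] is then the
    processing time about to be revealed, on which nothing so far depends. *)
Lemma agree_De (z z' : prim -> R) : (forall i, i != ki -> z i = z' i) ->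
  De z -> [/\ De z', wslot_time n lam z' p = wslot_time n lam z p,
    forall q, wa lam z' q = wa lam z q &
    forall i, (i < s.2)%N -> wservice n lam z' i = wservice n lam z i].
Proof.
move=> zz [sz kz].
have rr : wr z = wr z' by apply/funext => l; exact: zz.
have aa : wa lam z = wa lam z' by apply/funext => q; apply: eq_bigr => l _; rewrite /wu zz.
have XX l m : (l, m) != (k : nat, s.1 k) -> wX z l m = wX z' l m.
  by move=> lm; apply: zz; apply: contra lm => /eqP[-> ->].
have pc : ((state n (wr z) (wX z) (wa lam z) p).1 k <= s.1 k)%N.
  by rewrite -[state _ _ _ _ _]/(wstate n lam z p) sz.
have E1 : wstate n lam z' p = s by rewrite -sz /wstate -rr -aa (state_local XX pc).
have E2 : wserver n lam z' p = k by rewrite -kz /wserver -rr -aa (server_local XX pc).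
split.
- exact: conj E1 E2.
- by rewrite /wslot_time -rr -aa (slot_time_local XX pc).
- by move=> q; rewrite aa.
- move=> i si; rewrite /wservice -rr -aa (service_local XX pc)//.
  by rewrite -[state _ _ _ _ _]/(wstate n lam z p) sz.
Qed.

Lemma sel_step (z : prim -> R) (x : R) : De z ->
  let z' := fun i => if i == ki then x else z i in
  sel_prod p.+1 z' = \prod_(j <- J)
    (if (j == inr (inl s.2)) && (wa lam z s.2 <= wslot_time n lam z p)%R then \1_(E j) x
     else sel_factor p j z).
Proof.
move=> Dz z'.
have zz i : i != ki -> z i = z' i by rewrite /z' => /negbTE ->.
have [[sz' kz'] tt aa vv] := agree_De zz Dz.
have [sz kz] := Dz.
have s1 : (wstate n lam z' p.+1).2 = (s.2 + (wa lam z s.2 <= wslot_time n lam z p)%R)%N.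
  have := servedS n (wr z') (wX z') (wa lam z') p.
  rewrite -![state _ _ _ _ _]/(wstate n lam z' _) sz' => ->.
  rewrite -/(wslot_time n lam z' p) tt aa; exact: erefl.
apply: eq_bigr => -[i|[i|l]] _; rewrite /sel_factor; [by rewrite /queue_data -zz| |by rewrite /queue_data -zz].
rewrite s1 sz (inj_eq inr_inj) (inj_eq inl_inj).
have [si|si] := ltnP i s.2.
  rewrite (ltn_addr _ si) (vv i si) (ltn_eqF si); exact: erefl.
have [b|b] := boolP (wa lam z s.2 <= wslot_time n lam z p); last first.
  by rewrite andbF addn0 ltnNge si.
rewrite andbT addn1 ltnS; case: eqP => [->|/eqP ne]; last first.
  by rewrite leq_eqVlt (negbTE ne) ltnNge si.
rewrite leqnn; congr (\1_(E _) _).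
have sp : serves n (wr z') (wX z') (wa lam z') p s.2.
  rewrite /serves -[state _ _ _ _ _]/(wstate n lam z' p) sz' eqxx /=.
  by rewrite aa -[slot_time _ _ _ _ _]/(wslot_time n lam z' p) tt.
rewrite /wservice (serviceE sp) -[server _ _ _ _ _]/(wserver n lam z' p) kz'.
by rewrite -[state _ _ _ _ _]/(wstate n lam z' p) sz' /wX /z' eqxx.
Qed.

(** On [De] the coordinate [ki] is redrawn. If step p serves a job tested in [J], its indicator
    averages to the probability that stood in its place; otherwise the product is unchanged. *)
Lemma sel_step_integral :
  (\int[P]_(w in [set w | De (W^~ w)]) (sel_prod p.+1 (W^~ w))%:E =
   \int[P]_(w in [set w | De (W^~ w)]) (sel_prod p (W^~ w))%:E)%E.
Proof.
have mD : measurable De by exact: measurable_server.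
pose f q (z : path R prim) := (\1_De z * sel_prod q z)%:E.
have f0 q z : (0 <= f q z)%E.
  by rewrite lee_fin mulr_ge0 ?sel_prod_ge0.
have mf q : measurable_fun setT (f q).
  apply/measurable_EFinP; apply: measurable_funM; last exact: measurable_sel_prod.
  exact: measurable_indic.
have fE q : (\int[P]_(w in [set w | De (W^~ w)]) (sel_prod q (W^~ w))%:E = \int[P]_w f q (W^~ w))%E.
  rewrite integral_mkcond; apply: eq_integral => w _; rewrite patchE /f indicE.
  by rewrite (_ : (w \in _) = ((W^~ w) \in De)); [case: ifP; rewrite ?mul1r ?mul0r|apply/idP/idP; rewrite !inE].
rewrite !fE (resample_integral (pred1 ki) mW iW (mf p.+1) (f0 p.+1)).
apply: eq_integral => w _.
pose z := W^~ w.
have zE w' : (fun i => if pred1 ki i then W i w' else W i w) = (fun i => if i == ki then W ki w' else z i).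
  by apply/funext => i /=; case: eqP => // ->.
under eq_integral do rewrite zE.
have agr w' i : i != ki -> z i = (fun i => if i == ki then W ki w' else z i) i.
  by move=> /negbTE /= ->.
have [Dz|Dz] := pselect (De z); last first.
  rewrite /f [in RHS]indicE (memNset Dz) mul0r.
  apply: integral0_eq => w' _.
  rewrite indicE memNset; first by rewrite mul0r.
  move=> Dz'; apply: Dz.
  have agr' i : i != ki -> (fun i => if i == ki then W ki w' else z i) i = z i.
    by move=> /negbTE /= ->.
  by have [Dz'' _ _ _] := agree_De agr' Dz'; exact: Dz''.
rewrite /f [in RHS]indicE (mem_set Dz) mul1r.
under eq_integral => w' _.
  rewrite indicE mem_set; last by have [] := agree_De (agr w') Dz.
  rewrite mul1r sel_step//; over.
have [jJ|jJ] := boolP ((inr (inl s.2) \in J) && (wa lam z s.2 <= wslot_time n lam z p)); last first.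
  rewrite (eq_integral (fun=> (sel_prod p z)%:E)).
    by rewrite integral_cst//= probability_setT mule1.
  move=> w' _; congr EFin; apply: eq_big_seq => j jJ'.
  case: eqP => //= jE; case: ifP => // b; move: jJ; rewrite b andbT -jE.
  by rewrite (_ : (j \in J) = true).
have [jJ' b] := andP jJ.
pose j0 : queue_index := inr (inl s.2).
pose Z := \prod_(j <- J | j != j0) sel_factor p j z.
have Z0 : 0 <= Z by apply: prodr_ge0 => j _; have /andP[] := sel_factor01 p j z.
have mEk : measurable (W ki @^-1` E j0) by rewrite -[X in measurable X]setTI; exact: mW.
rewrite (eq_integral (fun w' => (Z%:E * (\1_(W ki @^-1` E j0) w')%:E)%E)); last first.
  move=> w' _; rewrite -EFinM; congr EFin.
  rewrite (bigD1_seq j0) ?fset_uniq//= eqxx b mulrC; congr (_ * _).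
  by apply: eq_bigr => j /negbTE ->.
rewrite ge0_integralZl//; last by apply/measurable_EFinP; exact: measurable_indic.
rewrite integral_indic// setIT /sel_prod (bigD1_seq j0) ?fset_uniq//= mulrC.
have [-> _] := Dz; rewrite ltnn EFinM; congr (_ * _)%E.
rewrite /c fineK; last by rewrite fin_num_measure// -[X in measurable X]setTI; exact: mW.
exact: same_X.
Qed.

End one_step.

(** The events [De] over all states and servers form a countable partition, so the equality on each
    of them adds up. *)
Lemma sel_prodS_integral p :
  (\int[P]_w (sel_prod p.+1 (W^~ w))%:E = \int[P]_w (sel_prod p (W^~ w))%:E)%E.
Proof.
pose D m := if (choice.pickle_inv m : option (({ffun 'I_n.+1 -> nat} * nat) * 'I_n.+1)) is Some e
  then [set w | wstate n lam (W^~ w) p = e.1 /\ wserver n lam (W^~ w) p = e.2]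
  else classical_sets.set0.
have mD m : measurable (D m).
  rewrite /D; case: choice.pickle_inv => // -[s k].
  rewrite -[X in measurable X]setTI.
  exact: (measurable_path mW measurableT (measurable_server lam p s k)).
have DT : \bigcup_m D m = setT.
  apply/seteqP; split => // w _.
  exists (choice.pickle (wstate n lam (W^~ w) p, wserver n lam (W^~ w) p)); first exact: I.
  rewrite /D choice.pickleK_inv; exact: conj erefl erefl.
have tD : trivIset setT D.
  move=> i j _ _ [w []]; rewrite /D.
  have := @choice.pickle_invK (({ffun 'I_n.+1 -> nat} * nat) * 'I_n.+1)%type i.
  have := @choice.pickle_invK (({ffun 'I_n.+1 -> nat} * nat) * 'I_n.+1)%type j.
  case: choice.pickle_inv => //= e' <-; case: choice.pickle_inv => //= e <- [e1 e2] [e1' e2'].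
  by congr choice.pickle; case: e e' e1 e2 e1' e2' => [e1 e2] [f1 f2] /= <- <- <- <-.
have mp q : measurable_fun setT (fun w => (sel_prod q (W^~ w))%:E).
  apply/measurable_EFinP; exact: (measurableT_comp (measurable_sel_prod q) (measurable_path mW)).
rewrite -DT !ge0_integral_bigcup//; last 4 first.
- by rewrite DT.
- by move=> w _; rewrite lee_fin sel_prod_ge0.
- by rewrite DT.
- by move=> w _; rewrite lee_fin sel_prod_ge0.
apply: eq_eseriesr => m _; rewrite /D; case: choice.pickle_inv => [[s k]|].
  exact: sel_step_integral.
by rewrite !integral_set0.
Qed.

Lemma sel_prod_limit w : exists p, forall q, (p <= q)%N ->
  sel_prod q (W^~ w) = \prod_(j <- J) \1_(E j) (queue_data (W^~ w) j).
Proof.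
have all_srv i : exists p, serves n (wr (W^~ w)) (wX (W^~ w)) (wa lam (W^~ w)) p i.
  by apply: all_served => // k m; exact: W0.
have H i : exists p, (i < (wstate n lam (W^~ w) p).2)%N.
  have [p /andP[/eqP E1 E2]] := all_srv i; exists p.+1.
  by rewrite /wstate servedS E1 E2 addn1.
have [m Hm] : exists m, forall i, inr (inl i) \in J -> (i <= m)%N.
  exists (\max_(j <- J) (if j is inr (inl i) then i else 0)%N) => i iJ.
  exact: (@leq_bigmax_seq _ _ xpredT (fun j : queue_index => if j is inr (inl i) then i else 0)%N _ iJ).
have [p pm] := H m; exists p => q pq.
apply: eq_big_seq => -[i|[i|k]] // jJ.
rewrite /sel_factor (leq_trans (leq_ltn_trans (Hm i jJ) pm))//.
exact: served_nd.
Qed.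

(** The mean does not depend on p. Pathwise, all jobs in [J] are served after finitely many steps
    and the product becomes the indicator of the event; dominated convergence identifies the
    mean. *)
Lemma sel_prod_integral p : (\int[P]_w (sel_prod p (W^~ w))%:E =
  P (\bigcap_(j in [set` J]) ((fun w => queue_data (W^~ w) j) @^-1` E j)))%E.
Proof.
have mp q : measurable_fun setT (fun w => (sel_prod q (W^~ w))%:E).
  apply/measurable_EFinP; exact: (measurableT_comp (measurable_sel_prod q) (measurable_path mW)).
have mV : measurable (\bigcap_(j in [set` J]) ((fun w => queue_data (W^~ w) j) @^-1` E j)).
  apply: fin_bigcap_measurable => // j _; rewrite -[X in measurable X]setTI.
  exact: (measurableT_comp (measurable_queue_data j) (measurable_path mW) measurableT (mE j)).
have cst q : (\int[P]_w (sel_prod q (W^~ w))%:E = \int[P]_w (sel_prod p (W^~ w))%:E)%E.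
  have H0 r : (\int[P]_w (sel_prod r (W^~ w))%:E = \int[P]_w (sel_prod 0 (W^~ w))%:E)%E.
    by elim: r => // r <-; exact: sel_prodS_integral.
  by rewrite !H0.
have := @dominated_cvg _ _ _ P setT measurableT (fun q w => (sel_prod q (W^~ w))%:E)
  (fun w => (\1_(\bigcap_(j in [set` J]) ((fun w => queue_data (W^~ w) j) @^-1` E j)) w)%:E)
  (fun=> 1%E) mp.
move=> /(_ _ _ _ _)/wrap[] => [w _|//||q w _|H].
- apply: cvg_near_cst; have [r Hr] := sel_prod_limit w.
  exists r => // q /= rq; rewrite Hr//; congr EFin.
  rewrite indicE; case: (boolP (w \in _)) => [/set_mem wV|/negP wV].
    by rewrite big_seq big1// => j jJ; rewrite indicE mem_set//; exact: wV.
  have [j jJ jE] : exists2 j, j \in J & ~ E j (queue_data (W^~ w) j).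
    apply: contrapT => nj; apply: wV; apply/mem_set => j jJ.
    by apply: contrapT => nE; apply: nj; exists j.
  by rewrite (bigD1_seq j) ?fset_uniq//= indicE memNset ?mul0r.
- exact: finite_measure_integrable_cst.
- by rewrite lee_fin ger0_norm ?sel_prod_ge0// sel_prod_le1.
rewrite -[X in P X]setIT -integral_indic//.
have H' : (\int[P]_w (sel_prod q (W^~ w))%:E)%E @[q --> \oo] -->
    (\int[P]_w (sel_prod p (W^~ w))%:E)%E.
  by rewrite (funext cst); exact: cvg_cst.
exact: (cvg_unique _ H' H).
Qed.

(* Which server takes a job is decided before the corresponding processing time
   is revealed, so the services received by the successive jobs are still i.i.d. *)
Lemma queue_data_law : P (\bigcap_(j in [set` J]) ((fun w => queue_data (W^~ w) j) @^-1` E j)) =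
  (\prod_(j <- J) P (W (fresh j) @^-1` E j))%E.
Proof.
have mWE i (A : set R) : measurable A -> measurable (W i @^-1` A).
  by move=> mA; rewrite -[X in measurable X]setTI; exact: mW.
rewrite -(sel_prod_integral 0).
pose E' j := if j is inr (inl _) then setT else E j.
have mE' j : measurable (E' j) by rewrite /E'; case: j => [i|[i|i]].
pose C : R := \prod_(j <- J) (if j is inr (inl _) then c j else 1).
have C0 : 0 <= C by apply: prodr_ge0 => -[i|[i|i]] _ //; exact: c_ge0.
pose B := \bigcap_(j in [set` J]) (W (fresh j) @^-1` E' j).
have mB : measurable B by apply: fin_bigcap_measurable => // j _; exact: mWE.
transitivity (\int[P]_w (C%:E * (\1_B w)%:E))%E.
  apply: eq_integral => w _; rewrite -EFinM; congr EFin; rewrite indicE.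
  case: (boolP (w \in B)) => [/set_mem wB|/negP wB].
    rewrite mulr1; apply: eq_big_seq => -[i|[i|k]] jJ //=; rewrite indicE mem_set//.
      exact: (wB _ jJ).
    exact: (wB _ jJ).
  rewrite mulr0.
  have [j jJ jE] : exists2 j, j \in J & ~ E' j (W (fresh j) w).
    apply: contrapT => nj; apply: wB; apply/mem_set => j jJ.
    by apply: contrapT => nE; apply: nj; exists j.
  rewrite /sel_prod (bigD1_seq j) ?fset_uniq//=.
  by case: j jE {jJ} => [i|[i|i]] //= jE; rewrite indicE memNset ?mul0r.
rewrite ge0_integralZl//; last by apply/measurable_EFinP; exact: measurable_indic.
rewrite integral_indic// setIT.
transitivity (C%:E * \prod_(j <- J) P (W (fresh j) @^-1` E' j))%E.
  congr (_ * _)%E; exact: (reindex_independent fresh_inj iW J mE').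
rewrite /C -prodEFin -big_split /=; apply: eq_bigr => -[i|[i|i]] _ /=; rewrite ?mul1e//.
rewrite probability_setT mule1 /c fineK; last by apply: fin_num_measure; exact: mWE.
by rewrite same_X.
Qed.

End selection_law.

(** * Measurability of the number of jobs in the system *)

Section nat_measurable.
Context d (T : measurableType d).

Definition nat_measurable (f : T -> nat) := forall m, measurable [set w | f w = m].

Lemma nat_measurableE (f : T -> nat) (D : set nat) : nat_measurable f ->
  measurable [set w | D (f w)].
Proof.
move=> mf; rewrite (_ : [set w | _] = [set w | exists m, ([set w | f w = m] `&` [set w | D m]) w]).
  apply: measurable_ex_count => m; apply: measurableI => //.
  have [Dm|Dm] := pselect (D m).
    by rewrite (_ : [set w | _] = setT)//; apply/seteqP; split.
  by rewrite (_ : [set w | _] = classical_sets.set0)//; apply/seteqP; split.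
by apply/seteqP; split => w /=; [move=> Df; exists (f w)|move=> [m [->]]].
Qed.

Lemma nat_measurable_op (g : nat -> nat -> nat) (f1 f2 : T -> nat) :
  nat_measurable f1 -> nat_measurable f2 -> nat_measurable (fun w => g (f1 w) (f2 w)).
Proof.
move=> m1 m2 m; rewrite (_ : [set w | _] = [set w | exists a,
   ([set w | f1 w = a] `&` [set w | [set c | g a c = m] (f2 w)]) w]).
  by apply: measurable_ex_count => a; apply: measurableI => //; exact: nat_measurableE.
by apply/seteqP; split => w /=; [move=> E; exists (f1 w)|move=> [a [<-]]].
Qed.

Lemma nat_measurable_cst a : nat_measurable (fun=> a).
Proof.
move=> m; have [E|E] := pselect (a = m).
  by rewrite (_ : [set w | _] = setT)//; apply/seteqP; split.
by rewrite (_ : [set w | _] = set0)//; apply/seteqP; split.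
Qed.

Lemma nat_measurable_bool (b : T -> bool) : measurable [set w | b w] ->
  nat_measurable (fun w => b w : nat).
Proof.
move=> mb [|[|m]].
- rewrite (_ : [set w | _] = ~` [set w | b w]); first exact: measurableC.
  by apply/seteqP; split => w /=; case: (b w).
- by rewrite (_ : [set w | _] = [set w | b w])//; apply/seteqP; split => w /=; case: (b w).
- by rewrite (_ : [set w | _] = set0)//; apply/seteqP; split => w //=; case: (b w).
Qed.

Lemma nat_measurable_sum N (f : nat -> T -> nat) : (forall i, nat_measurable (f i)) ->
  nat_measurable (fun w => \sum_(i < N) f i w)%N.
Proof.
move=> mf; elim: N => [|N IH].
  rewrite (_ : (fun w => _) = fun=> 0%N); first exact: nat_measurable_cst.
  by apply/funext => w; rewrite big_ord0.
rewrite (_ : (fun w => _) = fun w => (\sum_(i < N) f i w + f N w)%N).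
  exact: (nat_measurable_op addn).
by apply/funext => w; rewrite big_ord_recr.
Qed.

End nat_measurable.

Section measurable_queue.
Context {R : realType} d (T : measurableType d).

Lemma measurable_real_gt (f : T -> R) : (forall x, measurable [set w | x < f w]) ->
  measurable_fun setT f.
Proof.
move=> mf; apply: (@measurability _ _ _ _ _ _ (@RGenOInfty.G R)).
  exact: RGenOInfty.measurableE.
move=> _ [_ [x ->] <-]; rewrite setTI.
rewrite (_ : _ @^-1` _ = [set w | x < f w])//.
by apply/seteqP; split => w; rewrite /= in_itv /= andbT.
Qed.

Lemma nat_measurable_count (s : T -> seq R) N x : (forall w, size (s w) = N) ->
  (forall j, measurable_fun setT (fun w => nth 0 (s w) j)) ->
  nat_measurable (fun w => count (fun y => (y <= x)%R) (s w)).
Proof.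
move=> sN ms; rewrite (_ : (fun w => _) = fun w => (\sum_(j < N) (nth 0 (s w) j <= x)%R)%N).
  apply: (@nat_measurable_sum _ _ _ (fun j w => (nth 0 (s w) j <= x)%R : nat)) => j; apply: nat_measurable_bool.
  by apply/measurable_boolP; exact: measurable_fun_ler.
apply/funext => w; rewrite -sum1_count big_mkcond (big_nth 0) sN big_mkord.
by apply: eq_bigr => j _; case: (_ <= _).
Qed.

(** The j-th entry in increasing order exceeds x exactly when at most j entries are at most x, and a
    count is measurable. *)
Lemma measurable_nth_sort (s : T -> seq R) N : (forall w, size (s w) = N) ->
  (forall j, measurable_fun setT (fun w => nth 0 (s w) j)) ->
  forall j, measurable_fun setT (fun w => nth 0 (sort <=%R (s w)) j).
Proof.
move=> sN ms j; have [jN|Nj] := ltnP j N; last first.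
  rewrite (_ : (fun w => _) = fun=> 0); first exact: measurable_cst.
  by apply/funext => w; rewrite nth_default// size_sort sN.
apply: measurable_real_gt => x.
rewrite (_ : [set w | _] = [set w | [set m | ~~ (j < m)%N] (count (fun y => (y <= x)%R) (s w))]).
  by apply: nat_measurableE; exact: nat_measurable_count sN ms.
have srt w : sorted <=%R (sort <=%R (s w)) by apply: sort_sorted; exact: le_total.
apply/seteqP; split => w /=; rewrite -(count_sort <=%R).
  move=> xj; apply/negP => jc; have := nth_count_le 0 (srt w) jc.
  by rewrite leNgt xj.
rewrite -leqNgt => cj; apply: (nth_count_gt 0 (srt w)).
by rewrite cj size_sort sN.
Qed.

(** On the event that all indices are below m the cardinality is a finite sum; where no such m
    exists the set is infinite and [fset_set] returns the empty set. *)
Lemma nat_measurable_card (B : nat -> T -> bool) : (forall i, measurable [set w | B i w]) ->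
  nat_measurable (fun w => #|` fset_set [set i | B i w]|).
Proof.
move=> mB.
pose C m := [set w | forall i, (m <= i)%N -> ~~ B i w].
have mC m : measurable (C m).
  rewrite (_ : C m = ~` [set w | exists i, ([set w | (m <= i)%N] `&` [set w | B i w]) w]).
    apply: measurableC; apply: measurable_ex_count => i; apply: measurableI => //.
    by case: (m <= i)%N; [rewrite (_ : [set w | _] = setT)//; apply/seteqP; split
                       |rewrite (_ : [set w | _] = set0)//; apply/seteqP; split].
  apply/seteqP; split => w /=; first by move=> H [i [mi Bi]]; have := H i mi; rewrite Bi.
  by move=> H i mi; apply/negP => Bi; apply: H; exists i.
have cE m w : C m w -> #|` fset_set [set i | B i w]| = (\sum_(i < m) B i w)%N.
  move=> Cw; have [s sE] : exists s, s = index_iota 0 m by exists (index_iota 0 m).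
  have -> : [set i | B i w] = [set` [fset i in s | B i w]%fset].
    apply/seteqP; split => i; rewrite /= !inE /=; last by move=> /andP[].
    move=> Bi; rewrite Bi andbT sE; change (i \in index_iota 0 m).
    by rewrite mem_index_iota /= ltnNge; apply/negP => /Cw; rewrite Bi.
  rewrite set_fsetK -sum1_size (perm_big [seq i <- s | B i w]) /=; last first.
    apply: uniq_perm; rewrite ?filter_uniq ?fset_uniq ?sE ?iota_uniq// => i.
    by rewrite mem_filter !inE /= andbC.
  by rewrite big_filter sE big_mkcond big_mkord.
have infE w : (forall m, ~ C m w) -> fset_set [set i | B i w] = fset0.
  move=> H; rewrite /fset_set; case: pselect => // fin; exfalso.
  have [M HM] : exists M, forall i, B i w -> (i < M)%N.
    exists (\max_(i <- fset_set [set i | B i w]) i).+1 => i Bi.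
    rewrite ltnS; apply: (@leq_bigmax_seq _ _ xpredT id) => //.
    by rewrite in_fset_set//; apply/mem_set.
  apply: (H M) => i Mi; apply/negP => /HM; by rewrite ltnNge Mi.
move=> c.
rewrite (_ : [set w | _] = [set w | exists m, (C m `&` [set w | (\sum_(i < m) B i w)%N = c]) w] `|`
  (~` [set w | exists m, C m w] `&` [set w | 0%N = c])).
  apply: measurableU; last first.
    apply: measurableI; last exact: nat_measurable_cst.
    by apply: measurableC; exact: measurable_ex_count.
  apply: measurable_ex_count => m; apply: measurableI => //.
  exact: (@nat_measurable_sum _ _ _ (fun i w => B i w : nat) (fun i => nat_measurable_bool (mB i))).
apply/seteqP; split => w /=.
  have [[m Cm]|H] := pselect (exists m, C m w); first by rewrite (cE _ _ Cm) => E; left; exists m.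
  rewrite infE; last by move=> m Cm; apply: H; exists m.
  by rewrite cardfs0; right.
case=> [[m [Cm E]]|[H <-]]; first by rewrite (cE _ _ Cm).
by rewrite infE ?cardfs0// => m Cm; apply: H; exists m.
Qed.

End measurable_queue.

Section measurable_number.
Context {R : realType} (n : nat) (lam : R).

Definition data_ic (z : queue_index -> R) :=
  InitialCondition (mkseq (fun k => z (inr (inr k))) n.+1) 0 (0 : R).
Definition data_number (z : queue_index -> R) (t : R) :=
  number_in_system n.+1 (data_ic z) (fun i => z (inl i) / lam) (fun i => z (inr (inl i))) t.

Let free (z : path R queue_index) i :=
  server_free n.+1 (data_ic z) (fun i => z (inl i) / lam) (fun i => z (inr (inl i))) i.

Let arr (z : path R queue_index) i := job_arrival (data_ic z) (fun i => z (inl i) / lam) i.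

Lemma measurable_data_arrival i : measurable_fun setT (arr ^~ i).
Proof.
rewrite /arr /job_arrival /= /arrival /=; apply: measurable_funD => //.
by apply: measurable_sum => k; apply: measurable_funM => //; exact: measurable_coord.
Qed.

Lemma size_free z i : size (free z i) = n.+1.
Proof.
elim: i => [|i IH]; last by rewrite /free /= size_sort /= size_behead IH.
change (size (sort <=%R (mkseq (fun k => z (inr (inr k))) n.+1 ++
  nseq (n.+1 - size (mkseq (fun k => z (inr (inr k))) n.+1)) 0)) = n.+1).
by rewrite size_sort size_cat size_mkseq size_nseq subnn addn0.
Qed.

Lemma measurable_free i j : measurable_fun setT (fun z => nth 0 (free z i) j).
Proof.
elim: i j => [|i IH] j.
  apply: (@measurable_nth_sort _ _ _ (fun z : path R queue_index =>
    mkseq (fun k => z (inr (inr k))) n.+1 ++ nseq (n.+1 - size (mkseq (fun k => z (inr (inr k))) n.+1)) 0) n.+1).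
    by move=> z; rewrite size_cat size_mkseq size_nseq subnn addn0.
  move=> l; have [ln|nl] := ltnP l n.+1; last first.
    rewrite (_ : (fun z => _) = fun=> 0); first exact: measurable_cst.
    by apply/funext => z; rewrite size_mkseq subnn cats0 nth_default// size_mkseq.
  rewrite (_ : (fun z => _) = fun z : path R queue_index => z (inr (inr l))).
    exact: measurable_coord.
  by apply/funext => z; rewrite size_mkseq subnn cats0 nth_mkseq.
apply: (@measurable_nth_sort _ _ _ (fun z : path R queue_index =>
  (Num.max (arr z i) (head 0 (free z i)) + z (inr (inl i))) :: behead (free z i)) n.+1).
  by move=> z /=; rewrite size_behead size_free.
case=> [|l] /=.
  apply: measurable_funD; last exact: measurable_coord.
  apply: measurable_maxr; first exact: measurable_data_arrival.
  rewrite (_ : (fun x => _) = fun z => nth 0 (free z i) 0); first exact: IH.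
  by apply/funext => z; rewrite nth0.
rewrite (_ : (fun x => _) = fun z => nth 0 (free z i) l.+1); first exact: IH.
by apply/funext => z; rewrite nth_behead.
Qed.

Lemma measurable_data_number t : nat_measurable (fun z : path R queue_index => data_number z t).
Proof.
apply: (nat_measurable_op addn).
  rewrite (_ : (fun z => _) = fun z : path R queue_index => (\sum_(k < n.+1) (t < z (inr (inr (k : nat))))%R)%N).
    apply: (@nat_measurable_sum _ _ _ (fun k (z : path R queue_index) => (t < z (inr (inr k)))%R : nat)) => k.
    apply: nat_measurable_bool; apply/measurable_boolP; apply: measurable_fun_ltr => //.
    exact: measurable_coord.
  apply/funext => z.
  change (count (fun r => (t < r)%R) (mkseq (fun k => z (inr (inr k))) n.+1) =
    \sum_(k < n.+1) (t < z (inr (inr (k : nat))))%R)%N.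
  rewrite /mkseq count_map -sum1_count.
  rewrite (_ : iota 0 n.+1 = index_iota 0 n.+1); last by rewrite /index_iota subn0.
  by rewrite big_mkcond big_mkord; apply: eq_bigr => k _ /=; case: (_ < _).
apply: nat_measurable_card => i; apply/measurable_boolP; apply: measurable_and.
  by apply: measurable_fun_ler => //; exact: measurable_data_arrival.
apply: measurable_fun_ltr => //; apply: measurable_funD; last exact: measurable_coord.
apply: measurable_maxr; first exact: measurable_data_arrival.
rewrite (_ : (fun x => _) = fun z => nth 0 (free z i) 0); first exact: measurable_free.
by apply/funext => z; rewrite nth0.
Qed.

End measurable_number.

(** * Stationary initial condition *)

Section almost_sure.
Context {R : realType} d (T : measurableType d) (P : probability T R).

Lemma full_setI (B G : set T) : measurable B -> measurable G -> P (~` G) = 0%E ->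
  P (B `&` G) = P B.
Proof.
move=> mB mG G0; apply/eqP; rewrite eq_le; apply/andP; split.
  by apply: le_measure; rewrite ?inE//; exact: measurableI.
rewrite -[in leLHS](setIT B) -(setUv G) setIUr.
apply: le_trans (measureU2 _ _ _) _ => //; [exact: measurableI|apply: measurableI => //; exact: measurableC|].
rewrite [X in (_ + X)%E](_ : _ = 0%E) ?adde0//.
apply/eqP; rewrite eq_le measure_ge0 andbT -G0.
by apply: le_measure; rewrite ?inE//; [apply: measurableI => //; exact: measurableC|exact: measurableC].
Qed.

Lemma full_eq (B C G : set T) : measurable B -> measurable C -> measurable G ->
  P (~` G) = 0%E -> B `&` G = C `&` G -> P B = P C.
Proof. by move=> mB mC mG G0 BC; rewrite -(full_setI mB mG G0) BC full_setI. Qed.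

Lemma null_bigcup (I : countType) (B : I -> set T) :
  (forall i, measurable (B i)) -> (forall i, P (B i) = 0%E) ->
  P [set w | exists i, B i w] = 0%E.
Proof.
move=> mB B0; pose C m := if (choice.unpickle m : option I) is Some i then B i else classical_sets.set0.
rewrite (_ : [set w | _] = \bigcup_m C m).
  have mC m : measurable (C m) by rewrite /C; case: choice.unpickle.
  apply/eqP; rewrite eq_le measure_ge0 andbT.
  apply: le_trans (@measure_sigma_subadditive_tail _ _ _ P _ C 0 mC _ _) _.
  - exact: bigcupT_measurable.
  - by move=> w [m _ Cm]; exists m.
  - rewrite eseries0// => m _ _; rewrite /C; case: choice.unpickle => //.
apply/seteqP; split => w /=.
  by move=> [i Bi]; exists (choice.pickle i) => //; rewrite /C choice.pickleK.
by move=> [m _]; rewrite /C; case: choice.unpickle => // i Bi; exists i.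
Qed.

Section modification.
Context {I : choiceType} (W : I -> T -> R) (G : set T).
Hypotheses (mW : forall i, measurable_fun setT (W i)) (mG : measurable G)
  (G0 : P (~` G) = 0%E).

(** The constant 1 is positive and has divergent partial sums, so the regularity properties also
    hold off [G]. *)
Definition modify i w : R := if w \in G then W i w else 1.

Lemma measurable_modify i : measurable_fun setT (modify i).
Proof.
apply: measurable_fun_ifT => //.
apply/measurable_boolP; rewrite (_ : [set w | _] = G)//.
by apply/seteqP; split => w /=; rewrite ?inE.
Qed.

Let measurable_preimage (X : T -> R) (E : set R) : measurable_fun setT X ->
  measurable E -> measurable (X @^-1` E).
Proof. by move=> mX mE; rewrite -[X in measurable X]setTI; exact: mX. Qed.

Lemma modify_same_law i : same_law P P (modify i) (W i).
Proof.
move=> E mE; apply: (full_eq _ _ mG G0).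
- exact: (measurable_preimage (measurable_modify i)).
- exact: measurable_preimage.
- by apply/seteqP; split => w /= [+ Gw]; rewrite /modify mem_set.
Qed.

Lemma modify_independent : mutually_independent P W -> mutually_independent P modify.
Proof.
move=> iW J E mE; transitivity (P (\bigcap_(i in [set` J]) (W i @^-1` E i))).
  apply: (full_eq _ _ mG G0).
  - by apply: fin_bigcap_measurable => // i _; exact: (measurable_preimage (measurable_modify i)).
  - by apply: fin_bigcap_measurable => // i _; exact: measurable_preimage.
  - by apply/seteqP; split => w /= [H Gw]; split => // i iJ; have := H i iJ; rewrite /modify/= mem_set.
by rewrite iW//; apply: eq_bigr => i _; rewrite modify_same_law.
Qed.
End modification.

Section unbounded_sums.
Variable xi : nat -> T -> R.
Hypotheses (mxi : forall i, measurable_fun setT (xi i)) (ixi : mutually_independent P xi).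

Lemma rsum_mgf theta k : (\int[P]_w (expR (theta * rsum (xi^~ w) k))%:E =
  \prod_(i < k) \int[P]_w (expR (theta * xi i w))%:E)%E.
Proof.
elim: k => [|k IH].
  rewrite big_ord0 (eq_integral (fun=> 1%E)).
    by rewrite integral_cst//= probability_setT mule1.
  by move=> w _; rewrite /rsum big_ord0 mulr0 expR0.
rewrite big_ord_recr /= -IH.
have mS q : measurable_fun setT (fun x : path R nat => (expR (theta * rsum x q))%:E).
  apply/measurable_EFinP; apply: measurableT_comp => //; apply: measurable_funM => //.
  exact: measurable_rsum.
have me : measurable_fun setT (fun w => (expR (theta * xi k w))%:E).
  by apply/measurable_EFinP; apply: measurableT_comp => //; exact: measurable_funM.
rewrite (resample_integral (pred1 k) mxi ixi (mS k.+1)); last first.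
  by move=> x; rewrite lee_fin expR_ge0.
rewrite muleC -ge0_integralZl//; last 2 first.
- exact: (measurableT_comp (mS k) (measurable_path mxi)).
- by apply: integral_ge0 => w _; rewrite lee_fin expR_ge0.
apply: eq_integral => w _; rewrite muleC -ge0_integralZl//.
apply: eq_integral => w' _; rewrite -EFinM -expRD -mulrDr rsumS.
rewrite (@eq_rsum _ _ (xi^~ w)); last by move=> i ik; rewrite /= ltn_eqF.
by rewrite /= eqxx.
Qed.

Variable c : R.
Hypotheses (c0 : 0 <= c) (c1 : c < 1).
Hypothesis xic : forall i, (\int[P]_w (expR (- xi i w))%:E <= c%:E)%E.

(** Chernoff's bound: the probability that all partial sums stay below t is at most exp t c^m for
    every m. *)
Lemma unbounded_sums :
  P (~` [set w | forall t : nat, exists m, (t%:R < rsum (xi^~ w) m)%R]) = 0%E.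
Proof.
pose B (t : nat) := [set w | forall m, rsum (xi^~ w) m <= t%:R].
have mr m : measurable_fun setT (fun w => rsum (xi^~ w) m).
  exact: (measurableT_comp (measurable_rsum m) (measurable_path mxi)).
have mBm t m : measurable [set w | rsum (xi^~ w) m <= t%:R].
  by rewrite -[X in measurable X]setTI; apply: measurable_fun_ler.
have mB t : measurable (B t).
  rewrite (_ : B t = \bigcap_m [set w | rsum (xi^~ w) m <= t%:R]).
    exact: bigcapT_measurable.
  by apply/seteqP; split => w /= H m; [move=> _; exact: H|exact: H].
rewrite (_ : ~` _ = [set w | exists t, B t w]); last first.
  apply/seteqP; split => w /=.
    move=> /existsNP[t /forallNP H]; exists t => m; rewrite leNgt; apply/negP; exact: H.
  move=> [t Ht] /(_ t)[m]; rewrite ltNge => /negP; apply; exact: Ht.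
apply: null_bigcup => // t.
have bound m : (P (B t) <= (expR t%:R * c ^+ m)%:E)%E.
  apply: (@le_trans _ _ (\int[P]_w ((expR t%:R)%:E * (expR (-1 * rsum (xi^~ w) m))%:E))%E).
    rewrite -[X in P X]setIT -integral_indic//; apply: ge0_le_integral => //.
    - by apply/measurable_EFinP; exact: measurable_indic.
    - apply: measurable_funeM; apply/measurable_EFinP; apply: measurableT_comp => //.
      exact: measurable_funM.
    - move=> w _; rewrite -EFinM lee_fin indicE -expRD.
      case: (boolP (w \in B t)) => [/set_mem wB|_]; last exact: expR_ge0.
      by rewrite -[leLHS]expR0 ler_expR mulN1r subr_ge0 wB.
  rewrite ge0_integralZl//; last first.
    by apply/measurable_EFinP; apply: measurableT_comp => //; exact: measurable_funM.
  rewrite EFinM lee_wpmul2l ?lee_fin ?expR_ge0// rsum_mgf.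
  elim: m => [|m IH]; first by rewrite big_ord0 expr0.
  rewrite big_ord_recr /= exprSr EFinM; apply: lee_pmul => //.
  - by apply: prode_ge0 => i _; apply: integral_ge0 => w _; rewrite lee_fin expR_ge0.
  - by apply: integral_ge0 => w _; rewrite lee_fin expR_ge0.
  - by under eq_integral do rewrite mulN1r; exact: xic.
apply/eqP; rewrite eq_le measure_ge0 andbT.
have H : (expR t%:R * c ^+ m)%:E @[m --> \oo] --> (0 : \bar R).
  apply: cvg_EFin; first by near=> m.
  rewrite -(mulr0 (expR t%:R)); apply: cvgM; first exact: cvg_cst.
  by apply: cvg_expr; rewrite ger0_norm.
apply: (closed_cvg (fun y => (P (B t) <= y)%E)) H.
  exact: closed_ereal_le_ereal.
by near=> m; exact: bound.
Unshelve. all: by end_near. Qed.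

End unbounded_sums.

(* If [Y] were at most 1/2 almost surely, its mean would be at most 1/2. *)
Lemma expRN_mean_lt1 (Y : T -> R) : measurable_fun setT Y -> (forall w, 0 <= Y w) ->
  (\int[P]_w (Y w)%:E = 1)%E ->
  exists2 c : R, 0 <= c < 1 & (\int[P]_w (expR (- Y w))%:E <= c%:E)%E.
Proof.
move=> mY Y0 EY; pose B := [set w | 2^-1 < Y w].
have mB : measurable B by rewrite -[X in measurable X]setTI; apply: measurable_fun_ltr.
have mYe : measurable_fun setT (fun w => (Y w)%:E) by exact/measurable_EFinP.
have pf : P B \is a fin_num by exact: fin_num_measure.
set p := fine (P B).
have p0 : 0 < p.
  rewrite lt_neqAle fine_ge0// andbT; apply/eqP => p00.
  have PB : P B = 0%E by rewrite -(fineK pf) -/p -p00.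
  have : (\int[P]_w (Y w)%:E <= \int[P]_w (2^-1)%:E)%E.
    have mBC : measurable (~` B) by exact: measurableC.
    rewrite -(setUv B) ge0_integral_setU//; last 3 first.
    - by rewrite setUv.
    - by move=> w _; rewrite lee_fin.
    - by apply/disj_set2P; rewrite setICr.
    rewrite null_set_integral//; last exact: measurable_funTS.
    rewrite add0e setUv; apply: (@le_trans _ _ (\int[P]_(w in ~` B) (2^-1)%:E)%E).
      have mYC : measurable_fun (~` B) (fun w => (Y w)%:E) by exact: measurable_funTS.
      apply: (@ge0_le_integral _ _ _ P (~` B) mBC _ _ _ mYC); [by move=> w _; rewrite lee_fin|exact: measurable_cst|].
      by move=> w /= /negP; rewrite -leNgt lee_fin.
    by apply: ge0_subset_integral.
  rewrite EY integral_cst//= probability_setT mule1 lee_fin; lra.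
have p1 : p <= 1 by rewrite -lee_fin fineK ?probability_le1.
(* On [B], where Y > 1/2, exp (-Y) falls short of 1 by at least [e]. *)
pose e : R := 1 - expR (- 2^-1).
have e0 : 0 < e by rewrite subr_gt0 -[ltRHS]expR0 ltr_expR oppr_lt0.
have e1 : e <= 1 by rewrite lerBlDr lerDl expR_ge0.
exists (1 - e * p).
  rewrite subr_ge0 mulr_ile1 ?(ltW p0) ?(ltW e0)//= ltrBlDr ltrDl; exact: mulr_gt0.
have mi : measurable_fun setT (fun w => (e%:E * (\1_B w)%:E)%E : \bar R).
  by apply: measurable_funeM; apply/measurable_EFinP; exact: measurable_indic.
have H : (\int[P]_w ((expR (- Y w))%:E + e%:E * (\1_B w)%:E) <= 1)%E.
  apply: (@le_trans _ _ (\int[P]_w (1%R)%:E)%E); last first.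
    by rewrite integral_cst//= probability_setT mule1.
  apply: ge0_le_integral => //.
  - by move=> w _; rewrite -EFinM -EFinD lee_fin addr_ge0 ?mulr_ge0 ?expR_ge0 ?(ltW e0).
  - apply: emeasurable_funD => //; apply/measurable_EFinP.
    by apply: measurableT_comp => //; exact: measurableT_comp.
  - move=> w _; rewrite -EFinM -EFinD lee_fin indicE.
    case: (boolP (w \in B)) => [/set_mem wB|_].
      rewrite mulr1 /e addrCA gerDl subr_le0 ler_expR lerN2.
      exact: ltW.
    by rewrite mulr0 addr0 -expR0 ler_expR oppr_le0.
move: H; rewrite ge0_integralD//; last 2 first.
- apply/measurable_EFinP.
  by apply: measurableT_comp => //; exact: measurableT_comp.
- by move=> w _; rewrite -EFinM lee_fin mulr_ge0// ltW.
rewrite ge0_integralZl ?lee_fin ?(ltW e0)//; last first.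
  by apply/measurable_EFinP; exact: measurable_indic.
have -> : (\int[P]_x (\1_B x)%:E = p%:E)%E.
  rewrite integral_indic// setIT; exact/esym/fineK.
rewrite -EFinM EFinB => H.
by rewrite leeBrDr//.
Qed.

End almost_sure.

Lemma ge0_integral_mrestr {R : realType} d (T : measurableType d) (m : {measure set T -> \bar R})
    (D : set T) (mD : measurable D) (f : T -> \bar R) : measurable_fun setT f ->
  (forall x, 0 <= f x)%E -> (\int[mrestr m mD]_x f x = \int[m]_(x in D) f x)%E.
Proof.
move=> mf f0; have mDC := measurableC mD.
have fD0 x : (0 <= (f \_ D) x)%E by rewrite patchE; case: ifP.
have mfD : measurable_fun setT (f \_ D).
  by apply/(measurable_restrictT _ mD); exact: measurable_funTS.
rewrite [RHS]integral_mkcond.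
rewrite [RHS](eq_measure_integral (measure_add (mrestr m mD) (mrestr m mDC))); last first.
  move=> A mA _; transitivity (mrestr m mD A + mrestr m mDC A)%E; last exact/esym/measure_addE.
  rewrite /mrestr -measureU.
  - by rewrite -setIUr setUv setIT.
  - exact: measurableI.
  - exact: measurableI.
  - by rewrite setIACA setICr setI0.
rewrite ge0_integral_measure_add//.
rewrite [X in (_ + X)%E](ae_eq_integral (cst 0%E)) ?integral0 ?adde0//; last first.
  exists D; split => //; first by apply: (@eq_trans _ _ (m classical_sets.set0));
    [congr (m _); apply/seteqP; split => x //= -[]|exact: measure0].
  move=> x /= H; apply: contrapT => xD; apply: H => _; rewrite patchE memNset//.
apply: ae_eq_integral => //.
exists (~` D); split => //; first by apply: (@eq_trans _ _ (m classical_sets.set0));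
  [congr (m _); apply/seteqP; split => x //= -[]|exact: measure0].
by move=> x /= H xD; apply: H => _; rewrite patchE mem_set.
Qed.

(* The equilibrium law of the residual processing time, with density [P0 (S > y)]. *)
Section equilibrium.
Context {R : realType} d0 (T0 : measurableType d0) (P0 : probability T0 R).
Variable S : {RV P0 >-> R}.
Hypotheses (S_ge0 : forall w, 0 <= S w) (ES : (\int[P0]_w (S w)%:E = 1)%E).
Notation mu := (@lebesgue_measure R).

(** The equilibrium law is realized by a uniform point below the graph of S: the area is E S = 1 and
    the height of the point has density P0 (S > y). No density or quantile function is needed. *)
Definition below_graph : set (T0 * measurableTypeR R) := [set z | 0 <= z.2 < S z.1].

Lemma measurable_below_graph : measurable below_graph.
Proof.
apply/measurable_boolP; apply: measurable_and.
  apply: measurable_fun_ler; first exact: measurable_cst.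
  exact: measurable_snd.
apply: measurable_fun_ltr; first exact: measurable_snd.
by apply: measurableT_comp => //; exact: measurable_fst.
Qed.

Definition equilibrium := mrestr (P0 \x (mu : measure (measurableTypeR R) R))%E measurable_below_graph.
HB.instance Definition _ := Measure.on equilibrium.

Lemma below_graph_integral (f : R -> \bar R) : measurable_fun setT f -> (forall x, 0 <= f x)%E ->
  (\int[equilibrium]_z f z.2 = \int[P0]_w \int[mu]_(y in `[0%R, S w[) f y)%E.
Proof.
move=> mf f0.
have mf2 : measurable_fun setT (fun z : T0 * measurableTypeR R => f z.2).
  by apply: (measurableT_comp mf); exact: measurable_snd.
rewrite /equilibrium ge0_integral_mrestr// integral_mkcond.
have mg : measurable_fun setT ((fun z : T0 * measurableTypeR R => f z.2) \_ below_graph).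
  by apply/(measurable_restrictT _ measurable_below_graph); exact: measurable_funTS.
transitivity (\int[P0]_x fubini_F mu ((fun z : T0 * measurableTypeR R => f z.2) \_ below_graph) x)%E.
  apply: (@fubini_tonelli1 _ _ _ _ _ P0 mu _ mg).
  by move=> z; rewrite patchE; case: ifP.
apply: eq_integral => w _; rewrite /fubini_F [RHS]integral_mkcond.
by apply: eq_integral => y _; rewrite !patchE; congr (if _ then _ else _).
Qed.

Lemma equilibrium_setT : equilibrium setT = 1%E.
Proof.
transitivity (\int[equilibrium]_z (cst 1%E : T0 * R -> \bar R) z)%E; first by rewrite integral_cst// mul1e.
rewrite (@below_graph_integral (fun=> 1%E))//.
transitivity (\int[P0]_w (S w)%:E)%E; last exact: ES.
apply: eq_integral => w _; transitivity (mu `[0%R, S w[%classic); first by rewrite integral_cst// mul1e.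
rewrite lebesgue_measure_itv /= lte_fin.
by case: ltP (S_ge0 w) => // h1 h2; [rewrite sube0|rewrite (le_anti (introT andP (conj h1 h2)))].
Qed.

HB.instance Definition _ := Measure_isProbability.Build _ _ _ equilibrium equilibrium_setT.

Definition equilibriumP : probability (T0 * measurableTypeR R)%type R := equilibrium.

(** The maximum only corrects heights outside [below_graph], a null set, so that the variable is
    nonnegative everywhere. *)
Definition residual (z : T0 * measurableTypeR R) : R := Num.max z.2 0.

Lemma measurable_residual : measurable_fun setT residual.
Proof. by apply: measurable_maxr => //; exact: measurable_snd. Qed.

Lemma residual_integral (f : R -> \bar R) : measurable_fun setT f -> (forall x, 0 <= f x)%E ->
  (\int[equilibriumP]_z f (residual z) = \int[P0]_w \int[mu]_(y in `[0%R, S w[) f y)%E.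
Proof.
move=> mf f0.
have mm : measurable_fun setT (fun y : R => f (Num.max y 0)).
  by apply: (measurableT_comp mf); apply: measurable_maxr.
transitivity (\int[P0]_w \int[mu]_(y in `[0%R, S w[) f (Num.max y 0%R))%E.
  by rewrite -below_graph_integral.
apply: eq_integral => w _; apply: eq_integral => y.
by rewrite inE /= in_itv /= => /andP[y0 _]; congr f; apply/max_idPl.
Qed.

Lemma residual_gt0 : equilibriumP [set z | residual z <= 0] = 0%E.
Proof.
have m0 : measurable [set y : R | y <= 0].
  by rewrite -[X in measurable X]setTI; apply: measurable_fun_ler.
have mi : measurable_fun setT (fun y : R => (\1_[set y : R | y <= 0] y)%:E : \bar R).
  by apply/measurable_EFinP; exact: measurable_indic.
have := residual_integral mi; rewrite /=.
rewrite (_ : (fun z => _) = fun z => (\1_[set z | residual z <= 0] z)%:E : \bar R); last first.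
  by apply/funext => z; rewrite !indicE; congr (_%:R)%:E; apply/idP/idP; rewrite !inE.
rewrite integral_indic// ?setIT; last first.
  rewrite -[X in measurable X]setTI; apply: measurable_fun_ler => //; exact: measurable_residual.
move=> ->; last by [].
apply: integral0_eq => w _; apply/eqP; rewrite eq_le; apply/andP; split; last exact: integral_ge0.
rewrite (ae_eq_integral (cst 0%E)) ?integral0//; first exact: measurable_funTS.
exists [set 0]; split => //; first exact: lebesgue_measure_set1.
move=> y /= /not_implyP[]; rewrite in_itv /= => /andP[y0 _] H.
apply/eqP; rewrite eq_le y0 andbT leNgt; apply/negP => yp; apply: H.
by rewrite indicE memNset//=; apply/negP; rewrite -ltNge.
Qed.

End equilibrium.

(** * A probability space carrying the busy servers *)

Section extension.
Context {R : realType} d0 (T0 : measurableType d0) (P0 : probability T0 R).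
Variables (A S : {RV P0 >-> R}).
Hypotheses (A_ge0 : forall w, 0 <= A w) (S_ge0 : forall w, 0 <= S w).
Hypotheses (EA : (\int[P0]_w (A w)%:E = 1)%E) (ES : (\int[P0]_w (S w)%:E = 1)%E).
Context d (T : measurableType d) (P : probability T R) (As Ss : nat -> {RV P >-> R}).
Hypothesis primitives : queue_primitives As Ss A S.

Definition extension_of N d' (T' : measurableType d') (P' : probability T' R) (W : prim -> T' -> R) :=
  [/\ (forall i, measurable_fun setT (W i)) /\ mutually_independent P' W,
      forall i, same_law P' P0 (W (inl i)) A,
      forall k m, same_law P' P0 (W (inr (inl (k, m)))) S,
      forall k, (N <= k)%N -> same_law P' P0 (W (inr (inr k))) S &
      forall k, (k < N)%N -> same_law P' (equilibriumP S_ge0 ES) (W (inr (inr k))) (@residual R d0 T0)].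

(** Induction on N. At N = 0 all service coordinates are distinct terms of [Ss], through an
    injection of the indices into the naturals. Each step multiplies the space by one equilibrium
    factor and puts it at coordinate N. *)
Lemma extension_exists N : exists d' (T' : measurableType d') (P' : probability T' R)
  (W : prim -> T' -> R), extension_of N P' W.
Proof.
have [sA sS iAS] := primitives.
elim: N => [|N [d' [T' [P' [W [[mW iW] WA WS WR' WR]]]]]].
  pose h (i : prim) : nat + nat := match i with inl i => inl i | inr j => inr (choice.pickle j) end.
  have hI : injective h.
    by case=> [i|i] [j|j] //= [] => [->//|/(pcan_inj choice.pickleK) ->].
  exists d, T, P, (fun i => match h i with inl k => As k : T -> R | inr k => Ss k : T -> R end).
  split; [split| | | |].
  - by case=> [i|i] /=.
  - exact: (reindex_independent hI iAS).
  - by move=> i; exact: sA.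
  - by move=> k m; exact: sS.
  - by move=> k _; exact: sS.
  - by [].
pose K : pred prim := pred1 (inr (inr N)).
pose Y (i : prim) := @residual R d0 T0.
have mY (i : prim) : measurable_fun setT (Y i) by exact: measurable_residual.
exists _, (T' * (T0 * measurableTypeR R))%type,
  (prod_prob P' (equilibriumP S_ge0 ES)), (splice W Y K); split; [split| | | |].
- exact: measurable_splice.
- apply: splice_independent => // J E JK mE.
  have [J0|[j jJ]] := fset_0Vmem J.
    rewrite [RHS]big_seq [RHS]big1; last by move=> i; rewrite J0 inE.
    rewrite (_ : \bigcap_(i in _) _ = setT) ?probability_setT//.
    by apply/seteqP; split => // z _ i /=; rewrite J0 inE.
  have JE i : i \in J -> i = inr (inr N) by move=> /JK /eqP.
  have -> : J = [fset (inr (inr N) : prim)]%fset.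
    apply/fsetP => i; rewrite inE; apply/idP/eqP => [/JE//|->].
    by rewrite -(JE _ jJ).
  rewrite big_seq_fset1 (_ : [set` _] = [set inr (inr N)]) ?bigcap_set1//.
  by apply/seteqP; split => i /=; rewrite inE => /eqP.
- by move=> i E mE; rewrite splice_same_lawl//; exact: WA.
- by move=> k m E mE; rewrite splice_same_lawl//; exact: WS.
- move=> k Nk E mE; rewrite splice_same_lawl//; first by apply: WR' => //; exact: ltnW.
  by rewrite /K /=; apply/eqP => -[kE]; rewrite kE ltnn in Nk.
- move=> k; rewrite ltnS leq_eqVlt => /predU1P[->|kN] E mE.
    by rewrite splice_same_lawr// /K/= eqxx.
  rewrite splice_same_lawl//; first exact: WR.
  by rewrite /K /=; apply/eqP => -[kE]; rewrite kE ltnn in kN.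
Qed.

(* After a modification on a null set, the regularity properties used by the
   pathwise arguments hold everywhere. *)
Lemma good_extension_exists N : exists d' (T' : measurableType d') (P' : probability T' R)
    (W : prim -> T' -> R), extension_of N P' W /\
  [/\ forall i w, 0 <= W i w, forall k w, (k < N)%N -> 0 < W (inr (inr k)) w,
      forall w k t, exists m, t < rsum (fun l => W (inr (inl (k, l))) w) m &
      forall w t, exists m, t < rsum (fun l => W (inl l) w) m].
Proof.
have [d' [T' [P' [W [[mW iW] WA WS WR' WR]]]]] := extension_exists N.
have mpre i (E : set R) : measurable E -> measurable (W i @^-1` E).
  by move=> mE; rewrite -[X in measurable X]setTI; exact: mW.
have mA : measurable_fun setT A by [].
have mS : measurable_fun setT S by [].
pose neg i := W i @^-1` [set y : R | y < 0].
pose npos k := W (inr (inr k)) @^-1` [set y : R | y <= 0].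
pose bnd (f : nat -> prim) := ~` [set w | forall t : nat, exists m, (t%:R < rsum (fun l => W (f l) w) m)%R].
have mneg0 : measurable [set y : R | y < 0].
  by rewrite -[X in measurable X]setTI; apply: measurable_fun_ltr.
have mle0 : measurable [set y : R | y <= 0].
  by rewrite -[X in measurable X]setTI; apply: measurable_fun_ler.
have mbnd f : measurable (bnd f).
  apply: measurableC.
  rewrite (_ : [set w | _] = \bigcap_t \bigcup_m [set w | t%:R < rsum (fun l => W (f l) w) m]).
    apply: bigcapT_measurable => t; apply: bigcupT_measurable => m.
    rewrite -[X in measurable X]setTI; apply: measurable_fun_ltr => //.
    by apply: measurable_sum => l; exact: mW.
  apply/seteqP; split => w /= H t.
    by move=> _; have [m] := H t; exists m.
  by have [m _] := H t I; exists m.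
have bnd0 f (Y : {RV P0 >-> R}) : injective f -> (forall w, 0 <= Y w) -> (\int[P0]_w (Y w)%:E = 1)%E ->
    (forall l, same_law P' P0 (W (f l)) Y) -> P' (bnd f) = 0%E.
  move=> fI Y0 EY fY.
  have mY : measurable_fun setT Y by [].
  have [c /andP[c0 c1] cE] := expRN_mean_lt1 mY Y0 EY.
  apply: (@unbounded_sums _ _ _ P' (fun l => W (f l)) _ _ c c0 c1) => //.
    exact: reindex_independent fI iW.
  move=> l; apply: le_trans cE; rewrite (same_law_integral (mW (f l)) mY (fY l) (f := fun y => (expR (- y))%:E))//.
    by apply/measurable_EFinP; exact: measurable_expRN.
(* All exceptional events in one countable family, so that a single null set is removed. *)
pose bad (e : prim + (nat + option nat)) := match e with
  | inl i => neg i
  | inr (inl k) => if (k < N)%N then npos k else classical_sets.set0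
  | inr (inr (Some k)) => bnd (fun l => inr (inl (k, l)))
  | inr (inr None) => bnd inl
  end.
have mbad e : measurable (bad e).
  case: e => [i|[k|[k|]]] /=; [exact: mpre| |exact: mbnd|exact: mbnd].
  by case: ifP => // _; exact: mpre.
have law0 i (Y : {RV P0 >-> R}) : (forall w, 0 <= Y w) -> same_law P' P0 (W i) Y -> P' (neg i) = 0%E.
  move=> Y0 iY; rewrite /neg iY// (_ : Y @^-1` _ = set0) ?measure0//.
  by apply/seteqP; split => w //=; rewrite ltNge Y0.
have npos0 k : (k < N)%N -> P' (npos k) = 0%E.
  by move=> kN; rewrite /npos WR//; exact: residual_gt0.
have bad0 e : P' (bad e) = 0%E.
  case: e => [i|[k|[k|]]] /=.
  - case: i => [i|[[k m]|k]]; [exact: (law0 _ A)|exact: (law0 _ S)|].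
    have [kN|Nk] := ltnP k N; last exact: (law0 _ S _ (WR' _ Nk)).
    apply/eqP; rewrite eq_le measure_ge0 andbT -(npos0 k kN).
    apply: le_measure; rewrite ?inE; [exact: mpre|exact: mpre|].
    by move=> w /= /ltW.
  - by case: ifPn => [|_]; [exact: npos0|exact: measure0].
  - by apply: (bnd0 _ S) => //; move=> a b [->].
  - by apply: (bnd0 _ A) => //; move=> a b [->].
pose G := ~` [set w | exists e, bad e w].
have mG : measurable G by apply: measurableC; exact: measurable_ex_count.
have G0 : P' (~` G) = 0%E by rewrite setCK; exact: null_bigcup.
pose W' := modify W G.
have sl i : same_law P' P' (W' i) (W i) by exact: modify_same_law.
exists d', T', P', W'; split.
  split; first (split; [exact: measurable_modify|exact: modify_independent]).
  - by move=> i E mE; rewrite sl// WA.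
  - by move=> k m E mE; rewrite sl// WS.
  - by move=> k Nk E mE; rewrite sl// WR'.
  - by move=> k kN E mE; rewrite sl// WR.
have ones t : exists m, t < rsum (fun=> 1 : R) m.
  exists (Num.truncn t).+1; rewrite /rsum sumr_const card_ord.
  have [t0|t0] := leP 0 t; last exact: lt_trans t0 _.
  by have /andP[] := truncn_itv t0.
have unb (f : nat -> prim) w : (w \in G -> ~ bnd f w) -> forall t, exists m, t < rsum (fun l => W' (f l) w) m.
  move=> H t; rewrite /W' /modify; case: (boolP (w \in G)) => [wG|_]; last exact: ones.
  have /contrapT /(_ (Num.truncn t).+1)[m Hm] := H wG; exists m; apply: lt_trans Hm.
  have [t0|t0] := leP 0 t; last exact: lt_trans t0 _.
  by have /andP[] := truncn_itv t0.
split.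
- move=> i w; rewrite /W' /modify; case: (boolP (w \in G)) => // /set_mem wG.
  by rewrite leNgt; apply/negP => wi; apply: wG; exists (inl i).
- move=> k w kN; rewrite /W' /modify; case: (boolP (w \in G)) => // /set_mem wG.
  by rewrite ltNge; apply/negP => wi; apply: wG; exists (inr (inl k)); rewrite /= kN.
- by move=> w k t; apply: unb => /set_mem wG wb; apply: wG; exists (inr (inr (Some k))).
- by move=> w t; apply: unb => /set_mem wG wb; apply: wG; exists (inr (inr None)).
Qed.

End extension.

(** * Moments of stationary renewal processes *)

Section renewal.
Context {R : realType} d0 (T0 : measurableType d0) (P0 : probability T0 R).
Variable S : {RV P0 >-> R}.
Hypotheses (S_ge0 : forall w, 0 <= S w) (ES : (\int[P0]_w (S w)%:E = 1)%E).
Context d (T : measurableType d) (P : probability T R) (Y : option nat -> T -> R).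
Hypotheses (mY : forall i, measurable_fun setT (Y i)) (iY : mutually_independent P Y).
Hypothesis Y0 : forall i w, 0 <= Y i w.
Hypothesis YS : forall m, same_law P P0 (Y (Some m)) S.
Hypothesis Yr : same_law P (equilibriumP S_ge0 ES) (Y None) (@residual R d0 T0).
Notation mu := (@lebesgue_measure R).
Implicit Types x : option nat -> R.

Definition psum (x : option nat -> R) m j := \sum_(l < j) x (Some (m + l)%N).
Definition epoch (x : option nat -> R) m := x None + psum x 0 m.

Lemma psumS x m j : psum x m j.+1 = psum x m j + x (Some (m + j)%N).
Proof. by rewrite /psum big_ord_recr. Qed.

Lemma epochD x m j : epoch x (m + j) = epoch x m + psum x m j.
Proof.
rewrite /epoch -addrA; congr (_ + _).
elim: j => [|j IH]; first by rewrite addn0 /psum big_ord0 addr0.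
by rewrite addnS !psumS IH addrA.
Qed.

Lemma psum_ge0 w m j : 0 <= psum (Y^~ w) m j.
Proof. by apply: sumr_ge0 => l _; exact: Y0. Qed.

Lemma measurable_psum m j : measurable_fun setT (fun x : path R (option nat) => psum x m j).
Proof. by apply: measurable_sum => l; exact: measurable_coord. Qed.

Lemma measurable_epoch m : measurable_fun setT (fun x : path R (option nat) => epoch x m).
Proof. by apply: measurable_funD; [exact: measurable_coord|exact: measurable_psum]. Qed.

Let mp : measurable_fun setT (fun w => (Y^~ w) : path R (option nat)) := measurable_path mY.

Lemma eq_psum x y m j : (forall l, (m <= l < m + j)%N -> x (Some l) = y (Some l)) ->
  psum x m j = psum y m j.
Proof.
by move=> xy; apply: eq_bigr => l _; apply: xy; rewrite leq_addr ltn_add2l ltn_ord.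
Qed.

Lemma measurable_lt_bool d' (T' : measurableType d') (f g : T' -> R) :
  measurable_fun setT f -> measurable_fun setT g ->
  measurable_fun setT (fun w => ((f w < g w)%R%:R : R)).
Proof.
move=> mf mg; rewrite (_ : (fun w => _) = fun w => if f w < g w then 1 else 0); last first.
  by apply/funext => w; case: (f w < g w).
by apply: measurable_fun_ifT => //; exact: measurable_fun_ltr.
Qed.

(** The equilibrium law is characterized by P (residual < u) = E min (S, u); with u = t - s, the
    mean gain of min (., t) from one more interval is the probability that the delayed sum s is
    before t. *)
Lemma min_residual (s t : R) : 0 <= s -> 0 <= t ->
  (\int[P0]_w (Num.min (s + S w) t)%:E =
   (Num.min s t)%:E + \int[P]_w ((Y None w + s < t)%R%:R)%:E)%E.
Proof.
move=> s0 t0.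
have mf : measurable_fun setT (fun y : R => (((y + s < t)%R%:R : R))%:E).
  by apply/measurable_EFinP; apply: measurable_lt_bool => //; exact: measurable_funD.
have f0 (y : R) : (0 <= (((y + s < t)%R%:R : R))%:E)%E by [].
rewrite (same_law_integral (mY None) (@measurable_residual R d0 T0) Yr mf f0).
have H := residual_integral S_ge0 ES mf f0; rewrite /= in H; rewrite {}H.
have E w : (\int[mu]_(y in `[0%R, S w[) ((y + s < t)%R%:R : R)%:E = (Num.max 0 (Num.min (S w) (t - s)))%:E)%E.
  transitivity (mu `[0%R, Num.min (S w) (t - s)[%classic).
    rewrite -[X in mu X]setIT -integral_indic// [LHS]integral_mkcond.
    apply: eq_integral => y _; rewrite patchE indicE !mem_setE !in_itv /= lt_min.
    by rewrite -ltrBrDr; case: (0 <= y); case: (y < S w); case: (y < t - s).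
  rewrite lebesgue_measure_itv /= lte_fin.
  by case: ltP => h; rewrite ?oppr0 ?adde0.
have mE : measurable_fun setT (fun w => (Num.max 0 (Num.min (S w) (t - s)))%:E : \bar R).
  by apply/measurable_EFinP; apply: measurable_maxr => //; exact: measurable_minr.
under [X in (_ + X)%E]eq_integral do rewrite E.
rewrite -[X in (X + _)%E]mule1 -(probability_setT P0) -integral_cst// -ge0_integralD//; last 2 first.
- by move=> w _; rewrite lee_fin le_min s0 t0.
- by move=> w _; rewrite lee_fin le_max lexx.
apply: eq_integral => w _; rewrite -EFinD; congr EFin.
have S0w := S_ge0 w; rewrite !minEle !maxEle.
case: (leP (s + S w) t) => h1; case: (leP s t) => h2; case: (leP (S w) (t - s)) => h3;
  case: leP => h4; lra.
Qed.

Lemma min_psum m t : 0 <= t ->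
  (\int[P]_w (Num.min (psum (Y^~ w) 0 m) t)%:E + \int[P]_w ((epoch (Y^~ w) m < t)%R%:R : R)%:E =
   \int[P]_w (Num.min (psum (Y^~ w) 0 m.+1) t)%:E)%E.
Proof.
move=> t0.
pose f (x : path R (option nat)) := (Num.max 0 (Num.min (psum x 0 m.+1) t))%:E.
have mf : measurable_fun setT f.
  apply/measurable_EFinP; apply: measurable_maxr => //; apply: measurable_minr => //.
  exact: measurable_psum.
have f0 x : (0 <= f x)%E by rewrite lee_fin le_max lexx.
have fE w : f (Y^~ w) = (Num.min (psum (Y^~ w) 0 m.+1) t)%:E.
  by rewrite /f (max_idPr _)// le_min psum_ge0.
pose g (x : path R (option nat)) := (((epoch x m < t)%R%:R : R))%:E.
have mg : measurable_fun setT g.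
  by apply/measurable_EFinP; apply: measurable_lt_bool => //; exact: measurable_epoch.
have g0 x : (0 <= g x)%E by rewrite lee_fin ler0n.
under [RHS]eq_integral do rewrite -fE.
rewrite (resample_integral (pred1 (Some m)) mY iY mf f0).
have -> : (\int[P]_w ((epoch (Y^~ w) m < t)%R%:R : R)%:E = \int[P]_w g (Y^~ w))%E by [].
rewrite (resample_integral (pred1 None) mY iY mg g0).
have mmin : measurable_fun setT (fun w => (Num.min (psum (Y^~ w) 0 m) t)%:E : \bar R).
  apply/measurable_EFinP; apply: measurable_minr => //.
  exact: (measurableT_comp (measurable_psum 0 m) mp).
rewrite -ge0_integralD//; last 3 first.
- by move=> w _; rewrite lee_fin le_min psum_ge0.
- by move=> w _; exact: integral_ge0.
- have mg' : measurable_fun setT (fun z : T * T => g (fun i => if pred1 None i then Y i z.2 else Y i z.1)).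
    apply: (measurableT_comp mg); apply: measurable_path => i.
    by case: (pred1 None i); [exact: (measurableT_comp (mY i) measurable_snd)|exact: (measurableT_comp (mY i) measurable_fst)].
  exact: (@measurable_fun_fubini_tonelli_F _ _ _ _ _ P _ mg' (fun z => g0 _)).
apply: eq_integral => w _.
have p0 := psum_ge0 w 0 m.
have H0 := min_residual p0 t0.
have mS2 : measurable_fun setT (fun y : R => (Num.max 0 (Num.min (psum (Y^~ w) 0 m + y) t))%:E : \bar R).
  apply/measurable_EFinP; apply: measurable_maxr => //; apply: measurable_minr => //.
  exact: measurable_funD.
have mS : measurable_fun setT S by [].
have H := same_law_integral (mY (Some m)) mS (YS m) mS2.
transitivity (\int[P0]_w0 (Num.min (psum (Y^~ w) 0 m + S w0) t)%:E)%E.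
  by rewrite H0; congr (_ + _)%E.
transitivity (\int[P0]_w0 (Num.max 0 (Num.min (psum (Y^~ w) 0 m + S w0) t))%:E)%E.
  by apply: eq_integral => w0 _; rewrite (max_idPr _)// le_min t0 andbT addr_ge0.
rewrite -H; last by move=> y; rewrite lee_fin le_max lexx.
apply: eq_integral => w' _; rewrite /f psumS add0n /= eqxx; congr (Num.max 0 (Num.min (_ + _) t))%:E.
by apply: eq_psum => l /andP[_]; rewrite add0n => lm; rewrite /= (inj_eq Some_inj) ltn_eqF.
Qed.

(** Stationarity in truncated form: the mean number of epochs before t among the first M is E min
    (S_M, t), which increases to exactly t. Hence the counts have no bias of order 1. *)
Lemma sum_epoch M t : 0 <= t -> (\sum_(m < M) \int[P]_w ((epoch (Y^~ w) m < t)%R%:R : R)%:E =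
  \int[P]_w (Num.min (psum (Y^~ w) 0 M) t)%:E)%E.
Proof.
move=> t0; elim: M => [|M IH].
  rewrite big_ord0; apply/esym/integral0_eq => w _.
  by rewrite /psum big_ord0 (min_idPl t0).
by rewrite big_ord_recr /= IH min_psum.
Qed.

Variable b : R.
Hypothesis b0 : 0 < b.
Definition mean_min := fine (\int[P0]_w (Num.min (S w) b)%:E).

Lemma mean_minE : (\int[P0]_w (Num.min (S w) b)%:E = mean_min%:E)%E.
Proof.
rewrite /mean_min fineK//; apply: integrable_fin_num => //.
apply: (@bounded_integrable _ _ _ P0 (fun w => Num.min (S w) b) b).
  exact: measurable_minr.
by move=> w; rewrite ger0_norm ?le_min ?S_ge0 ?(ltW b0)// ge_min lexx orbT.
Qed.

(* Wald's identity for the truncated processing times. *)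
Lemma renewal_bound m J y : 0 < y ->
  (mean_min%:E * (\sum_(j < J) \int[P]_w ((psum (Y^~ w) m j < y)%R%:R : R)%:E) <= (y + b)%:E)%E.
Proof.
move=> y0.
pose f j (x : path R (option nat)) := ((psum x m j < y)%R%:R * Num.max 0 (Num.min (x (Some (m + j)%N)) b))%:E : \bar R.
have mf j : measurable_fun setT (f j).
  apply/measurable_EFinP; apply: measurable_funM.
    by apply: measurable_lt_bool => //; exact: measurable_psum.
  by apply: measurable_maxr => //; apply: measurable_minr => //; exact: measurable_coord.
have f0 j x : (0 <= f j x)%E by rewrite lee_fin mulr_ge0 ?le_max ?lexx.
have fE j : (\int[P]_w f j (Y^~ w) = mean_min%:E * \int[P]_w ((psum (Y^~ w) m j < y)%R%:R : R)%:E)%E.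
  rewrite (resample_integral (pred1 (Some (m + j)%N)) mY iY (mf j) (f0 j)).
  rewrite -ge0_integralZl//; last 2 first.
  - apply/measurable_EFinP; apply: measurable_lt_bool => //.
    exact: (measurableT_comp (measurable_psum m j) mp).
  - by rewrite -mean_minE; apply: integral_ge0 => w _; rewrite lee_fin le_min S_ge0 ltW.
  apply: eq_integral => w _.
  have mh : measurable_fun setT (fun z : R => (Num.max 0 (Num.min z b))%:E : \bar R).
    by apply/measurable_EFinP; apply: measurable_maxr => //; exact: measurable_minr.
  have mS : measurable_fun setT S by [].
  have h0 (z : R) : (0 <= (Num.max 0 (Num.min z b))%:E)%E by rewrite lee_fin le_max lexx.
  have mh' : measurable_fun setT (fun w' => (Num.max 0 (Num.min (Y (Some (m + j)%N) w') b))%:E : \bar R).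
    exact: (measurableT_comp mh (mY _)).
  rewrite -mean_minE muleC.
  transitivity (((psum (Y^~ w) m j < y)%R%:R : R)%:E * \int[P]_w' (Num.max 0 (Num.min (Y (Some (m + j)%N) w') b))%:E)%E.
    rewrite -ge0_integralZl//; apply: eq_integral => w' _; rewrite /f -EFinM /= eqxx.
    congr ((_ < y)%R%:R * _)%:E; apply: eq_psum => l /andP[_ lm].
    by rewrite /= (inj_eq Some_inj) ltn_eqF.
  congr (_ * _)%E; rewrite (same_law_integral (mY _) mS (YS _) mh h0).
  by apply: eq_integral => w' _; rewrite (max_idPr _)// le_min S_ge0 ltW.
rewrite ge0_sume_distrr//; last by move=> j _; exact: integral_ge0.
under eq_bigr do rewrite -fE.
rewrite -ge0_integral_sum//; last by move=> j; exact: (measurableT_comp (mf j) mp).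
have -> : ((y + b)%:E = \int[P]_w (y + b)%:E)%E.
  by rewrite integral_cst//= probability_setT mule1.
apply: ge0_le_integral => //.
- by move=> w _; apply: sume_ge0 => j _; exact: f0.
- by apply: emeasurable_sum => j; exact: (measurableT_comp (mf j) mp).
- move=> w _; rewrite sumEFin lee_fin.
  elim: J => [|J IH]; first by rewrite big_ord0 addr_ge0// ltW.
  rewrite big_ord_recr /=; case: ltP => h; last by rewrite mul0r addr0.
  rewrite mul1r lerD//.
    apply: le_trans (ltW h); apply: ler_sum => j _.
    rewrite (max_idPr _) ?le_min ?Y0 ?(ltW b0)//.
    by case: (_ < y); rewrite ?mul0r ?Y0// mul1r ge_min lexx.
  by rewrite (max_idPr _) ?le_min ?Y0 ?(ltW b0)// ge_min lexx orbT.
Qed.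

Variable M : nat.
Variables (s t : R).
Hypotheses (s0 : 0 <= s) (st : s < t).
Let l := t - s.

Definition epochs (x : option nat -> R) : R :=
  \sum_(m < M) ((s <= epoch x m) && (epoch x m < t))%R%:R.

Let win (x : option nat -> R) m : bool := (s <= epoch x m) && (epoch x m < t).

Lemma measurable_win m : measurable_fun setT (fun x : path R (option nat) => (win x m)%:R : R).
Proof.
rewrite (_ : (fun x => _) = fun x : path R (option nat) => if win x m then 1 else 0); last first.
  by apply/funext => x; case: (win x m).
apply: measurable_fun_ifT => //; apply: measurable_and.
  by apply: measurable_fun_ler => //; exact: measurable_epoch.
by apply: measurable_fun_ltr => //; exact: measurable_epoch.
Qed.

Lemma sum_win (s' t' : R) : 0 <= s' -> s' <= t' ->
  (\int[P]_w (Num.min (psum (Y^~ w) 0 M) s')%:E +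
   \sum_(m < M) \int[P]_w (((s' <= epoch (Y^~ w) m) && (epoch (Y^~ w) m < t'))%R%:R : R)%:E =
   \int[P]_w (Num.min (psum (Y^~ w) 0 M) t')%:E)%E.
Proof.
move=> s'0 st'; rewrite -!sum_epoch ?(le_trans s'0)// -big_split /=.
apply: eq_bigr => m _; rewrite -ge0_integralD//.
- apply: eq_integral => w _; rewrite -EFinD -natrD; congr (_%:R)%:E.
  case: (leP s' (epoch (Y^~ w) m)) => h /=; first by rewrite add0n.
  by rewrite (lt_le_trans h st').
- apply/measurable_EFinP; apply: measurable_lt_bool => //.
  exact: (measurableT_comp (measurable_epoch m) mp).
- apply/measurable_EFinP.
  rewrite (_ : (fun w => _) = fun w => if (s' <= epoch (Y^~ w) m) && (epoch (Y^~ w) m < t') then 1 else 0); last first.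
    by apply/funext => w; case: (_ && _).
  have me := measurableT_comp (measurable_epoch m) mp.
  apply: measurable_fun_ifT => //; apply: measurable_and.
    exact: measurable_fun_ler.
  exact: measurable_fun_ltr.
Qed.

Lemma sum_win_le (s' t' : R) : 0 <= s' -> s' <= t' ->
  (\sum_(m < M) \int[P]_w (((s' <= epoch (Y^~ w) m) && (epoch (Y^~ w) m < t'))%R%:R : R)%:E
    <= (t' - s')%:E)%E.
Proof.
move=> s'0 st'; have t'0 := le_trans s'0 st'.
have mm u : measurable_fun setT (fun w => (Num.min (psum (Y^~ w) 0 M) u)%:E : \bar R).
  apply/measurable_EFinP; apply: measurable_minr => //.
  exact: (measurableT_comp (measurable_psum 0 M) mp).
have fin u : 0 <= u -> (\int[P]_w (Num.min (psum (Y^~ w) 0 M) u)%:E)%E \is a fin_num.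
  move=> u0; apply: integrable_fin_num => //.
  apply: (@bounded_integrable _ _ _ P (fun w => Num.min (psum (Y^~ w) 0 M) u) u).
    apply: measurable_minr => //; exact: (measurableT_comp (measurable_psum 0 M) mp).
  by move=> w; rewrite ger0_norm ?le_min ?psum_ge0// ge_min lexx orbT.
rewrite -(@leeD2lE _ (\int[P]_w (Num.min (psum (Y^~ w) 0 M) s')%:E)%E) ?fin//.
rewrite sum_win//.
have -> : ((t' - s')%:E = \int[P]_w (t' - s')%:E)%E.
  by rewrite integral_cst//= probability_setT mule1.
rewrite -ge0_integralD//; last 2 first.
- by move=> w _; rewrite lee_fin le_min psum_ge0.
- by move=> w _; rewrite lee_fin subr_ge0.
apply: ge0_le_integral => //.
- by move=> w _; rewrite lee_fin le_min psum_ge0.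
- exact: emeasurable_funD.
- move=> w _; rewrite -EFinD lee_fin; have p0 := psum_ge0 w 0 M; move: p0.
  set p := psum _ _ _ => p0; rewrite !minEle.
  by case: (leP p t') => h1; case: (leP p s') => h2; lra.
Qed.

Lemma epochsE w : (epochs (Y^~ w))%:E =
  (\sum_(m < M) (((s <= epoch (Y^~ w) m) && (epoch (Y^~ w) m < t))%R%:R : R)%:E)%E.
Proof. by rewrite sumEFin. Qed.

Lemma epochs_mean_le : (\int[P]_w (epochs (Y^~ w))%:E <= l%:E)%E.
Proof.
apply: le_trans (sum_win_le s0 (ltW st)); rewrite -ge0_integral_sum//.
- by under [leLHS]eq_integral do rewrite epochsE.
- by move=> m; apply/measurable_EFinP; exact: (measurableT_comp (measurable_win m) mp).
Qed.

Lemma epochs_mean_ge (ka : R) :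
  ((t - ka)%:E <= \int[P]_w (Num.min (psum (Y^~ w) 0 M) t)%:E)%E ->
  ((l - ka)%:E <= \int[P]_w (epochs (Y^~ w))%:E)%E.
Proof.
rewrite -(sum_win s0 (ltW st)) => H.
have : ((t - ka)%:E <= s%:E + \int[P]_w (epochs (Y^~ w))%:E)%E.
  apply: le_trans H _; apply: leeD.
    have -> : (s%:E = \int[P]_w s%:E)%E by rewrite integral_cst//= probability_setT mule1.
    apply: ge0_le_integral => //.
    - by move=> w _; rewrite lee_fin le_min psum_ge0.
    - apply/measurable_EFinP; apply: measurable_minr => //.
      exact: (measurableT_comp (measurable_psum 0 M) mp).
    - by move=> w _; rewrite lee_fin ge_min lexx orbT.
  rewrite -ge0_integral_sum//.
    by under [leRHS]eq_integral do rewrite epochsE.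
  by move=> m; apply/measurable_EFinP; exact: (measurableT_comp (measurable_win m) mp).
by rewrite -leeBlDl// -EFinB /l; congr (_%:E <= _)%E; ring.
Qed.

(** The double sum over ordered pairs m <= m', doubled; the diagonal is counted twice, hence an
    inequality. *)
Lemma sqr_sum_le (z : nat -> R) K : (forall m, 0 <= z m) ->
  (\sum_(m < K) z m) ^+ 2 <= \sum_(m < K) (2 * z m * \sum_(j < K - m) z (m + j)%N).
Proof.
elim: K z => [|K IH] z z0; first by rewrite !big_ord0 expr0n.
have {IH} := IH (fun m => z m.+1) (fun m => z0 _).
set A := \sum_(i < K) z i.+1; set C := \sum_(m < K) _ => H.
have E1 : \sum_(m < K.+1) z m = z 0%N + A by rewrite big_ord_recl.
have -> : \sum_(m < K.+1) 2 * z m * \sum_(j < K.+1 - m) z (m + j)%N = 2 * z 0%N * (z 0%N + A) + C.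
  by rewrite big_ord_recl -E1; congr (_ + _).
have A0 : 0 <= A by apply: sumr_ge0.
by rewrite E1; have := z0 0%N; nra.
Qed.

(* Layer-cake bound of [(t - y) * 1(s <= y < t)] by the indicators of the
   intervals [s, s + j l / K). *)
Lemma window_layers K (y : R) : (0 < K)%N -> s <= y -> y < t ->
  t - y <= l / K%:R * \sum_(j < K) ((s <= y) && (y < s + j.+1%:R * (l / K%:R)))%R%:R.
Proof.
move=> K0 sy yt; have l0 : 0 < l by rewrite subr_gt0.
have K0' : 0 < K%:R :> R by rewrite ltr0n.
pose h := l / K%:R; have h0 : 0 < h by rewrite divr_gt0.
rewrite -/h.
have ys0 : 0 <= (y - s) / h by rewrite divr_ge0 ?subr_ge0// ltW.
have /andP[h1 h2] := truncn_itv ys0.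
set q := Num.truncn _ in h1 h2.
have qy : q%:R * h <= y - s by rewrite -ler_pdivlMr.
have yq : y - s < q.+1%:R * h by rewrite -ltr_pdivrMr.
have lK : l = K%:R * h by rewrite /h mulrC divfK// gt_eqF.
have main (L : nat) : L%:R - q%:R <= \sum_(j < L) ((s <= y) && (y < s + j.+1%:R * h))%R%:R :> R.
  elim: L => [|L IH]; first by rewrite big_ord0 sub0r oppr_le0.
  rewrite big_ord_recr /=; have [qL|Lq] := leqP q L.
    have -> : (s <= y) && (y < s + L.+1%:R * h).
      rewrite sy /= -ltrBlDl; apply: lt_le_trans yq _.
      by rewrite ler_wpM2r ?(ltW h0)// ler_nat ltnS.
    by move: IH; rewrite -natr1 mulr1n; lra.
  apply: (@le_trans _ _ 0); first by rewrite subr_le0 ler_nat.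
  by apply: addr_ge0 => //; apply: sumr_ge0.
apply: le_trans (ler_wpM2l (ltW h0) (main K)).
by rewrite mulrBr; move: lK qy; rewrite /l ![_ * h]mulrC; lra.
Qed.

Lemma mean_min_ge0 : 0 <= mean_min.
Proof. by apply: fine_ge0; apply: integral_ge0 => w _; rewrite lee_fin le_min S_ge0 ltW. Qed.

(** Counts the epochs m + j before t, j = 0 included, when epoch m lies in the window; the condition
    is phrased with [psum] to separate it from the past of epoch m. *)
Let pairs m (x : option nat -> R) : R :=
  (win x m)%:R * \sum_(j < M) (psum x m j < t - epoch x m)%R%:R.

Lemma pairs_ge0 m x : 0 <= pairs m x.
Proof. by rewrite mulr_ge0 ?sumr_ge0. Qed.

Lemma measurable_pairs m : measurable_fun setT (fun x : path R (option nat) => pairs m x).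
Proof.
apply: measurable_funM; first exact: measurable_win.
apply: measurable_sum => j; apply: measurable_lt_bool; first exact: measurable_psum.
by apply: measurable_funB => //; exact: measurable_epoch.
Qed.

Lemma epochs_sqr_le x : epochs x ^+ 2 <= 2 * \sum_(m < M) pairs m x.
Proof.
apply: le_trans (sqr_sum_le (z := fun m => (win x m)%:R) M _) _ => //.
rewrite mulr_sumr; apply: ler_sum => m _; rewrite -mulrA ler_wpM2l// ler_wpM2l//.
rewrite -(big_mkord xpredT (fun j => (win x (m + j))%:R)).
rewrite -(big_mkord xpredT (fun j => (psum x m j < t - epoch x m)%R%:R)).
rewrite [leRHS](big_cat_nat (n := (M - m)%N))//= ?leq_subr//.
apply: ler_wpDr; first by rewrite big_nat sumr_ge0.
apply: ler_sum_nat => j _; rewrite ler_nat /win epochD ltrBrDl.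
by case: (_ <= _) => //=.
Qed.

(** The intervals of index at least m are independent of epoch m. Redrawing them and applying
    [renewal_bound] over the remaining time t - epoch m gives the bound. *)
Lemma pairs_mean m : (mean_min%:E * \int[P]_w (pairs m (Y^~ w))%:E <=
  \int[P]_w ((win (Y^~ w) m)%:R * (t - epoch (Y^~ w) m + b))%:E)%E.
Proof.
pose K (i : option nat) := if i is Some i0 then (m <= i0)%N else false.
have mf : measurable_fun setT (fun x : path R (option nat) => (pairs m x)%:E).
  by apply/measurable_EFinP; exact: measurable_pairs.
have f0 (x : path R (option nat)) : (0 <= (pairs m x)%:E)%E by rewrite lee_fin pairs_ge0.
rewrite (resample_integral K mY iY mf f0).
have mf2 : measurable_fun setT (fun z : T * T => (pairs m (fun i => if K i then Y i z.2 else Y i z.1))%:E).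
  apply: (measurableT_comp mf); apply: measurable_path => i.
  by case: (K i); [exact: (measurableT_comp (mY i) measurable_snd)|exact: (measurableT_comp (mY i) measurable_fst)].
have mi := @measurable_fun_fubini_tonelli_F _ _ _ _ _ P _ mf2 (fun z => f0 _).
rewrite -ge0_integralZl//; last 2 first.
- by move=> w _; apply: integral_ge0.
- by rewrite lee_fin mean_min_ge0.
have mw : measurable_fun setT (fun w => (win (Y^~ w) m)%:R : R).
  exact: (measurableT_comp (measurable_win m) mp).
have me : measurable_fun setT (fun w => epoch (Y^~ w) m).
  exact: (measurableT_comp (measurable_epoch m) mp).
apply: ge0_le_integral => //.
- by move=> w _; rewrite mule_ge0 ?lee_fin ?mean_min_ge0//; apply: integral_ge0.
- exact: measurable_funeM.
- apply/measurable_EFinP; apply: measurable_funM => //.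
  by apply: measurable_funD => //; exact: measurable_funB.
- move=> w _.
  have eE w' : epoch (fun i => if K i then Y i w' else Y i w) m = epoch (Y^~ w) m.
    rewrite /epoch; congr (_ + _); apply: eq_psum => i0 /andP[_ lm] /=.
    by rewrite leqNgt lm.
  have pE w' j : psum (fun i => if K i then Y i w' else Y i w) m j = psum (Y^~ w') m j.
    by apply: eq_psum => i0 /andP[ml _] /=; rewrite ml.
  rewrite (eq_integral (fun w' => ((win (Y^~ w) m)%:R : R)%:E *
     (\sum_(j < M) ((psum (Y^~ w') m j < t - epoch (Y^~ w) m)%R%:R : R)%:E))%E); last first.
    move=> w' _; rewrite sumEFin -EFinM; congr EFin; rewrite /pairs /win eE; congr (_ * _).
    by apply: eq_bigr => j _; rewrite pE.
  case: (boolP (win (Y^~ w) m)) => hw; last first.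
    rewrite mul0r; under eq_integral do rewrite mul0e.
    by rewrite integral0 mule0.
  rewrite mul1r; under eq_integral do rewrite mul1e.
  rewrite ge0_integral_sum//; last first.
    move=> j; apply/measurable_EFinP; apply: measurable_lt_bool => //.
    exact: (measurableT_comp (measurable_psum m j) mp).
  by apply: renewal_bound; rewrite subr_gt0; case/andP: hw.
Qed.

Lemma epochs_second_moment :
  (mean_min%:E * \int[P]_w (epochs (Y^~ w) ^+ 2)%:E <= (l ^+ 2 + l + 2 * b * l)%:E)%E.
Proof.
have l0 : 0 < l by rewrite subr_gt0.
(* The sum over K layers exceeds l^2 by l (l/K), at most l since K >= l; this is the middle term of
   the bound. *)
pose K := (Num.truncn l).+1; have K0 : 0 < K%:R :> R by rewrite ltr0n.
have lK : l <= K%:R by have /andP[_ /ltW] := truncn_itv (ltW l0).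
have mep : measurable_fun setT (fun w => epochs (Y^~ w)).
  by apply: measurable_sum => m; exact: (measurableT_comp (measurable_win m) mp).
have mpr m : measurable_fun setT (fun w => (pairs m (Y^~ w))%:E : \bar R).
  by apply/measurable_EFinP; exact: (measurableT_comp (measurable_pairs m) mp).
have m0 := mean_min_ge0.
pose lay m j w : R := ((s <= epoch (Y^~ w) m) && (epoch (Y^~ w) m < s + j.+1%:R * (l / K%:R)))%R%:R.
have mlay m j : measurable_fun setT (fun w => (lay m j w)%:E : \bar R).
  apply/measurable_EFinP; rewrite /lay.
  rewrite (_ : (fun w => _) = fun w => if (s <= epoch (Y^~ w) m) && (epoch (Y^~ w) m < s + j.+1%:R * (l / K%:R)) then 1 else 0); last first.
    by apply/funext => w; case: (_ && _).
  have me := measurableT_comp (measurable_epoch m) mp.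
  by apply: measurable_fun_ifT => //; apply: measurable_and; [exact: measurable_fun_ler|exact: measurable_fun_ltr].
have lay0 m j w : (0 <= (lay m j w)%:E)%E by rewrite lee_fin /lay ler0n.
have mw m : measurable_fun setT (fun w => ((win (Y^~ w) m)%:R : R)%:E).
  by apply/measurable_EFinP; exact: (measurableT_comp (measurable_win m) mp).
apply: (@le_trans _ _ (mean_min%:E * \int[P]_w (2%:E * \sum_(m < M) (pairs m (Y^~ w))%:E))%E).
  rewrite lee_wpmul2l ?lee_fin//; apply: ge0_le_integral => //.
  - by move=> w _; rewrite lee_fin sqr_ge0.
  - by apply/measurable_EFinP; exact: (measurableT_comp (@exprn_measurable R setT 2) mep).
  - by apply: measurable_funeM; apply: emeasurable_sum.
  - by move=> w _; rewrite sumEFin -EFinM lee_fin epochs_sqr_le.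
rewrite ge0_integralZl//; last 2 first.
- by apply: emeasurable_sum.
- by move=> w _; apply: sume_ge0 => m _; rewrite lee_fin pairs_ge0.
rewrite muleCA ge0_integral_sum//; last by move=> m w _; rewrite lee_fin pairs_ge0.
rewrite ge0_sume_distrr//; last first.
  by move=> m _; apply: integral_ge0 => w _; rewrite lee_fin pairs_ge0.
apply: (@le_trans _ _ (2%:E * \sum_(m < M) (b%:E * \int[P]_w ((win (Y^~ w) m)%:R : R)%:E +
    (l / K%:R)%:E * \sum_(j < K) \int[P]_w (lay m j w)%:E))%E).
  rewrite lee_wpmul2l//; apply: lee_sum => m _; apply: le_trans (pairs_mean m) _.
  rewrite -ge0_integral_sum// -!ge0_integralZl//; last 4 first.
  - by rewrite lee_fin ltW.
  - by apply: emeasurable_sum.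
  - by move=> w _; apply: sume_ge0.
  - by rewrite lee_fin divr_ge0// ltW.
  rewrite -ge0_integralD//; last 4 first.
  - by move=> w _; rewrite mule_ge0 ?lee_fin// ltW.
  - exact: measurable_funeM.
  - by move=> w _; rewrite mule_ge0 ?lee_fin ?divr_ge0 ?(ltW l0)//; apply: sume_ge0.
  - by apply: measurable_funeM; apply: emeasurable_sum.
  apply: ge0_le_integral => //.
  - move=> w _; rewrite lee_fin /win; case: (s <= _) => /=; last by rewrite mul0r.
    case: ltP => h; rewrite ?mul0r// mul1r addr_ge0// ?(ltW b0)// subr_ge0 ltW//.
  - apply/measurable_EFinP; apply: measurable_funM; first exact: (measurableT_comp (measurable_win m) mp).
    apply: measurable_funD => //; apply: measurable_funB => //.
    exact: (measurableT_comp (measurable_epoch m) mp).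
  - apply: emeasurable_funD; first exact: measurable_funeM.
    by apply: measurable_funeM; apply: emeasurable_sum.
  - move=> w _; rewrite sumEFin -!EFinM -EFinD lee_fin.
    have sl : 0 <= l / K%:R * \sum_(j < K) lay m j w.
      by rewrite mulr_ge0 ?divr_ge0 ?sumr_ge0// ltW.
    case: (boolP (win (Y^~ w) m)) => hw; last by rewrite mul0r mulr0 add0r.
    rewrite mul1r mulr1 addrC lerD2l; have /andP[h1 h2] := hw.
    exact: window_layers.
rewrite big_split /= -!ge0_sume_distrr//; last 2 first.
- by move=> m _; apply: sume_ge0 => j _; apply: integral_ge0.
- by move=> m _; apply: integral_ge0.
rewrite exchange_big /=.
apply: (@le_trans _ _ (2%:E * (b%:E * l%:E + (l / K%:R)%:E * \sum_(j < K) (j.+1%:R * (l / K%:R))%:E))%E).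
  rewrite lee_wpmul2l//; apply: leeD.
    rewrite lee_wpmul2l ?lee_fin ?(ltW b0)//.
    exact: (sum_win_le s0 (ltW st)).
  rewrite lee_wpmul2l ?lee_fin ?divr_ge0 ?(ltW l0)//; apply: lee_sum => j _.
  have h0 : 0 <= j.+1%:R * (l / K%:R) by rewrite mulr_ge0// divr_ge0// ltW.
  apply: le_trans (@sum_win_le s (s + j.+1%:R * (l / K%:R)) s0 _) _.
    by rewrite lerDl.
  by rewrite lee_fin addrAC subrr add0r.
rewrite sumEFin -(EFinM b) -(EFinM (l / K%:R)).
rewrite -EFinD.
rewrite -EFinM lee_fin -mulr_suml.
have gauss (L : nat) : 2 * \sum_(j < L) j.+1%:R = L%:R * (L%:R + 1) :> R.
  elim: L => [|L IH]; first by rewrite big_ord0 mulr0 mul0r.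
  by rewrite big_ord_recr /= mulrDr IH -natr1; ring.
rewrite mulrDr [X in _ + X](_ : _ = (l / K%:R) ^+ 2 * (2 * \sum_(j < K) j.+1%:R)); last by ring.
rewrite gauss (_ : (l / K%:R) ^+ 2 * _ = l ^+ 2 + l * (l / K%:R)); last by field; rewrite gt_eqF.
have : l * (l / K%:R) <= l by rewrite ler_piMr ?(ltW l0)// ler_pdivrMr// mul1r.
lra.
Qed.

End renewal.

(** * Maximal inequality for the service completions *)

Section blocks.
Context {R : realType}.
Implicit Types x : nat -> R.

Definition block x s l := \sum_(i < l) x (s + i)%N.

(** The squared sums over all dyadic subblocks of the block of length 2^L starting at s; any initial
    segment is a union of at most one subblock per level. *)
Fixpoint dyadic_squares x L s := if L is L'.+1 then
  dyadic_squares x L' s + dyadic_squares x L' (s + 2 ^ L')%N + block x s (2 ^ L'.+1) ^+ 2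
  else x s ^+ 2.

Lemma blockD x s l k : block x s (l + k) = block x s l + block x (s + l) k.
Proof.
rewrite /block big_split_ord /=; congr (_ + _).
by apply: eq_bigr => i _; rewrite addnA.
Qed.

Lemma block1 x s : block x s 1 = x s.
Proof. by rewrite /block big_ord1 addn0. Qed.

Lemma dyadic_ge0 x L s : 0 <= dyadic_squares x L s.
Proof.
by elim: L s => [|L IH] s /=; rewrite ?sqr_ge0 ?addr_ge0 ?sqr_ge0.
Qed.

Lemma block_sqr_dyadic x L s : block x s (2 ^ L) ^+ 2 <= dyadic_squares x L s.
Proof.
case: L => [|L] /=; first by rewrite block1.
by rewrite lerDr addr_ge0 ?dyadic_ge0.
Qed.

(* The Rademacher-Menshov inequality. *)
Lemma block_sqr_le x L s l : (l <= 2 ^ L)%N ->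
  block x s l ^+ 2 <= L.+1%:R * dyadic_squares x L s.
Proof.
elim: L s l => [|L IH] s l.
  case: l => [|[|//]] _; rewrite mul1r /=; last by rewrite block1.
  by rewrite /block big_ord0 expr0n /= sqr_ge0.
have h : (2 ^ L.+1 = 2 ^ L + 2 ^ L)%N by rewrite expnS mul2n addnn.
rewrite h => lL.
have [l1|l1] := leqP l (2 ^ L).
  apply: le_trans (IH _ _ l1) _.
  have d0 := dyadic_ge0 x L s; have d1 := dyadic_ge0 x L (s + 2 ^ L)%N.
  have b0 := sqr_ge0 (block x s (2 ^ L.+1)).
  apply: ler_pM => //=; first by rewrite ler_nat.
  by rewrite -addrA lerDl addr_ge0.
have -> : l = (2 ^ L + (l - 2 ^ L))%N by rewrite subnKC// ltnW.
rewrite blockD.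
have H1 := block_sqr_dyadic x L s.
have H2 : block x (s + 2 ^ L)%N (l - 2 ^ L) ^+ 2 <= L.+1%:R * dyadic_squares x L (s + 2 ^ L)%N.
  by apply: IH; rewrite leq_subLR.
have b0 := sqr_ge0 (block x s (2 ^ L.+1)).
move: H1 H2 b0 => /=; set a := block x s _; set c := block x _ _; set u := dyadic_squares _ _ _.
set v := dyadic_squares _ _ _; set g := block x s (2 ^ L.+1) ^+ 2 => H1 H2 g0.
have k0 : 0 < L.+1%:R :> R by rewrite ltr0n.
have -> : L.+2%:R = L.+1%:R + 1 :> R by rewrite -[in LHS]natr1.
set k : R := L.+1%:R in k0 H2 *.
(* The weights turn the constant k of the induction hypothesis into k + 1 on both halves, so the
   factor grows only linearly with the level. *)
have H3 : (a + c) ^+ 2 <= (1 + k) * a ^+ 2 + (1 + k^-1) * c ^+ 2.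
  rewrite -subr_ge0 (_ : _ - _ = k^-1 * (k * a - c) ^+ 2); last by field; rewrite gt_eqF.
  by rewrite mulr_ge0 ?sqr_ge0// invr_ge0 ltW.
have H4 : (1 + k^-1) * c ^+ 2 <= (k + 1) * v.
  have -> : (k + 1) * v = (1 + k^-1) * (k * v) by field; rewrite gt_eqF.
  by rewrite ler_wpM2l// addr_ge0 ?invr_ge0 ?ltW.
have H5 : (1 + k) * a ^+ 2 <= (k + 1) * u by rewrite addrC ler_wpM2l// addr_ge0 ?ltW.
apply: le_trans H3 (le_trans (lerD H5 H4) _).
rewrite -mulrDr ler_wpM2l//; last by rewrite lerDl.
by rewrite addr_ge0// ltW.
Qed.

End blocks.

Lemma markov_sum {R : realType} d (T : measurableType d) (P : probability T R)
    (f : nat -> T -> R) (c v : nat -> R) K :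
  (forall i, measurable_fun setT (f i)) -> (forall i w, 0 <= f i w) ->
  (forall i, 0 < c i) ->
  (forall i, (i < K)%N -> \int[P]_w (f i w)%:E <= (v i)%:E)%E ->
  exists B, [/\ measurable B, (P B <= (\sum_(i < K) v i / c i)%:E)%E &
    forall w, ~ B w -> forall i, (i < K)%N -> f i w <= c i].
Proof.
move=> mf f0 c0 fv.
pose B i := [set w | c i < f i w].
have mB i : measurable (B i).
  have -> : B i = f i @^-1` `]c i, +oo[%classic.
    by apply/seteqP; split => w; rewrite /B /= in_itv /= andbT.
  by rewrite -[X in measurable X]setTI; exact: mf.
exists (\big[setU/set0]_(i < K) B i); split; first exact: bigsetU_measurable.
  2: by rewrite -(bigcup_mkord K B) => w Bw i iK; rewrite leNgt; apply/negP => h; apply: Bw; exists i.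
apply: (@le_trans _ _ (\sum_(i < K) P (B i))%E).
  exact: (@Boole_inequality _ _ _ P B K (fun i _ => mB i)).
rewrite -sumEFin; apply: lee_sum => i _.
rewrite EFinM lee_pdivlMr//.
apply: le_trans (fv i (ltn_ord i)).
rewrite -[X in (P X)]setIT -integral_indic// muleC -ge0_integralZl//; last 2 first.
- by apply/measurable_EFinP; exact: measurable_indic.
- by rewrite lee_fin ltW.
apply: ge0_le_integral => //.
- by move=> w _; rewrite mule_ge0// lee_fin ltW.
- by apply: measurable_funeM; apply/measurable_EFinP; exact: measurable_indic.
- exact/measurable_EFinP.
- move=> w _; rewrite -EFinM lee_fin indicE; case: (boolP (w \in B i)) => h.
    by rewrite mulr1; move: h; rewrite inE /B /= => /ltW.
  by rewrite mulr0.
Qed.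

Section maximal.
Context {R : realType} d (T : measurableType d) (P : probability T R).
Variables (x : nat -> T -> R) (H : nat) (v : nat -> R).
Hypothesis mx : forall i, measurable_fun setT (x i).
Hypothesis v0 : forall l, 0 <= v l.
Hypothesis v2 : forall l, 2 * v l <= v (l + l)%N.
Hypothesis xv : forall s l, (0 < l)%N -> (s + l <= H)%N ->
  (\int[P]_w (block (x^~ w) s l ^+ 2)%:E <= (v l)%:E)%E.

Let mblock s l : measurable_fun setT (fun w => block (x^~ w) s l ^+ 2).
Proof.
apply: (measurableT_comp (@exprn_measurable R setT 2)).
by apply: measurable_sum.
Qed.

Lemma measurable_dyadic_squares L s : measurable_fun setT (fun w => dyadic_squares (x^~ w) L s).
Proof.
elim: L s => [|L IH] s; first exact: (measurableT_comp (@exprn_measurable R setT 2) (mx s)).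
by apply: measurable_funD; [exact: measurable_funD|exact: mblock].
Qed.

(** By [v2], the blocks of one dyadic level together contribute at most v (2^L), and there are L + 1
    levels. *)
Lemma dyadic_mean_le L s : (s + 2 ^ L <= H)%N ->
  (\int[P]_w (dyadic_squares (x^~ w) L s)%:E <= (L.+1%:R * v (2 ^ L)%N)%:E)%E.
Proof.
elim: L s => [|L IH] s sL.
  have := xv (ltn0Sn 0) sL; rewrite mul1r.
  by under eq_integral do rewrite block1.
have h : (2 ^ L.+1 = 2 ^ L + 2 ^ L)%N by rewrite expnS mul2n addnn.
have h1 : (s + 2 ^ L <= H)%N.
  by apply: leq_trans sL; rewrite leq_add2l h leq_addr.
have h2 : (s + 2 ^ L + 2 ^ L <= H)%N by rewrite -addnA -h.
have /= I1 := IH _ h1; have /= I2 := IH _ h2.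
have I3 := xv (expn_gt0 2 L.+1) sL.
have md L' s' : measurable_fun setT (fun w => (dyadic_squares (x^~ w) L' s')%:E : \bar R).
  by apply/measurable_EFinP; exact: measurable_dyadic_squares.
rewrite /=; under eq_integral do rewrite !EFinD.
rewrite ge0_integralD//; last 4 first.
- by move=> w _; rewrite -EFinD lee_fin addr_ge0 ?dyadic_ge0.
- exact: emeasurable_funD.
- by move=> w _; rewrite lee_fin sqr_ge0.
- by apply/measurable_EFinP; exact: mblock.
rewrite ge0_integralD//; last 2 first.
- by move=> w _; rewrite lee_fin dyadic_ge0.
- by move=> w _; rewrite lee_fin dyadic_ge0.
apply: le_trans (leeD (leeD I1 I2) I3) _.
rewrite -!EFinD lee_fin h.
have H1 : L.+1%:R * (2 * v (2 ^ L)%N) <= L.+1%:R * v (2 ^ L + 2 ^ L)%N :> R by rewrite ler_wpM2l.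
by rewrite -[L.+2%:R](natr1 L.+1); lra.
Qed.

Lemma maximal_inequality (c : nat -> R) K : (2 ^ K <= H)%N -> (forall L, 0 < c L) ->
  exists B, [/\ measurable B,
    (P B <= (\sum_(L < K.+1) L.+1%:R ^+ 2 * v (2 ^ L)%N / c L)%:E)%E &
    forall w, ~ B w -> forall L, (L <= K)%N -> L.+1%:R * dyadic_squares (x^~ w) L 0 <= c L].
Proof.
move=> KH c0; apply: (@markov_sum _ _ _ P (fun L w => L.+1%:R * dyadic_squares (x^~ w) L 0) c
  (fun L => L.+1%:R ^+ 2 * v (2 ^ L)%N)) => //.
- by move=> L; apply: measurable_funM => //; exact: measurable_dyadic_squares.
- by move=> L w; rewrite mulr_ge0 ?dyadic_ge0.
- move=> L LK.
  have LH : (0 + 2 ^ L <= H)%N by rewrite add0n; apply: leq_trans KH; rewrite leq_exp2l.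
  under eq_integral do rewrite EFinM.
  rewrite ge0_integralZl//; last 2 first.
  - by apply/measurable_EFinP; exact: measurable_dyadic_squares.
  - by move=> w _; rewrite lee_fin dyadic_ge0.
  apply: (@le_trans _ _ (L.+1%:R%:E * (L.+1%:R * v (2 ^ L)%N)%:E)%E).
    by rewrite lee_wpmul2l ?lee_fin//; exact: dyadic_mean_le.
  by rewrite -EFinM lee_fin expr2 mulrA.
Qed.

End maximal.

Lemma sum_sqr_geometric {R : realType} (y : R) : 0 < y -> y < 1 ->
  exists2 C, 0 < C & forall K, \sum_(L < K) L.+1%:R ^+ 2 * y ^+ L <= C.
Proof.
move=> y0 y1; have z0 : 0 < 1 - y by rewrite subr_gt0.
pose a := (1 - y)^-1; pose b := (2 + 2 * a) / (1 - y); pose c := (1 + a + b) / (1 - y).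
have a0 : 0 < a by rewrite invr_gt0.
have b0 : 0 < b by rewrite divr_gt0// addr_gt0// mulr_gt0.
have c0 : 0 < c by rewrite divr_gt0// !addr_gt0.
have Ea : a * (1 - y) = 1 by rewrite mulVf// gt_eqF.
have Eb : b * (1 - y) = 2 + 2 * a by rewrite divfK// gt_eqF.
have Ec : c * (1 - y) = 1 + a + b by rewrite divfK// gt_eqF.
(* The coefficients make u L - u L.+1 dominate (L+1)^2 y^L; the sum telescopes and is at most u 0 =
   c. *)
pose u (L : nat) := y ^+ L * (a * L%:R ^+ 2 + b * L%:R + c).
have uS L : L.+1%:R ^+ 2 * y ^+ L <= u L - u L.+1.
  rewrite /u (exprS y) -!(natr1 L); have l0 : 0 <= L%:R :> R by [].
  set l : R := L%:R in l0 *; set z := y ^+ L.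
  rewrite (_ : _ - _ = z * ((a * (1 - y)) * l ^+ 2 + (b * (1 - y) - 2 * a * y) * l + (c * (1 - y) - (a + b) * y))); last by ring.
  have zz : 0 <= z by rewrite exprn_ge0// ltW.
  rewrite mulrC ler_wpM2l// Ea Eb Ec.
  nra.
exists c => // K; apply: (@le_trans _ _ (c - u K)); last first.
  rewrite lerBlDr lerDl mulr_ge0 ?exprn_ge0 ?(ltW y0)//.
  by rewrite addr_ge0 ?(ltW c0)// addr_ge0// mulr_ge0 ?sqr_ge0 ?(ltW a0) ?(ltW b0).
elim: K => [|K IH]; first by rewrite big_ord0 /u mul1r expr0n /= !mulr0 !add0r subrr.
by rewrite big_ord_recr /=; have := uS K; lra.
Qed.

Section bounded.
Context {R : realType} d (T : measurableType d) (P : probability T R).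

Definition bounded_rv (f : T -> R) :=
  measurable_fun setT f /\ exists C, forall w, `|f w| <= C.

Lemma bounded_rvD f g : bounded_rv f -> bounded_rv g -> bounded_rv (fun w => f w + g w).
Proof.
move=> [mf [C hC]] [mg [D hD]]; split; first exact: measurable_funD.
by exists (C + D) => w; apply: le_trans (ler_normD _ _) _; rewrite lerD.
Qed.

Lemma bounded_rvM f g : bounded_rv f -> bounded_rv g -> bounded_rv (fun w => f w * g w).
Proof.
move=> [mf [C hC]] [mg [D hD]]; split; first exact: measurable_funM.
by exists (C * D) => w; rewrite normrM ler_pM.
Qed.

Lemma bounded_rv_cst c : bounded_rv (fun=> c).
Proof. by split => //; exists `|c|. Qed.

Lemma bounded_rv_sum K (f : nat -> T -> R) : (forall k, (k < K)%N -> bounded_rv (f k)) ->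
  bounded_rv (fun w => \sum_(k < K) f k w).
Proof.
elim: K => [|K IH] fb.
  by under eq_fun do rewrite big_ord0; exact: bounded_rv_cst.
under eq_fun do rewrite big_ord_recr /=.
by apply: bounded_rvD; [apply: IH => k kK; apply: fb; exact: ltnW|exact: fb].
Qed.

Lemma bounded_rv_integrable f : bounded_rv f -> P.-integrable setT (EFin \o f).
Proof. by move=> [mf [C hC]]; exact: bounded_integrable hC. Qed.

Lemma bounded_meanE f : bounded_rv f -> (\int[P]_w (f w)%:E = (Rintegral P setT f)%:E)%E.
Proof.
move=> bf; rewrite /Rintegral fineK//; apply: integrable_fin_num => //.
exact: bounded_rv_integrable.
Qed.

Lemma mean_cst c : Rintegral P setT (fun=> c) = c.
Proof. by rewrite /Rintegral integral_cst//= probability_setT mule1. Qed.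

Lemma meanD f g : bounded_rv f -> bounded_rv g ->
  Rintegral P setT (fun w => f w + g w) = Rintegral P setT f + Rintegral P setT g.
Proof. by move=> bf bg; apply: RintegralD => //; exact: bounded_rv_integrable. Qed.

Lemma meanZ c f : bounded_rv f ->
  Rintegral P setT (fun w => c * f w) = c * Rintegral P setT f.
Proof. by move=> bf; apply: RintegralZl => //; exact: bounded_rv_integrable. Qed.

End bounded.

Section independent_mean.
Context {R : realType} {I : choiceType} d (T : measurableType d) (P : probability T R).
Variable X : I -> T -> R.
Hypotheses (mX : forall i, measurable_fun setT (X i)) (iX : mutually_independent P X).
Variable K : pred I.
Variables f g : path R I -> R.
Hypotheses (bf : bounded_rv f) (bg : bounded_rv g).
Hypothesis fK : forall x y, (forall i, ~~ K i -> x i = y i) -> f x = f y.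
Hypothesis gK : forall x y, (forall i, K i -> x i = y i) -> g x = g y.

Lemma bounded_rv_path (h : path R I -> R) : bounded_rv h -> bounded_rv (fun w => h (X^~ w)).
Proof.
move=> [mh [C hC]]; split; last by exists C.
exact: (measurableT_comp mh (measurable_path mX)).
Qed.

Lemma mean_independent :
  Rintegral P setT (fun w => f (X^~ w) * g (X^~ w)) =
  Rintegral P setT (fun w => f (X^~ w)) * Rintegral P setT (fun w => g (X^~ w)).
Proof.
have [mf [C hC]] := bf; have [mg [D hD]] := bg.
have bf' := bounded_rv_path bf; have bg' := bounded_rv_path bg.
(* Resampling is available for nonnegative integrands; the shifts by C and D are removed by
   linearity at the end. *)
have f0 x : 0 <= C + f x by have := hC x; rewrite ler_norml => /andP[]; lra.
have g0 x : 0 <= D + g x by have := hD x; rewrite ler_norml => /andP[]; lra.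
pose h x : \bar R := ((C + f x) * (D + g x))%:E.
have mh : measurable_fun setT h.
  by apply/measurable_EFinP; apply: measurable_funM; apply: measurable_funD.
have h0 x : (0 <= h x)%E by rewrite lee_fin mulr_ge0.
have bC := bounded_rvD (bounded_rv_cst T C) bf'.
have bD := bounded_rvD (bounded_rv_cst T D) bg'.
have := resample_integral K mX iX mh h0.
rewrite (bounded_meanE P (bounded_rvM bC bD)).
have -> : (\int[P]_w \int[P]_w' h (fun i => if K i then X i w' else X i w) =
   \int[P]_w ((C + f (X^~ w)) * (D + Rintegral P setT (fun w => g (X^~ w))))%:E)%E.
  apply: eq_integral => w _.
  transitivity (\int[P]_w' ((C + f (X^~ w)) * (D + g (X^~ w')))%:E)%E.
    apply: eq_integral => w' _; rewrite /h; congr ((_ + _) * (_ + _))%:E.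
      by apply: fK => i /negbTE ->.
    by apply: gK => i ->.
  rewrite (bounded_meanE P (bounded_rvM (bounded_rv_cst T _) bD)); congr EFin.
  rewrite (meanZ _ _ bD) (meanD _ (bounded_rv_cst T D) bg'); congr (_ * (_ + _)).
  exact: mean_cst.
rewrite (bounded_meanE P (bounded_rvM bC (bounded_rv_cst T _))) => -[].
set m := Rintegral P setT (fun w => g _).
have -> : (fun w => (C + f (X^~ w)) * (D + m)) = (fun w => (D + m) * (C + f (X^~ w))).
  by apply/funext => w; rewrite mulrC.
rewrite (meanZ _ _ bC) (meanD _ (bounded_rv_cst T C) bf') mean_cst.
have -> : (fun w => (C + f (X^~ w)) * (D + g (X^~ w))) =
  (fun w => f (X^~ w) * g (X^~ w) + (D * f (X^~ w) + (C * D + C * g (X^~ w)))).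
  by apply/funext => w; ring.
have b1 := bounded_rvM (bounded_rv_cst T D) bf'.
have b2 := bounded_rvM (bounded_rv_cst T C) bg'.
rewrite (meanD _ (bounded_rvM bf' bg')); last first.
  by apply: bounded_rvD => //; apply: bounded_rvD => //; exact: bounded_rv_cst.
rewrite (meanD _ b1); last by apply: bounded_rvD => //; exact: bounded_rv_cst.
rewrite (meanD _ (bounded_rv_cst T (C * D)) b2) mean_cst !meanZ// -/m.
by set F := Rintegral P setT (fun w => f _); lra.
Qed.

End independent_mean.

(** * Variance of a stationary renewal count with 1 + eps moments *)

Section variance.
Context {R : realType} d0 (T0 : measurableType d0) (P0 : probability T0 R).
Variable S : {RV P0 >-> R}.
Hypotheses (S_ge0 : forall w, 0 <= S w) (ES : (\int[P0]_w (S w)%:E = 1)%E).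
Variable eps : R.
Hypotheses (eps_gt0 : 0 < eps).
Variable CS : R.
Hypothesis momentS : (\int[P0]_w (S w `^ (1 + eps))%:E = CS%:E)%E.

(** On S > b one has S <= b^(-eps) S^(1+eps), so truncation at b loses at most b^(-eps) CS of the
    mean 1. *)
Lemma mean_min_ge (b : R) : 0 < b -> 1 <= mean_min S b + b `^ (- eps) * CS.
Proof.
move=> b0; rewrite -lee_fin EFinD EFinM -(mean_minE S_ge0 b0) -momentS -ES.
have mS : measurable_fun setT S by [].
have mp : measurable_fun setT (fun w => (S w `^ (1 + eps))%:E : \bar R).
  by apply/measurable_EFinP; exact: (measurableT_comp (measurable_powR _)).
have mm : measurable_fun setT (fun w => (Num.min (S w) b)%:E : \bar R).
  by apply/measurable_EFinP; exact: measurable_minr.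
rewrite -ge0_integralZl//; last 2 first.
- by move=> w _; rewrite lee_fin powR_ge0.
- by rewrite lee_fin powR_ge0.
rewrite -ge0_integralD//; last 3 first.
- by move=> w _; rewrite lee_fin le_min S_ge0 ltW.
- by move=> w _; rewrite -EFinM lee_fin mulr_ge0 ?powR_ge0.
- exact: measurable_funeM.
apply: ge0_le_integral => //.
- by move=> w _; rewrite lee_fin.
- exact/measurable_EFinP.
- by apply: emeasurable_funD => //; exact: measurable_funeM.
- move=> w _; rewrite -EFinM -EFinD lee_fin.
  have [h|h] := leP (S w) b; first by rewrite lerDl mulr_ge0 ?powR_ge0.
  have s0 : 0 < S w := lt_trans b0 h.
  apply: (@le_trans _ _ (b `^ (- eps) * S w `^ (1 + eps))); last by rewrite lerDr ltW.
  rewrite powRD ?(gt_eqF s0) ?implybT// powRr1 ?(ltW s0)// powRN.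
  rewrite mulrCA ler_peMr ?(ltW s0)//.
  by rewrite mulrC ler_pdivlMr ?powR_gt0// mul1r ge0_ler_powR ?nnegrE ?(ltW eps_gt0) ?(ltW s0) ?(ltW b0)// ltW.
Qed.

Definition renewal_data d (T : measurableType d) (P : probability T R) (Y : option nat -> T -> R) :=
  [/\ (forall i, measurable_fun setT (Y i)) /\ mutually_independent P Y,
    forall i w, 0 <= Y i w,
    forall m, same_law P P0 (Y (Some m)) S &
    same_law P (equilibriumP S_ge0 ES) (Y None) (@residual R d0 T0)].

Lemma epochs_ge0 M s t (x : option nat -> R) : 0 <= epochs M s t x.
Proof. by rewrite /epochs sumr_ge0. Qed.

Lemma epochs_le M s t (x : option nat -> R) : epochs M s t x <= M%:R.
Proof.
apply: (@le_trans _ _ (\sum_(m < M) 1)); last by rewrite sumr_const card_ord.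
by apply: ler_sum => m _; case: (_ && _).
Qed.

Lemma measurable_epochs M s t :
  measurable_fun setT (fun x : path R (option nat) => epochs M s t x).
Proof. by apply: measurable_sum => m; exact: measurable_win. Qed.

Lemma bounded_epochs M s t : bounded_rv (fun x : path R (option nat) => epochs M s t x).
Proof.
split; first exact: measurable_epochs.
by exists M%:R => x; rewrite ger0_norm ?epochs_ge0 ?epochs_le.
Qed.

(** Monotone convergence: E min (S_M, t) increases to t. Keeping only M epochs thus costs an
    arbitrarily small bias [ka], and every count remains a bounded variable. *)
Lemma renewal_mean_cvg d (T : measurableType d) (P : probability T R) (Y : option nat -> T -> R)
    (t ka : R) : renewal_data P Y ->
  (forall w u, exists m, u < psum (Y^~ w) 0 m) -> 0 <= t -> 0 < ka ->
  \forall M \near \oo, ((t - ka)%:E <= \int[P]_w (Num.min (psum (Y^~ w) 0 M) t)%:E)%E.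
Proof.
move=> [[mY iY] Y0 YS Yr] unb t0 ka0.
pose g M w := (Num.min (psum (Y^~ w) 0 M) t)%:E.
have mg M : measurable_fun setT (g M).
  apply/measurable_EFinP; apply: measurable_minr => //.
  exact: (measurableT_comp (measurable_psum 0 M) (measurable_path mY)).
have pnd w : {homo (psum (Y^~ w) 0) : m n / (m <= n)%N >-> m <= n}.
  by apply/nondecreasing_seqP => m; rewrite psumS lerDl.
have gnd w : setT w -> nondecreasing_seq (g^~ w).
  move=> _ m n mn; rewrite lee_fin le_min !ge_min lexx orbT andbT.
  by rewrite pnd.
have g0 M w : setT w -> (0 <= g M w)%E.
  by move=> _; rewrite lee_fin le_min t0 andbT sumr_ge0.
have := cvg_monotone_convergence measurableT mg g0 gnd (mu := P).
have -> : (\int[P]_w limn (g^~ w) = t%:E)%E.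
  transitivity (\int[P]_w t%:E)%E; last by rewrite integral_cst//= probability_setT mule1.
  apply: eq_integral => w _; apply/cvg_lim => //.
  have [m hm] := unb w t.
  apply: cvg_near_cst; exists m => // M /= mM; rewrite /g (min_idPr _)//.
  exact: le_trans (ltW hm) (pnd _ _ _ mM).
move=> H.
have : \forall M \near \oo, (((t - ka)%:E < \int[P]_w g M w)%E).
  have hn : nbhs t%:E [set y | ((t - ka)%:E < y)%E].
    by apply: open_nbhs_nbhs; split; [exact: open_ereal_gt_ereal|rewrite /= lte_fin; lra].
  exact: H _ hn.
by apply: filterS => M /ltW.
Qed.

Hypothesis eps_le1 : eps <= 1.

Lemma epochs_variance (q : R) : 0 < q -> q <= eps / 2 ->
  exists2 C, 0 < C & forall d (T : measurableType d) (P : probability T R)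
      (Y : option nat -> T -> R) M (s t ka : R), renewal_data P Y ->
    0 <= s -> s < t -> ka <= 1 ->
    ((t - ka)%:E <= \int[P]_w (Num.min (psum (Y^~ w) 0 M) t)%:E)%E ->
    Rintegral P setT (fun w => (epochs M s t (Y^~ w) - (t - s)) ^+ 2) <=
      C * ((t - s) * (1 + (t - s)) `^ (1 - q)).
Proof.
move=> q0 qe; have qh : q <= 2^-1 by have := eps_le1; lra.
have CS0 : 0 <= CS.
  by rewrite -lee_fin -momentS; apply: integral_ge0 => w _; rewrite lee_fin powR_ge0.
have D0 : 0 < 2 * CS + 1 by lra.
(* Makes b0^(-eps) CS at most 1/2, so that [mean_min] is at least 1/2 and may be divided by. *)
pose b0 := (2 * CS + 1) `^ eps^-1.
have b00 : 0 < b0 by exact: powR_gt0.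
exists (5 + 4 * b0); first by lra.
move=> d T P Y M s t ka rY s0 st ka1 mM.
have [[mY iY] Y0 YS Yr] := rY.
set l := t - s; have l0 : 0 < l by rewrite subr_gt0.
set w := 1 + l; have w1 : 1 <= w by rewrite lerDl ltW.
have w0 : 0 < w by lra.
(* Truncation at order sqrt (1 + l): the overshoot costs b l and the lost mean costs l^2 b^(-eps),
   and both are at most of order l (1 + l)^(1-q) because q <= eps/2 <= 1/2. *)
pose b := b0 * w `^ 2^-1.
have bb : 0 < b by rewrite mulr_gt0 ?powR_gt0.
have be := epochs_second_moment mY iY Y0 YS Yr bb M s0 st.
have := mean_min_ge bb.
set mm := mean_min S b in be *; set z := _ * CS => hm.
have hz : z <= 2^-1 * w `^ (- q).
  have -> : z = w `^ (- (eps / 2)) * (CS / (2 * CS + 1)).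
    rewrite /z /b powRM ?powR_ge0// /b0 -!powRrM mulrN mulVf ?gt_eqF// powR_inv1 ?(ltW D0)//.
    rewrite mulrN [2^-1 * eps]mulrC; ring.
  rewrite [leLHS]mulrC; apply: ler_pM => //.
  - by rewrite divr_ge0// ltW.
  - exact: powR_ge0.
  - by rewrite ler_pdivrMr//; lra.
  - by rewrite ler_powR// lerN2.
have wq1 : w `^ (- q) <= 1.
  by rewrite -[leRHS](powRr0 w) ler_powR// oppr_le0 ltW.
have wq0 : 0 < w `^ (- q) by rewrite powR_gt0.
have wE : w * w `^ (- q) = w `^ (1 - q).
  by rewrite powRD ?(gt_eqF w0) ?implybT// powRr1// ltW.
have wq : 1 <= w `^ (1 - q).
  by rewrite -[leLHS](powRr0 w) ler_powR//; lra.
have wh : w `^ 2^-1 <= w `^ (1 - q) by rewrite ler_powR//; lra.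
have z0 : 0 <= z by rewrite mulr_ge0 ?powR_ge0.
set N := fun w => epochs M s t (Y^~ w).
have bN : bounded_rv N by apply: (bounded_rv_path mY); exact: bounded_epochs.
have bN2 : bounded_rv (fun w => N w * N w) := bounded_rvM bN bN.
have m1 := epochs_mean_le mY iY Y0 YS Yr M s0 st.
have m2 := epochs_mean_ge mY iY Y0 YS Yr s0 st mM.
rewrite (bounded_meanE P bN) !lee_fin -/l in m1 m2.
have beE : (\int[P]_w (epochs M s t (Y^~ w) ^+ 2)%:E = (Rintegral P setT (fun w => N w * N w))%:E)%E.
  by rewrite -(bounded_meanE P bN2).
rewrite beE -EFinM lee_fin -/l in be.
have -> : (fun w => (N w - l) ^+ 2) = (fun w => N w * N w + ((- 2 * l) * N w + l ^+ 2)).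
  by apply/funext => w'; ring.
have bc := bounded_rv_cst T (l ^+ 2).
have bl := bounded_rvM (bounded_rv_cst T (-2 * l)) bN.
rewrite (meanD P bN2 (bounded_rvD bl bc)) (meanD P bl bc) (meanZ P _ bN) mean_cst.
set m := Rintegral P setT N in m1 m2 *; set V := Rintegral P setT _ in be *.
have lw : l <= w by rewrite /w; lra.
set W := w `^ (1 - q) in wE wq wh *.
have bw : b <= b0 * W by rewrite ler_wpM2l// ltW.
have mm2 : 2^-1 <= mm by lra.
have VV : V <= (l ^+ 2 + l + 2 * b * l) * (1 + 2 * z).
  have A0 : 0 <= l ^+ 2 + l + 2 * b * l.
    by have := mulr_ge0 (ltW bb) (ltW l0); have := sqr_ge0 l; lra.
  apply: (@le_trans _ _ ((l ^+ 2 + l + 2 * b * l) / mm)).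
    by rewrite ler_pdivlMr ?(lt_le_trans _ mm2)// mulrC.
  rewrite ler_wpM2l// -[leLHS]mul1r ler_pdivrMr ?(lt_le_trans _ mm2)//.
  by nra.
have z1 : 2 * z <= w `^ (- q) by lra.
have e1 : l ^+ 2 * (2 * z) <= l * W.
  apply: (@le_trans _ _ (l ^+ 2 * w `^ (- q))); first by rewrite ler_wpM2l ?sqr_ge0.
  rewrite expr2 -mulrA ler_wpM2l ?(ltW l0)// -wE ler_wpM2r ?(ltW wq0)//.
have e2 : (l + 2 * b * l) * (1 + 2 * z) <= 2 * l + 4 * b * l.
  have : 0 <= l + 2 * b * l by have := mulr_ge0 (ltW bb) (ltW l0); lra.
  move=> p0; have z2 : 2 * z <= 1 := le_trans z1 wq1.
  by rewrite (_ : 2 * l + 4 * b * l = (l + 2 * b * l) * 2); [rewrite ler_wpM2l//; lra|ring].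
have e3 : b * l <= b0 * (l * W).
  by rewrite [leRHS]mulrCA [leLHS]mulrC ler_wpM2l ?(ltW l0).
have e4 : l <= l * W by rewrite ler_peMr// ltW.
have e5 : - 2 * l * m + l ^+ 2 <= - l ^+ 2 + 2 * l by nra.
have e6 : V <= l ^+ 2 + l ^+ 2 * (2 * z) + (l + 2 * b * l) * (1 + 2 * z).
  by apply: le_trans VV _; rewrite le_eqVlt; apply/orP; left; apply/eqP; ring.
lra.
Qed.

End variance.

Section epochs_lemmas.
Context {R : realType}.
Implicit Types x : option nat -> R.

Lemma epochsD M (a b c : R) x : a <= b -> b <= c ->
  epochs M a c x = epochs M a b x + epochs M b c x.
Proof.
move=> ab bc; rewrite /epochs -big_split /=; apply: eq_bigr => m _; rewrite -natrD; congr (_%:R).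
case: (leP b (epoch x m)) => h1 /=; first by rewrite (le_trans ab h1) andbF.
by rewrite (lt_le_trans h1 bc) andbT addn0.
Qed.

Lemma epochs_ler M (a b c : R) x : a <= b -> b <= c -> epochs M b c x <= epochs M a c x.
Proof. by move=> ab bc; rewrite (epochsD _ _ ab bc) lerDr epochs_ge0. Qed.

Lemma epochs_nil M (a : R) x : epochs M a a x = 0.
Proof.
by rewrite /epochs big1// => m _; case: (leP a (epoch x m)).
Qed.

End epochs_lemmas.

Lemma near_forall_lt (N : nat) (Q : nat -> nat -> Prop) :
  (forall k, (k < N)%N -> \forall M \near \oo, Q k M) ->
  \forall M \near \oo, forall k, (k < N)%N -> Q k M.
Proof.
elim: N => [|N IH] H; first by near=> M.
have := IH (fun k kN => H k (ltnW kN)); have := H N (ltnSn N).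
apply: filterS2 => M h1 h2 k; rewrite ltnS leq_eqVlt => /predU1P[->//|].
exact: h2.
Unshelve. all: by end_near. Qed.

Lemma near_powRN {R : realType} (c r e : R) : 0 < r -> 0 < e ->
  \forall N \near \oo, c * N%:R `^ (- r) <= e.
Proof.
move=> r0 e0; pose y := (`|c| / e) `^ r^-1.
exists (Num.truncn y).+1 => // N /= hN.
have y0 : 0 <= y := powR_ge0 _ _.
have /andP[_ yN] := truncn_itv y0.
have {}yN : y < N%:R by apply: lt_le_trans yN _; rewrite ler_nat.
have N0 : 0 < N%:R :> R by exact: le_lt_trans yN.
rewrite powRN ler_pdivrMr ?powR_gt0//; apply: le_trans (ler_norm c) _.
rewrite mulrC -ler_pdivrMr//.
have -> : `|c| / e = y `^ r by rewrite /y -powRrM mulVf ?gt_eqF// powRr1// divr_ge0// ltW.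
by rewrite ge0_ler_powR ?nnegrE ?(ltW r0) ?(ltW N0) ?(ltW yN).
Qed.

Lemma powR_geometric {R : realType} (h q : R) L : 0 <= h ->
  (h * (2 ^ L)%:R) `^ (- q) = h `^ (- q) * (2 `^ (- q)) ^+ L.
Proof.
move=> h0; rewrite powRM//; congr (_ * _).
by rewrite natrX -(powR_mulrn _ (powR_ge0 _ _)) -(powR_mulrn _ (ler0n R 2)) -!powRrM mulrC.
Qed.

(** * Uniform lower bound for the completions of N servers *)

Section servers.
Context {R : realType} d0 (T0 : measurableType d0) (P0 : probability T0 R).
Variable S : {RV P0 >-> R}.
Hypotheses (S_ge0 : forall w, 0 <= S w) (ES : (\int[P0]_w (S w)%:E = 1)%E).

Definition server_times (k : nat) (z : prim -> R) (o : option nat) : R :=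
  if o is Some m then z (inr (inl (k, m))) else z (inr (inr k)).

Definition servers_data N d (T : measurableType d) (P : probability T R) (W : prim -> T -> R) :=
  [/\ (forall i, measurable_fun setT (W i)) /\ mutually_independent P W,
    forall i w, 0 <= W i w,
    forall k m, same_law P P0 (W (inr (inl (k, m)))) S,
    forall k, (k < N)%N -> same_law P (equilibriumP S_ge0 ES) (W (inr (inr k))) (@residual R d0 T0) &
    forall w k t, exists m, t < rsum (fun l => W (inr (inl (k, l))) w) m].

Definition served_by k (i : prim) : bool :=
  match i with inl _ => false | inr (inl (k', _)) => k' == k | inr (inr k') => k' == k end.

Section fixed.
Context d (T : measurableType d) (P : probability T R) (W : prim -> T -> R) (N : nat).
Hypothesis sW : servers_data N P W.

Lemma server_renewal k : (k < N)%N ->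
  renewal_data S_ge0 ES P (fun o w => server_times k (W^~ w) o).
Proof.
have [[mW iW] W0 WS WR _] := sW.
pose h (o : option nat) : prim := if o is Some m then inr (inl (k, m)) else inr (inr k).
have hI : injective h by case=> [m|] [m'|] //= [] ->.
have hE o : (fun w => server_times k (W^~ w) o) = W (h o) by case: o.
move=> kN; split.
- split; first by move=> o; rewrite hE.
  rewrite (_ : (fun o w => _) = fun o => W (h o)); last by apply/funext.
  exact: reindex_independent.
- by move=> o w; case: o => [m|] /=.
- by move=> m; exact: WS.
- exact: WR.
Qed.

Lemma measurable_server_times k : measurable_fun setT (fun z : path R prim => (server_times k z : path R (option nat))).
Proof. by apply: (@measurable_path R _ _ (path R prim) (fun o z => server_times k z o)) => -[m|]; exact: measurable_coord. Qed.

Let cnt M s t k (z : prim -> R) := epochs M s t (server_times k z) - (t - s).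

Lemma bounded_cnt M s t k : bounded_rv (cnt M s t k : path R prim -> R).
Proof.
have [me [C hC]] := @bounded_epochs R M s t.
rewrite /cnt; apply: bounded_rvD; last exact: bounded_rv_cst.
split; first exact: (measurableT_comp me (measurable_server_times k)).
by exists C => z; exact: hC.
Qed.

Let mean (f : T -> R) := Rintegral P setT f.

(** Distinct servers are independent, so a cross term is a product of means. The means are not 0,
    because only M epochs are kept; this bias gives the term (K ka)^2. *)
Lemma total_variance M (s t v ka : R) K : (K <= N)%N -> 0 <= ka ->
  (forall k, (k < N)%N -> mean (fun w => cnt M s t k (W^~ w) ^+ 2) <= v) ->
  (forall k, (k < N)%N -> - ka <= mean (fun w => cnt M s t k (W^~ w)) <= 0) ->
  (- K%:R * ka <= mean (fun w => \sum_(k < K) cnt M s t k (W^~ w)) <= 0) /\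
  mean (fun w => (\sum_(k < K) cnt M s t k (W^~ w)) ^+ 2) <= K%:R * v + (K%:R * ka) ^+ 2.
Proof.
have [[mW iW] W0 WS WR _] := sW.
move=> KN ka0 hv hm; elim: K KN => [|K IH] KN.
  have E0 : (fun w : T => \sum_(k < 0) cnt M s t k (W^~ w)) = (fun=> 0).
    by apply/funext => w; rewrite big_ord0.
  have E1 : (fun w : T => (\sum_(k < 0) cnt M s t k (W^~ w)) ^+ 2) = (fun=> 0).
    by apply/funext => w; rewrite big_ord0 expr0n.
  by rewrite E0 E1 /mean mean_cst !mul0r oppr0 mul0r lexx expr0n addr0.
have [/andP[I1 I2] I3] := IH (ltnW KN).
have /andP[h1 h2] := hm K KN; have h3 := hv K KN.
pose f (z : path R prim) := \sum_(k < K) cnt M s t k z.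
pose g (z : path R prim) := cnt M s t K z.
have bf : bounded_rv f by apply: bounded_rv_sum => k _; exact: bounded_cnt.
have bg : bounded_rv g := bounded_cnt M s t K.
have bf' := bounded_rv_path mW bf; have bg' := bounded_rv_path mW bg.
have fg : mean (fun w => f (W^~ w) * g (W^~ w)) = mean (fun w => f (W^~ w)) * mean (fun w => g (W^~ w)).
  apply: (mean_independent mW iW (K := served_by K)) => //.
  - move=> x y xy; apply: eq_bigr => k _.
    rewrite /cnt (_ : server_times k x = server_times k y)//; apply/funext => -[m|] /=; apply: xy => /=.
      by rewrite ltn_eqF.
    by rewrite ltn_eqF.
  - move=> x y xy; rewrite /g /cnt (_ : server_times K x = server_times K y)//.
    by apply/funext => -[m|] /=; apply: xy => /=.
have E1 : mean (fun w => \sum_(k < K.+1) cnt M s t k (W^~ w)) = mean (fun w => f (W^~ w)) + mean (fun w => g (W^~ w)).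
  rewrite -(meanD P bf' bg'); congr (Rintegral P setT _).
  by apply/funext => w; rewrite big_ord_recr.
have E2 : mean (fun w => (\sum_(k < K.+1) cnt M s t k (W^~ w)) ^+ 2) =
   mean (fun w => f (W^~ w) ^+ 2) + (2 * mean (fun w => f (W^~ w) * g (W^~ w)) + mean (fun w => g (W^~ w) ^+ 2)).
  have b1 := bounded_rvM bf' bf'; have b2 := bounded_rvM bf' bg'; have b3 := bounded_rvM bg' bg'.
  have b4 := bounded_rvM (bounded_rv_cst T 2) b2.
  rewrite /mean -(meanZ P 2 b2) -(meanD P b4 b3) -(meanD P b1 (bounded_rvD b4 b3)).
  congr (Rintegral P setT _); apply/funext => w; rewrite big_ord_recr /= -/(f _) -/(g _); ring.
rewrite E1 E2 fg -!(natr1 K).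
move: I1 I2 I3 h1 h2 h3; rewrite -/(mean (fun w => f (W^~ w))) -/(mean (fun w => g (W^~ w))).
rewrite -/(mean (fun w => g (W^~ w) ^+ 2)) -/(mean (fun w => f (W^~ w) ^+ 2)).
set a := mean (fun w => f _); set b := mean (fun w => g _); set c := mean _; set e := mean _.
move=> I1 I2 I3 h1 h2 h3; set k : R := K%:R in I1 I3 *.
have k0 : 0 <= k by [].
split; first by apply/andP; split; lra.
have : a * b <= (k * ka) * ka.
  by rewrite -(mulrNN a b); apply: ler_pM; lra.
by move: h3 I3; nra.
Qed.

End fixed.

Variable eps : R.
Hypotheses (eps_gt0 : 0 < eps) (eps_le1 : eps <= 1).
Variable CS : R.
Hypothesis momentS : (\int[P0]_w (S w `^ (1 + eps))%:E = CS%:E)%E.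
Variables (al de : R).
Hypotheses (al1 : 1 < al) (al2 : al < 2) (de0 : 0 < de).

Definition completions N M (s t : R) (z : prim -> R) : R :=
  \sum_(k < N) epochs M s t (server_times k z).

(* Chosen so that [N] servers complete about [de / 2 * N ^ (1 / al)] jobs during
   one mesh interval. *)
Definition mesh (N : nat) : R := de / 2 * N%:R `^ (al^-1 - 1).

(** The deficit t - E min (S_M, t) is nondecreasing in t, so an M chosen for the horizon serves all
    earlier times. *)
Lemma min_psum_lower d (T : measurableType d) (P : probability T R) (Y : option nat -> T -> R)
   M (t t' ka : R) : renewal_data S_ge0 ES P Y -> 0 <= t' -> t' <= t ->
  ((t - ka)%:E <= \int[P]_w (Num.min (psum (Y^~ w) 0 M) t)%:E)%E ->
  ((t' - ka)%:E <= \int[P]_w (Num.min (psum (Y^~ w) 0 M) t')%:E)%E.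
Proof.
move=> [[mY iY] Y0 YS Yr] t'0 tt' H.
have mm u : measurable_fun setT (fun w => (Num.min (psum (Y^~ w) 0 M) u)%:E : \bar R).
  apply/measurable_EFinP; apply: measurable_minr => //.
  exact: (measurableT_comp (measurable_psum 0 M) (measurable_path mY)).
have p0 w : 0 <= psum (Y^~ w) 0 M by exact: sumr_ge0.
rewrite -(leeD2rE _ _ (x := (t - t')%:E))// -EFinD.
have -> : t' - ka + (t - t') = t - ka by ring.
apply: le_trans H _.
have -> : ((t - t')%:E = \int[P]_w (t - t')%:E)%E.
  by rewrite integral_cst//= probability_setT mule1.
rewrite -ge0_integralD//; last 2 first.
- by move=> w _; rewrite lee_fin le_min p0.
- by move=> w _; rewrite lee_fin subr_ge0.
apply: ge0_le_integral => //.
- by move=> w _; rewrite lee_fin le_min p0 (le_trans t'0).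
- exact: emeasurable_funD.
- move=> w _; rewrite -EFinD lee_fin; set p := psum _ _ _; rewrite !minEle.
  by case: (leP p t) => h1; case: (leP p t') => h2; lra.
Qed.

Lemma completions_moment (q : R) : 0 < q -> q <= eps / 2 ->
  exists2 C, 0 < C & forall N d (T : measurableType d) (P : probability T R) (W : prim -> T -> R) (t h : R),
    servers_data N P W -> 0 < h -> 0 <= t ->
    exists M, forall a b, 0 <= a -> a + h <= b -> b <= t ->
      (\int[P]_w ((completions N M a b (W^~ w) - N%:R * (b - a)) ^+ 2)%:E <=
       (N%:R * C * ((b - a) * (1 + (b - a)) `^ (1 - q)))%:E)%E.
Proof.
move=> q0 qe; have [C C0 HC] := epochs_variance S_ge0 ES eps_gt0 momentS eps_le1 q0 qe.
exists (C + 1); first by rewrite addr_gt0.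
move=> N d T P W t h sW h0 t0.
have [[mW iW] W0 WS WR unb] := sW.
(* Makes the squared bias (N ka)^2 at most N h, hence at most N l for every window of length l >=
   h. *)
pose ka := Num.min 1 (h / N.+1%:R).
have ka0 : 0 < ka by rewrite lt_min ltr01 divr_gt0.
have /near_forall_lt [M _ /(_ M (leqnn M)) hM] :
    forall k, (k < N)%N -> \forall M \near \oo,
      ((t - ka)%:E <= \int[P]_w (Num.min (psum (server_times k (W^~ w)) 0 M) t)%:E)%E.
  by move=> k kN; apply: (renewal_mean_cvg (server_renewal sW kN)) => // w u; exact: (unb w k u).
exists M => a b a0 hab bt; have ab : a < b by apply: lt_le_trans hab; rewrite ltrDl.
have b0 : 0 <= b by rewrite (le_trans a0)// ltW.
set l := b - a; have hl : h <= l by rewrite /l; lra.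
have l0 : 0 < l by rewrite subr_gt0.
have KA : ka <= 1 by rewrite ge_min lexx.
have rd k kN := server_renewal sW (k := k) kN.
have hb k (kN : (k < N)%N) := min_psum_lower (rd k kN) b0 bt (hM k kN).
have V k : (k < N)%N -> Rintegral P setT (fun w => (epochs M a b (server_times k (W^~ w)) - l) ^+ 2) <=
      C * (l * (1 + l) `^ (1 - q)).
  by move=> kN; exact: (HC _ _ _ _ _ _ _ ka (rd k kN) a0 ab KA (hb k kN)).
have bc k : bounded_rv (fun w => epochs M a b (server_times k (W^~ w))).
  by apply: (bounded_rv_path mW (h := fun z => epochs M a b (server_times k z))); have [me [D hD]] := @bounded_epochs R M a b;
     split; [exact: (measurableT_comp me (measurable_server_times k))|exists D => z; exact: hD].
have E k : (k < N)%N -> - ka <= Rintegral P setT (fun w => epochs M a b (server_times k (W^~ w)) - l) <= 0.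
  move=> kN; have [[mY iY] Y0 YS Yr] := rd k kN.
  rewrite (meanD P (bc k) (bounded_rv_cst T (- l))) mean_cst.
  have h1 := epochs_mean_le mY iY Y0 YS Yr M a0 ab.
  have h2 := epochs_mean_ge mY iY Y0 YS Yr a0 ab (hb k kN).
  rewrite (bounded_meanE P (bc k)) lee_fin in h1.
  rewrite (bounded_meanE P (bc k)) lee_fin in h2.
  by apply/andP; split; rewrite /l; lra.
have [_ H] := total_variance sW (leqnn N) (ltW ka0) V E.
have bt2 : bounded_rv (fun w => (\sum_(k < N) (epochs M a b (server_times k (W^~ w)) - l)) *
   (\sum_(k < N) (epochs M a b (server_times k (W^~ w)) - l))).
  have bs : bounded_rv (fun w => \sum_(k < N) (epochs M a b (server_times k (W^~ w)) - l)).
    apply: (bounded_rv_sum (f := fun k w => epochs M a b (server_times k (W^~ w)) - l)) => k _.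
    by apply: bounded_rvD => //; exact: bounded_rv_cst.
  exact: (bounded_rvM bs bs).
have sE w : completions N M a b (W^~ w) - N%:R * l = \sum_(k < N) (epochs M a b (server_times k (W^~ w)) - l).
  by rewrite big_split /= sumrN sumr_const card_ord mulr_natl.
under eq_integral do rewrite sE expr2.
rewrite (bounded_meanE P bt2) lee_fin; apply: le_trans H _.
have wq : 1 <= (1 + l) `^ (1 - q).
  rewrite -[leLHS](powRr0 (1 + l)) ler_powR ?lerDl ?(ltW l0)//.
  by have := eps_le1; lra.
set X := (1 + l) `^ _ in wq *.
have kN : (N%:R * ka) ^+ 2 <= N%:R * (l * X).
  have k1 : ka * N%:R <= h.
    apply: (@le_trans _ _ (h / N.+1%:R * N%:R)).
      by rewrite ler_wpM2r// ge_min lexx orbT.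
    by rewrite mulrAC ler_pdivrMr// ler_wpM2l ?(ltW h0)// ler_nat.
  rewrite (_ : _ ^+ 2 = N%:R * (ka * (ka * N%:R))); last by ring.
  rewrite ler_wpM2l//; apply: (@le_trans _ _ (1 * h)).
    by rewrite ler_pM ?mulr_ge0 ?(ltW ka0).
  by rewrite mul1r; apply: le_trans hl _; rewrite ler_peMr// ltW.
by rewrite mulrA mulrDr mulrDl mulr1 mulrA lerD// -mulrA; lra.
Qed.

Lemma completions_nil N M s (z : prim -> R) : completions N M s s z = 0.
Proof. by rewrite /completions big1// => k _; rewrite epochs_nil. Qed.

(** At a dyadic scale T the variance bound N T (1+T)^(1-q) is set against the squared threshold
    N^(2/al) (1+T)^2. The ratio carries a factor T^(-q), which makes the scales summable despite the
    squares of levels, and what remains is N^(-r). N is chosen before K, so the bound is uniform in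
    the horizon. *)
Lemma service_bound (e : R) : 0 < e -> \forall N \near \oo,
  forall d (T : measurableType d) (P : probability T R) (W : prim -> T -> R),
    servers_data N P W -> forall K, exists M, exists B,
    [/\ measurable B, (P B <= e%:E)%E & forall w, ~ B w ->
      let t := mesh N * (2 ^ K)%:R in forall s, 0 <= s -> s < t ->
      N%:R * (t - s) - de * N%:R `^ al^-1 * (1 + (t - s)) <= completions N M s t (W^~ w)].
Proof.
move=> e0; have al0 : 0 < al by have := al1; lra.
(* The first bound is that of the variance estimate; the second, with al < 2, makes the exponent [r]
   positive. *)
pose q := Num.min (eps / 2) ((2 - al) / 2).
have q0 : 0 < q by rewrite lt_min !divr_gt0// subr_gt0.
have qe : q <= eps / 2 by rewrite ge_min lexx.
have qa : q <= (2 - al) / 2 by rewrite ge_min lexx orbT.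
have [C C0 HC] := completions_moment q0 qe.
pose y := 2 `^ (- q) : R.
have y0 : 0 < y by exact: powR_gt0.
have y1 : y < 1.
  have h1 : (1 : R) `^ q < 2 `^ q by rewrite gt0_ltr_powR ?nnegrE// ltr1n.
  by rewrite powR1 in h1; rewrite /y powRN invf_lt1 ?powR_gt0.
have [Cq Cq0 HCq] := sum_sqr_geometric y0 y1.
pose r := 2 / al - 1 - q * (1 - al^-1).
have r0 : 0 < r.
  have -> : r = ((2 - al) - q * (al - 1)) / al by rewrite /r; field; rewrite gt_eqF.
  rewrite divr_gt0//; have := al1; have := al2; nra.
pose c := 16 * C / de ^+ 2 * (de / 2) `^ (- q) * Cq.
have := near_powRN c r0 e0; apply: filterS2 (nbhs_infty_gt 0) => N N0 hN.
move=> d T P W sW K.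
have [[mW iW] _ _ _ _] := sW.
have X0 : 0 < N%:R :> R by rewrite ltr0n.
have X1 : 1 <= N%:R :> R by rewrite ler1n.
set h := mesh N; have h0 : 0 < h by rewrite mulr_gt0 ?divr_gt0 ?powR_gt0.
pose t := h * (2 ^ K)%:R; have t0 : 0 <= t by rewrite mulr_ge0// ltW.
have [M HM] := HC N d T P W t h sW h0 t0.
pose D := de / 2 * N%:R `^ al^-1.
have D0 : 0 < D by rewrite mulr_gt0 ?divr_gt0 ?powR_gt0.
have hN' : N%:R * h = D.
  by rewrite /h /mesh /D powRB ?(gt_eqF X0) ?implybT// powRr1 ?(ltW X0)//; field; rewrite gt_eqF.
(* Cells are numbered backwards from t, so that initial blocks are the windows ending at t. *)
pose cell s l z := completions N M (t - (s + l)%:R * h) (t - s%:R * h) z - N%:R * (l%:R * h).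
pose x i w := cell i 1%N (W^~ w).
have bcell w s l : block (x^~ w) s l = cell s l (W^~ w).
  elim: l => [|l IH].
    by rewrite /block big_ord0 /cell addn0 completions_nil mul0r mulr0 subr0.
  rewrite -addn1 blockD block1 IH /x /cell addn1 -addnS addn1.
  have -> : completions N M (t - (s + l.+1)%:R * h) (t - s%:R * h) (W^~ w) =
    completions N M (t - (s + l.+1)%:R * h) (t - (s + l)%:R * h) (W^~ w) +
    completions N M (t - (s + l)%:R * h) (t - s%:R * h) (W^~ w); last first.
    by rewrite -[in RHS](natr1 l); ring.
  rewrite /completions -big_split /=; apply: eq_bigr => k _; apply: epochsD;
    by rewrite lerD2l lerN2 ler_wpM2r ?(ltW h0)// ler_nat ?leq_add2l ?leq_addr.
pose v (l : nat) := N%:R * C * (l%:R * h * (1 + l%:R * h) `^ (1 - q)).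
have q1 : 0 <= 1 - q by have := al1; lra.
have xv s l : (0 < l)%N -> (s + l <= 2 ^ K)%N ->
    (\int[P]_w (block (x^~ w) s l ^+ 2)%:E <= (v l)%:E)%E.
  move=> l0 sl.
  have hs : 0 <= s%:R * h by rewrite mulr_ge0// ltW.
  have hsl : (s + l)%:R * h <= t by rewrite /t mulrC ler_wpM2l ?(ltW h0)// ler_nat.
  have lh : h <= l%:R * h by rewrite ler_peMl ?(ltW h0)// ler1n.
  have dE : t - s%:R * h - (t - (s + l)%:R * h) = l%:R * h by rewrite natrD; ring.
  have := HM (t - (s + l)%:R * h) (t - s%:R * h).
  rewrite dE => HM'; under eq_integral do rewrite bcell.
  by apply: HM'; rewrite ?subr_ge0// ?natrD; lra.
have v2 l : 2 * v l <= v (l + l)%N.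
  have lh : 0 <= l%:R * h by rewrite mulr_ge0// ltW.
  rewrite /v (natrD R l l) (mulrDl l%:R l%:R h) (_ : 2 * _ = N%:R * C * ((l%:R * h + l%:R * h) * (1 + l%:R * h) `^ (1 - q))); last by ring.
  rewrite ler_wpM2l ?mulr_ge0 ?(ltW C0)// ler_wpM2l ?addr_ge0// ge0_ler_powR ?q1 ?nnegrE ?addr_ge0//.
  by rewrite lerD2l lerDl.
have mx i : measurable_fun setT (x i).
  rewrite /x /cell /completions; apply: measurable_funB => //; apply: measurable_sum => k.
  exact: (measurableT_comp (measurable_epochs M _ _) (measurableT_comp (measurable_server_times k) (measurable_path mW))).
pose TL (L : nat) := h * (2 ^ L)%:R.
have TL0 L : 0 < TL L by rewrite mulr_gt0// ltr0n expn_gt0.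
(* The dyadic scale covering l cells has at most 2l cells; the half turns its threshold into a bound
   by the length l h itself. *)
pose th (L : nat) := (D * (1 + TL L / 2)) ^+ 2.
have th0 L : 0 < th L by rewrite exprn_gt0// mulr_gt0// addr_gt0// divr_gt0.
have [B [mB PB HB]] := maximal_inequality mx v2 xv (leqnn _) th0.
exists M, B; split => //.
  apply: le_trans PB _; rewrite lee_fin.
  apply: (@le_trans _ _ (\sum_(L < K.+1) (4 * N%:R * C / D ^+ 2 * h `^ (- q)) * (L.+1%:R ^+ 2 * y ^+ L))).
    apply: ler_sum => L _.
    have TE : (TL L) `^ (- q) = h `^ (- q) * y ^+ L := powR_geometric _ _ (ltW h0).
    rewrite (_ : 4 * _ * C / D ^+ 2 * h `^ (- q) * (L.+1%:R ^+ 2 * y ^+ L) =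
       L.+1%:R ^+ 2 * (N%:R * C) * (4 / D ^+ 2 * (TL L) `^ (- q))); last first.
      rewrite TE; move: (h `^ (- q)) (y ^+ L) ((D ^+ 2)^-1) (L.+1%:R ^+ 2 : R) (N%:R : R) => a1 a2 a3 a4 a5; ring.
    have -> : v (2 ^ L)%N = N%:R * C * (TL L * (1 + TL L) `^ (1 - q)).
      by rewrite /v [_%:R * h]mulrC.
    have LNC : 0 <= L.+1%:R ^+ 2 * (N%:R * C) by rewrite mulr_ge0 ?sqr_ge0// mulr_ge0// ltW.
    rewrite [leLHS](_ : _ = L.+1%:R ^+ 2 * (N%:R * C) * (TL L * (1 + TL L) `^ (1 - q) / th L)); last by rewrite !mulrA.
    rewrite ler_wpM2l//.
    rewrite ler_pdivrMr// /th; set u := TL L; have u0 : 0 < u := TL0 L.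
    have -> : (D * (1 + u / 2)) ^+ 2 = D ^+ 2 * ((2 + u) ^+ 2 / 4) by field.
    rewrite (_ : 4 / D ^+ 2 * _ * _ = u `^ (- q) * (2 + u) ^+ 2); last by field; rewrite gt_eqF.
    apply: (@le_trans _ _ (u `^ (- q) * (1 + u) ^+ 2)); last first.
      by rewrite ler_wpM2l ?powR_ge0// ler_sqr ?nnegrE ?addr_ge0 ?(ltW u0)// lerD2r ler1n.
    have uu : 0 < 1 + u by rewrite addr_gt0.
    have -> : (1 + u) ^+ 2 = (1 + u) `^ (1 - q) * (1 + u) `^ (1 + q).
      by rewrite -powRD ?(gt_eqF uu) ?implybT// -powR_mulrn ?(ltW uu)//; congr (_ `^ _); ring.
    have uE : u = u `^ (- q) * u `^ (1 + q).
      by rewrite -powRD ?(gt_eqF u0) ?implybT// addrCA addNr addr0 powRr1// ltW.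
    rewrite [X in X * _ <= _]uE -mulrA ler_wpM2l ?powR_ge0// mulrC ler_wpM2l ?powR_ge0//.
    have q10 : 0 <= 1 + q by lra.
    by rewrite ge0_ler_powR ?nnegrE ?(ltW u0) ?(ltW uu)// lerDr.
  rewrite -mulr_sumr; apply: (@le_trans _ _ (4 * N%:R * C / D ^+ 2 * h `^ (- q) * Cq)).
    by rewrite ler_wpM2l// !mulr_ge0 ?powR_ge0 ?invr_ge0 ?sqr_ge0 ?(ltW C0).
  apply: le_trans hN; rewrite le_eqVlt; apply/orP; left; apply/eqP.
  have XE : N%:R * (N%:R `^ (al^-1 - 1)) `^ (- q) / (N%:R `^ al^-1) ^+ 2 = N%:R `^ (- r) :> R.
    rewrite -powR_mulrn ?powR_ge0// -!powRrM -[X in X * _ / _](powRr1 (ltW X0)).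
    by rewrite -powRN -!powRD ?(gt_eqF X0) ?implybT//; congr (_ `^ _); rewrite /r; ring.
  rewrite -XE /c /D /h /mesh powRM ?powR_ge0 ?divr_ge0 ?(ltW de0)//.
  by field; rewrite !gt_eqF// powR_gt0.
move=> w Bw s s0 st.
have key l : (l <= 2 ^ K)%N -> - (D * (1 + l%:R * h)) <= block (x^~ w) 0 l.
  move=> lK; case: l lK => [|l] lK.
    by rewrite /block big_ord0 oppr_le0 mulr_ge0 ?(ltW D0)// mul0r addr0.
  pose L := up_log 2 l.+1.
  have lL : (l.+1 <= 2 ^ L)%N by exact: up_logP.
  have LK : (L <= K)%N by exact: up_log_min.
  have := HB w Bw L LK; have := block_sqr_le (x^~ w) 0 lL.
  move=> /le_trans/[apply]; set b := block _ _ _ => hb.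
  have : `|b| <= D * (1 + TL L / 2).
    have p0 : 0 <= D * (1 + TL L / 2) := mulr_ge0 (ltW D0) (addr_ge0 ler01 (divr_ge0 (ltW (TL0 L)) (ler0n R 2))).
    rewrite -ler_sqr ?nnegrE ?normr_ge0//.
    by rewrite real_normK ?num_real.
  rewrite ler_norml => /andP[+ _]; apply: le_trans.
  rewrite lerN2 ler_wpM2l ?(ltW D0)// lerD2l ler_pdivrMr// /TL mulrC -mulrAC ler_wpM2r ?(ltW h0)//.
  rewrite -natrM ler_nat; case: l lK @L lL LK b hb => [|l] lK L lL LK b hb; first by rewrite /L.
  have /andP[h1 _] := up_log_bounds (leqnn 2) (isT : (1 < l.+2)%N).
  rewrite -/L in h1; have L0 : (0 < L)%N by rewrite /L up_log_gt0.
  by rewrite -(prednK L0) expnS mulnC leq_mul2r ltnW.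
have u0 : 0 < t - s by rewrite subr_gt0.
set u := t - s.
pose l := Num.truncn (u / h).
have /andP[l1 l2] := truncn_itv (ltW (divr_gt0 u0 h0)).
rewrite -/u -/l in l1 l2.
have {}l1 : l%:R * h <= u by rewrite -ler_pdivlMr.
have {}l2 : u < l.+1%:R * h by rewrite -ltr_pdivrMr.
have lK : (l <= 2 ^ K)%N.
  rewrite -(ler_nat R) -(ler_pM2r h0); apply: le_trans l1 _.
  by rewrite [leRHS]mulrC -/t /u; lra.
have := key l lK; rewrite bcell /cell add0n mul0r subr0.
have : completions N M (t - l%:R * h) t (W^~ w) <= completions N M s t (W^~ w).
  apply: ler_sum => k _; apply: epochs_ler; last by rewrite lerBlDr lerDl mulr_ge0// ltW.
  by rewrite lerBrDr -lerBrDl.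
set a := completions _ _ _ _ _; set b := completions _ _ _ _ _ => ab hb.
(* Rounding s to the mesh loses at most one cell, of mean N h = D; this uses up the other half of
   [de]. *)
have e1 : N%:R * u <= N%:R * (l%:R * h) + D.
  rewrite -hN' -mulrDr ler_wpM2l// ltW//; apply: lt_le_trans l2 _.
  by rewrite -natr1 mulrDl mul1r.
have e2 : D * (1 + l%:R * h) <= D * (1 + u) by rewrite ler_wpM2l ?(ltW D0)// lerD2l.
have e3 : D <= D * (1 + u) by rewrite ler_peMr ?(ltW D0)// lerDl ltW.
have -> : de * N%:R `^ al^-1 * (1 + u) = D * (1 + u) + D * (1 + u) by rewrite /D; field.
lra.
Qed.

End servers.

(** * Arrivals *)

Section layer_cake.
Context {R : realType} d (T : measurableType d) (m : {sigma_finite_measure set T -> \bar R}).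
Notation mu := (@lebesgue_measure R).
Variables (X k : T -> R) (g : R -> R).
Hypotheses (mX : measurable_fun setT X) (mk : measurable_fun setT k) (mg : measurable_fun setT g).
Hypotheses (k0 : forall x, 0 <= k x) (g0 : forall z, 0 < z -> 0 <= g z).

(** Tonelli with a weight [k]; it is applied once to A under [P0] and once to Lebesgue measure
    weighted by z^(-al). *)
Lemma layer_cake :
  (\int[m]_x ((k x)%:E * \int[mu]_(z in `]0%R, X x[) (g z)%:E) =
   \int[mu]_(z in `]0%R, +oo[) ((g z)%:E * \int[m]_x (if z < X x then k x else 0)%:E))%E.
Proof.
pose h (p : T * measurableTypeR R) : \bar R := (if (0 < p.2) && (p.2 < X p.1)
  then k p.1 * g p.2 else 0)%:E.
have mX1 : measurable_fun setT (fun p : T * measurableTypeR R => X p.1).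
  exact: (measurableT_comp mX measurable_fst).
have mh : measurable_fun setT h.
  apply/measurable_EFinP/measurable_fun_ifT.
  - apply: measurable_and; first by apply: measurable_fun_ltr => //; exact: measurable_snd.
    by apply: measurable_fun_ltr => //; exact: measurable_snd.
  - apply: measurable_funM; first exact: (measurableT_comp mk measurable_fst).
    exact: (measurableT_comp mg measurable_snd).
  - exact: measurable_cst.
have h0 p : (0 <= h p)%E.
  by rewrite /h lee_fin; case: ifP => // /andP[h1 _]; rewrite mulr_ge0 ?g0.
have mg' (D : set R) : measurable_fun D (fun z => (g z)%:E).
  by apply: measurable_funTS; exact/measurable_EFinP.
transitivity (\int[m]_x \int[mu]_z h (x, z))%E.
  apply: eq_integral => x _.
  rewrite -ge0_integralZl//; last 3 first.
  - exact: mg'.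
  - by move=> z /=; rewrite in_itv /= => /andP[z0 _]; rewrite lee_fin g0.
  - by rewrite lee_fin.
  rewrite -[X in (\int[_]_(_ in X) _)%E]/[set y | y \in `]0, X x[].
  rewrite integral_set_if; apply: eq_integral => z _.
  by rewrite in_itv /= /h /=; case: ifP => // _; rewrite -EFinM.
transitivity (\int[mu]_z \int[m]_x h (x, z))%E.
  exact: (@fubini_tonelli _ _ _ _ _ m mu h mh h0).
rewrite -[X in (_ = \int[_]_(_ in X) _)%E]/[set y | y \in `]0, +oo[].
rewrite integral_set_if; apply: eq_integral => z _.
rewrite in_itv /= andbT; case: ifPn => z0; last first.
  by rewrite (eq_integral (cst 0%E)) ?integral0// => x _; rewrite /h /= (negbTE z0).
rewrite -ge0_integralZl//; last 3 first.
- apply/measurable_EFinP; apply: measurable_fun_ifT => //.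
  exact: measurable_fun_ltr.
- by move=> x _; rewrite lee_fin; case: ifP.
- by rewrite lee_fin g0.
apply: eq_integral => x _; rewrite /h /= z0 /=; case: ifP => // _; last by rewrite mule0.
by rewrite -EFinM mulrC.
Qed.

End layer_cake.

Section integrals.
Context {R : realType}.
Notation mu := (@lebesgue_measure R).

Lemma FTC_open (f F : R -> R) (b m : R) : 0 <= b -> F 0 = m ->
  (forall x : R, {for x, continuous f}) -> (forall x : R, is_derive x 1 F (f x)) ->
  (forall x : R, 0 < x -> 0 <= f x) ->
  (\int[mu]_(x in `]0%R, b[) (f x)%:E = (F b - m)%:E)%E.
Proof.
move=> b0 F0 cf dF f0; move: b0; rewrite le_eqVlt => /predU1P[<-|b0].
  by rewrite set_itv_ge ?bnd_simp ?ltxx// integral_set0 F0 subrr.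
have mf : measurable_fun setT (EFin \o f).
  by apply/measurable_EFinP; apply: continuous_measurable_fun => x; exact: cf.
rewrite -(@ge0_FTC_right _ f F b m)//.
  by rewrite integral_itv_bndo_bndc//; exact: measurable_funTS.
rewrite -F0; apply: cvg_at_right_filter; exact: is_derive_continuous (dF 0).
Qed.

Lemma integral_1_sub_expRN (a : R) : 0 <= a ->
  (\int[mu]_(z in `]0%R, a[) (1 - expR (- z))%:E = (expR (- a) - 1 + a)%:E)%E.
Proof.
move=> a0.
have d (y : R) : is_derive y 1 (fun z => z + expR (- z)) (1 - expR (- y)).
  by apply: (deriveW (dD (dI y) (dexp (dN (dI y))))); ring.
rewrite (@FTC_open _ (fun z => z + expR (- z)) a 1)//.
- by congr EFin; ring.
- by rewrite oppr0 expR0 add0r.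
- by move=> x; exact: (is_derive_continuous (dB (dC 1 x) (dexp (dN (dI x))))).
- by move=> x x0; rewrite subr_ge0 -expR0 ler_expR oppr_le0 ltW.
Qed.

Lemma integral_expRN_open (a : R) : 0 <= a ->
  (\int[mu]_(z in `]0%R, a[) (expR (- z))%:E = (1 - expR (- a))%:E)%E.
Proof.
move=> a0.
have d (y : R) : is_derive y 1 (fun z => - expR (- z)) (expR (- y)).
  by apply: (deriveW (dN (dexp (dN (dI y))))); ring.
rewrite (@FTC_open _ (fun z => - expR (- z)) a (-1))//.
- by congr EFin; ring.
- by rewrite oppr0 expR0.
- by move=> x; exact: (is_derive_continuous (dexp (dN (dI x)))).
Qed.

Lemma powRN_cvg0 (s : R) : 0 < s -> (x `^ (- s)) @[x --> +oo] --> 0.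
Proof.
move=> s0; have sn : s != 0 by rewrite gt_eqF.
apply/cvgrPdist_le => e e0; near=> x.
have x0 : (e^-1) `^ s^-1 < x by near: x; apply: nbhs_pinfty_gt; exact: num_real.
have xp : 0 < x by apply: le_lt_trans x0; exact: powR_ge0.
rewrite sub0r normrN ger0_norm ?powR_ge0// powRN invf_ple ?posrE ?powR_gt0//.
rewrite -[leLHS](@powRr1 _ e^-1) ?invr_ge0 ?(ltW e0)// -(mulVf sn) powRrM.
by rewrite ge0_ler_powR ?nnegrE ?powR_ge0 ?(ltW s0) ?(ltW xp) ?(ltW x0).
Unshelve. all: by end_near. Qed.

Variable al : R.
Hypotheses (al1 : 1 < al) (al2 : al < 2).

Lemma integral_powRN (y : R) : 0 < y ->
  (\int[mu]_(z in `[y, +oo[) (z `^ (- al))%:E = (y `^ (1 - al) / (al - 1))%:E)%E.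
Proof.
move=> y0; have a0 : 0 < al - 1 by rewrite subr_gt0.
have d (z : R) : 0 < z -> is_derive z 1 (fun z => - (al - 1)^-1 * z `^ (- (al - 1))) (z `^ (- al)).
  move=> z0; apply: (deriveW (dZ _ (dpowR _ z0 (dI z)))).
  rewrite mulr1 (_ : - (al - 1) - 1 = - al); last by ring.
  by field; rewrite gt_eqF.
rewrite (@ge0_continuous_FTC2y _ _ (fun z => - (al - 1)^-1 * z `^ (- (al - 1))) _ 0).
- rewrite sub0e -EFinN; congr EFin; rewrite (_ : - (al - 1) = 1 - al); last by ring.
  by rewrite mulNr opprK mulrC.
- by move=> z _; exact: powR_ge0.
- apply: continuous_in_subspaceT => z /[!inE] /=; rewrite in_itv /= andbT => yz.
  exact: (is_derive_continuous (dpowR _ (lt_le_trans y0 yz) (dI z))).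
- by rewrite -[X in _ --> X](mulr0 (- (al - 1)^-1)); apply: cvgM; [exact: cvg_cst|exact: powRN_cvg0].
- by move=> z yz; exact: is_derive_derivable (d z (lt_trans y0 yz)).
- exact: cvg_at_right_filter (is_derive_continuous (d y y0)).
- by move=> z; rewrite in_itv /= andbT => yz; exact: is_derive_val (d z (lt_trans y0 yz)).
Qed.

(* The constant [c] in [E exp (- eta A) = 1 - eta + C_A c eta ^ al + o(eta ^ al)]. *)
Lemma integral_stable_exponent :
  (\int[mu]_(z in `]0%R, +oo[) ((1 - expR (- z)) * z `^ (- al))%:E =
   (Gamma (2 - al) / (al - 1))%:E)%E.
Proof.
have a0 : 0 < al - 1 by rewrite subr_gt0.
pose k (z : R) := if 0 < z then z `^ (- al) else 0.
have mk : measurable_fun setT k.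
  by apply: measurable_fun_ifT => //; exact: measurable_fun_ltr.
have k0 z : 0 <= k z by rewrite /k; case: ifP => // _; exact: powR_ge0.
have me : measurable_fun setT (fun z : R => expR (- z)) := @measurable_expRN R.
have H := @layer_cake R _ _ mu id k (fun z => expR (- z)) (@measurable_id _ _ _) mk me k0 (fun z _ => expR_ge0 _).
transitivity (\int[mu]_(z in `]0%R, +oo[) ((expR (- z))%:E * (z `^ (1 - al) / (al - 1))%:E))%E; last first.
  rewrite mulrC EFinM GammaE; last by rewrite subr_gt0.
  have /andP[ef _] := @egamma_fin_num R (2 - al) ltac:(by rewrite subr_gt0).
  rewrite /rgamma fineK//.
  rewrite egammaZ ?invr_ge0 ?(ltW a0)//; apply: eq_integral => z _.
  by rewrite -EFinM; congr EFin; rewrite /gamma_fun (_ : 2 - al - 1 = 1 - al); ring.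
transitivity (\int[mu]_x ((k x)%:E * \int[mu]_(z in `]0%R, x[) (expR (- z))%:E))%E.
  rewrite -[X in (\int[_]_(_ in X) _)%E]/[set y | y \in `]0, +oo[].
  rewrite integral_set_if; apply: eq_integral => z _.
  rewrite in_itv /= andbT /k; case: ifPn => z0; last by rewrite mul0e.
  by rewrite integral_expRN_open ?(ltW z0)// -EFinM mulrC.
rewrite H; apply: eq_integral => z /[!inE] /=; rewrite in_itv /= andbT => z0; congr (_ * _)%E.
rewrite -integral_powRN// -integral_itv_obnd_cbnd; last first.
  apply: measurable_funTS; apply/measurable_EFinP; exact: measurable_powR.
rewrite -[X in (_ = \int[_]_(_ in X) _)%E]/[set y | y \in `]z, +oo[].
rewrite integral_set_if; apply: eq_integral => y _.
rewrite in_itv /= andbT /k; case: ltP => // zy.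
by rewrite (lt_trans z0 zy).
Qed.

Context d0 (T0 : measurableType d0) (P0 : probability T0 R).
Variable A : {RV P0 >-> R}.
Hypotheses (A_ge0 : forall w, 0 <= A w) (EA : (\int[P0]_w (A w)%:E = 1)%E).
Variable C_A : R.
Hypothesis C_A0 : 0 < C_A.
Hypothesis tailA : x `^ al * fine (P0 [set w | x < A w]) @[x --> +oo] --> C_A.

Lemma tail_integral (eta z : R) :
  P0 [set w | z < eta * A w] = (\int[P0]_w (if (z < eta * A w)%R then 1 else 0)%:E)%E.
Proof.
have mA : measurable_fun setT A by [].
rewrite -[X in P0 X]setIT -integral_indic//; last first.
  by apply/measurable_boolP; apply: measurable_fun_ltr => //; exact: measurable_funM.
apply: eq_integral => w _; rewrite indicE; case: ifP => h; [rewrite mem_set//|rewrite memNset//].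
by rewrite /= h.
Qed.

Lemma measurable_tail (eta : R) :
  measurable_fun setT (fun z : measurableTypeR R => P0 [set w | z < eta * A w]).
Proof.
rewrite (_ : (fun z => _) = (fun z : R => \int[P0]_w (if (z < eta * A w)%R then 1 else 0)%:E)%E); last first.
  by apply/funext => z; exact: tail_integral.
have mA : measurable_fun setT A by [].
pose h (p : measurableTypeR R * T0) : \bar R := (if p.1 < eta * A p.2 then 1 else 0)%:E.
have mh : measurable_fun setT h.
  apply/measurable_EFinP; apply: measurable_fun_ifT => //.
  apply: measurable_fun_ltr; first exact: measurable_fst.
  by apply: measurable_funM => //; exact: (measurableT_comp mA measurable_snd).
have h0 p : (0 <= h p)%E by rewrite /h lee_fin; case: ifP.
exact: (@measurable_fun_fubini_tonelli_F _ _ _ _ _ P0 h mh h0).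
Qed.

(** The layer-cake formula for exp (-u) - 1 + u, whose derivative is 1 - exp (-u), at u = eta A; E A
    = 1 supplies the linear term. The identity is arranged without subtraction in the extended
    reals. *)
Lemma mgf_excess (eta : R) : 0 < eta ->
  (\int[P0]_w (expR (- (eta * A w)))%:E + eta%:E =
   1 + \int[mu]_(z in `]0%R, +oo[) ((1 - expR (- z))%:E * P0 [set w | (z < eta * A w)%R]))%E.
Proof.
move=> e0.
have mA : measurable_fun setT A by [].
have mX : measurable_fun setT (fun w => eta * A w) by exact: measurable_funM.
have m1 : measurable_fun setT (fun z : R => 1 - expR (- z)).
  by apply: measurable_funB => //; exact: measurable_expRN.
have g0 (z : R) : 0 < z -> 0 <= 1 - expR (- z).
  by move=> z0; rewrite subr_ge0 -expR0 ler_expR oppr_le0 ltW.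
have H := @layer_cake R _ _ P0 (fun w => eta * A w) (fun=> 1) (fun z => 1 - expR (- z)) mX
  (@measurable_cst _ _ _ _ _ _) m1 (fun=> ler01) g0.
have -> : (\int[mu]_(z in `]0%R, +oo[) ((1 - expR (- z))%:E * P0 [set w | (z < eta * A w)%R]) =
    \int[P0]_w (expR (- (eta * A w)) - 1 + eta * A w)%:E)%E.
  transitivity (\int[mu]_(z in `]0%R, +oo[) ((1 - expR (- z))%:E * \int[P0]_x (if z < eta * A x then 1 else 0)%:E))%E.
    apply: eq_integral => z _; congr (_ * _)%E.
    exact: tail_integral.
  rewrite -H; apply: eq_integral => w _; rewrite mul1e integral_1_sub_expRN//.
  by rewrite mulr_ge0// ltW.
have c0 w : 0 <= expR (- (eta * A w)) - 1 + eta * A w.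
  by have := expR_ge1Dx (- (eta * A w)); lra.
have me : measurable_fun setT (fun w => expR (- (eta * A w))).
  exact: (measurableT_comp (@measurable_expRN R) mX).
have -> : (eta%:E = \int[P0]_w (eta * A w)%:E)%E.
  under eq_integral do rewrite EFinM.
  rewrite ge0_integralZl//; last by rewrite lee_fin ltW.
  - by rewrite EA mule1.
  - exact/measurable_EFinP.
  - by move=> w _; rewrite lee_fin.
have -> : (1 = \int[P0]_w (cst 1%:E w) :> \bar R)%E.
  by rewrite integral_cst//= probability_setT mule1.
rewrite -!ge0_integralD//.
- by apply: eq_integral => w _; rewrite /= -!EFinD; congr EFin; ring.
- by move=> w _; rewrite lee_fin.
- by apply/measurable_EFinP; apply: measurable_funD => //; exact: measurable_funB.
- exact/measurable_EFinP.
- by move=> w _; rewrite lee_fin mulr_ge0// ltW.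
- exact/measurable_EFinP.
Qed.

(** The integral is cut at z = eta x0. Beyond it the tail estimate applies with the constant C_A +
    k1; before it the integrand is at most eta x0, which contributes eta^2 x0^2, negligible against
    eta^al. *)
Lemma mgf_le (ka : R) : 0 < ka -> exists2 eta0, 0 < eta0 & forall eta, 0 < eta -> eta < eta0 ->
  (\int[P0]_w (expR (- (eta * A w)))%:E <=
   (1 - eta + (C_A * (Gamma (2 - al) / (al - 1)) + ka) * eta `^ al)%:E)%E.
Proof.
move=> ka0; have a0 : 0 < al - 1 by rewrite subr_gt0.
have a2 : 0 < 2 - al by rewrite subr_gt0.
set G := Gamma (2 - al) / (al - 1).
have G0 : 0 < G by rewrite divr_gt0// GammaE// rgamma_gt0.
(* Half of [ka] pays for the tail constant, the other half for the part below the cut. *)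
pose k1 := ka / (2 * G); have k10 : 0 < k1 by rewrite divr_gt0// mulr_gt0.
have : \forall x \near +oo, x `^ al * fine (P0 [set w | x < A w]) < C_A + k1.
  by apply: (cvgr_lt C_A) => //; rewrite ltrDl.
move=> [b [_ hb]].
pose x0 := Num.max 1 (b + 1); have x01 : 1 <= x0 by rewrite le_max lexx.
have x00 : 0 < x0 by apply: lt_le_trans x01.
have tl x : x0 <= x -> (P0 [set w | (x < A w)%R] <= ((C_A + k1) * x `^ (- al))%:E)%E.
  move=> xx; have xp : 0 < x := lt_le_trans x00 xx.
  have bx : b < x by apply: lt_le_trans xx; rewrite lt_max ltrDl ltr01 orbT.
  have mA : measurable_fun setT A by [].
  have mS : measurable [set w | (x < A w)%R] by apply/measurable_boolP; exact: measurable_fun_ltr.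
  have := hb x bx; rewrite -[X in (X <= _)%E](fineK (fin_num_measure P0 _ mS)) lee_fin.
  by rewrite powRN ler_pdivlMr ?powR_gt0// mulrC => /ltW.
(* Solves eta^2 x0^2 = (ka/2) eta^al. *)
exists ((ka / (2 * x0 ^+ 2)) `^ (2 - al)^-1); first by rewrite powR_gt0// divr_gt0// mulr_gt0 ?exprn_gt0.
move=> eta e0 eh.
have e2 : eta ^+ 2 * x0 ^+ 2 <= ka / 2 * eta `^ al.
  have : eta `^ (2 - al) <= ka / (2 * x0 ^+ 2).
    set z := ka / _ in eh *.
    have z0 : 0 <= z by rewrite divr_ge0 ?(ltW ka0)// mulr_ge0 ?sqr_ge0.
    have -> : z = (z `^ (2 - al)^-1) `^ (2 - al).
      by rewrite -powRrM mulVf ?gt_eqF// powRr1.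
    by rewrite ge0_ler_powR ?nnegrE ?powR_ge0 ?(ltW a2) ?(ltW e0) ?(ltW eh).
  have -> : eta ^+ 2 = eta `^ (2 - al) * eta `^ al.
    by rewrite -powRD ?(gt_eqF e0) ?implybT// subrK powR_mulrn// ltW.
  move=> h; rewrite mulrAC ler_wpM2r ?powR_ge0//.
  by rewrite -ler_pdivlMr ?exprn_gt0// -mulrA -invfM.
have bound (z : R) : 0 < z ->
  ((1 - expR (- z))%:E * P0 [set w | (z < eta * A w)%R] <=
   (if (z < eta * x0)%R then eta * x0 else 0)%:E +
     ((C_A + k1) * eta `^ al)%:E * ((1 - expR (- z)) * z `^ (- al))%:E)%E.
  move=> z0.
  have z1 : 0 <= 1 - expR (- z) by rewrite subr_ge0 -expR0 ler_expR oppr_le0 ltW.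
  have Ck : 0 <= (C_A + k1) * eta `^ al by rewrite mulr_ge0 ?powR_ge0// addr_ge0// ltW.
  case: ltP => h.
    rewrite -EFinM -EFinD; apply: (@le_trans _ _ ((1 - expR (- z))%:E * 1%:E)%E).
      rewrite lee_wpmul2l ?lee_fin//; apply: probability_le1.
      by apply/measurable_boolP; apply: measurable_fun_ltr => //; exact: measurable_funM.
    rewrite -EFinM lee_fin mulr1; apply: (@le_trans _ _ (eta * x0)).
      by apply: le_trans (ltW h); have := expR_ge1Dx (- z); lra.
    by rewrite lerDl mulr_ge0// mulr_ge0// powR_ge0.
  rewrite add0e -EFinM mulrCA EFinM lee_wpmul2l ?lee_fin//.
  have -> : [set w | (z < eta * A w)%R] = [set w | (z / eta < A w)%R].
    by apply/seteqP; split => w /=; rewrite ltr_pdivrMr// mulrC.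
  apply: le_trans (tl _ _) _; first by rewrite ler_pdivlMr// mulrC.
  rewrite lee_fin -mulrA ler_wpM2l ?addr_ge0 ?(ltW C_A0) ?(ltW k10)//.
  by rewrite powRM ?(ltW z0) ?invr_ge0 ?(ltW e0)// mulrC ler_wpM2r ?powR_ge0// -powR_inv1 ?(ltW e0)// -powRrM mulN1r opprK.
have mA : measurable_fun setT A by [].
have mP : measurable_fun (`]0%R, +oo[ : set R) (fun z : R => P0 [set w | (z < eta * A w)%R]).
  exact: measurable_funTS (measurable_tail eta).
have me1 : measurable_fun setT (fun z : R => 1 - expR (- z)).
  by apply: measurable_funB => //; exact: measurable_expRN.
have m1 : measurable_fun (`]0%R, +oo[ : set R) (fun z => ((if z < eta * x0 then eta * x0 else 0)%:E : \bar R)).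
  apply: measurable_funTS; apply/measurable_EFinP; apply: measurable_fun_ifT => //.
  exact: measurable_fun_ltr.
have m2 : measurable_fun (`]0%R, +oo[ : set R) (fun z => ((1 - expR (- z)) * z `^ (- al))%:E).
  apply: measurable_funTS; apply/measurable_EFinP; apply: measurable_funM => //.
have p2 (z : R) : `]0%R, +oo[%classic z -> (0 <= ((1 - expR (- z)) * z `^ (- al))%:E)%E.
  rewrite /= in_itv /= andbT => z0; rewrite lee_fin mulr_ge0 ?powR_ge0//.
  by rewrite subr_ge0 -expR0 ler_expR oppr_le0 ltW.
have Ck : 0 <= (C_A + k1) * eta `^ al by rewrite mulr_ge0 ?powR_ge0// addr_ge0// ltW.
have ex0 : 0 < eta * x0 by rewrite mulr_gt0.
have H1 : (\int[mu]_(z in `]0%R, +oo[) (if z < eta * x0 then eta * x0 else 0)%:E <=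
    (eta ^+ 2 * x0 ^+ 2)%:E)%E.
  apply: (@le_trans _ _ (\int[mu]_(z in `]0%R, (eta * x0)%R[) (eta * x0)%:E)%E).
    rewrite [leLHS]integral_mkcond [leRHS]integral_mkcond; apply: ge0_le_integral => //.
    - by move=> z _; rewrite patchE; case: ifP => // _; rewrite lee_fin; case: ifP => // _; exact: ltW.
    - by apply/(measurable_restrictT _ (measurable_itv `]0%R, +oo[)); exact: m1.
    - apply/(measurable_restrictT _ (measurable_itv `]0%R, (eta * x0)%R[)).
      by apply: measurable_funTS; exact: measurable_cst.
    - move=> z _; rewrite !patchE !mem_setE !in_itv /= andbT.
      by case: (0 < z) => //=; case: (z < _).
  rewrite integral_cst//= lebesgue_measure_itv /= lte_fin ex0 oppr0 adde0 -EFinM lee_fin.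
  by rewrite -exprMn expr2.
have I : (\int[mu]_(z in `]0%R, +oo[) ((1 - expR (- z))%:E * P0 [set w | (z < eta * A w)%R]) <=
    ((C_A * G + ka) * eta `^ al)%:E)%E.
  apply: (@le_trans _ _ (\int[mu]_(z in `]0%R, +oo[) ((if z < eta * x0 then eta * x0 else 0)%:E +
     ((C_A + k1) * eta `^ al)%:E * ((1 - expR (- z)) * z `^ (- al))%:E))%E).
    apply: ge0_le_integral => //.
    - move=> z; rewrite /= in_itv /= andbT => z0; rewrite mule_ge0// lee_fin.
      by rewrite subr_ge0 -expR0 ler_expR oppr_le0 ltW.
    - by apply: emeasurable_funM => //; apply: measurable_funTS; exact/measurable_EFinP.
    - by apply: emeasurable_funD => //; exact: measurable_funeM.
    - by move=> z; rewrite /= in_itv /= andbT => z0; exact: bound.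
  rewrite ge0_integralD//; last 3 first.
  - by move=> z _; rewrite lee_fin; case: ifP => // _; exact: ltW.
  - by move=> z hz; rewrite mule_ge0 ?lee_fin//; have := p2 z hz; rewrite lee_fin.
  - exact: measurable_funeM.
  rewrite ge0_integralZl// integral_stable_exponent -/G.
  apply: (@le_trans _ _ ((eta ^+ 2 * x0 ^+ 2)%:E + ((C_A + k1) * eta `^ al)%:E * G%:E)%E).
    by apply: leeD => //; exact: H1.
  rewrite -EFinM -EFinD lee_fin.
  have k1G : k1 * G = ka / 2 by rewrite /k1; field; rewrite gt_eqF.
  rewrite (_ : (C_A + k1) * _ * G = C_A * G * eta `^ al + k1 * G * eta `^ al); last by ring.
  by rewrite k1G; lra.
have := mgf_excess e0; set J := (\int[P0]_w _)%E => HJ.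
rewrite -(leeD2rE _ _ (x := eta%:E))// HJ.
apply: le_trans (leeD2l _ I) _.
by rewrite -EFinD -EFinD lee_fin; lra.
Qed.

End integrals.

(** * Time reversal of the arrivals *)

Section reversal.
Context {R : realType} d (T : measurableType d) (P : probability T R).
Variable Z : nat -> T -> R.
Hypotheses (mZ : forall i, measurable_fun setT (Z i)) (iZ : mutually_independent P Z).
Hypotheses (Z0 : forall i w, 0 <= Z i w) (lawZ : forall i j, same_law P P (Z i) (Z j)).
Variables (t b be : R).

(** Index j stays fixed, so that both the j-th and the (j+1)-st partial sums, hence the number of
    arrivals before t, are preserved. *)
Definition flip (j i : nat) : nat := if (i < j)%N then (j - i.+1)%N else i.

Lemma flip_inj j : injective (flip j).
Proof.
apply: inv_inj => i; rewrite /flip; case: (ltnP i j) => ij; last by rewrite ltnNge ij.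
have -> : (j - i.+1 < j)%N by lia.
by lia.
Qed.

Lemma reversed_law j (B : set (path R nat)) : measurable B ->
  P ((fun w => Z^~ w) @^-1` B) = P ((fun w => (fun i => Z (flip j i) w)) @^-1` B).
Proof.
move=> mB; apply: law_unique => //.
move=> J E mE.
by apply: (independent_same_law iZ (reindex_independent (@flip_inj j) iZ)) => // i; exact: lawZ.
Qed.

(* The number [j] of arrivals before [t], and a large workload excess
   accumulated since one of them. *)
Definition excess (j : nat) (z : nat -> R) : bool :=
  [&& rsum z j <= t, t < rsum z j.+1 &
    [exists i : 'I_j.+1, b < \sum_(l < j - i) (1 - be * z (i + l)%N)]].

Lemma measurable_excess j : measurable [set z : path R nat | excess j z].
Proof.
apply/measurable_boolP; apply: measurable_and.
  by apply: measurable_fun_ler => //; exact: measurable_rsum.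
apply: measurable_and.
  by apply: measurable_fun_ltr => //; exact: measurable_rsum.
apply/measurable_boolP.
rewrite (_ : [set w | _] = [set z : path R nat | exists i : 'I_j.+1, b < \sum_(l < j - i) (1 - be * z (i + l)%N)]).
  apply: measurable_ex_count => i; apply/measurable_boolP; apply: measurable_fun_ltr => //.
  apply: measurable_sum => l; apply: measurable_funB => //; apply: measurable_funM => //.
  exact: measurable_coord.
by apply/seteqP; split => z /= => [/existsP|[i hi]] //; apply/existsP; exists i.
Qed.

Lemma measurable_exists_excess : measurable [set w | exists j, excess j (Z^~ w)].
Proof.
apply: measurable_ex_count => j.
have := measurable_path mZ measurableT (measurable_excess j).
by rewrite setTI.
Qed.

Definition ruin (z : nat -> R) : Prop := exists k, b < rsum (fun l => 1 - be * z l) k.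

Lemma excess_flip j (z : nat -> R) : excess j (fun i => z (flip j i)) ->
  [/\ rsum z j <= t, t < rsum z j.+1 & ruin z].
Proof.
have E k : (k <= j)%N -> \sum_(l < k) z (flip j (j - k + l)) = rsum z k.
  move=> kj; rewrite /rsum (reindex_inj rev_ord_inj) /=; apply: eq_bigr => l _.
  rewrite /flip; have lk := ltn_ord l.
  by rewrite (_ : (j - k + (k - l.+1) < j)%N); [congr z; lia|lia].
have Ej : rsum (fun i => z (flip j i)) j = rsum z j.
  by rewrite -E// subnn; apply: eq_bigr.
rewrite /excess rsumS Ej {1}/flip ltnn -rsumS => /and3P[h1 h2 /existsP[i hi]].
split => //; exists (j - i)%N; apply: lt_le_trans hi _.
rewrite /rsum (reindex_inj rev_ord_inj) /= le_eqVlt; apply/orP; left; apply/eqP.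
apply: eq_bigr => l _; have lk := ltn_ord l; have ij := ltn_ord i; congr (1 - be * _).
rewrite /flip (_ : (i + (j - i - l.+1) < j)%N); last lia.
by congr z; lia.
Qed.

Lemma measurable_ruin : measurable [set z : path R nat | ruin z].
Proof.
apply: measurable_ex_count => k; apply/measurable_boolP; apply: measurable_fun_ltr => //.
apply: measurable_sum => l; apply: measurable_funB => //; apply: measurable_funM => //.
exact: measurable_coord.
Qed.

(* Reversing the order of the arrivals before time [t] turns an excess since one
   of them into an excess of a random walk started at 0. *)
Lemma excess_le_ruin :
  (P [set w | exists j, excess j (Z^~ w)] <= P [set w | ruin (Z^~ w)])%E.
Proof.
have mp (B : set (path R nat)) : measurable B -> measurable ((fun w => Z^~ w) @^-1` B).
  by move=> mB; have := measurable_path mZ measurableT mB; rewrite setTI.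
(* The number j of arrivals is random, so the reversal is made separately for each j; the reversed
   events are disjoint in j and all lie in the ruin event. *)
pose Q j := [set z : path R nat | [/\ rsum z j <= t, t < rsum z j.+1 & ruin z]].
have mQ j : measurable (Q j).
  rewrite (_ : Q j = [set z : path R nat | rsum z j <= t] `&` [set z : path R nat | t < rsum z j.+1] `&` [set z : path R nat | ruin z]).
    apply: measurableI; last exact: measurable_ruin.
    apply: measurableI; apply/measurable_boolP.
      by apply: measurable_fun_ler => //; exact: measurable_rsum.
    by apply: measurable_fun_ltr => //; exact: measurable_rsum.
  by apply/seteqP; split => z /= => [[]|[[]]].
pose B j := (fun w => Z^~ w) @^-1` (Q j).
have mB j : measurable (B j) by exact: mp.
have rnd w : {homo rsum (Z^~ w) : m n / (m <= n)%N >-> m <= n}.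
  by apply/nondecreasing_seqP => m; rewrite rsumS lerDl.
have tB : trivIset setT B.
  apply/trivIsetP => i j _ _ ij; apply/seteqP; split => // w [[h1 h2 _] [h3 h4 _]].
  case: (ltngtP i j) ij => // l _.
    by have := lt_le_trans h2 (rnd w _ _ l); rewrite ltNge h3.
  by have := lt_le_trans h4 (rnd w _ _ l); rewrite ltNge h1.
rewrite (_ : [set w | exists j, _] = \bigcup_j ((fun w => Z^~ w) @^-1` [set z : path R nat | excess j z])); last first.
  by apply/seteqP; split => w /= [j]; exists j.
apply: (@le_trans _ _ (\big[+%E/0%R]_(0 <= j <oo) P ((fun w => Z^~ w) @^-1` [set z : path R nat | excess j z]))%E).
  apply: measure_sigma_subadditive_tail => //.
  - by move=> j; apply: mp; exact: measurable_excess.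
  - by apply: bigcupT_measurable => j; apply: mp; exact: measurable_excess.
  - by move=> w [j _ h]; exists j.
apply: (@le_trans _ _ (\big[+%E/0%R]_(0 <= j <oo) P (B j))%E).
  apply: lee_nneseries => // j _.
  rewrite (reversed_law j (measurable_excess j)); apply: le_measure; rewrite ?inE//.
    have mf : measurable_fun setT (fun w => (fun i => Z (flip j i) w) : path R nat).
      by apply: measurable_path.
    by have := mf measurableT _ (measurable_excess j); rewrite setTI.
  by move=> w h; exact: (@excess_flip j (Z^~ w) h).
have -> : (\big[+%E/0%R]_(0 <= j <oo) P (B j) = P (\bigcup_j B j))%E.
  by have /cvg_lim <- := @measure_semi_sigma_additive _ _ _ P B mB tB (bigcupT_measurable _ mB).
apply: le_measure; rewrite ?inE//.
- exact: bigcupT_measurable.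
- exact: (mp _ measurable_ruin).
- by move=> w [j _ []].
Qed.

End reversal.

(** * The reversed random walk satisfies Lundberg's condition *)

Section drift.
Context {R : realType} d0 (T0 : measurableType d0) (P0 : probability T0 R).
Variable A : {RV P0 >-> R}.
Hypotheses (A_ge0 : forall w, 0 <= A w) (EA : (\int[P0]_w (A w)%:E = 1)%E).
Variables al C_A B : R.
Hypotheses (al1 : 1 < al) (al2 : al < 2) (C_A0 : 0 < C_A) (B0 : 0 < B).
Hypothesis tailA : x `^ al * fine (P0 [set w | x < A w]) @[x --> +oo] --> C_A.

(** Guaranteed service rate over arrival rate; it exceeds 1 by about (B - de) N^(1/al - 1). *)
Definition service_ratio (de : R) (N : nat) : R :=
  (N%:R - de * N%:R `^ al^-1) / (N%:R - B * N%:R `^ al^-1).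

Let c := C_A * (Gamma (2 - al) / (al - 1)).

(** At exponent th N^(-1/al), the gain th N^(-1/al) (be - 1) and the loss c eta^al are both of order
    1/N, with coefficients th (B - de) and c th^al. The strict inequality leaves room for [de], [ka]
    and be^al. *)
Lemma drift_mgf (th : R) : 0 < th -> c * th `^ (al - 1) < B ->
  exists2 de0, 0 < de0 & forall de, 0 < de -> de <= de0 -> \forall N \near \oo,
    [/\ 0 < N%:R - B * N%:R `^ al^-1, 0 < service_ratio de N &
    (\int[P0]_w (expR (th * N%:R `^ (- al^-1) * (1 - service_ratio de N * A w)))%:E <= 1)%E].
Proof.
move=> th0 cB; have al0 : 0 < al by have := al1; lra.
have a0 : 0 < al - 1 by rewrite subr_gt0.
set K0 := th `^ (al - 1) in cB; have K00 : 0 < K0 by exact: powR_gt0.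
have c0 : 0 < c by rewrite mulr_gt0// divr_gt0// GammaE ?rgamma_gt0// subr_gt0.
pose g := B - c * K0; have g0 : 0 < g by rewrite subr_gt0.
have cK : 0 < c * K0 by rewrite mulr_gt0.
exists (g / 4); first by rewrite divr_gt0.
move=> de de0 deg.
pose ka := g / (4 * K0); have ka0 : 0 < ka by rewrite divr_gt0// mulr_gt0.
have [eta0 eta00 Heta] := mgf_le al1 al2 A_ge0 EA C_A0 tailA ka0.
(* The slack [g] is shared: a quarter for [ka], half for the factor be^al <= r, the last quarter for
   [de]. *)
pose r := (c * K0 + g / 4 + g / 2) / (c * K0 + g / 4).
have D0 : 0 < c * K0 + g / 4 by lra.
pose s := Num.min 1 ((r - 1) / 3).
have r1 : 0 < r - 1.
  rewrite /r mulrDl divff ?gt_eqF// addrAC subrr add0r !divr_gt0//.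
have s0 : 0 < s by rewrite lt_min ltr01 divr_gt0.
have s1 : s <= 1 by rewrite ge_min lexx.
have sr : (1 + s) ^+ 2 <= r.
  have : s <= (r - 1) / 3 by rewrite ge_min lexx orbT.
  by nra.
have p1 : 0 < 1 - al^-1 by rewrite subr_gt0 invf_lt1.
have q1 : 0 < al^-1 by rewrite invr_gt0.
have N1 := near_powRN (B * (1 + s)) p1 s0.
have e20 : 0 < eta0 / 2 by rewrite divr_gt0.
have N2 := near_powRN (th * 2) q1 e20.
apply: filterS (filterI (filterI N1 N2) (nbhs_infty_gt 0)) => N [[h1 h2] N0].
have X0 : 0 < N%:R :> R by rewrite ltr0n.
set X := N%:R `^ al^-1; have XX : 0 < X by exact: powR_gt0.
have XN : N%:R `^ (- (1 - al^-1)) = X / N%:R :> R.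
  by rewrite opprB powRB ?(gt_eqF X0) ?implybT// powRr1 ?(ltW X0).
rewrite XN in h1.
have {}h1 : B * (1 + s) * X <= s * N%:R by rewrite -ler_pdivrMr// -[leLHS]mulrA.
have la0 : 0 < N%:R - B * X.
  by rewrite subr_gt0; nra.
have dB : de < B by have : g = B - c * K0 by []; lra.
have n0 : 0 < N%:R - de * X.
  have : de * X < B * X by rewrite ltr_pM2r.
  by lra.
set be := service_ratio de N; have be0 : 0 < be by rewrite divr_gt0.
split => //.
have beE : be * (N%:R - B * X) = N%:R - de * X by rewrite divfK// gt_eqF.
have be1 : 1 <= be.
  rewrite ler_pdivlMr// mul1r lerD2l lerN2 ler_wpM2r ?(ltW XX)// ltW//.
have bes : be <= 1 + s.
  rewrite ler_pdivrMr//; have : 0 < de * X by rewrite mulr_gt0.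
  by rewrite -/X; move: h1; lra.
have bal : be `^ al <= r.
  apply: (@le_trans _ _ (be `^ 2)); first by rewrite ler_powR// ltW.
  by rewrite powR_mulrn ?(ltW be0)//; apply: le_trans sr; rewrite ler_sqr ?nnegrE; lra.
pose tN := th * N%:R `^ (- al^-1); have tN0 : 0 < tN by rewrite mulr_gt0// powR_gt0.
pose eta := tN * be; have e0 : 0 < eta by rewrite mulr_gt0.
have ee : eta < eta0.
  apply: (@le_lt_trans _ _ (tN * 2)); first by rewrite ler_wpM2l ?(ltW tN0)//; lra.
  by rewrite /tN mulrAC; apply: le_lt_trans h2 _; lra.
have key : (c + ka) * eta `^ al <= eta - tN.
  have -> : eta - tN = tN * (be - 1) by rewrite /eta; ring.
  have -> : eta `^ al = tN * (tN `^ (al - 1) * be `^ al).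
    rewrite /eta powRM ?(ltW tN0) ?(ltW be0)// mulrA; congr (_ * _).
    by rewrite powRB ?(gt_eqF tN0) ?implybT// powRr1 ?(ltW tN0)// mulrCA divff ?mulr1// gt_eqF.
  rewrite mulrCA ler_wpM2l ?(ltW tN0)//.
  have -> : tN `^ (al - 1) = K0 * (X / N%:R).
    rewrite /tN powRM ?(ltW th0) ?powR_ge0//; congr (_ * _).
    by rewrite -XN -powRrM; congr (_ `^ _); field; rewrite gt_eqF.
  have beX : X / N%:R * (B - de) <= be - 1.
    have -> : be - 1 = (B - de) * X / (N%:R - B * X).
      by rewrite /be /service_ratio -/X; field; rewrite gt_eqF.
    rewrite (_ : X / N%:R * (B - de) = (B - de) * X / N%:R); last by ring.
    apply: ler_wpM2l; first by rewrite mulr_ge0 ?(ltW XX)// subr_ge0 ltW.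
    by rewrite lef_pV2 ?posrE// lerBlDr lerDl mulr_ge0 ?(ltW B0) ?(ltW XX).
  apply: le_trans beX.
  have -> : (c + ka) * (K0 * (X / N%:R) * be `^ al) = X / N%:R * ((c + ka) * K0 * be `^ al) by ring.
  rewrite ler_wpM2l ?divr_ge0 ?(ltW XX) ?(ltW X0)//.
  have -> : (c + ka) * K0 = c * K0 + g / 4 by rewrite /ka; field; rewrite gt_eqF.
  apply: (@le_trans _ _ ((c * K0 + g / 4) * r)); first by rewrite ler_wpM2l// ltW.
  by rewrite /r mulrCA divff ?gt_eqF// mulr1 /g; rewrite /g in deg; lra.
have mA : measurable_fun setT A by [].
have me : measurable_fun setT (fun w => expR (- (eta * A w))).
  by apply: (measurableT_comp (@measurable_expR R)); apply: measurableT_comp => //; exact: measurable_funM.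
have -> : (\int[P0]_w (expR (tN * (1 - be * A w)))%:E = (expR tN)%:E * \int[P0]_w (expR (- (eta * A w)))%:E)%E.
  rewrite -ge0_integralZl//; last exact/measurable_EFinP.
  apply: eq_integral => w _; rewrite -EFinM -expRD; congr (expR _)%:E.
  by rewrite /eta; ring.
apply: (@le_trans _ _ ((expR tN)%:E * (1 - eta + (c + ka) * eta `^ al)%:E)%E).
  by rewrite lee_wpmul2l ?lee_fin ?expR_ge0//; exact: Heta.
rewrite -EFinM lee_fin; apply: (@le_trans _ _ (expR tN * expR (- tN))); last first.
  by rewrite -expRD subrr expR0.
rewrite ler_wpM2l ?expR_ge0//; apply: le_trans (expR_ge1Dx _).
by move: key; lra.
Qed.

End drift.

(** * The queue in steady state *)

(** A monotone function has countably many discontinuities, while an open interval has positive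
    Lebesgue measure. *)
Lemma continuity_point {R : realType} (nu : probability R R) (a b : R) : a < b ->
  exists y, [/\ a < y, y < b & {for y, continuous (fun y : R => nu [set z : R | z <= y])}].
Proof.
move=> ab.
pose F (y : R) := fine (nu [set z : R | z <= y]).
have mle (y : R) : measurable [set z : R | z <= y].
  by apply/measurable_boolP; exact: measurable_fun_ler.
have FE y : nu [set z : R | z <= y] = (F y)%:E.
  by rewrite /F fineK//; exact: (fin_num_measure nu _ (mle y)).
have ndF (x y : R) : x <= y -> F x <= F y.
  move=> xy; rewrite -lee_fin -!FE; apply: le_measure; rewrite ?inE//; try exact: mle.
  by move=> z /= zx; exact: le_trans zx xy.
have : ~ (`]a, b[%classic `<=` [set x | x \in (`]a, b[) /\ discontinuity F x]).
  move=> sub; have := countable_lebesgue_measure0 (sub_countable (subset_card_le sub) (discontinuity_countable (fun x y _ _ => @ndF x y))).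
  rewrite lebesgue_measure_itv /= lte_fin ab -EFinD => -[] /eqP.
  by rewrite subr_eq0 gt_eqF.
move=> /existsNP[y /not_implyP[yab ny]].
move: (yab); rewrite /= in_itv /= => /andP[ay yb].
exists y; split => //.
have cl : cvg (F x @[x --> y^'-]).
  apply: nondecreasing_at_left_is_cvgr; near=> x; first by move=> u v _ _; exact: ndF.
  by exists (F y) => _ [z zx <-]; apply: ndF; move: zx; rewrite /= in_itv /= => /andP[_ /ltW].
have cr : cvg (F x @[x --> y^'+]).
  apply: nondecreasing_at_right_is_cvgr; near=> x; first by move=> u v _ _; exact: ndF.
  by exists (F y) => _ [z zx <-]; apply: ndF; move: zx; rewrite /= in_itv /= => /andP[/ltW].
have lr : lim (F x @[x --> y^'-]) = lim (F x @[x --> y^'+]).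
  by apply/eqP/negPn/negP => ne; apply: ny; split; [rewrite inE|split].
have le1 : lim (F x @[x --> y^'-]) <= F y.
  by apply: limr_le => //; near=> x; apply: ndF; near: x; exact: nbhs_left_le.
have le2 : F y <= lim (F x @[x --> y^'+]).
  by apply: limr_ge => //; near=> x; apply: ndF; near: x; exact: nbhs_right_ge.
have e1 : lim (F x @[x --> y^'-]) = F y by apply/eqP; rewrite eq_le le1 lr le2.
have cF : F x @[x --> y] --> F y.
  by apply/left_right_continuousP; split; [rewrite -[X in _ --> X]e1|rewrite -[X in _ --> X]e1 lr].
suff : nu [set z : R | z <= x] @[x --> y] --> nu [set z : R | z <= y] by [].
rewrite FE (_ : (fun x => _) = (fun x => (F x)%:E)); last first.
  by apply/funext => x; exact: FE.
by apply: cvg_EFin => //; exact: nearW.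
Unshelve. all: by end_near. Qed.

(** * From the coupled queue to the given one *)

Section transfer.
Context {R : realType} d0 (T0 : measurableType d0) (P0 : probability T0 R).
Variables (A S : {RV P0 >-> R}).
Hypotheses (S_ge0 : forall w, 0 <= S w) (ES : (\int[P0]_w (S w)%:E = 1)%E).
Context d (T : measurableType d) (P : probability T R) (As Ss : nat -> {RV P >-> R}).
Hypothesis primitives : queue_primitives As Ss A S.
Context d' (T' : measurableType d') (P' : probability T' R) (W : prim -> T' -> R).
Variables (n : nat) (lam : R).
Hypothesis ext : extension_of A S_ge0 ES n.+1 P' W.
Hypothesis W0 : forall i w, 0 <= W i w.
Hypothesis r0 : forall k w, (k < n.+1)%N -> 0 < W (inr (inr k)) w.
Hypothesis unb : forall w k t, exists m, t < rsum (fun l => W (inr (inl (k, l))) w) m.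
Hypothesis lam0 : 0 < lam.

Definition number (t : R) (w : T') : R := (data_number n lam (queue_data n lam (W^~ w)) t)%:R.

Let ic (w : T') := InitialCondition (mkseq (fun k => W (inr (inr k)) w) n.+1) 0 0.

Lemma valid_ic w : valid_initial n.+1 (ic w).
Proof.
have s : size (in_service (ic w)) = n.+1 by exact: size_mkseq.
split; [by rewrite s| |by []|by []].
suff : all (fun r : R => 0 < r) (mkseq (fun k => W (inr (inr k)) w) n.+1) by [].
by apply/allP => _ /mapP[k + ->]; rewrite mem_iota => /andP[_ kn]; exact: r0.
Qed.

(** Arrivals and processing times are taken from the given sequences, residual times from the new
    space; [As 0] merely fills the remaining coordinates of [Y]. *)
Let is_prim (j : queue_index) := if j is inr (inr _) then false else true.
Let Y (j : queue_index) : T -> R :=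
  match j with inl i => As i | inr (inl i) => Ss i | inr (inr _) => As 0%N end.
Let X (j : queue_index) := W (fresh j).

Lemma primitives_independent (J : {fset queue_index}) (E : queue_index -> set R) :
  {in J, forall j, is_prim j} -> (forall j, measurable (E j)) ->
  P (\bigcap_(j in [set` J]) (Y j @^-1` E j)) = (\prod_(j <- J) P (Y j @^-1` E j))%E.
Proof.
move=> JK mE; have [_ _ iAS] := primitives.
pose h (j : queue_index) : nat + nat := match j with inl i => inl i | inr (inl i) => inr i | inr (inr i) => inl i end.
pose g (i : nat + nat) : queue_index := match i with inl i => inl i | inr i => inr (inl i) end.
have gh j : is_prim j -> g (h j) = j by case: j => [i|[i|i]].
have := iAS (h @` J)%fset (fun i => E (g i)) (fun i => mE _).
rewrite (_ : \bigcap_(i in _) _ = \bigcap_(j in [set` J]) (Y j @^-1` E j)); last first.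
  apply/seteqP; split => w /= H.
    move=> j jJ; have := H (h j) (in_imfset _ _ jJ); rewrite /= gh ?JK//.
    by have := JK j jJ; case: (j) => [i|[i|i]].
  move=> _ /= /imfsetP[j /= jJ ->]; have := H j jJ; rewrite /= gh ?JK//.
  by have := JK j jJ; case: (j) => [i|[i|i]].
move=> ->; rewrite big_imfset /=; last first.
  by move=> i j iJ jJ hij; rewrite -(gh i (JK i iJ)) hij gh// JK.
rewrite big_seq [RHS]big_seq; apply: eq_bigr => j jJ; rewrite gh ?JK//.
by have := JK j jJ; case: (j) => [i|[i|i]].
Qed.

Let mY j : measurable_fun setT (Y j).
Proof. by case: j => [i|[i|i]] /=. Qed.

Let C (t y : R) : set (T' * T) :=
  (fun z => (splice X Y is_prim)^~ z) @^-1` [set z : path R queue_index | (data_number n lam z t)%:R <= y].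

Let mX j : measurable_fun setT (X j).
Proof. by have [[mW iW] _ _ _ _] := ext; exact: mW. Qed.

Let mdata (t y : R) : measurable [set z : path R queue_index | (data_number n lam z t)%:R <= y].
Proof. exact: (nat_measurableE (fun m : nat => m%:R <= y) (measurable_data_number n lam t)). Qed.

Let mC t y : measurable (C t y).
Proof.
have ms := measurable_splice is_prim mX mY.
by have := measurable_path ms measurableT (mdata t y); rewrite setTI.
Qed.

Let xsectionC t y w' : xsection (C t y) w' =
  [set w | (number_in_system n.+1 (ic w') (fun k => As k w / lam) (fun k => Ss k w) t)%:R <= y].
Proof. by apply/seteqP; split => w; rewrite /xsection /= inE. Qed.

(** By [queue_data_law] the coupled data have the joint law of the residual times spliced with the
    original primitives; Fubini then fixes the residual times, which act as a deterministic initial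
    condition. *)
Lemma number_law t (y : R) :
  P' [set w | number t w <= y] =
  (\int[P']_w' P [set w | ((number_in_system n.+1 (ic w') (fun k => As k w / lam)%R (fun k => Ss k w) t)%:R <= y)%R])%E.
Proof.
have [[mW iW] WA WS WR' WR] := ext; have [sA sS iAS] := primitives.
have iX : mutually_independent P' X := reindex_independent fresh_inj iW.
have mV j : measurable_fun setT (fun w => queue_data n lam (W^~ w) j).
  exact: (measurableT_comp (measurable_queue_data n lam j) (measurable_path mW)).
have slotX w t0 (k : 'I_n.+1) : exists m, t0 < slot (wr (W^~ w)) (wX (W^~ w)) k m.
  have [m hm] := unb w k t0; exists m; apply: lt_le_trans hm _.
  by rewrite /slot lerDr; exact: W0.
have sX k m : same_law P' P' (W (inr (inl (k, m)))) (W (inr (inl (0%N, 0%N)))).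
  by move=> E mE; rewrite !WS.
have XY (J : {fset queue_index}) (E : queue_index -> set R) : (forall i, measurable (E i)) ->
   P' (\bigcap_(i in [set` J]) ((fun w => queue_data n lam (W^~ w) i) @^-1` E i)) =
   prod_prob P' P (\bigcap_(i in [set` J]) (splice X Y is_prim i @^-1` E i)).
  move=> mE; rewrite (queue_data_law lam mW iW W0 slotX sX)//.
  rewrite (splice_independent mX mY iX primitives_independent)//; apply: eq_bigr => j _.
  case: (boolP (is_prim j)) => jp; last by rewrite (splice_same_lawl P' P Y mX jp (mE j)).
  rewrite (splice_same_lawr P' P X mY jp (mE j)).
  by case: j jp => [i|[i|i]] //= _; rewrite ?WA ?WS ?sA ?sS.
have := law_unique mV (measurable_splice is_prim mX mY) XY (mdata t y).
rewrite (_ : _ @^-1` _ = [set w | number t w <= y])// => ->.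
transitivity (\int[P']_w' P (xsection (C t y) w'))%E; first by [].
by apply: eq_integral => w' _; rewrite xsectionC.
Qed.

(** The hypothesis is applied for each value of the residual times, with the same limit; dominated
    convergence integrates it. *)
Lemma number_cvg B al nu (y : R) (t : nat -> R) : lam = arrival_rate n.+1 B al ->
  steady_state_number As Ss n.+1 B al nu ->
  {for y, continuous (fun y : R => nu [set z : R | z <= y])} ->
  t K @[K --> \oo] --> +oo ->
  P' [set w | number (t K) w <= y] @[K --> \oo] --> nu [set z : R | z <= y].
Proof.
move=> lamE st cy tK.
rewrite (_ : (fun K => _) = (fun K => \int[P']_w' P (xsection (C (t K) y) w'))%E); last first.
  by apply/funext => K; rewrite number_law; apply: eq_integral => w' _; rewrite xsectionC.
have -> : nu [set z : R | z <= y] = (\int[P']_w' nu [set z : R | (z <= y)%R])%E.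
  by rewrite integral_cst//= probability_setT mule1.
apply: (@dominated_cvg _ _ _ P' setT measurableT (fun K w' => P (xsection (C (t K) y) w')) _ (cst 1%E)).
- by move=> K; exact: measurable_fun_xsection.
- move=> w' _; rewrite (_ : (fun K => _) = (fun K => P [set w | ((number_in_system n.+1 (ic w')
    (fun k => As k w / lam) (fun k => Ss k w) (t K))%:R <= y)%R])); last first.
    by apply/funext => K; rewrite xsectionC.
  have H := st (ic w') (valid_ic w') y cy; rewrite -lamE in H.
  exact: (cvg_comp _ _ tK H).
- by [].
- by apply: (@bounded_integrable _ _ _ P' (cst 1) 1) => // w; rewrite normr1.
- move=> K w' _; rewrite gee0_abs//; apply: probability_le1; exact: measurable_xsection.
Qed.

End transfer.

Lemma natr_geo_cvg {R : realType} (h : R) : 0 < h -> h * (2 ^ K)%:R @[K --> \oo] --> +oo.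
Proof.
move=> h0; apply/cvgryPge => a; exists (Num.truncn (`|a| / h)).+1 => // K /= hK.
have p0 : 0 <= `|a| / h by rewrite divr_ge0// ltW.
have /andP[_ q] := truncn_itv p0.
rewrite -ler_pdivrMl// mulrC; apply: le_trans (ler_norm _) _; rewrite normrM (gtr0_norm (x := h^-1)) ?invr_gt0//.
apply: le_trans (ltW q) _; rewrite ler_nat; apply: leq_trans hK _; exact/ltnW/ltn_expl.
Qed.

(** * Deterministic bound on the number of jobs *)

Section pathwise_bound.
Context {R : realType} (n : nat) (lam : R) (z : prim -> R).
Hypotheses (lam0 : 0 < lam) (z0 : forall i, 0 <= z i).
Hypothesis slotX : forall t (k : 'I_n.+1), exists m, t < slot (wr z) (wX z) k m.
Hypothesis unbA : forall t, exists m, t < rsum (fun l => z (inl l)) m.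
Variables (t b D : R) (M : nat).
Hypotheses (t0 : 0 <= t) (b0 : 0 <= b) (D0 : 0 <= D) (DN : D <= n.+1%:R).
Let N : R := n.+1%:R.
Let be : R := (N - D) / lam.
Hypothesis good : forall s, 0 <= s -> s < t ->
  N * (t - s) - D * (1 + (t - s)) <= completions n.+1 M s t z.
Hypothesis no_excess : forall j, ~~ excess (t * lam) b be j (fun i => z (inl i)).

(** The comparison leaves at most N + 1 + (j - i) - C jobs, where C counts the completions since a
    i. As C is at least (N - D)(a j - a i) - D, the jobs beyond N number at most 1 + D plus the sum
    of 1 - be x over the arrivals i to j, which [no_excess] bounds by b. *)
Lemma number_le : (data_number n lam (queue_data n lam z) t)%:R <= N + (b + 1 + D).
Proof.
rewrite leNgt; apply/negP => big.
pose x i := z (inl i).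
pose a (i : nat) : R := \sum_(k < i) wu lam z k.
have aE i : a i = rsum x i / lam by rewrite /a /rsum mulr_suml.
have [m hm mmin] := ex_minnP (unbA (t * lam)).
have : (0 < m)%N by case: m hm {mmin} => //; rewrite /rsum big_ord0 ltNge mulr_ge0// ltW.
case: m hm mmin => // j hj jmin _.
have hj' : rsum x j <= t * lam.
  by rewrite leNgt; apply/negP => /jmin; rewrite ltnn.
have aj : a j <= t by rewrite aE ler_pdivrMr.
have aj1 : t < a j.+1 by rewrite aE ltr_pdivlMr.
have X_ge0 k m : 0 <= wX z k m by exact: z0.
have u_ge0 k : 0 <= wu lam z k by rewrite divr_ge0 ?z0 ?(ltW lam0).
have [i ij] := number_in_system_le X_ge0 u_ge0 slotX M t0 aj aj1.
set C := (\sum_(k < n.+1) _)%N => hn.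
have CE : C%:R = completions n.+1 M (a i) t z.
  rewrite /C natr_sum; apply: eq_bigr => k _; rewrite natr_sum; exact: eq_bigr.
have {}hn : (data_number n lam (queue_data n lam z) t <= n.+1 + (j.+1 - i - C))%N := hn.
have nN : (n.+1 < data_number n lam (queue_data n lam z) t)%N.
  rewrite -(ltr_nat R); apply: le_lt_trans big; rewrite lerDl; have := b0; have := D0; lra.
move: hn nN big; move: (data_number n lam (queue_data n lam z) t) => q hn nN big.
have {hn nN} : (q + i + C <= n.+1 + j.+1)%N by lia.
rewrite -(ler_nat R) !natrD -/N CE -(natr1 j) => hn.
have ai j' : 0 <= a j' by apply: sumr_ge0 => k _; exact: u_ge0.
have aij : a j = a i + \sum_(l < j - i) x (i + l)%N / lam.
  have aD k l : a (k + l)%N = a k + \sum_(l' < l) x (k + l')%N / lam by rewrite /a big_split_ord.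
  by rewrite -aD subnKC.
have Si : 0 <= \sum_(l < j - i) x (i + l)%N / lam.
  by apply: sumr_ge0 => l _; rewrite divr_ge0 ?z0 ?(ltW lam0).
have sE : (N - D) * (\sum_(l < j - i) x (i + l)%N / lam) = \sum_(l < j - i) be * x (i + l)%N.
  by rewrite mulr_sumr; apply: eq_bigr => l _; rewrite /be -mulrA [lam^-1 * _]mulrC.
have Cge : (N - D) * (\sum_(l < j - i) x (i + l)%N / lam) - D <= completions n.+1 M (a i) t z.
  have [ait|tai] := ltP (a i) t.
    apply: le_trans (good (ai i) ait).
    have : (N - D) * (a j - a i) <= (N - D) * (t - a i).
      by rewrite ler_wpM2l ?subr_ge0// lerD2r.
    by rewrite aij addrAC subrr add0r; lra.
  (* If a i >= t, then a i = a j = t: the sum vanishes and C >= 0 suffices. *)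
  have -> : \sum_(l < j - i) x (i + l)%N / lam = 0 by lra.
  by rewrite mulr0 sub0r (le_trans _ (_ : 0 <= _))// ?oppr_le0// -CE.
have := no_excess j; rewrite /excess hj' hj /= negb_exists => /forallP/(_ (Ordinal (_ : (i < j.+1)%N))) /=.
move=> /(_ ij); rewrite -leNgt sumrB sumr_const card_ord -sE natrB//.
move: hn big Cge; move: (completions _ _ _ _ _) ((N - D) * _) (q%:R : R) (i%:R : R) (j%:R : R) => c1 c2 c3 c4 c5.
by lra.
Qed.

End pathwise_bound.

Section tail.
Context {R : realType} d0 (T0 : measurableType d0) (P0 : probability T0 R).
Variables (A S : {RV P0 >-> R}).
Hypotheses (A_ge0 : forall w, 0 <= A w) (S_ge0 : forall w, 0 <= S w).
Hypotheses (EA : (\int[P0]_w (A w)%:E = 1)%E) (ES : (\int[P0]_w (S w)%:E = 1)%E).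
Context d (T : measurableType d) (P : probability T R) (As Ss : nat -> {RV P >-> R}).
Hypothesis primitives : queue_primitives As Ss A S.
Variables (al B de e th : R) (n : nat).
Let N : R := n.+1%:R.
Let X : R := N `^ al^-1.
Hypotheses (al1 : 1 < al) (de0 : 0 < de) (e0 : 0 < e) (th0 : 0 < th).
Hypothesis service : forall d (T : measurableType d) (P : probability T R) (W : prim -> T -> R),
    servers_data S_ge0 ES n.+1 P W -> forall K, exists M, exists B,
    [/\ measurable B, (P B <= e%:E)%E & forall w, ~ B w ->
      let t := mesh al de n.+1 * (2 ^ K)%:R in forall s, 0 <= s -> s < t ->
      n.+1%:R * (t - s) - de * n.+1%:R `^ al^-1 * (1 + (t - s)) <= completions n.+1 M s t (W^~ w)].
Hypothesis lam0 : 0 < N - B * X.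
Hypothesis ratio0 : 0 < service_ratio al B de n.+1.
Hypothesis drift : (\int[P0]_w (expR (th * N `^ (- al^-1) * (1 - service_ratio al B de n.+1 * A w)))%:E <= 1)%E.
Variables (b y : R) (nu : probability R R).
Hypotheses (b0 : 0 <= b) (yb : N + (b + 1 + de * X) <= y).
Hypothesis st : steady_state_number As Ss n.+1 B al nu.
Hypothesis cy : {for y, continuous (fun y : R => nu [set z : R | z <= y])}.

(** The horizons are the times mesh 2^K for which [service_bound] is stated; they tend to infinity,
    which is all the passage to the limit requires. The two error terms are the failure of the
    service bound and the ruin of the reversed walk. *)
Lemma tail_bound :
  (1 <= nu [set z : R | (z <= y)%R] + (e + expR (- (th * N `^ (- al^-1) * b)))%:E)%E.
Proof.
have [d' [T' [P' [W [ext [W0 r0 unb unbA]]]]]] := good_extension_exists A_ge0 S_ge0 EA ES primitives n.+1.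
have [[mW iW] WA WS WR' WR] := ext.
pose lam := N - B * X.
have lamE : lam = arrival_rate n.+1 B al by [].
pose t K := mesh al de n.+1 * (2 ^ K)%:R.
have h0 : 0 < mesh al de n.+1 by rewrite mulr_gt0 ?divr_gt0 ?powR_gt0.
have tc : t K @[K --> \oo] --> +oo := natr_geo_cvg h0.
have H := number_cvg primitives ext W0 r0 unb lamE st cy tc.
have sW : servers_data S_ge0 ES n.+1 P' W by split.
pose be := service_ratio al B de n.+1.
have D0 : 0 <= de * X by rewrite mulr_ge0 ?powR_ge0// ltW.
have DN : de * X <= N.
  by move: ratio0; rewrite /service_ratio -/N -/X pmulr_lgt0 ?invr_gt0// subr_gt0 => /ltW.
pose eps : R := e + expR (- (th * N `^ (- al^-1) * b)).
have key K : ((1 - eps)%:E <= P' [set w | (number W n lam (t K) w <= y)%R])%E.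
  have [M [B1 [mB1 PB1 HB1]]] := service sW K.
  pose Z i := W (inl i).
  pose B2 := [set w | exists j, excess (t K * lam) b be j (fun i => Z i w)].
  have mZ i : measurable_fun setT (Z i) by exact: mW.
  have iZ : mutually_independent P' Z by apply: (reindex_independent (h := inl)) iW => i j [].
  have lZ i j : same_law P' P' (Z i) (Z j) by move=> E mE; rewrite !WA.
  have mB2 : measurable B2 by exact: measurable_exists_excess.
  have PB2 : (P' B2 <= (expR (- (th * N `^ (- al^-1) * b)))%:E)%E.
    apply: le_trans (excess_le_ruin mZ iZ (fun i w => W0 _ w) lZ _ _ _) _.
    pose f (x : R) := 1 - be * x.
    have mf : measurable_fun setT f by apply: measurable_funB => //; exact: measurable_funM.
    have mxi k : measurable_fun setT (fun w => f (Z k w)) by exact: (measurableT_comp mf (mZ k)).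
    have ixi : mutually_independent P' (fun k w => f (Z k w)) := independent_comp (fun=> mf) iZ.
    have tp : 0 <= th * N `^ (- al^-1) by rewrite mulr_ge0 ?powR_ge0// ltW.
    apply: (lundberg mxi ixi tp b0) => k.
    have mg : measurable_fun setT (fun x : R => (expR (th * N `^ (- al^-1) * f x))%:E).
      apply/measurable_EFinP; apply: (measurableT_comp (@measurable_expR R)).
      exact: measurable_funM.
    have mA : measurable_fun setT A by [].
    rewrite (same_law_integral (mZ k) mA (WA k) mg)//.
  have mQ : measurable [set w | number W n lam (t K) w <= y].
    have mV j : measurable_fun setT (fun w => queue_data n lam (W^~ w) j).
      exact: (measurableT_comp (measurable_queue_data n lam j) (measurable_path mW)).
    have := measurable_path mV measurableT
      (nat_measurableE (fun m : nat => m%:R <= y) (measurable_data_number n lam (t K))).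
    by rewrite setTI.
  have cover : setT `<=` [set w | number W n lam (t K) w <= y] `|` (B1 `|` B2).
    move=> w _; have [b1|nb1] := pselect (B1 w); first by right; left.
    have [b2|nb2] := pselect (B2 w); first by right; right.
    left; apply: le_trans yb.
    have t0 : 0 <= t K by rewrite mulr_ge0 ?(ltW h0).
    have slotX t' (k : 'I_n.+1) : exists m, t' < slot (wr (W^~ w)) (wX (W^~ w)) k m.
      have [m hm] := unb w k t'; exists m; apply: lt_le_trans hm _.
      by rewrite /slot lerDr; exact: W0.
    apply: (number_le (z := W^~ w) lam0 (fun i => W0 i w) slotX (unbA w) t0 b0 D0 DN (HB1 w nb1)).
    by move=> j; apply/negP => h; apply: nb2; exists j.
  have : (P' setT <= P' [set w | (number W n lam (t K) w <= y)%R] + (P' B1 + P' B2))%E.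
    apply: (@le_trans _ _ (P' ([set w | number W n lam (t K) w <= y] `|` (B1 `|` B2)))).
      by apply: le_measure; rewrite ?inE//; apply: measurableU => //; exact: measurableU.
    apply: le_trans (measureU2 _ _ _) _ => //; first exact: measurableU.
    by rewrite leeD2l// measureU2.
  rewrite probability_setT EFinB leeBlDr// => /le_trans; apply.
  by rewrite leeD2l// /eps EFinD leeD.
have : ((1 - eps)%:E <= nu [set z : R | (z <= y)%R])%E.
  apply: (closed_cvg (fun x => ((1 - eps)%:E <= x)%E)) H; first exact: closed_ereal_le_ereal.
  exact: nearW.
by rewrite EFinB leeBlDr.
Qed.

End tail.

Lemma limn_esup_le {R : realType} (u : (\bar R)^nat) (c : R) :
  (forall e, 0 < e -> \forall n \near \oo, (u n <= (c + e)%:E)%E) -> (limn_esup u <= c%:E)%E.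
Proof.
move=> H; rewrite limn_esup_lim; apply/lee_addgt0Pr => e e0.
rewrite -EFinD; apply: lime_le; first exact: is_cvg_esups.
have [N _ hN] := H e e0; exists N => // m /= Nm.
by apply: ub_ereal_sup => _ [k /= mk <-]; apply: hN => /=; exact: leq_trans Nm mk.
Qed.

(** * Choice of the parameters and the limsup *)

Section queue_tail.
Context {R : realType} d0 (T0 : measurableType d0) (P0 : probability T0 R).
Variables (A S : {RV P0 >-> R}).
Hypotheses (A_ge0 : forall w, 0 <= A w) (S_ge0 : forall w, 0 <= S w).
Hypotheses (EA : (\int[P0]_w (A w)%:E = 1)%E) (ES : (\int[P0]_w (S w)%:E = 1)%E).
Variables (al C_A eps CS : R).
Hypotheses (al1 : 1 < al) (al2 : al < 2) (C_A0 : 0 < C_A).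
Hypothesis tailA : x `^ al * fine (P0 [set w | x < A w]) @[x --> +oo] --> C_A.
Hypotheses (eps_gt0 : 0 < eps) (eps_le1 : eps <= 1).
Hypothesis momentS : (\int[P0]_w (S w `^ (1 + eps))%:E = CS%:E)%E.
Context d (T : measurableType d) (P : probability T R) (As Ss : nat -> {RV P >-> R}).
Hypothesis primitives : queue_primitives As Ss A S.
Variables (B : R) (x : R) (nuQ : nat -> probability R R).
Hypotheses (B0 : 0 < B) (x0 : 0 < x).
Hypothesis st : \forall n \near \oo, steady_state_number As Ss n B al (nuQ n).

Let c := C_A * (Gamma (2 - al) / (al - 1)).
Let ts := (B / c) `^ (al - 1)^-1.

Lemma queue_tail :
  (limn_esup (fun n => nuQ n [set q : R | (x < n%:R `^ (- al^-1) * Num.max (q - n%:R) 0)%R])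
    <= (expR (- (ts * x)))%:E)%E.
Proof.
have a0 : 0 < al - 1 by rewrite subr_gt0.
have al0 : 0 < al by have := al1; lra.
have q0 : 0 < al^-1 by rewrite invr_gt0.
have c0 : 0 < c by rewrite mulr_gt0// divr_gt0// GammaE ?rgamma_gt0// subr_gt0.
have ts0 : 0 < ts by rewrite powR_gt0// divr_gt0.
apply: limn_esup_le => e e0.
have e2 : 0 < e / 2 by rewrite divr_gt0.
(* The tolerance in the exponent: the replacements of ts by th and x by x', the loss [de] and the
   unit subtracted in [b] each cost at most g/4. *)
pose g := ln (1 + e / 2); have g0 : 0 < g by rewrite ln_gt0// ltrDl.
have eg : expR g = 1 + e / 2 by rewrite lnK// posrE addr_gt0.
have tx0 : 0 < 4 * x by rewrite mulr_gt0.
have tt0 : 0 < 4 * ts by rewrite mulr_gt0.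
(* Strictly below the critical exponent, as [drift_mgf] requires; the maximum keeps it positive. *)
pose th := Num.max (ts / 2) (ts - g / (4 * x)).
have th0 : 0 < th by rewrite lt_max divr_gt0.
have thts : th < ts.
  rewrite gt_max ltr_pdivrMr// ltr_pMr// ltr1n /=.
  by rewrite ltrBlDr ltrDl divr_gt0.
have thg : ts - g / (4 * x) <= th by rewrite le_max lexx orbT.
(* A level slightly below x leaves room for a continuity point of the limit law. *)
pose x' := Num.max (x / 2) (x - g / (4 * ts)).
have x'x : x' < x.
  rewrite gt_max ltr_pdivrMr// ltr_pMr// ltr1n /=.
  by rewrite ltrBlDr ltrDl divr_gt0.
have x'2 : x / 2 <= x' by rewrite le_max lexx.
have x'g : x - g / (4 * ts) <= x' by rewrite le_max lexx orbT.
have cth : c * th `^ (al - 1) < B.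
  rewrite mulrC -ltr_pdivlMr//.
  have -> : B / c = ts `^ (al - 1).
    by rewrite /ts -powRrM mulVf ?gt_eqF// powRr1// divr_ge0// ltW.
  by rewrite gt0_ltr_powR// nnegrE ltW.
have [de0 de00 hde] := drift_mgf A_ge0 EA al1 al2 C_A0 B0 tailA th0 cth.
pose de := Num.min de0 (Num.min (x / 4) (g / (4 * ts))).
have dep : 0 < de by rewrite !lt_min de00 !divr_gt0.
have dede : de <= de0 by rewrite ge_min lexx.
have dex : de <= x / 4 by rewrite !ge_min lexx orbT.
have deg : de <= g / (4 * ts) by rewrite !ge_min lexx !orbT.
have N1 := service_bound S_ge0 ES eps_gt0 eps_le1 momentS al1 al2 dep e2.
have N2 := hde de dep dede.
have N3 := near_powRN 1 q0 (divr_gt0 x0 (ltr0n R 4) : 0 < x / 4).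
have N4 := near_powRN ts q0 (divr_gt0 g0 (ltr0n R 4) : 0 < g / 4).
apply: filterS (filterI (filterI (filterI N1 N2) (filterI N3 N4)) (filterI st (nbhs_infty_gt 0))).
move=> [|n] [[[h1 h2] [h3 h4]] [h5 N0]] //.
have [lam0 ratio0 drift] := h2.
have NN : 0 < n.+1%:R :> R by [].
move: h3 h4; set X := n.+1%:R `^ al^-1; have X0 : 0 < X by exact: powR_gt0.
have XV : n.+1%:R `^ (- al^-1) = X^-1 by rewrite powRN.
rewrite XV mul1r => h3 h4.
have X4 : 1 <= X * (x / 4) by rewrite -ler_pdivrMl// mulr1.
have xx' : n.+1%:R + x' * X < n.+1%:R + x * X by rewrite ltrD2l ltr_pM2r.
have [y [y1 y2 cy]] := continuity_point (nuQ n.+1) xx'.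
(* Solves b + 1 + de X = x' X, the level reached by the pathwise bound. *)
pose b := X * (x' - de) - 1.
have b0 : 0 <= b.
  rewrite subr_ge0; apply: le_trans X4 _; rewrite ler_wpM2l ?(ltW X0)//.
  by move: dex x'2; lra.
have yb : n.+1%:R + (b + 1 + de * X) <= y.
  by apply: le_trans (ltW y1); rewrite /b lerD2l le_eqVlt; apply/orP; left; apply/eqP; ring.
have := tail_bound A_ge0 EA primitives dep th0 h1 lam0 ratio0 drift b0 yb h5 cy.
set r := expR _ => tb.
have hr : r <= expR (- (ts * x)) + e / 2.
  apply: (@le_trans _ _ (expR (- (ts * x)) * expR g)).
    rewrite -expRD ler_expR XV /b.
    have -> : - (th * X^-1 * (X * (x' - de) - 1)) = - (th * x') + th * de + th * X^-1.
      by field; rewrite gt_eqF.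
    have k1 : th * (x - x') <= g / 4.
      apply: (@le_trans _ _ (ts * (g / (4 * ts)))).
        by rewrite ler_pM ?(ltW th0) ?(ltW thts)// ?subr_ge0 ?(ltW x'x)//; lra.
      by rewrite le_eqVlt; apply/orP; left; apply/eqP; field; rewrite gt_eqF.
    have k2 : th * de <= g / 4.
      apply: (@le_trans _ _ (ts * (g / (4 * ts)))).
        by rewrite ler_pM ?(ltW th0) ?(ltW thts) ?(ltW dep).
      by rewrite le_eqVlt; apply/orP; left; apply/eqP; field; rewrite gt_eqF.
    have k3 : th * X^-1 <= g / 4.
      by apply: le_trans h4; rewrite ler_wpM2r ?invr_ge0 ?(ltW X0)// ltW.
    have k4 : (ts - th) * x <= g / 4.
      apply: (@le_trans _ _ (g / (4 * x) * x)); first by rewrite ler_wpM2r ?(ltW x0)//; lra.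
      by rewrite le_eqVlt; apply/orP; left; apply/eqP; field; rewrite gt_eqF.
    by move: k1 k2 k3 k4; lra.
  rewrite eg mulrDr mulr1 lerD2l ler_piMl ?(ltW e2)// -expR0 ler_expR oppr_le0.
  by rewrite mulr_ge0 ?(ltW ts0) ?(ltW x0).
have mle (z : R) : measurable [set q : R | q <= z].
  by apply/measurable_boolP; exact: measurable_fun_ler.
have fl : nuQ n.+1 [set z : R | z <= y] \is a fin_num := fin_num_measure _ _ (mle y).
apply: (@le_trans _ _ (nuQ n.+1 (~` [set z : R | z <= y]))).
  apply: le_measure; rewrite ?inE.
  - apply/measurable_boolP; apply: measurable_fun_ltr => //; apply: measurable_funM => //.
    by apply: measurable_maxr => //; exact: measurable_funB.
  - exact: measurableC.
  - move=> q /= hq; apply/negP; rewrite -ltNge; apply: lt_trans y2 _.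
    move: hq; rewrite mulrC ltr_pdivlMr// lt_max => /orP[]; first by rewrite ltrBrDl.
    by rewrite ltNge mulr_ge0 ?(ltW x0) ?(ltW X0).
rewrite probability_setC//; apply: (@le_trans _ _ (e / 2 + r)%:E).
  by rewrite leeBlDl.
by rewrite lee_fin; move: hr; lra.
Qed.

End queue_tail.

Theorem corollary2 (R : realType)
    (d0 : measure_display) (T0 : measurableType d0) (P0 : probability T0 R)
    (A S : {RV P0 >-> R})
    (A_ge0 : forall w, 0 <= A w) (S_ge0 : forall w, 0 <= S w)
    (EA : ('E_P0[A] = 1)%E) (ES : ('E_P0[S] = 1)%E)
    (alpha : R) (alpha_gt1 : 1 < alpha) (alpha_lt2 : alpha < 2)
    (C_A : R) (C_A_gt0 : 0 < C_A)
    (tailA : x `^ alpha * fine (P0 [set w | x < A w]) @[x --> +oo] --> C_A)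
    (eps : R) (eps_gt0 : 0 < eps) (eps_le1 : eps <= 1)
    (momentS : ('E_P0[fun w => (S w `^ (1 + eps))%R] < +oo)%E)
    (d : measure_display) (T : measurableType d) (P : probability T R)
    (As Ss : nat -> {RV P >-> R})
    (primitives : queue_primitives As Ss A S)
    (steady : forall B : R, 0 < B -> \forall n \near \oo,
       (exists nu, steady_state_number As Ss n B alpha nu) /\
       (exists nu, steady_state_wait As Ss n B alpha nu)) :
  forall B : R, 0 < B -> forall x : R, 0 < x ->
    (forall nuQ : nat -> probability R R,
       (\forall n \near \oo, steady_state_number As Ss n B alpha (nuQ n)) ->
       (limn_esup (fun n => nuQ n
            [set q : R | (x < n%:R `^ (- alpha^-1) * Num.max (q - n%:R) 0)%R])
        <= (expR (- ((B / (C_A * alpha * Gamma (- alpha)))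
                       `^ (alpha - 1)^-1 * x)))%:E)%E) /\
    (forall (dL : measure_display) (TL : measurableType dL)
       (PL : probability TL R) (Shat : R -> {RV PL >-> R}),
       stable_levy_motion alpha 1 Shat ->
       PL [set w | (x%:E < ereal_sup
             [set (- ((C_A / stable_const alpha) `^ alpha^-1 * Shat t w)
                   - B * t)%:E | t in `[0%R, +oo[])%E]
       = (expR (- ((B / (C_A * alpha * Gamma (- alpha)))
                     `^ (alpha - 1)^-1 * x)))%:E).
Proof.
move=> B B0 x x0; split; last first.
  by move=> dL TL PL Shat sL; exact: levy_sup.
move=> nuQ st.
have EA' : (\int[P0]_w (A w)%:E = 1)%E by move: EA; rewrite unlock.
have ES' : (\int[P0]_w (S w)%:E = 1)%E by move: ES; rewrite unlock.
have [CS mS] : exists CS : R, (\int[P0]_w (S w `^ (1 + eps))%:E = CS%:E)%E.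
  exists (fine (\int[P0]_w (S w `^ (1 + eps))%:E)); rewrite fineK//.
  rewrite ge0_fin_numE; first by move: momentS; rewrite unlock.
  by apply: integral_ge0 => w _; rewrite lee_fin powR_ge0.
rewrite (_ : C_A * alpha * Gamma (- alpha) = C_A * (Gamma (2 - alpha) / (alpha - 1))); last first.
  by rewrite -mulrA Gamma_reflection// alpha_gt1.
exact: (queue_tail A_ge0 S_ge0 EA' ES' alpha_gt1 alpha_lt2 C_A_gt0 tailA eps_gt0 eps_le1 mS primitives B0 x0 st).
Qed.
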